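(* Let $X$ be a graph of graphs such that no connected component of its mid-graph $\Gamma_M$ is a tree. Then $X$ can be converted, by finitely many applications of the moves (M1)--(M7), to a reduced graph of graphs $X'$ such that every vertex of the underlying graph $\Gamma_U(X')$ has valence three. Moreover, writing $\Gamma_H,\Gamma_M$ for the horizontal subgraph and mid-graph of $X$ and $\Gamma_H',\Gamma_M'$ for those of $X'$, there is a homotopy equivalence of triples $(X',\Gamma_H',\Gamma_M')\to(X,\Gamma_H,\Gamma_M)$.
   Context: **Graphs of graphs.** A graph of graphs $X$ is a finite graph of spaces all of whose vertex spaces are (finite) combinatorial graphs and all of whose edge maps are embeddings. That is, there is a finite underlying graph $\Gamma_U(X)$, a graph $V$ for each vertex $v$, a graph $E$ for each edge $e$, and for each edge $e$ two embeddings of graphs $\iota,\tau$ of $E$ into the vertex spaces at the two endpoints of $e$. The total space, also denoted $X$, is obtained from the disjoint union of all $V$ and all $E\times I$ ($I=[0,1]$) by gluing the two ends of each $E\times I$ to vertex spaces via $\iota$ and $\tau$. Edges incident to a vertex are counted with multiplicity, a loop counting twice; the valence of a vertex is this count. **Moves.** (M1) Make vertex and edge spaces connected: replace each vertex $v_i$ by one vertex $v_{i,k}$ for each connected component $V_{i,k}$ of $V_i$, and each edge $e_j$ by one edge $e_{j,l}$ for each component $E_{j,l}$ of $E_j$. These carry the spaces $V_{i,k}$ and $E_{j,l}$, and $e_{j,l}$ is attached to $v_{i,k}$ by the restricted embedding when the image of $E_{j,l}$ lies in $V_{i,k}$. (M2) Remove unnecessary vertices: if $V$ has exactly two incident edges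 and both inclusions are isomorphisms, remove $v$ and regard the pair of incident edges as a single edge (if both are ends of one loop, the result is a circle edge with no vertex). If $V$ has one incident edge and the inclusion is an isomorphism, remove $V$ and the incident edge. (M3) Remove isolated edges: if an edge $e$ of a vertex space $V$ is not the image of an edge of any incident edge space, remove $e$ from $V$. (M4) Collapse free edges or vertices: an edge $e$ of $V$ is free if it is the image of only one edge from the collection of incident edge spaces, say $e'\subset E$; then remove $e$ from $V$ and $e'$ from $E$. If a vertex space $V$ is a point and has only one incident edge space, remove $v$ and the incident edge. (M5) For a vertex space $V$, divide the incident edge spaces into two classes $E_1,\dots,E_n$ and $E_{n+1},\dots,E_m$. Let $V_1$ be the union of the images in $V$ of the $E_i$ with $i\le n$, and $V_2$ the union of those with $i>n$. When $V_1\cap V_2$ is nonempty, replace $V$ by $V_1\sqcup V_2$ and introduce a new edge carrying the edge space $V_1\cap V_2$, attached to $V_1$ and $V_2$ by the inclusions. Attach $E_i$ to $V_1$ for $i\le n$ and to $V_2$ for $i>n$. (M6) Blow up: apply (M5) at a vertex, pass to connected components of the newly created vertex and edge spaces via (M1), then pass to the associated reduced graph of graphs using (M2). (M7) Blow down: if $E$ is an edge space whose two embeddings have disjoint images, $\iota(E)\cap\tau(E)=\emptyset$, remove the edge $e$ of the underlying graph and identify its two endpoints. The graph carried by the new vertex is obtained from the vertex space(s) at the ends of $e$ by setting $\iota(f)=\tau(f)$ for every vertex or edge $f$ of $E$. **Reduced.** A graph of graphs is reduced if any application of (M1)--(M4) leaves it unchanged. **Subgraphs.** The horizontal subgraph $\Gamma_H\subset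 X$ is the graph obtained by restricting all vertex and edge spaces to their vertices: its vertices are the vertices of the vertex spaces, and its edges are the arcs $\{p\}\times I$ for $p$ a vertex of an edge space. The mid-graph $\Gamma_M\subset X$ is obtained by restricting vertex and edge spaces to midpoints of edges: its vertices are the midpoints of edges of the vertex spaces, and its edges are the arcs $\{p\}\times I$ for $p$ the midpoint of an edge of an edge space. Neither is necessarily connected.
   Formalization: It is also assumed that no connected component of X is a tree contained in Γ_H (a tree component of Γ_H meeting no edge of any vertex space); without this the claim fails, e.g. for X a single vertex whose space is a point, with no edges. *)

(* Defs.v *)
From HB Require Import structures.
From Stdlib Require Import Relation_Operators.
From mathcomp Require Import all_boot all_order all_algebra generic_quotient.
From mathcomp Require Import boolp classical_sets set_interval reals topology.

Set Implicit Arguments.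
Unset Strict Implicit.
Unset Printing Implicit Defensive.

(** * Finite combinatorial graphs *)

(* Loops and multiple edges are allowed.  Each edge carries an arbitrary
   reference orientation, from [ends e false] to [ends e true]; graph maps are
   free to reverse it. *)
Record graph := Graph {
  vert : finType;
  edge : finType;
  ends : edge -> bool -> vert }.

(* A dart (e, b) is the edge e traversed starting from [ends e b]. *)
Definition dart (G : graph) : finType := (edge G * bool)%type.
Definition dsrc (G : graph) (d : dart G) : vert G := ends d.1 d.2.
Definition drev (G : graph) (d : dart G) : dart G := (d.1, ~~ d.2).

Definition item (G : graph) : finType := (vert G + dart G)%type.

(* Maps sending vertices to vertices and edges isometrically to edges;
   [gflip f e] tells whether f reverses the reference orientation of e. *)
Record gmap (G H : graph) := Gmap {
  gvert : vert G -> vert H;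
  gedge : edge G -> edge H;
  gflip : edge G -> bool;
  gmap_ends : forall e b, ends (gedge e) (b (+) gflip e) = gvert (ends e b) }.

Definition gdart G H (f : gmap G H) (d : dart G) : dart H :=
  (gedge f d.1, d.2 (+) gflip f d.1).

Definition gitem G H (f : gmap G H) (x : item G) : item H :=
  match x with inl p => inl (gvert f p) | inr d => inr (gdart f d) end.
Coercion gitem : gmap >-> Funclass.

Record embedding (G H : graph) := Embedding {
  emb_gmap :> gmap G H;
  emb_vert_inj : injective (gvert emb_gmap);
  emb_edge_inj : injective (gedge emb_gmap) }.

Definition giso G H (f : gmap G H) :=
  bijective (gvert f) /\ bijective (gedge f).

Definition adj (G : graph) : rel (vert G) :=
  [rel x y | [exists d : dart G, (dsrc d == x) && (dsrc (drev d) == y)]].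

Definition gconnected (G : graph) :=
  (exists x : vert G, True) /\ forall x y : vert G, connect (@adj G) x y.

Definition is_component (G : graph) (C : {set vert G}) :=
  exists x, C = [set y | connect (@adj G) x y].

Definition is_circuit (G : graph) (p : seq (dart G)) :=
  [/\ p != [::],
      cycle [rel d d' | (dsrc (drev d) == dsrc d') && (d' != drev d)] p
    & uniq (map (@dsrc G) p)].

Definition is_tree_component (G : graph) (C : {set vert G}) :=
  is_component C /\
  ~ exists p, is_circuit p /\ forall d, d \in p -> dsrc d \in C.

(* Disjoint union of a finite family of graphs. *)
Section DisjointUnion.
Variables (I : finType) (F : I -> graph).

Definition gsum : graph :=
  @Graph {i : I & vert (F i)} {i : I & edge (F i)}
    (fun e b => Tagged (fun i => vert (F i)) (ends (tagged e) b)).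

Definition over (x : item gsum) : I :=
  match x with inl p => tag p | inr d => tag d.1 end.

Definition gsum_in (i : I) : gmap (F i) gsum :=
  @Gmap (F i) gsum
    (fun p => Tagged (fun i => vert (F i)) p)
    (fun e => Tagged (fun i => edge (F i)) e) (fun _ => false)
    (fun e b => congr1 (fun c => Tagged (fun i => vert (F i)) (ends e c))
                       (addbF b)).
End DisjointUnion.

(** * Graphs of graphs *)

(* Besides vertices and edges, the underlying graph may have circle edges
   meeting no vertex, which arise by removing the only vertex of a loop.  A
   circle edge carries a graph E and an automorphism of E (an injective
   endomorphism of a finite graph): it contributes to the total space the
   mapping torus of that automorphism. *)
Record gog := Gog {
  uvert : finType;
  uedge : finType;
  ucirc : finType;
  uend : uedge -> bool -> uvert;
  vspace : uvert -> graph;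
  espace : uedge -> graph;
  cspace : ucirc -> graph;
  emb : forall (e : uedge) (b : bool), embedding (espace e) (vspace (uend e b));
  mono : forall c : ucirc, embedding (cspace c) (cspace c) }.
Arguments uend : clear implicits.
Arguments emb : clear implicits.
Arguments mono : clear implicits.
Arguments vspace : clear implicits.
Arguments espace : clear implicits.
Arguments cspace : clear implicits.

Definition valence (X : gog) (v : uvert X) : nat :=
  #|[set h : uedge X * bool | uend X h.1 h.2 == v]|.

(* All vertex (edge, circle) spaces at once, with the maps induced by the
   embeddings; [over] recovers the vertex (edge, circle) an item belongs to. *)
Definition VS (X : gog) : graph := gsum (vspace X).
Definition ES (X : gog) : graph := gsum (espace X).
Definition CS (X : gog) : graph := gsum (cspace X).

Definition att (X : gog) (b : bool) : gmap (ES X) (VS X) :=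
  @Gmap (ES X) (VS X)
    (fun p => Tagged (fun v => vert (vspace X v))
                (gvert (emb X (tag p) b) (tagged p)))
    (fun e => Tagged (fun v => edge (vspace X v))
                (gedge (emb X (tag e) b) (tagged e)))
    (fun e => gflip (emb X (tag e) b) (tagged e))
    (fun e c => congr1 (fun q => Tagged (fun v => vert (vspace X v)) q)
                  (gmap_ends (emb X (tag e) b) (tagged e) c)).

Definition monodromy (X : gog) : gmap (CS X) (CS X) :=
  @Gmap (CS X) (CS X)
    (fun p => Tagged (fun c => vert (cspace X c))
                (gvert (mono X (tag p)) (tagged p)))
    (fun e => Tagged (fun c => edge (cspace X c))
                (gedge (mono X (tag e)) (tagged e)))
    (fun e => gflip (mono X (tag e)) (tagged e))
    (fun e b => congr1 (fun q => Tagged (fun c => vert (cspace X c)) q)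
                  (gmap_ends (mono X (tag e)) (tagged e) b)).

(** * Horizontal graph and mid-graph as combinatorial graphs *)

(* The arcs {p} x I in a circle edge close up to circles containing no vertex
   of a vertex space; they are subdivided at the points (p, 0). *)
Definition horizontal_graph (X : gog) : graph :=
  @Graph (vert (VS X) + vert (CS X))%type (vert (ES X) + vert (CS X))%type
    (fun a b => match a with
     | inl p => inl (gvert (att X b) p)
     | inr p => inr (if b then gvert (monodromy X) p else p)
     end).

Definition mid_graph (X : gog) : graph :=
  @Graph (edge (VS X) + edge (CS X))%type (edge (ES X) + edge (CS X))%type
    (fun a b => match a with
     | inl e => inl (gedge (att X b) e)
     | inr e => inr (if b then gedge (monodromy X) e else e)
     end).

(* A tree component of the horizontal graph meeting no edge of a vertex space
   is a whole connected component of the total space.  It is homotopy equivalent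
   to a point and disjoint from the mid-graph, and no graph of graphs with
   connected spaces and all valences three is: with an empty mid-graph the
   vertex spaces are points, and a nonempty finite trivalent graph is not
   contractible. *)
Definition isolated_tree (X : gog) (C : {set vert (horizontal_graph X)}) :=
  is_tree_component C /\
  forall d : dart (VS X), (inl (dsrc d) : vert (horizontal_graph X)) \notin C.

(** * Isomorphisms and deletions *)

Section CellMaps.
Variables Y X : gog.

Inductive cell (Z : gog) :=
| UV of uvert Z | UE of uedge Z | VI of item (VS Z) | EI of item (ES Z).

Record cellmap := Cellmap {
  cm_uv : uvert Y -> uvert X;
  cm_ue : uedge Y -> uedge X;
  cm_V : gmap (VS Y) (VS X);
  cm_E : gmap (ES Y) (ES X);
  cm_overV : forall x, over (cm_V x) = cm_uv (over x);
  cm_overE : forall x, over (cm_E x) = cm_ue (over x) }.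

Definition on_cell (i : cellmap) (c : cell Y) : cell X :=
  match c with
  | UV v => UV (cm_uv i v) | UE e => UE (cm_ue i e)
  | VI x => VI (cm_V i x) | EI x => EI (cm_E i x)
  end.

Definition onto_all_but (D : cell X -> Prop) (i : cellmap) :=
  injective (on_cell i) /\ forall c, (exists c', on_cell i c' = c) <-> ~ D c.

Definition same_circles :=
  exists (ic : ucirc Y -> ucirc X) (iC : gmap (CS Y) (CS X)),
    [/\ bijective ic, giso iC, (forall x, over (iC x) = ic (over x))
      & forall x, iC (monodromy Y x) = monodromy X (iC x)].

(* Y is X with exactly the cells in D removed. *)
Definition deletes (D : cell X -> Prop) :=
  exists i : cellmap,
    [/\ onto_all_but D i,
        forall e b, cm_uv i (uend Y e b) = uend X (cm_ue i e) b
      & forall b x, cm_V i (att Y b x) = att X b (cm_E i x)].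
End CellMaps.
Arguments same_circles : clear implicits.
Arguments deletes : clear implicits.

Definition iso (Y X : gog) :=
  deletes Y X (fun _ => False) /\ same_circles Y X.

Definition over_vert (X : gog) (v : uvert X) (c : cell X) : Prop :=
  match c with UV w => w = v | VI x => over x = v | _ => False end.

Definition over_edge (X : gog) (e : uedge X) (c : cell X) : Prop :=
  match c with UE a => a = e | EI x => over x = e | _ => False end.

(** * Moves *)

(* In each case the relation [m X Y] says that Y is, up to isomorphism, the result of
   applying the move to X; surviving edges of the underlying graph keep their
   reference orientation. *)

Definition connected_spaces (X : gog) :=
  [/\ forall v, gconnected (vspace X v), forall e, gconnected (espace X e)
    & forall c, gconnected (cspace X c)].

(* The monodromy of a circle edge may permute the components of its space
   cyclically.  Such a cycle of k components E_1 -> ... -> E_k -> E_1 is a cycle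
   of k edges joined end to end with no vertex in between, that is, one circle
   edge carrying E_1 with the first-return map as monodromy. *)
Definition circle_components (X Y : gog) :=
  exists j : gmap (CS Y) (CS X),
    [/\ injective j,
        forall d : dart (CS X), (exists p, gvert j p = dsrc d) ->
          exists a, gdart j a = d,
        forall x, exists n y, iter n (monodromy X) x = j y
      & forall y, exists n, iter n.+1 (monodromy X) (j y) = j (monodromy Y y)
          /\ forall k y', k < n -> iter k.+1 (monodromy X) (j y) <> j y'].

(* The disjoint unions of all vertex spaces and of all edge spaces stay the same
   and are only regrouped: since the spaces of Y are connected, they are the
   components of the spaces of X. *)
Definition split_components (X Y : gog) :=
  [/\ connected_spaces Y,
      exists (iV : gmap (VS Y) (VS X)) (iE : gmap (ES Y) (ES X)),
        [/\ giso iV, giso iE & forall b x, iV (att Y b x) = att X b (iE x)]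
    & circle_components X Y].

(* Vertex with two incident edges e1 != e2: e2 is absorbed into e1, whose end b1
   is moved across v to the far end of e2. *)
Definition merge_edges (X Y : gog) :=
  exists (v : uvert X) (e1 e2 : uedge X) (b1 b2 : bool),
    [/\ [/\ valence v = 2, e1 != e2, uend X e1 b1 = v & uend X e2 b2 = v],
        giso (emb X e1 b1), giso (emb X e2 b2), same_circles Y X
      & exists i : cellmap Y X,
        [/\ onto_all_but (fun c => over_vert v c \/ over_edge e2 c) i,
            forall e b, cm_uv i (uend Y e b) =
              if (cm_ue i e, b) == (e1, b1) then uend X e2 (~~ b2)
              else uend X (cm_ue i e) b
          & forall b x,
              if (over (cm_E i x), b) == (e1, b1) then
                exists y, [/\ over y = e2, att X b2 y = att X b1 (cm_E i x)
                            & cm_V i (att Y b x) = att X (~~ b2) y]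
              else cm_V i (att Y b x) = att X b (cm_E i x)]].

(* Vertex both of whose incident half-edges belong to one loop e: the loop
   becomes the circle edge c0. *)
Definition loop_to_circle (X Y : gog) :=
  exists (v : uvert X) (e : uedge X),
    [/\ [/\ valence v = 2, uend X e false = v & uend X e true = v],
        giso (emb X e false), giso (emb X e true),
        deletes Y X (fun c => over_vert v c \/ over_edge e c)
      & exists (kc : ucirc X -> ucirc Y) (c0 : ucirc Y)
          (jC : gmap (CS X) (CS Y)) (jN : gmap (espace X e) (cspace Y c0)),
        [/\ injective kc /\ (forall c, (exists c', kc c' = c) <-> c <> c0),
            injective jC /\
              (forall y, (exists x, jC x = y) <-> over y <> c0),
            (forall x, over (jC x) = kc (over x)) /\
              (forall x, monodromy Y (jC x) = jC (monodromy X x)),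
            giso jN
          & forall x y : item (espace X e),
              att X true (gsum_in _ e y) = att X false (gsum_in _ e x) ->
              mono Y c0 (jN x) = jN y]].

Definition drop_leaf (X Y : gog) :=
  exists (v : uvert X) (e : uedge X) (b : bool),
    [/\ valence v = 1, uend X e b = v, giso (emb X e b), same_circles Y X
      & deletes Y X (fun c => over_vert v c \/ over_edge e c)].

Definition remove_vertex (X Y : gog) :=
  [\/ merge_edges X Y, loop_to_circle X Y | drop_leaf X Y].

Definition remove_isolated_edge (X Y : gog) :=
  exists e : edge (VS X),
    [/\ forall b a, gedge (att X b) a <> e, same_circles Y X
      & deletes Y X (fun c => exists b, c = VI (inr (e, b)))].

Definition collapse_free_edge (X Y : gog) :=
  exists (e : edge (VS X)) (b : bool) (a : edge (ES X)),
    [/\ gedge (att X b) a = e,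
        #|[set h : bool * edge (ES X) | gedge (att X h.1) h.2 == e]| = 1,
        same_circles Y X
      & deletes Y X (fun c => exists s,
          c = VI (inr (e, s)) \/ c = EI (inr (a, s)))].

Definition collapse_free_vertex (X Y : gog) :=
  exists (v : uvert X) (e : uedge X) (b : bool),
    [/\ #|vert (vspace X v)| = 1 /\ #|edge (vspace X v)| = 0,
        valence v = 1, uend X e b = v, same_circles Y X
      & deletes Y X (fun c => over_vert v c \/ over_edge e c)].

Definition collapse_free (X Y : gog) :=
  collapse_free_edge X Y \/ collapse_free_vertex X Y.

(* The union of the images, in the space of v, of the incident half-edges assigned
   to class s. *)
Definition side_image (X : gog) (v : uvert X) (cls : uedge X -> bool -> bool)
    (s : bool) (x : item (VS X)) :=
  exists e b y, [/\ uend X e b = v, cls e b = s, over y = e & att X b y = x].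

(* A loop at v is incident twice, and its two ends may be put in different
   classes.  The vertex v becomes the two vertices [w false] and [w true], and
   e0 is the new edge, carrying the intersection. *)
Definition separate (X Y : gog) :=
  exists (v : uvert X) (cls : uedge X -> bool -> bool),
  let side := side_image v cls in
  [/\ exists p, side false (inl p) /\ side true (inl p),
      same_circles Y X
    & exists (pu : uvert Y -> uvert X) (w : bool -> uvert Y)
        (pV : gmap (VS Y) (VS X)) (ie : uedge X -> uedge Y) (e0 : uedge Y)
        (iE : gmap (ES X) (ES Y)) (pN : gmap (espace Y e0) (VS X)),
      [/\ [/\ w false <> w true, forall u, pu u = v <-> exists s, u = w s
            & forall u, u <> v -> exists! u', pu u' = u],
          [/\ forall x, over (pV x) = pu (over x),
              forall s x, side s x <-> exists y, over y = w s /\ pV y = x,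
              forall x, over x <> v -> exists y, pV y = x
            & forall y y', over y = over y' -> pV y = pV y' -> y = y'],
          [/\ injective ie, forall e, (exists e', ie e' = e) <-> e <> e0,
              forall s, uend Y e0 s = w s
            & forall e b, if uend X e b == v then uend Y (ie e) b = w (cls e b)
                          else pu (uend Y (ie e) b) = uend X e b],
          [/\ injective iE, forall y, (exists x, iE x = y) <-> over y <> e0,
              forall x, over (iE x) = ie (over x)
            & forall b x, pV (att Y b (iE x)) = att X b x]
        & [/\ injective pN,
              forall x, (exists z, pN z = x) <-> side false x /\ side true x
            & forall s z, pV (att Y s (gsum_in _ e0 z)) = pN z]]].

(* For a loop e0 the identification may destroy injectivity of another edge
   inclusion; the move then has no result Y. *)
Definition blow_down (X Y : gog) :=
  exists e0 : uedge X,
  [/\ forall x y, over x = e0 -> over y = e0 -> att X false x <> att X true y,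
      same_circles Y X
    & exists (qu : uvert X -> uvert Y) (ie : uedge Y -> uedge X)
        (qV : gmap (VS X) (VS Y)) (iE : gmap (ES Y) (ES X)),
      [/\ [/\ forall u, exists w, qu w = u
            & forall u u', qu u = qu u' <->
                u = u' \/ exists b, u = uend X e0 b /\ u' = uend X e0 (~~ b)],
          [/\ forall y, exists x, qV x = y, forall x, over (qV x) = qu (over x)
            & forall x x', qV x = qV x' <->
                x = x' \/ exists b z,
                  [/\ over z = e0, x = att X b z & x' = att X (~~ b) z]],
          [/\ injective ie, forall e, (exists e', ie e' = e) <-> e <> e0
            & forall e b, uend Y e b = qu (uend X (ie e) b)]
        & [/\ injective iE, forall x, (exists y, iE y = x) <-> over x <> e0,
              forall y, over (iE y) = ie (over y)
            & forall b y, att Y b y = qV (att X b (iE y))]]].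

Definition reduced (X : gog) :=
  forall Y, [\/ split_components X Y, remove_vertex X Y,
                remove_isolated_edge X Y | collapse_free X Y] -> iso Y X.

(* When the spaces of X are connected, [split_components] affects only the
   vertex and edge spaces created by [separate]. *)
Definition blow_up (X Y : gog) :=
  exists Z W, [/\ separate X Z, split_components Z W,
                  clos_refl_trans gog remove_vertex W Y & reduced Y].

Definition gog_move (X Y : gog) :=
  split_components X Y \/ remove_vertex X Y \/ remove_isolated_edge X Y \/
  collapse_free X Y \/ separate X Y \/ blow_up X Y \/ blow_down X Y.

Definition converts_to : gog -> gog -> Prop := clos_refl_trans gog gog_move.

(** * Total spaces *)

Local Open Scope classical_set_scope.
Local Open Scope ring_scope.
Local Open Scope quotient_scope.
Import Order.TTheory GRing.Theory Num.Theory numFieldTopology.Exports.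

Section Gluing.
Variables (T : topologicalType) (r : T -> T -> Prop).

Definition glue_rel (x y : T) : bool := `[< clos_refl_sym_trans T r x y >].

Lemma glue_rel_refl : reflexive glue_rel.
Proof. by move=> x; apply/asboolP; exact: rst_refl. Qed.

Lemma glue_rel_sym : symmetric glue_rel.
Proof.
by move=> x y; apply/idP/idP => /asboolP xy; apply/asboolP; exact: rst_sym.
Qed.

Lemma glue_rel_trans : transitive glue_rel.
Proof.
move=> y x z /asboolP xy /asboolP yz; apply/asboolP.
exact: rst_trans xy yz.
Qed.

Definition glue_equiv := EquivRel _ glue_rel_refl glue_rel_sym glue_rel_trans.

Definition glued : topologicalType := quotient_topology {eq_quot glue_equiv}.

Definition to_glued (x : T) : glued := \pi_({eq_quot glue_equiv}) x.

Definition of_glued (x : glued) : T := repr (x : {eq_quot glue_equiv}).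
End Gluing.

Section TotalSpace.
Variable R : realType.

Definition unit_interval : topologicalType := set_type (`[0, 1]%classic : set R).

Definition ival (t : unit_interval) : R := \val t.

Lemma flip_subproof (t : unit_interval) : 1 - ival t \in (`[0, 1]%classic : set R).
Proof.
have := valP t; rewrite !inE /= !in_itv /= => /andP[t0 t1].
by rewrite subr_ge0 t1 lerBlDr lerDl.
Qed.

Definition flip (t : unit_interval) : unit_interval :=
  exist _ (1 - ival t) (flip_subproof t).

Definition graph_piece (G : graph) (i : vert G + edge G) : topologicalType :=
  match i with
  | inl _ => discrete_topology unit
  | inr _ => unit_interval
  end.

Definition graph_pieces (G : graph) : topologicalType :=
  {i : vert G + edge G & graph_piece i}.

Definition vert_point (G : graph) (p : vert G) : graph_pieces G :=
  existT (@graph_piece G) (inl p) tt.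

Definition edge_point (G : graph) (e : edge G) (t : unit_interval) :
  graph_pieces G := existT (@graph_piece G) (inr e) t.

Inductive graph_glue (G : graph) : graph_pieces G -> graph_pieces G -> Prop :=
| GraphGlue (e : edge G) (b : bool) t : ival t = (b : nat)%:R ->
    graph_glue (edge_point e t) (vert_point (ends e b)).

Definition realization (G : graph) : topologicalType := glued (@graph_glue G).

Definition pieces_map G H (f : gmap G H) (x : graph_pieces G) :
    graph_pieces H :=
  match x with
  | existT (inl p) _ => vert_point (gvert f p)
  | existT (inr e) t => edge_point (gedge f e) (if gflip f e then flip t else t)
  end.

Definition realization_map G H (f : gmap G H) (x : realization G) :
    realization H :=
  to_glued (@graph_glue H) (pieces_map f (of_glued x)).

Definition vertices (G : graph) : set (realization G) :=
  [set x | exists p, x = to_glued _ (vert_point p)].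

Definition midpoints (G : graph) : set (realization G) :=
  [set x | exists e t, ival t = 2^-1 /\ x = to_glued _ (edge_point e t)].

Variable X : gog.

Definition total_piece (i : uvert X + uedge X + ucirc X) : topologicalType :=
  match i with
  | inl (inl v) => realization (vspace X v)
  | inl (inr e) => (realization (espace X e) * unit_interval)%type
  | inr c => (realization (cspace X c) * unit_interval)%type
  end.

Definition total_pieces : topologicalType :=
  {i : uvert X + uedge X + ucirc X & total_piece i}.

Definition in_vspace v (x : realization (vspace X v)) : total_pieces :=
  existT total_piece (inl (inl v)) x.

Definition in_espace e (x : realization (espace X e)) (t : unit_interval) :
  total_pieces := existT total_piece (inl (inr e)) (x, t).

Definition in_cspace c (x : realization (cspace X c)) (t : unit_interval) :
  total_pieces := existT total_piece (inr c) (x, t).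

Inductive total_glue : total_pieces -> total_pieces -> Prop :=
| GlueEnd e (b : bool) x t : ival t = (b : nat)%:R ->
    total_glue (in_espace x t) (in_vspace (realization_map (emb X e b) x))
| GlueCircle c x s t : ival s = 0 -> ival t = 1 ->
    total_glue (in_cspace x s) (in_cspace (realization_map (mono X c) x) t).

Definition total_space : topologicalType := glued total_glue.

(* The subspace of the total space obtained by restricting all spaces to A. *)
Definition restrict_total (A : forall G, set (realization G)) : set total_space :=
  to_glued total_glue @`
    [set z : total_pieces | match z with
     | existT (inl (inl v)) x => A (vspace X v) x
     | existT (inl (inr e)) xt => A (espace X e) xt.1
     | existT (inr c) xt => A (cspace X c) xt.1
     end].

Definition horizontal : set total_space := restrict_total vertices.
Definition midgraph : set total_space := restrict_total midpoints.
End TotalSpace.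
Arguments total_space : clear implicits.
Arguments horizontal : clear implicits.
Arguments midgraph : clear implicits.

(** * Homotopy equivalence of triples *)

Section Triples.
Variable R : realType.

Definition triple_map (T U : topologicalType) (A B : set T) (C D : set U)
    (f : T -> U) :=
  [/\ continuous f, forall x, A x -> C (f x) & forall x, B x -> D (f x)].

Definition triple_homotopic (T U : topologicalType) (A B : set T)
    (C D : set U) (f g : T -> U) :=
  exists H : (T * unit_interval R)%type -> U,
    [/\ continuous H,
        forall x t, ival t = 0 -> H (x, t) = f x,
        forall x t, ival t = 1 -> H (x, t) = g x,
        forall x t, A x -> C (H (x, t))
      & forall x t, B x -> D (H (x, t))].

Definition triple_homotopy_equivalence (T U : topologicalType)
    (A B : set T) (C D : set U) (f : T -> U) :=
  triple_map A B C D f /\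
  exists g : U -> T,
    [/\ triple_map C D A B g,
        triple_homotopic A B A B (g \o f) id
      & triple_homotopic C D C D (f \o g) id].
End Triples.
Arguments triple_homotopy_equivalence R {T U} A B C D f.

(* Main.v *)
From HB Require Import structures.
From Stdlib Require Import Relation_Operators.
From mathcomp Require Import all_boot boolp reals zify.
From mathcomp Require all_order all_algebra generic_quotient classical_sets set_interval.
From mathcomp Require topology functions normedtype ring lra.
Require Import Defs.

(** The total space of a graph of graphs is glued from squares, one for each edge
    of each edge space, along the vertex spaces.  Taking all vertex spaces together,
    and all edge spaces together, it is described by two graphs V and E and two maps
    E -> V ([flat_of], [total_space_flat]); the horizontal graph and the mid-graph are
    the lines s = 0 and s = 1/2 of the squares.  In this description all moves used
    below are homotopy equivalences of triples for one of two reasons.  Either a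
    product N x I is collapsed onto one of its ends ([product_collapse_heq]): this
    removes vertices of valence one and two, and, read backwards, doubles a vertex
    space before its incident edges are separated.  Or squares with a side that meets
    nothing else are pushed across onto their other three sides, symmetrically about
    the line s = 1/2 ([remove_free_cells_heq]): this collapses free edges, and trims
    the two copies of a doubled vertex space to the images of the two classes of edge
    spaces ([pull_apart_heq]).  Passing to components changes nothing but the
    names of the cells, except that a circle edge is cut at fewer places
    ([splitting_heq]).

    Combinatorially, the conversion has two parts.  The first makes the graph of
    graphs tame: the spaces are connected, every edge of a vertex space is covered by
    at least two edges of edge spaces, and all valences are at least two.  Free edges
    are collapsed as long as there are any.  No edge ends up uncovered: since no
    component of the mid-graph is a tree, from each of its vertices one can walk
    without ever backtracking ([rich]), and collapses preserve this
    ([collapse_to_doubly_covered]).  After passing to components, a vertex of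
    valence at most one is a point that lies on no edge; the same argument in the horizontal
    graph, where a walk may also stop at a point lying on an edge, shows that it has
    valence exactly one and that dropping it is harmless ([drop_leaves]).  In a tame
    graph of graphs both inclusions at a vertex of valence two are onto, hence such
    vertices can be removed as well ([remove_valence2]).

    The second part lowers the valences.  Among four or more half-edges at a vertex
    there are two disjoint pairs whose members have intersecting images
    ([four_halves]).  Separating one pair from the rest and passing to components
    yields, on each of the two sides, a vertex of valence at least three: it meets
    both members of a pair and a component of the new edge space.  So the number
    of vertices of valence at least three grows ([grow_step]).  But it is bounded:
    every horizontal valence is at least two, every vertex space contains a point of
    horizontal valence at least three, and the Euler characteristic of the
    horizontal graph does not change ([vertex_bound]).  Hence all valences become
    three.  The result is reduced, because every simplification needs a disconnected
    space, an edge covered at most once, or a vertex of valence at most two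
    ([tame_reduced]). *)

Set Implicit Arguments.
Unset Strict Implicit.
Unset Printing Implicit Defensive.

(** * Graph maps *)

Lemma drevK G : involutive (@drev G).
Proof. by case=> e b; rewrite /drev /= negbK. Qed.

Lemma gdart_rev G H (f : gmap G H) d : gdart f (drev d) = drev (gdart f d).
Proof. by case: d => e b; rewrite /gdart /drev /= addNb. Qed.

Lemma dsrc_gdart G H (f : gmap G H) d : dsrc (gdart f d) = gvert f (dsrc d).
Proof. by case: d => e b; exact: gmap_ends. Qed.

Definition gcomp G H K (g : gmap H K) (f : gmap G H) : gmap G K.
Proof.
refine (@Gmap G K (fun p => gvert g (gvert f p)) (fun e => gedge g (gedge f e))
          (fun e => gflip f e (+) gflip g (gedge f e)) _).
by move=> e b; rewrite addbA gmap_ends gmap_ends.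
Defined.

Lemma gcompE G H K (g : gmap H K) (f : gmap G H) x : gcomp g f x = g (f x).
Proof. by case: x => [p|[e b]] //=; rewrite /gdart /= addbA. Qed.

Definition gid G : gmap G G :=
  @Gmap G G id id (fun _ => false) (fun e b => congr1 (ends e) (addbF b)).

Lemma gidE G x : gid G x = x.
Proof. by case: x => [p|[e b]] //=; rewrite /gdart /= addbF. Qed.

Lemma gitem_inj G H (f : gmap G H) :
  injective (gvert f) -> injective (gedge f) -> injective f.
Proof.
move=> vi ei [p|[e b]] [q|[e' b']] //= [].
  by move/vi => ->.
by move=> /ei -> /addIb ->.
Qed.

Lemma item_inj_vert G H (f : gmap G H) : injective f -> injective (gvert f).
Proof. by move=> fi p q e; have [] := fi (inl p) (inl q) (congr1 inl e). Qed.

Lemma item_inj_edge G H (f : gmap G H) : injective f -> injective (gedge f).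
Proof.
move=> fi e e' ee.
suff : @inr (vert G) _ (e, false) = inr (e', gflip f e (+) gflip f e') by case.
by apply: fi; rewrite /= /gdart /= -ee -addbA addbb addbF.
Qed.

Lemma giso_inverse G H (f : gmap G H) :
  giso f -> exists g : gmap H G, (forall x, g (f x) = x) /\ (forall y, f (g y) = y).
Proof.
move=> [[gv fvK gvK] [ge feK geK]].
have ok e b : ends (ge e) (b (+) gflip f (ge e)) = gv (ends e b).
  apply: (can_inj fvK); rewrite gvK -gmap_ends -addbA addbb addbF geK //.
exists (Gmap ok); split=> [[p|[e b]]|[p|[e b]]] //=.
- by rewrite fvK.
- by rewrite /gdart /= feK -addbA addbb addbF.
- by rewrite gvK.
- by rewrite /gdart /= geK -addbA addbb addbF.
Qed.

Lemma giso_comp G H K (g : gmap H K) (f : gmap G H) :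
  giso g -> giso f -> giso (gcomp g f).
Proof. by move=> [bg cg] [bf cf]; split; apply: bij_comp. Qed.

Lemma giso_id G : giso (gid G).
Proof. by split; exists id. Qed.

Lemma giso_inj G H (f : gmap G H) : giso f -> injective f.
Proof. by move=> [/bij_inj vi /bij_inj ei]; exact: gitem_inj. Qed.

Lemma giso_surj G H (f : gmap G H) : giso f -> forall y, exists x, f x = y.
Proof. by move=> /giso_inverse [g [_ fg]] y; exists (g y). Qed.

Lemma inj_surj_bij (A : Type) (B : Type) (f : A -> B) :
  injective f -> (forall y, exists x, f x = y) -> bijective f.
Proof.
move=> fi /choice [g fg]; exists g => // x; exact: fi.
Qed.

Lemma giso_bij G H (f : gmap G H) :
  injective f -> (forall y, exists x, f x = y) -> giso f.
Proof.
move=> fi fs; split; apply: inj_surj_bij.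
- exact: item_inj_vert.
- by move=> p; have [[q|d] // [<-]] := fs (inl p); exists q.
- exact: item_inj_edge.
- by move=> e; have [[q|[e' b]] // [<-]] := fs (inr (e, false)); exists e'.
Qed.

(** * Sums and subgraphs *)

Definition gplus (G H : graph) : graph :=
  @Graph (vert G + vert H)%type (edge G + edge H)%type
    (fun e b => match e with inl a => inl (ends a b) | inr a => inr (ends a b) end).

Definition ginl G H : gmap G (gplus G H) :=
  @Gmap G (gplus G H) inl inl (fun _ => false)
    (fun e b => congr1 (fun c => inl (ends e c)) (addbF b)).

Definition ginr G H : gmap H (gplus G H) :=
  @Gmap H (gplus G H) inr inr (fun _ => false)
    (fun e b => congr1 (fun c => inr (ends e c)) (addbF b)).

Definition gcase G H K (f : gmap G K) (g : gmap H K) : gmap (gplus G H) K.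
Proof.
refine (@Gmap (gplus G H) K
  (fun p => match p with inl q => gvert f q | inr q => gvert g q end)
  (fun p => match p with inl q => gedge f q | inr q => gedge g q end)
  (fun p => match p with inl q => gflip f q | inr q => gflip g q end) _).
by case=> e b; exact: gmap_ends.
Defined.

Lemma gcaseEl G H K (f : gmap G K) (g : gmap H K) x : gcase f g (ginl G H x) = f x.
Proof. by case: x => [p|[e b]] //=; rewrite /gdart /= addbF. Qed.

Lemma gcaseEr G H K (f : gmap G K) (g : gmap H K) x : gcase f g (ginr G H x) = g x.
Proof. by case: x => [p|[e b]] //=; rewrite /gdart /= addbF. Qed.

Lemma gplusP G H (z : item (gplus G H)) :
  (exists x, z = ginl G H x) \/ (exists x, z = ginr G H x).
Proof.
case: z => [[p|p]|[[e|e] b]].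
- by left; exists (inl p).
- by right; exists (inl p).
- by left; exists (inr (e, b)); rewrite /= /gdart /= addbF.
- by right; exists (inr (e, b)); rewrite /= /gdart /= addbF.
Qed.

Lemma ginl_inj G H : injective (ginl G H).
Proof. by apply: gitem_inj => p q []. Qed.

Lemma ginr_inj G H : injective (ginr G H).
Proof. by apply: gitem_inj => p q []. Qed.

Lemma ginlr G H x y : ginl G H x <> ginr G H y.
Proof. by case: x y => [p|[e b]] [q|[e' b']]. Qed.

Definition gplus_map G G' H H' (f : gmap G G') (g : gmap H H') :
  gmap (gplus G H) (gplus G' H') := gcase (gcomp (ginl G' H') f) (gcomp (ginr G' H') g).

Lemma gplus_mapEl G G' H H' (f : gmap G G') (g : gmap H H') x :
  gplus_map f g (ginl _ _ x) = ginl _ _ (f x).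
Proof. by rewrite gcaseEl gcompE. Qed.

Lemma gplus_mapEr G G' H H' (f : gmap G G') (g : gmap H H') x :
  gplus_map f g (ginr _ _ x) = ginr _ _ (g x).
Proof. by rewrite gcaseEr gcompE. Qed.

Section Subgraph.
Variables (G : graph) (P : pred (vert G)) (Q : pred (edge G)).
Hypothesis PQ : forall e b, Q e -> P (ends e b).

Definition gsub : graph :=
  @Graph {p : vert G | P p} {e : edge G | Q e}
    (fun e b => exist _ (ends (val e) b) (PQ b (valP e))).

Definition gsub_in : gmap gsub G :=
  @Gmap gsub G val val (fun _ => false) (fun e b => congr1 (ends (val e)) (addbF b)).

Definition in_sub (x : item G) : bool :=
  match x with inl p => P p | inr d => Q d.1 end.

Lemma gsub_in_inj : injective gsub_in.
Proof. by apply: gitem_inj; exact: val_inj. Qed.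

Lemma gsub_inP x : (exists y, gsub_in y = x) <-> in_sub x.
Proof.
split=> [[[p|[e b]] <-] /=|]; [exact: valP | exact: valP |].
case: x => [p|[e b]] /= h; first by exists (inl (exist _ p h)).
by exists (inr (exist _ e h, b)); rewrite /= /gdart /= addbF.
Qed.
End Subgraph.

Section Spaces.
Import all_order all_algebra generic_quotient classical_sets set_interval.
Import topology functions normedtype ring lra.
Import Defs.
Import Order.TTheory GRing.Theory Num.Theory numFieldTopology.Exports.
Local Open Scope classical_set_scope.
Local Open Scope ring_scope.
Local Open Scope quotient_scope.

(** * The unit interval and gluing *)

Section UnitInterval.
Import ArrowAsCompactOpen.
Variable R : realType.
Notation I := (unit_interval R).

Definition clamp (x : R) : R := Num.max 0 (Num.min 1 x).

Lemma clamp_subproof x : clamp x \in (`[0, 1]%classic : set R).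
Proof.
rewrite inE /= in_itv /= /clamp le_max lexx /= ge_max ler01 /=.
by rewrite ge_min lexx.
Qed.

(** The retraction of the line onto the interval makes every formula denote a point, so
    bounds have to be proved only where the value matters. *)
Definition ui (x : R) : I := exist _ (clamp x) (clamp_subproof x).

Lemma ival_ge0 (t : I) : 0 <= ival t.
Proof. by have := valP t; rewrite inE /= in_itv /= => /andP[]. Qed.

Lemma ival_le1 (t : I) : ival t <= 1.
Proof. by have := valP t; rewrite inE /= in_itv /= => /andP[]. Qed.

Lemma ival_ui x : ival (ui x) = clamp x. Proof. by []. Qed.

Lemma clamp_id x : 0 <= x <= 1 -> clamp x = x.
Proof. by move=> /andP[x0 x1]; rewrite /clamp (min_idPr x1) (max_idPr x0). Qed.

Lemma clamp0 x : x <= 0 -> clamp x = 0.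
Proof.
move=> x0; rewrite /clamp (min_idPr _) ?(max_idPl x0) //.
exact: le_trans x0 ler01.
Qed.

Lemma clamp1 x : 1 <= x -> clamp x = 1.
Proof. by move=> x1; rewrite /clamp (min_idPl x1) (max_idPr ler01). Qed.

Lemma ival_inj : injective (@ival R).
Proof. exact: val_inj. Qed.

Lemma ivalK : cancel (@ival R) ui.
Proof.
by move=> t; apply: ival_inj; rewrite ival_ui clamp_id // ival_ge0 ival_le1.
Qed.

Lemma ival_flip (t : I) : ival (flip t) = 1 - ival t.
Proof. by []. Qed.

Lemma flipK : involutive (@flip R).
Proof. by move=> t; apply: ival_inj; rewrite !ival_flip opprB addrCA subrr addr0. Qed.

Lemma ival_continuous : continuous (@ival R).
Proof. exact: initial_continuous. Qed.

Lemma continuous_to_interval (T : topologicalType) (f : T -> I) :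
  continuous (fun x => ival (f x)) -> continuous f.
Proof. exact: continuous_comp_initial. Qed.

Lemma ui_continuous : continuous ui.
Proof.
apply: continuous_to_interval => x /=.
apply: (@continuous_max R R (fun=> 0) (fun x => Num.min 1 x)); first exact: cvg_cst.
apply: (@continuous_min R R (fun=> 1) id); first exact: cvg_cst.
exact: cvg_id.
Qed.

Lemma continuous_ui (T : topologicalType) (f : T -> R) :
  continuous f -> continuous (ui \o f).
Proof. by move=> cf x; apply: continuous_comp; [exact: cf | exact: ui_continuous]. Qed.

Lemma continuous_ival (T : topologicalType) (f : T -> I) :
  continuous f -> continuous (fun x => ival (f x)).
Proof. by move=> cf x; apply: continuous_comp; [exact: cf | exact: ival_continuous]. Qed.

Lemma interval_compact : compact [set: I].
Proof.
have -> : [set: I] = ui @` `[0, 1].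
  by apply/seteqP; split=> // t _; exists (ival t); [exact: set_mem (valP t) | exact: ivalK].
apply: continuous_compact; last exact: segment_compact.
by apply: continuous_subspaceT; exact: ui_continuous.
Qed.

Lemma interval_hausdorff : hausdorff_space I.
Proof.
move=> s t st; apply: ival_inj; apply: Rhausdorff => A B As Bt.
have [r [Ar Br]] := st _ _ (ival_continuous As) (ival_continuous Bt).
by exists (ival r).
Qed.

Lemma interval_locally_compact : locally_compact [set: I].
Proof.
move=> x _; exists setT; first by rewrite withinET; exact: filterT.
by split; [exact: interval_compact | exact: closedT].
Qed.

Lemma glued_continuous (T U : topologicalType) (r : T -> T -> Prop)
    (f : glued r -> U) :
  continuous (f \o to_glued r) -> continuous f.
Proof. by move=> cf; apply/quotient_continuous. Qed.

Lemma to_glued_continuous (T : topologicalType) (r : T -> T -> Prop) :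
  continuous (to_glued r).
Proof. exact: pi_continuous. Qed.

Lemma to_glued_eq (T : topologicalType) (r : T -> T -> Prop) x y :
  r x y -> to_glued r x = to_glued r y.
Proof.
by move=> rxy; apply/(@eqmodP _ (glue_equiv r)); apply/asboolP; exact: rst_step.
Qed.

Lemma of_gluedK (T : topologicalType) (r : T -> T -> Prop) :
  cancel (@of_glued T r) (to_glued r).
Proof. by move=> x; rewrite /to_glued /of_glued reprK. Qed.

Lemma glued_respects (T : topologicalType) (U : Type) (r : T -> T -> Prop)
    (f : T -> U) :
  (forall x y, r x y -> f x = f y) -> forall x, f (of_glued (to_glued r x)) = f x.
Proof.
move=> rf x; have : to_glued r (of_glued (to_glued r x)) = to_glued r x.
  exact: of_gluedK.
move=> /(@eqmodP _ (glue_equiv r)) /asboolP.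
move: (of_glued _) => y.
by elim=> [a b /rf|//|a b _ ->|a b c _ -> _ ->].
Qed.

Lemma prod_continuous_l (T U V : topologicalType) (f : T * U -> V) u :
  continuous f -> continuous (fun x => f (x, u)).
Proof.
move=> cf x; apply: (@continuous_comp _ _ _ (fun x => (x, u)) f); last exact: cf.
by apply: cvg_pair => //=; exact: cvg_cst.
Qed.

Lemma prod_continuous_r (T U V : topologicalType) (f : T * U -> V) x :
  continuous f -> continuous (fun u => f (x, u)).
Proof.
move=> cf u; apply: (@continuous_comp _ _ _ (fun u => (x, u)) f); last exact: cf.
by apply: cvg_pair => //=; exact: cvg_cst.
Qed.

(** The product of a quotient map with the interval is a quotient map, because the
    interval is locally compact: a map on it is the same as a map into paths. *)
Lemma glued_prod_continuous (T U : topologicalType) (r : T -> T -> Prop)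
    (f : (glued r * I)%type -> U) :
  continuous (fun x : T * I => f (to_glued r x.1, x.2)) -> continuous f.
Proof.
move=> cf; have [cc c1] := continuous_curry cf.
have -> : f = uncurry (fun x t => f (x, t)) by apply/funext => -[].
apply: continuous_uncurry => //.
- exact: interval_locally_compact.
- exact: interval_hausdorff.
- by apply: glued_continuous; exact: cc.
- by move=> x; rewrite -(of_gluedK x); exact: c1.
Qed.

(** The sets p <= q and q <= p are closed, and the two formulas agree on both. *)
Lemma paste_continuous (T U : topologicalType) (p q : T -> R) (f g : T -> U) :
  continuous p -> continuous q -> continuous f -> continuous g ->
  (forall x, p x = q x -> f x = g x) ->
  continuous (fun x => if p x <= q x then f x else g x).
Proof.
move=> cp cq cf cg fg.
set A := [set x | p x <= q x]; set B := [set x | q x <= p x].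
have cd (a b : T -> R) : continuous a -> continuous b -> closed [set x | a x <= b x].
  move=> ca cb.
  have -> : [set x | a x <= b x] = (fun x => a x - b x) @^-1` [set y | y <= 0].
    by apply/seteqP; split=> x /=; rewrite subr_le0.
  apply: closed_comp => [x _|]; last exact: closed_le.
  by apply: (@continuousB _ R^o); [exact: ca | exact: cb].
apply/continuous_subspace_setT.
have -> : [set: T] = A `|` B.
  by apply/seteqP; split=> // x _; case/orP: (le_total (p x) (q x)); [left|right].
apply: withinU_continuous; [exact: cd | exact: cd | |].
- apply: (@subspace_eq_continuous _ _ _ f); last exact: continuous_subspaceT.
  by move=> x /set_mem; rewrite /A /from_subspace /= => ->.
- apply: (@subspace_eq_continuous _ _ _ g); last exact: continuous_subspaceT.
  move=> x /set_mem; rewrite /B /from_subspace /= => qp; case: ifP => // pq; symmetry; apply: fg.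
  by apply/eqP; rewrite eq_le pq qp.
Qed.
End UnitInterval.

(** * Continuity of explicit formulas *)

Section Continuity.
Variables (R : realType) (T : topologicalType).
Implicit Types f g : T -> R.

Lemma contD f g : continuous f -> continuous g -> continuous (fun x => f x + g x).
Proof. by move=> cf cg x; apply: (@continuousD _ R^o); [exact: cf | exact: cg]. Qed.

Lemma contN f : continuous f -> continuous (fun x => - f x).
Proof. by move=> cf x; apply: (@continuousN _ R^o); exact: cf. Qed.

Lemma contM f g : continuous f -> continuous g -> continuous (fun x => f x * g x).
Proof. by move=> cf cg x; apply: continuousM; [exact: cf | exact: cg]. Qed.

Lemma cont_max f g : continuous f -> continuous g -> continuous (fun x => Num.max (f x) (g x)).
Proof. by move=> cf cg x; apply: continuous_max; [exact: cf | exact: cg]. Qed.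

Lemma cont_min f g : continuous f -> continuous g -> continuous (fun x => Num.min (f x) (g x)).
Proof. by move=> cf cg x; apply: continuous_min; [exact: cf | exact: cg]. Qed.

Lemma contV f : (forall x, f x != 0) -> continuous f -> continuous (fun x => (f x)^-1).
Proof. by move=> f0 cf x; apply: continuousV; [exact: f0 | exact: cf]. Qed.

Lemma cont_cst (U : topologicalType) (c : U) : continuous (fun _ : T => c).
Proof. by move=> x; exact: cvg_cst. Qed.

Lemma cont_id : continuous (fun x : T => x).
Proof. by move=> x; exact: cvg_id. Qed.

Lemma cont_fst (U V : topologicalType) (h : T -> U * V) :
  continuous h -> continuous (fun x => (h x).1).
Proof. by move=> ch x; apply: (@continuous_comp _ _ _ h fst); [exact: ch | exact: cvg_fst]. Qed.

Lemma cont_snd (U V : topologicalType) (h : T -> U * V) :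
  continuous h -> continuous (fun x => (h x).2).
Proof. by move=> ch x; apply: (@continuous_comp _ _ _ h snd); [exact: ch | exact: cvg_snd]. Qed.

Lemma cont_pair (U V : topologicalType) (h : T -> U) (k : T -> V) :
  continuous h -> continuous k -> continuous (fun x => (h x, k x)).
Proof. by move=> ch ck x; apply: cvg_pair; [exact: ch | exact: ck]. Qed.

Lemma cont_comp (U V : topologicalType) (k : U -> V) (h : T -> U) :
  continuous k -> continuous h -> continuous (fun x => k (h x)).
Proof. by move=> ck ch x; apply: continuous_comp; [exact: ch | exact: ck]. Qed.

Lemma cont_ui f : continuous f -> continuous (fun x => ui (f x)).
Proof. exact: continuous_ui. Qed.

Lemma cont_ival (h : T -> unit_interval R) :
  continuous h -> continuous (fun x => ival (h x)).
Proof. exact: continuous_ival. Qed.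

Lemma cont_flip (h : T -> unit_interval R) :
  continuous h -> continuous (fun x => flip (h x)).
Proof.
move=> ch; apply: continuous_to_interval; apply: contD; first exact: cont_cst.
by apply: contN; exact: cont_ival.
Qed.
End Continuity.

Ltac cont := repeat first [ assumption | lazymatch goal with
  | |- continuous (fun x => ui (@?f x)) => refine (cont_ui _)
  | |- continuous (fun x => ival (@?f x)) => refine (cont_ival _)
  | |- continuous (fun x => flip (@?f x)) => refine (cont_flip _)
  | |- continuous (fun x => @?f x + @?g x) => refine (contD _ _)
  | |- continuous (fun x => - @?f x) => refine (contN _)
  | |- continuous (fun x => @?f x * @?g x) => refine (contM _ _)
  | |- continuous (fun x => clamp (@?f x)) => refine (cont_max _ (cont_min _ _))
  | |- continuous (fun x => Num.max (@?f x) (@?g x)) => refine (cont_max _ _)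
  | |- continuous (fun x => Num.min (@?f x) (@?g x)) => refine (cont_min _ _)
  | |- continuous (fun x => (@?f x, @?g x)) => refine (cont_pair _ _)
  | |- continuous (fun x => (@?f x).1) => refine (cont_fst _)
  | |- continuous (fun x => (@?f x).2) => refine (cont_snd _)
  | |- continuous (fun x => x) => refine (@cont_id _)
  | |- continuous fst => refine (cont_fst (@cont_id _))
  | |- continuous snd => refine (cont_snd (@cont_id _))
  | |- continuous (fun _ => ?c) => refine (@cont_cst _ _ c)
  end ].

(** * Homotopy equivalence of triples is an equivalence relation *)

Section HomotopyEquivalence.
Variable R : realType.
Notation I := (unit_interval R).

Definition heq (T U : topologicalType) (A B : set T) (C D : set U) :=
  exists f : T -> U, triple_homotopy_equivalence R A B C D f.

Lemma triple_map_comp (T U W : topologicalType) (A B : set T) (C D : set U)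
    (E F : set W) f g :
  triple_map A B C D f -> triple_map C D E F g -> triple_map A B E F (g \o f).
Proof.
move=> [cf fA fB] [cg gC gD]; split.
- by move=> x; apply: continuous_comp; [exact: cf | exact: cg].
- by move=> x /fA /gC.
- by move=> x /fB /gD.
Qed.

Lemma homotopic_comp (S T U W : topologicalType) (A' B' : set S) (A B : set T)
    (C D : set U) (E F : set W) h f f' g :
  triple_map A' B' A B h -> triple_map C D E F g ->
  triple_homotopic R A B C D f f' ->
  triple_homotopic R A' B' E F (g \o f \o h) (g \o f' \o h).
Proof.
move=> [ch hA hB] [cg gC gD] [H [cH H0 H1 HA HB]].
exists (fun xt => g (H (h xt.1, xt.2))); split.
- apply: cont_comp => //; apply: cont_comp => //; apply: cont_pair; last by cont.
  by apply: cont_comp => //; cont.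
- by move=> x t t0 /=; rewrite H0.
- by move=> x t t1 /=; rewrite H1.
- by move=> x t /hA Ax; apply: gC; exact: HA.
- by move=> x t /hB Bx; apply: gD; exact: HB.
Qed.

Lemma homotopic_trans (T U : topologicalType) (A B : set T) (C D : set U) f g h :
  triple_homotopic R A B C D f g -> triple_homotopic R A B C D g h ->
  triple_homotopic R A B C D f h.
Proof.
move=> [H [cH H0 H1 HA HB]] [K [cK K0 K1 KA KB]].
exists (fun xt : T * I => if 2 * ival xt.2 <= 1 then H (xt.1, ui (2 * ival xt.2))
                  else K (xt.1, ui (2 * ival xt.2 - 1))); split.
- apply: paste_continuous; [by cont | by cont | | |].
  + by apply: cont_comp => //; cont.
  + by apply: cont_comp => //; cont.
  + move=> [x t] /= ->; rewrite H1 ?ival_ui ?clamp1 // K0 //.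
    by rewrite ival_ui clamp0 // subrr.
- by move=> x t t0 /=; rewrite t0 mulr0 ler01 H0 // ival_ui clamp0.
- move=> x t t1 /=; rewrite t1 mulr1 ifF; last by apply/negbTE; rewrite -ltNge; lra.
  by rewrite K1 // ival_ui clamp1 //; lra.
- by move=> x t Ax /=; case: ifP => _; [exact: HA | exact: KA].
- by move=> x t Ax /=; case: ifP => _; [exact: HB | exact: KB].
Qed.

Lemma heq_sym (T U : topologicalType) (A B : set T) (C D : set U) :
  heq A B C D -> heq C D A B.
Proof. by move=> [f [mf [g [mg gf fg]]]]; exists g; split=> //; exists f. Qed.

Lemma heq_trans (T U W : topologicalType) (A B : set T) (C D : set U) (E F : set W) :
  heq A B C D -> heq C D E F -> heq A B E F.
Proof.
move=> [f [mf [g [mg gf fg]]]] [f' [mf' [g' [mg' gf' fg']]]].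
exists (f' \o f); split; first exact: triple_map_comp mf mf'.
exists (g \o g'); split; first exact: triple_map_comp mg' mg.
- apply: homotopic_trans gf; have := homotopic_comp mf mg gf'.
  by congr triple_homotopic; apply/funext.
- apply: homotopic_trans fg'; have := homotopic_comp mg' mf' fg.
  by congr triple_homotopic; apply/funext.
Qed.

Lemma homotopic_refl (T U : topologicalType) (A B : set T) (C D : set U) f :
  triple_map A B C D f -> triple_homotopic R A B C D f f.
Proof.
move=> [cf fA fB]; exists (fun xt => f xt.1); split=> //.
- by apply: cont_comp => //; cont.
- by move=> x t /fA.
- by move=> x t /fB.
Qed.

Lemma triple_map_id (T : topologicalType) (A B : set T) : triple_map A B A B id.
Proof. by split=> // x; exact: cvg_id. Qed.

Lemma homeo_heq (T U : topologicalType) (A B : set T) (C D : set U) f g :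
  triple_map A B C D f -> triple_map C D A B g -> cancel f g -> cancel g f ->
  heq A B C D.
Proof.
move=> mf mg fK gK; exists f; split=> //; exists g; split=> //.
- have -> : g \o f = id by apply/funext => x /=; rewrite fK.
  by apply: homotopic_refl; exact: triple_map_id.
- have -> : f \o g = id by apply/funext => x /=; rewrite gK.
  by apply: homotopic_refl; exact: triple_map_id.
Qed.
End HomotopyEquivalence.

(** * Square complexes *)

(** A complex of squares: each edge of fE spans a square, whose sides t = 0 and t = 1
    are attached to edges of fV by the maps fa; each vertex of fE spans an arc. *)
Record flat := Flat { fV : graph; fE : graph; fa : bool -> gmap fE fV }.

Definition fcell (F : flat) := (item (fV F) + item (fE F))%type.

Section FlatSpace.
Variable R : realType.
Notation I := (unit_interval R).

(** The gluing of a realization in terms of darts: the two darts of an edge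
    parametrize it in opposite directions. *)
Inductive irel (G : graph) : item G -> I -> item G -> I -> Prop :=
| IVert p s s' : irel (inl p) s (inl p) s'
| IEnd d s s' : ival s = 0 -> irel (inr d) s (inl (dsrc d)) s'
| IRev d s : irel (inr d) s (inr (drev d)) (flip s).

Lemma irel_map G H (f : gmap G H) x s y s' : irel x s y s' -> irel (f x) s (f y) s'.
Proof.
case=> [p {}s {}s'|d {}s {}s' s0|d {}s] /=.
- exact: IVert.
- by rewrite -dsrc_gdart; exact: IEnd.
- by rewrite gdart_rev; exact: IRev.
Qed.

Definition fpieces (F : flat) : topologicalType := {z : fcell F & (I * I)%type}.

Definition fpiece (F : flat) (z : fcell F) (s t : I) : fpieces F :=
  existT (fun _ : fcell F => (I * I)%type) z (s, t).

(** All cells are given pieces of the same type I x I, including those of fV, for which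
    FT makes the second coordinate immaterial. *)
Inductive fglue (F : flat) : fpieces F -> fpieces F -> Prop :=
| FV x s y s' t : irel x s y s' ->
    fglue (@fpiece F (inl x) s t) (@fpiece F (inl y) s' t)
| FE x s y s' t : irel x s y s' ->
    fglue (@fpiece F (inr x) s t) (@fpiece F (inr y) s' t)
| FT x s t t' : fglue (@fpiece F (inl x) s t) (@fpiece F (inl x) s t')
| FA (b : bool) x s t : ival t = (b : nat)%:R ->
    fglue (@fpiece F (inr x) s t) (@fpiece F (inl (fa F b x)) s t).

Definition fspace (F : flat) : topologicalType := glued (@fglue F).

Definition fpt (F : flat) (z : fcell F) (s t : I) : fspace F :=
  to_glued (@fglue F) (fpiece z s t).

Lemma fptV F x s y s' t t' :
  irel x s y s' -> fpt (F := F) (inl x) s t = fpt (inl y) s' t'.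
Proof.
move=> xy; transitivity (fpt (F := F) (inl y) s' t); apply: to_glued_eq.
  exact: FV.
exact: FT.
Qed.

Lemma fptE F x s y s' t :
  irel x s y s' -> fpt (F := F) (inr x) s t = fpt (inr y) s' t.
Proof. by move=> xy; apply: to_glued_eq; exact: FE. Qed.

Lemma fptT F x s t t' : fpt (F := F) (inl x) s t = fpt (inl x) s t'.
Proof. by apply: to_glued_eq; exact: FT. Qed.

Lemma fptA F (b : bool) x s t t' : ival t = (b : nat)%:R ->
  fpt (F := F) (inr x) s t = fpt (inl (fa F b x)) s t'.
Proof.
move=> tb; rewrite (fptT _ _ t' t); apply: to_glued_eq; exact: FA.
Qed.

Lemma fpt_surj F (w : fspace F) : exists z s t, w = fpt z s t.
Proof.
rewrite -(of_gluedK w); case: (of_glued w) => z [s t].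
by exists z, s, t.
Qed.

Lemma fpt_cont (T : topologicalType) F (z : fcell F) (p q : T -> I) :
  continuous p -> continuous q -> continuous (fun x => fpt z (p x) (q x)).
Proof.
move=> cp cq.
apply: (cont_comp (k := fun st : I * I => fpt z st.1 st.2)
  (h := fun x => (p x, q x))); last exact: cont_pair.
have -> : (fun st : I * I => fpt z st.1 st.2) =
    to_glued (@fglue F) \o existT (fun _ : fcell F => (I * I)%type) z.
  by apply/funext => -[].
move=> x; apply: continuous_comp; first exact: existT_continuous.
exact: to_glued_continuous.
Qed.

Definition vertical_vertex F (z : fcell F) : bool :=
  match z with inl (inl _) | inr (inl _) => true | _ => false end.

Definition fhor F : set (fspace F) :=
  [set w | exists z s t, vertical_vertex z /\ w = fpt z s t].

Definition fmid F : set (fspace F) :=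
  [set w | exists z s t, [/\ ~~ vertical_vertex z, ival s = 2^-1 & w = fpt z s t]].

Lemma fhor_pt F z s t : vertical_vertex z -> @fhor F (fpt z s t).
Proof. by exists z, s, t. Qed.

Lemma fmid_pt F z s t : ~~ vertical_vertex z -> ival s = 2^-1 -> @fmid F (fpt z s t).
Proof. by exists z, s, t. Qed.

(** Families of maps on the cells, depending on a parameter, that descend to the glued
    space and respect the horizontal graph and the mid-graph. *)
Record compatible (F : flat) (U : topologicalType) (C D : set U)
    (h : fcell F -> I -> I -> I -> U) : Prop := Compatible {
  comp_cont : forall z, continuous (fun p : I * I * I => h z p.1.1 p.1.2 p.2);
  comp_V : forall x s y s' t u, irel x s y s' -> h (inl x) s t u = h (inl y) s' t u;
  comp_E : forall x s y s' t u, irel x s y s' -> h (inr x) s t u = h (inr y) s' t u;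
  comp_T : forall x s t t' u, h (inl x) s t u = h (inl x) s t' u;
  comp_A : forall (b : bool) x s t u, ival t = (b : nat)%:R ->
    h (inr x) s t u = h (inl (fa F b x)) s t u;
  comp_hor : forall z s t u, vertical_vertex z -> C (h z s t u);
  comp_mid : forall z s t u, ~~ vertical_vertex z -> ival s = 2^-1 -> D (h z s t u) }.

Lemma compatible_homotopy F (U : topologicalType) (C D : set U) h :
  compatible C D h -> exists H : fspace F * I -> U,
    [/\ continuous H, forall z s t u, H (fpt z s t, u) = h z s t u,
      forall x u, fhor x -> C (H (x, u)) & forall x u, fmid x -> D (H (x, u))].
Proof.
move=> [hc hV hE hT hA hh hm].
pose H (p : fspace F * I) : U :=
  match of_glued p.1 with existT z st => h z st.1 st.2 p.2 end.
have HE z s t u : H (fpt z s t, u) = h z s t u.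
  pose k (w : fpieces F) : U := match w with existT z st => h z st.1 st.2 u end.
  have : forall x y, fglue x y -> k x = k y.
    by move=> x y []; rewrite /k /=; auto.
  by move=> /glued_respects /(_ (fpiece z s t)).
exists H; split=> //.
- apply: glued_prod_continuous.
  pose k z (st : I * I) := fun u => h z st.1 st.2 u.
  have -> : (fun x : fpieces F * I => H (to_glued (@fglue F) x.1, x.2)) =
     (fun x : fpieces F * I => match x.1 with existT z st => h z st.1 st.2 x.2 end).
    by apply/funext => -[[z [s t]] u] /=; exact: HE.
  move=> [[z st] u] W /= nW.
  have [[P Q] /= [Pst Qu] PQ] := hc z (st, u) _ nW.
  exists (existT (fun _ : fcell F => (I * I)%type) z @` P, Q) => /=.
    by split=> //; exact: existT_nbhs.
  by move=> [[z' st'] u'] /= [[st2 P2 [? ?]] Q2]; subst; apply: (PQ (_, _)); split.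
- by move=> x u [z [s [t [zv ->]]]]; rewrite HE; exact: hh.
- by move=> x u [z [s [t [zv s2 ->]]]]; rewrite HE; exact: hm.
Qed.

Lemma compatible_map F (U : topologicalType) (C D : set U) (h : fcell F -> I -> I -> U) :
  compatible C D (fun z s t _ => h z s t) -> exists f : fspace F -> U,
    triple_map (@fhor F) (@fmid F) C D f /\ forall z s t, f (fpt z s t) = h z s t.
Proof.
move=> /compatible_homotopy [H [cH HE hH mH]].
exists (fun x => H (x, ui 0)); split; last by move=> z s t; rewrite HE.
split; [exact: prod_continuous_l | by move=> x; exact: hH | by move=> x; exact: mH].
Qed.

Lemma compatible_homotopic F (U : topologicalType) (C D : set U)
    (h : fcell F -> I -> I -> I -> U) f g :
  compatible C D h ->
  (forall z s t u, ival u = 0 -> h z s t u = f (fpt z s t)) ->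
  (forall z s t u, ival u = 1 -> h z s t u = g (fpt z s t)) ->
  triple_homotopic R (@fhor F) (@fmid F) C D f g.
Proof.
move=> /compatible_homotopy [H [cH HE hH mH]] h0 h1.
exists H; split=> //.
- by move=> x u u0; have [z [s [t ->]]] := fpt_surj x; rewrite HE h0.
- by move=> x u u0; have [z [s [t ->]]] := fpt_surj x; rewrite HE h1.
Qed.

Definition fheq (F G : flat) :=
  heq R (@fhor F) (@fmid F) (@fhor G) (@fmid G).

Definition flat_iso (F G : flat) :=
  exists (gV : gmap (fV F) (fV G)) (gE : gmap (fE F) (fE G)),
    [/\ giso gV, giso gE & forall b x, gV (fa F b x) = fa G b (gE x)].

Lemma natural_compatible F G (gV : gmap (fV F) (fV G)) (gE : gmap (fE F) (fE G)) :
  (forall b x, gV (fa F b x) = fa G b (gE x)) ->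
  compatible (@fhor G) (@fmid G) (fun z s t _ =>
    match z with inl x => fpt (inl (gV x)) s t | inr x => fpt (inr (gE x)) s t end).
Proof.
move=> gEV; split.
- by case=> x /=; apply: fpt_cont; cont.
- by move=> x s y s' t _ xy; apply: fptV; exact: irel_map.
- by move=> x s y s' t _ xy; apply: fptE; exact: irel_map.
- by move=> x s t t' _; exact: fptT.
- by move=> b x s t _ tb; rewrite (fptA _ _ t tb) gEV.
- by case=> [[p|d]|[p|d]] s t _ // _; exact: fhor_pt.
- by case=> [[p|d]|[p|d]] s t _ // _ s2; exact: fmid_pt.
Qed.

Lemma flat_iso_heq F G : flat_iso F G -> fheq F G.
Proof.
move=> [gV [gE [/giso_inverse [kV [gVK kVK]] /giso_inverse [kE [gEK kEK]] gEV]]].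
have kEV b x : kV (fa G b x) = fa F b (kE x).
  by rewrite -[in LHS](kEK x) -gEV gVK.
have [f [mf fE]] := compatible_map (natural_compatible gEV).
have [g [mg gE']] := compatible_map (natural_compatible kEV).
apply: (homeo_heq _ mf mg) => w; have [[x|x] [s [t ->]]] := fpt_surj w.
- by rewrite fE gE' gVK.
- by rewrite fE gE' gEK.
- by rewrite gE' fE kVK.
- by rewrite gE' fE kEK.
Qed.
End FlatSpace.

(** * Collapsing product edges *)

Section SplitItems.
Variables G H : graph.

Definition gsplit (z : item (gplus G H)) : item G + item H :=
  match z with
  | inl (inl p) => inl (inl p) | inl (inr p) => inr (inl p)
  | inr (inl e, b) => inl (inr (e, b)) | inr (inr e, b) => inr (inr (e, b))
  end.

Lemma gsplitl x : gsplit (ginl G H x) = inl x.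
Proof. by case: x => [p|[e b]] //=; rewrite addbF. Qed.

Lemma gsplitr x : gsplit (ginr G H x) = inr x.
Proof. by case: x => [p|[e b]] //=; rewrite addbF. Qed.

Lemma gsplit_irel (R : realType) (z z' : item (gplus G H)) (s s' : unit_interval R) :
  irel z s z' s' ->
  (exists x x', [/\ z = ginl G H x, z' = ginl G H x' & irel x s x' s']) \/
  (exists x x', [/\ z = ginr G H x, z' = ginr G H x' & irel x s x' s']).
Proof.
case=> [[p|p] {}s {}s'|[[e|e] b] {}s {}s' s0|[[e|e] b] {}s].
- by left; exists (inl p), (inl p); split=> //; exact: IVert.
- by right; exists (inl p), (inl p); split=> //; exact: IVert.
- left; exists (inr (e, b)), (inl (dsrc (e, b))); rewrite /= /gdart /= addbF.
  by split=> //; exact: IEnd.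
- right; exists (inr (e, b)), (inl (dsrc (e, b))); rewrite /= /gdart /= addbF.
  by split=> //; exact: IEnd.
- left; exists (inr (e, b)), (inr (drev (e, b))); rewrite /= /gdart /= !addbF.
  by split=> //; exact: IRev.
- right; exists (inr (e, b)), (inr (drev (e, b))); rewrite /= /gdart /= !addbF.
  by split=> //; exact: IRev.
Qed.
End SplitItems.

Section CollapseProduct.
Variables (R : realType) (V' E' N : graph) (c : bool) (h : gmap N V').
Variable a : bool -> gmap E' (gplus V' N).
Notation I := (unit_interval R).

(** The cells of N in the second summand span a product N x I; its end c is the copy of
    N, and its other end is attached to the rest along h. *)
Definition product_flat : flat :=
  @Flat (gplus V' N) (gplus E' N)
    (fun b => gcase (a b) (if b == c then ginr V' N else gcomp (ginl V' N) h)).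

Definition collapsed_flat : flat :=
  @Flat V' E' (fun b => gcomp (gcase (gid V') h) (a b)).

(** Parametrizes the arcs of the product so that they end, at 1, in the copy of N. *)
Definition toward (t : I) : I := if c then t else flip t.

Lemma towardK : involutive toward.
Proof. by rewrite /toward; case: c => // t; exact: flipK. Qed.

Lemma toward_cont : continuous toward.
Proof. by rewrite /toward; case: c => /=; cont. Qed.

Lemma ival_toward1 t : ival t = 1 -> ival (toward t) = (c : bool)%:R.
Proof. by rewrite /toward; case: c => // t1; rewrite ival_flip t1 subrr. Qed.

Lemma ival_toward0 t : ival t = 0 -> ival (toward t) = (~~ c : bool)%:R.
Proof. by rewrite /toward; case: c => // t1; rewrite ival_flip t1 subr0. Qed.

Definition Npt (n : item N) (s v : I) : fspace R product_flat :=
  fpt (F := product_flat) (inr (ginr E' N n)) s (toward v).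

Lemma Npt1 n s v t : ival v = 1 ->
  Npt n s v = fpt (F := product_flat) (inl (ginr V' N n)) s t.
Proof.
move=> v1; rewrite /Npt (fptA _ _ t (ival_toward1 v1)) /=.
by rewrite gcaseEr eqxx.
Qed.

Lemma Npt0 n s v t : ival v = 0 ->
  Npt n s v = fpt (F := product_flat) (inl (ginl V' N (h n))) s t.
Proof.
move=> v1; rewrite /Npt (fptA _ _ t (ival_toward0 v1)) /=.
by rewrite gcaseEr -addbT -[X in _ == X]addbF (inj_eq (@addbI c)) gcompE.
Qed.

(** The part of the product between the end of e and the rest of the complex; it is
    constant when e is not attached to the copy of N. *)
Definition near (b : bool) (e : item E') (s v : I) : fspace R product_flat :=
  match gsplit (a b e) with
  | inl x => fpt (F := product_flat) (inl (ginl V' N x)) s v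
  | inr n => Npt n s v
  end.

Lemma near1 b e s v t : ival v = 1 ->
  near b e s v = fpt (F := product_flat) (inl (a b e)) s t.
Proof.
move=> v1; rewrite /near; have [[x ->]|[n ->]] := gplusP (a b e).
  by rewrite gsplitl; exact: fptT.
by rewrite gsplitr; exact: Npt1.
Qed.

(** The path across e at time u of the deformation: the outer parts, of length
    (1 - u) / 3, run through the product, and the inner part is all of e. *)
Definition stretch (e : item E') (s t u : I) : fspace R product_flat :=
  if 3 * ival t <= 1 - ival u then near false e s (ui (ival u + 3 * ival t))
  else if 3 * (1 - ival t) <= 1 - ival u then
    near true e s (ui (ival u + 3 * (1 - ival t)))
  else fpt (F := product_flat) (inr (ginl E' N e)) s
         (ui ((3 * ival t - 1 + ival u) * (1 + 2 * ival u)^-1)).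

Lemma near_cont (T : topologicalType) b e (p q : T -> I) :
  continuous p -> continuous q -> continuous (fun x => near b e (p x) (q x)).
Proof.
move=> cp cq; rewrite /near; case: (gsplit _) => x; apply: fpt_cont => //.
by apply: cont_comp => //; exact: toward_cont.
Qed.

Lemma near_irel b x s y s' t : irel x s y s' -> near b x s t = near b y s' t.
Proof.
rewrite /near => /(irel_map (a b)) /gsplit_irel [] [z [z' [-> -> zz]]];
  rewrite !(gsplitl, gsplitr).
- by apply: fptV; exact: irel_map.
- by apply: fptE; exact: irel_map.
Qed.

Lemma stretch_cont e :
  continuous (fun p : I * I * I => stretch e p.1.1 p.1.2 p.2).
Proof.
have pos (u : I) : 1 + 2 * ival u != 0.
  by apply: lt0r_neq0; have := ival_ge0 u; lra.
apply: paste_continuous; [by cont | by cont | by apply: near_cont; cont | |].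
  apply: paste_continuous; [by cont | by cont | by apply: near_cont; cont | |].
    apply: fpt_cont; first by cont.
    apply: cont_ui; apply: contM; first by cont.
    by apply: contV => //; cont.
  move=> [[s t] u] /= tu; have -> : ival t = 1 - 3^-1 * (1 - ival u) by lra.
  have u1 : (ui (ival u + 3 * (1 - (1 - 3^-1 * (1 - ival u)))) : I) = ui 1.
    by congr ui; field.
  rewrite u1 (near1 _ _ _ t) ?ival_ui ?clamp1 //.
  rewrite (@fptA _ product_flat true _ _ _ t) /=; first by rewrite gcaseEl.
  rewrite (_ : _ * _ = 1) ?ival_ui ?clamp1 //.
  by field; exact: pos.
move=> [[s t] u] /= tu; have t3 : ival t = 3^-1 * (1 - ival u) by lra.
have := ival_ge0 u; have := ival_le1 u => ul ug.
rewrite ifF; last by apply/negbTE; rewrite -ltNge t3; lra.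
rewrite (near1 _ _ _ t); last by rewrite ival_ui clamp1 // t3; lra.
rewrite (@fptA _ product_flat false _ _ _ t) /=; first by rewrite gcaseEl.
rewrite (_ : _ * _ = 0) ?ival_ui ?clamp0 //.
by rewrite t3; field; exact: pos.
Qed.

Lemma stretch_irel x s y s' t u : irel x s y s' -> stretch x s t u = stretch y s' t u.
Proof.
move=> xy; rewrite /stretch !(near_irel _ _ xy).
by rewrite (fptE (F := product_flat) _ (irel_map (ginl E' N) xy)).
Qed.

Lemma stretch_end b e s t u : ival t = (b : bool)%:R ->
  stretch e s t u = near b e s u.
Proof.
have := ival_ge0 u; have := ival_le1 u => ul ug tb.
rewrite /stretch tb; case: b tb => /= tb.
  rewrite ifF; last by apply/negbTE; rewrite -ltNge; lra.
  rewrite ifT; last by lra.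
  by rewrite subrr mulr0 addr0 ivalK.
by rewrite ifT; [rewrite mulr0 addr0 ivalK | lra].
Qed.

Lemma stretch1 e s t u : ival u = 1 ->
  stretch e s t u = fpt (F := product_flat) (inr (ginl E' N e)) s t.
Proof.
have := ival_ge0 t; have := ival_le1 t => tl tg u1.
rewrite /stretch u1; case: ifPn => [t0|_].
  have {}t0 : ival t = 0 by lra.
  rewrite (near1 _ _ _ t); last by rewrite ival_ui clamp1 //; lra.
  by rewrite (@fptA _ product_flat false _ _ _ t t0) /= gcaseEl.
case: ifPn => [t1|_].
  have {}t1 : ival t = 1 by lra.
  rewrite (near1 _ _ _ t); last by rewrite ival_ui clamp1 //; lra.
  by rewrite (@fptA _ product_flat true _ _ _ t t1) /= gcaseEl.
congr fpt; apply: ival_inj; rewrite ival_ui (_ : _ * _ = ival t) ?clamp_id ?tg //.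
by field; lra.
Qed.

Definition collapse_fun (z : fcell product_flat) (s t : I) : fspace R collapsed_flat :=
  match z with
  | inl x => fpt (F := collapsed_flat) (inl (gcase (gid V') h x)) s t
  | inr y => match gsplit y with
    | inl e => fpt (F := collapsed_flat) (inr e) s t
    | inr n => fpt (F := collapsed_flat) (inl (h n)) s t end
  end.

Definition expand_fun (z : fcell collapsed_flat) (s t : I) : fspace R product_flat :=
  match z with
  | inl x => fpt (F := product_flat) (inl (ginl V' N x)) s t
  | inr e => stretch e s t (ui 0)
  end.

Definition push_fun (z : fcell product_flat) (s t u : I) : fspace R product_flat :=
  match z with
  | inl x => match gsplit x with
    | inl x => fpt (F := product_flat) (inl (ginl V' N x)) s t
    | inr n => Npt n s u end
  | inr y => match gsplit y with
    | inl e => stretch e s t u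
    | inr n => Npt n s (ui (ival u * ival (toward t))) end
  end.

(** In the collapsed complex, the outer thirds of a stretched path are constant. *)
Definition unstretch_fun (z : fcell collapsed_flat) (s t u : I) : fspace R collapsed_flat :=
  match z with
  | inl x => fpt (F := collapsed_flat) (inl x) s t
  | inr e => fpt (F := collapsed_flat) (inr e) s
       (ui ((1 - ival u) * clamp (3 * ival t - 1) + ival u * ival t))
  end.

Notation "'HM' F" := (compatible (@fhor R F) (@fmid R F)) (at level 10, F at level 9).

Lemma fhor_near b e s v : @fhor R product_flat (near b (inl e) s v).
Proof. by rewrite /near; case: (a b) => va ea fl ok /=; case: (va e) => p; exact: fhor_pt. Qed.

Lemma fmid_near b e s v : ival s = 2^-1 -> @fmid R product_flat (near b (inr e) s v).
Proof.
move=> s2; rewrite /near; case: (a b) => va ea fl ok /=; case: e => e b'.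
by rewrite /gdart /=; case: (ea e) => p; exact: fmid_pt.
Qed.

Lemma fhor_stretch e s t u : @fhor R product_flat (stretch (inl e) s t u).
Proof.
rewrite /stretch; case: ifP => _; first exact: fhor_near.
by case: ifP => _; [exact: fhor_near | exact: fhor_pt].
Qed.

Lemma fmid_stretch e s t u : ival s = 2^-1 ->
  @fmid R product_flat (stretch (inr e) s t u).
Proof.
move=> s2; rewrite /stretch; case: ifP => _; first exact: fmid_near.
by case: ifP => _; [exact: fmid_near | exact: fmid_pt].
Qed.

Lemma collapse_compatible :
  HM collapsed_flat (fun z s t _ => collapse_fun z s t).
Proof.
split.
- by case=> [x|y] /=; [|case: (gsplit y) => x]; apply: fpt_cont; cont.
- by move=> x s y s' t _ xy; apply: (fptV (F := collapsed_flat)); exact: irel_map.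
- move=> x s y s' t _ /gsplit_irel [] [z [z' [-> -> zz]]] /=;
    rewrite !(gsplitl, gsplitr).
  + by apply: (fptE (F := collapsed_flat)).
  + by apply: (fptV (F := collapsed_flat)); exact: irel_map.
- by move=> x s t t' _; exact: (fptT (F := collapsed_flat)).
- move=> b x s t _ tb /=; have [[e ->]|[n ->]] := gplusP x;
    rewrite ?(gsplitl, gsplitr) ?(gcaseEl, gcaseEr).
  + by rewrite (fptA _ _ t tb) /= gcompE.
  + by case: ifP => _; rewrite ?gcompE ?(gcaseEl, gcaseEr) ?gidE.
- case=> [[[p|p]|d]|[[p|p]|d]] s t _ //= _; exact: (fhor_pt (F := collapsed_flat)).
- case=> [[p|[[e|e] b]]|[p|[[e|e] b]]] s t _ //= _ s2; exact: (fmid_pt (F := collapsed_flat)).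
Qed.

Lemma expand_compatible :
  HM product_flat (fun z s t _ => expand_fun z s t).
Proof.
split.
- case=> x /=; first by apply: fpt_cont; cont.
  apply: (cont_comp (k := fun p : I * I * I => stretch x p.1.1 p.1.2 p.2)
    (h := fun p => (p.1.1, p.1.2, ui 0))); first exact: stretch_cont.
  by cont.
- by move=> x s y s' t _ xy; apply: (fptV (F := product_flat)); exact: irel_map.
- by move=> x s y s' t _ xy; exact: stretch_irel.
- by move=> x s t t' _; exact: (fptT (F := product_flat)).
- move=> b x s t _ tb /=; rewrite (stretch_end _ _ _ tb) gcompE /near.
  have [[y ->]|[n ->]] := gplusP (a b x).
    by rewrite gsplitl gcaseEl gidE; exact: (fptT (F := product_flat)).
  by rewrite gsplitr gcaseEr; apply: Npt0; rewrite ival_ui clamp0.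
- case=> [[p|d]|[p|d]] s t _ //= _; [exact: (fhor_pt (F := product_flat)) | exact: fhor_stretch].
- case=> [[p|d]|[p|d]] s t _ //= _ s2; [exact: (fmid_pt (F := product_flat)) | exact: fmid_stretch].
Qed.

Lemma push_compatible : HM product_flat push_fun.
Proof.
split.
- case=> x /=.
    by case: (gsplit x) => y; apply: fpt_cont; cont; apply: cont_comp; cont; exact: toward_cont.
  case: (gsplit x) => y; first exact: stretch_cont.
  apply: fpt_cont; cont; apply: cont_comp; first exact: toward_cont.
  by cont; apply: cont_comp; [exact: toward_cont | cont].
- move=> x s y s' t u /gsplit_irel [] [z [z' [-> -> zz]]] /=;
    rewrite !(gsplitl, gsplitr).
  + by apply: (fptV (F := product_flat)); exact: irel_map.
  + by apply: (fptE (F := product_flat)); exact: irel_map.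
- move=> x s y s' t u /gsplit_irel [] [z [z' [-> -> zz]]] /=;
    rewrite !(gsplitl, gsplitr).
  + exact: stretch_irel.
  + by apply: (fptE (F := product_flat)); exact: irel_map.
- by move=> x s t t' u /=; case: (gsplit x) => y //; exact: (fptT (F := product_flat)).
- move=> b x s t u tb /=; have [[e ->]|[n ->]] := gplusP x;
    rewrite ?(gsplitl, gsplitr) ?(gcaseEl, gcaseEr).
    rewrite (stretch_end _ _ _ tb) /near; case: (gsplit _) => // y; exact: (fptT (F := product_flat)).
  have tbE : ival (toward t) = (b == c)%:R.
    rewrite /toward; case: (c); rewrite ?ival_flip tb; case: (b); rewrite /= ?subrr ?subr0 //.
  move: tbE; case: eqP => bc -> /=; rewrite ?gcompE ?gsplitl ?gsplitr.
    by rewrite mulr1 ivalK.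
  by apply: Npt0; rewrite mulr0 ival_ui clamp0.
- case=> [[[p|p]|d]|[[p|p]|d]] s t u //= _; try exact: (fhor_pt (F := product_flat)); exact: fhor_stretch.
- case=> [[p|[[e|e] b]]|[p|[[e|e] b]]] s t u //= _ s2; try exact: (fmid_pt (F := product_flat)); exact: fmid_stretch.
Qed.

Lemma unstretch_compatible : HM collapsed_flat unstretch_fun.
Proof.
split.
- by case=> x /=; apply: fpt_cont; cont.
- by move=> x s y s' t u; exact: (fptV (F := collapsed_flat)).
- by move=> x s y s' t u; exact: (fptE (F := collapsed_flat)).
- by move=> x s t t' u; exact: (fptT (F := collapsed_flat)).
- move=> b x s t u tb /=; apply: (fptA (F := collapsed_flat)); rewrite ival_ui.
  rewrite (_ : _ + _ = (b : nat)%:R); first by case: (b); [exact: clamp1 | exact: clamp0].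
  by rewrite tb; case: (b) => /=; [rewrite clamp1 | rewrite clamp0]; lra.
- by case=> [[p|d]|[p|d]] s t u //= _; exact: (fhor_pt (F := collapsed_flat)).
- by case=> [[p|d]|[p|d]] s t u //= _ s2; exact: (fmid_pt (F := collapsed_flat)).
Qed.

(** The product deforms onto the end at h; a square attached to the other end is
    prolonged by the part of the product between the two ends. *)
Theorem product_collapse_heq : fheq R product_flat collapsed_flat.
Proof.
have [r [mr rE]] := compatible_map collapse_compatible.
have [f [mf fE]] := compatible_map expand_compatible.
exists r; split=> //; exists f; split=> //.
- apply: (compatible_homotopic push_compatible) => [z s t u u0|z s t u u1] /=.
    rewrite rE; case: z => x /=.
      rewrite fE /=; have [[y ->]|[n ->]] := gplusP x.
        by rewrite gsplitl gcaseEl gidE.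
      by rewrite gsplitr gcaseEr; exact: Npt0.
    case: (gsplit x) => y; rewrite fE /=.
      by rewrite (_ : u = ui 0) //; apply: ival_inj; rewrite ival_ui clamp0.
    by apply: Npt0; rewrite u0 mul0r ival_ui clamp0.
  case: z => x /=; have [[y ->]|[n ->]] := gplusP x; rewrite ?(gsplitl, gsplitr) //.
  + exact: Npt1.
  + exact: stretch1.
  + by rewrite u1 mul1r ivalK /Npt towardK.
- apply: (compatible_homotopic unstretch_compatible) => [z s t u u0|z s t u u1] /=.
    rewrite fE; case: z => x /=.
      by rewrite rE /= gcaseEl gidE.
    rewrite u0 subr0 mul1r mul0r addr0.
    have nearE b v t' : r (near b x s v) =
        fpt (F := collapsed_flat) (inl (fa collapsed_flat b x)) s t'.
      rewrite /near /= gcompE; have [[y ->]|[n ->]] := gplusP (a b x).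
        by rewrite gsplitl rE /= !gcaseEl gidE; exact: (fptT (F := collapsed_flat)).
      by rewrite gsplitr rE /= gsplitr gcaseEr; exact: (fptT (F := collapsed_flat)).
    have ui0 : ival (ui 0 : I) = 0 by rewrite ival_ui clamp0.
    rewrite /stretch ui0 !subr0 !mulr0 !addr0 invr1 mulr1.
    case: ifP => t1.
      rewrite (nearE _ _ t); apply: (@fptA _ collapsed_flat false).
      by rewrite ival_ui !clamp0 //; lra.
    case: ifP => t2.
      rewrite (nearE _ _ t); apply: (@fptA _ collapsed_flat true).
      by rewrite ival_ui !clamp1 //; lra.
    rewrite rE /= gsplitl -[clamp _]/(ival (ui _)) ivalK.
    by [].

  case: z => x //=; rewrite u1 subrr mul0r add0r mul1r ivalK //.
Qed.
End CollapseProduct.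

(** * Removing free cells *)

Lemma irel_lift (R : realType) G H (f : gmap G H) x y' (s s' : unit_interval R) :
  irel (f x) s y' s' -> exists y, y' = f y /\ irel x s y s'.
Proof.
move E: (f x) => z xy; case: xy E => [p {}s {}s'|d {}s {}s' s0|d {}s]; case: x => [q|d'] //= [<-].
- by exists (inl q); split=> //; exact: IVert.
- by exists (inl (dsrc d')); rewrite dsrc_gdart; split=> //; exact: IEnd.
- by exists (inr (drev d')); rewrite /= gdart_rev; split=> //; exact: IRev.
Qed.

(** The cells x of fE with rho x = Some b are removed together with their ends b, to which
    no other cell is attached. *)
Section RemoveFreeCells.
Variables (R : realType) (F G : flat).
Variables (jV : gmap (fV G) (fV F)) (jE : gmap (fE G) (fE F)).
Variable rho : item (fE F) -> option bool.
Notation I := (unit_interval R).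
Hypotheses (jVi : injective jV) (jEi : injective jE).
Hypothesis jVE : forall b y, jV (fa G b y) = fa F b (jE y).
Hypothesis rho_rev : forall d, rho (inr (drev d)) = rho (inr d).
Hypothesis jE_image : forall x, (exists y, jE y = x) <-> rho x = None.
Hypothesis jV_image : forall v,
  (exists y, jV y = v) <-> ~ exists x b, rho x = Some b /\ fa F b x = v.
Hypothesis rho_free : forall x b x' b',
  rho x = Some b -> fa F b' x' = fa F b x -> x' = x /\ b' = b.
Hypothesis rho_isolated : forall q d, rho (inl q) <> None -> dsrc d <> q.

Definition freeing (v : item (fV F)) : option (item (fE F) * bool) :=
  [pick xb | (rho xb.1 == Some xb.2) && (fa F xb.2 xb.1 == v)].

Lemma freeing_None v : freeing v = None <-> exists y, jV y = v.
Proof.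
rewrite jV_image /freeing; case: pickP => [[x b] /andP[/eqP/= xb /eqP xv]|none].
  by split=> // -[]; exists x, b.
split=> // _ [x [b [xb xv]]]; have /negbT := none (x, b).
by rewrite /= xb xv !eqxx.
Qed.

Lemma freeingE x b : rho x = Some b -> freeing (fa F b x) = Some (x, b).
Proof.
move=> xb; rewrite /freeing; case: pickP => [[x' b'] /andP[_ /eqP/=]|none].
  by move=> /(rho_free xb) [-> ->].
by have := none (x, b); rewrite /= xb !eqxx.
Qed.

Lemma freeing_far x b b' : rho x = Some b -> b' != b -> freeing (fa F b' x) = None.
Proof.
move=> xb bb; rewrite /freeing; case: pickP => // -[x2 b2] /andP[/eqP/= xb2 /eqP e].
have [e1 e2] := rho_free xb2 (esym e); move: bb; rewrite e2; move: xb; rewrite e1 xb2 => -[->].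
by rewrite eqxx.
Qed.

Lemma rho_end d : rho (inl (dsrc d)) = None.
Proof. by case E: (rho _) => //; exfalso; apply: (@rho_isolated (dsrc d) d); rewrite ?E. Qed.

(** A removed cell of fV is the free end of exactly one removed cell of fE, which
    therefore determines the map on it. *)
Definition cell_fun (U : Type) (gV : item (fV F) -> I -> I -> U)
    (gE : item (fE F) -> I -> I -> I -> U) (z : fcell F) (s t u : I) : U :=
  match z with
  | inr x => gE x s t u
  | inl v => match freeing v with
    | Some xb => gE xb.1 s (ui (xb.2 : nat)%:R) u
    | None => gV v s u end
  end.

Lemma cell_fun_compatible (U : topologicalType) (C D : set U) gV gE :
  (forall v, continuous (fun p : I * I => gV v p.1 p.2)) ->
  (forall x, continuous (fun p : I * I * I => gE x p.1.1 p.1.2 p.2)) ->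
  (forall y s v' s' u, irel (jV y) s v' s' -> gV (jV y) s u = gV v' s' u) ->
  (forall x s x' s' t u, irel x s x' s' -> gE x s t u = gE x' s' t u) ->
  (forall (b : bool) x s t u, ival t = (b : nat)%:R -> freeing (fa F b x) = None ->
     gE x s t u = gV (fa F b x) s u) ->
  (forall p s u, freeing (inl p) = None -> C (gV (inl p) s u)) -> (forall q s t u, C (gE (inl q) s t u)) ->
  (forall d s u, ival s = 2^-1 -> freeing (inr d) = None -> D (gV (inr d) s u)) ->
  (forall d s t u, ival s = 2^-1 -> D (gE (inr d) s t u)) ->
  compatible C D (cell_fun gV gE).
Proof.
move=> cV cE hV hE hA vC eC vD eD.
have uib (b : bool) : ival (ui (b : nat)%:R : I) = (b : nat)%:R.
  by rewrite ival_ui; case: b; [rewrite clamp1 | rewrite clamp0].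
have hVE (b : bool) x s t u : ival t = (b : nat)%:R ->
    gE x s t u = cell_fun gV gE (inl (fa F b x)) s t u.
  move=> tb; rewrite /=; case E: (freeing _) => [[x' b']|]; last exact: hA.
  move: E; rewrite /freeing; case: pickP => // -[x2 b2] /andP[/eqP/= xb2 /eqP e] [? ?]; subst.
  have [-> e2] := rho_free xb2 (esym e); congr gE; apply: ival_inj.
  by rewrite tb uib e2.
split.
- case=> [v|x] /=; last exact: cE.
  case: (freeing v) => [[x b]|] /=.
    apply: (cont_comp (k := fun p : I * I * I => gE x p.1.1 p.1.2 p.2)
      (h := fun p : I * I * I => (p.1.1, ui (b : nat)%:R, p.2))); first exact: cE.
    by cont.
  apply: (cont_comp (k := fun p : I * I => gV v p.1 p.2)
      (h := fun p : I * I * I => (p.1.1, p.2))); first exact: cV.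
  by cont.
- move=> x s y s' t u xy; case E: (freeing x) => [[x' b]|].
    move: (E); rewrite /freeing; case: pickP => // -[x2 b2] /andP[/eqP/= xb2 /eqP e] [? ?].
    subst; have [y' [-> xy']] := irel_lift xy.
    rewrite /= E /= (hE _ _ _ _ _ _ xy') (hVE b) ?uib //=.
  move: (E) xy => /freeing_None [y0 <-] xy; have [y' [yE _]] := irel_lift xy.
  have f1 : freeing (jV y0) = None by apply/freeing_None; exists y0.
  have f2 : freeing y = None by apply/freeing_None; exists y'; rewrite yE.
  by rewrite /cell_fun f1 f2; exact: hV.
- by move=> x s y s' t u; exact: hE.
- by [].
- by move=> b x s t u; exact: hVE.
- case=> [[p|d]|[p|d]] s t u //= _; case E: (freeing _) => [[x b]|] /=; last exact: vC.
  move: E; rewrite /freeing; case: pickP => // -[[q|x2] b2] /andP[_ /eqP/= e] [<- _] //.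
- case=> [[p|d]|[p|d]] s t u //= _ s2; last exact: eD.
  case E: (freeing _) => [[x b]|] //=; last exact: vD.
  move: E; rewrite /freeing; case: pickP => // -[[q|x2] b2] /andP[_ /eqP/= e] [<- _] //.
  exact: eD.
Qed.

(** The distance to the end opposite to the end b. *)
Definition height (b : bool) (t : R) : R := if b then t else 1 - t.

Lemma heightK b : involutive (height b).
Proof. by case: b => // t; rewrite /height opprB addrCA subrr addr0. Qed.

Lemma height_end (b b' : bool) (t : I) : ival t = (b' : nat)%:R ->
  height b (ival t) = (b == b')%:R.
Proof. by rewrite /height => ->; case: b; case: b'; rewrite /= ?subr0 ?subrr. Qed.

Lemma height_bounds b (t : I) : 0 <= height b (ival t) <= 1.
Proof. by have := ival_ge0 t; have := ival_le1 t; rewrite /height; case: b; lra. Qed.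

Lemma height_cont (T : topologicalType) b (p : T -> R) :
  continuous p -> continuous (fun x => height b (p x)).
Proof. by case: b => //= cp; cont. Qed.

(** The retraction of the square onto the three sides other than the free one, in the
    coordinates (s, height).  It maps the lines s = 0, 1/2, 1 as required of triples:
    the outer ones are fixed, and the middle one is sent to the midpoint of the far end.
    The factor 4 only has to be large enough for squeeze to reach the
    boundary of the interval before sink becomes positive. *)
Definition squeeze (s h : R) : R := 2^-1 + (s - 2^-1) * (1 + h).
Definition sink (s h : R) : R := Num.max 0 (h - 4 * Num.min s (1 - s)).

Lemma squeeze_rev s h : squeeze (1 - s) h = 1 - squeeze s h.
Proof. by rewrite /squeeze; field. Qed.

Lemma clamp_rev (x : R) : clamp (1 - x) = 1 - clamp x.
Proof.
have [x0|x0] := lerP x 0; first by rewrite clamp1 ?clamp0 //; lra.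
have [x1|x1] := lerP 1 x; first by rewrite clamp0 ?clamp1 //; lra.
by rewrite !clamp_id //; lra.
Qed.

Lemma sink_rev s h : sink (1 - s) h = sink s h.
Proof. by rewrite /sink opprB addrCA subrr addr0 minC. Qed.

Lemma squeeze_le0 s h : 0 <= s -> 0 <= h <= 1 -> 4 * s <= h -> squeeze s h <= 0.
Proof. by move=> s0 /andP[h0 h1] sh; rewrite /squeeze; nra. Qed.

Lemma sink_low s h : s <= 2^-1 -> h <= 4 * s -> sink s h = 0.
Proof.
move=> s2 sh; rewrite /sink (min_idPl _); last lra.
by apply/max_idPl; lra.
Qed.

Lemma sink_high s h : s <= 2^-1 -> 4 * s <= h -> sink s h = h - 4 * s.
Proof.
move=> s2 sh; rewrite /sink (min_idPl _); last lra.
by apply/max_idPr; lra.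
Qed.

Section Retraction.
Variable w0 : fspace R G.

Definition keptV (v : item (fV F)) (s : I) : fspace R G :=
  if [pick y | jV y == v] is Some y then fpt (inl y) s s else w0.

Definition keptE (x : item (fE F)) (s t : I) : fspace R G :=
  if [pick y | jE y == x] is Some y then fpt (inr y) s t else w0.

Lemma keptVE y s t : keptV (jV y) s = fpt (inl y) s t.
Proof.
rewrite /keptV; case: pickP => [y' /eqP/jVi ->|/(_ y)]; first exact: fptT.
by rewrite eqxx.
Qed.

Lemma keptEE y s t : keptE (jE y) s t = fpt (inr y) s t.
Proof.
rewrite /keptE; case: pickP => [y' /eqP/jEi ->|/(_ y)] //.
by rewrite eqxx.
Qed.

Lemma keptV_irel v s v' s' : freeing v = None -> irel v s v' s' -> keptV v s = keptV v' s'.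
Proof.
move=> /freeing_None [y <-] /irel_lift [y' [-> yy']].
by rewrite !(keptVE _ _ s); exact: fptV.
Qed.

Lemma keptE_irel x s x' s' t : rho x = None -> irel x s x' s' -> keptE x s t = keptE x' s' t.
Proof.
move=> /jE_image [y <-] /irel_lift [y' [-> yy']].
by rewrite !keptEE; exact: fptE.
Qed.

Lemma keptA (b : bool) x s t : rho x = None -> ival t = (b : nat)%:R ->
  keptE x s t = keptV (fa F b x) s.
Proof.
by move=> /jE_image [y <-] tb; rewrite keptEE -jVE (keptVE _ _ t); exact: fptA.
Qed.

(** The half s <= 1/2 of the retraction; the other half is its mirror image, obtained by
    reversing the dart. *)
Definition half_square (b : bool) d (s t : I) : fspace R G :=
  let h := height b (ival t) in
  if h <= 4 * ival s then keptV (fa F (~~ b) (inr d)) (ui (squeeze (ival s) h))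
  else keptE (inl (dsrc d)) s (ui (height b (h - 4 * ival s))).

Definition retractE (x : item (fE F)) (s t u : I) : fspace R G :=
  match rho x with
  | None => keptE x s t
  | Some b => match x with
    | inl q => keptV (fa F (~~ b) x) s
    | inr d => if 2 * ival s <= 1 then half_square b d s t
               else half_square b (drev d) (flip s) t
    end
  end.

Lemma keptV_cont (T : topologicalType) v (p : T -> I) :
  continuous p -> continuous (fun x => keptV v (p x)).
Proof.
by move=> cp; rewrite /keptV; case: pickP => *; [exact: fpt_cont | exact: cont_cst].
Qed.

Lemma keptE_cont (T : topologicalType) x (p q : T -> I) :
  continuous p -> continuous q -> continuous (fun z => keptE x (p z) (q z)).
Proof.
by move=> cp cq; rewrite /keptE; case: pickP => *; [exact: fpt_cont | exact: cont_cst].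
Qed.

Lemma half_square_cont (T : topologicalType) b d (p q : T -> I) : rho (inr d) = Some b ->
  continuous p -> continuous q -> continuous (fun z => half_square b d (p z) (q z)).
Proof.
move=> db cp cq; have ch : continuous (fun z => height b (ival (q z))).
  by apply: height_cont; cont.
apply: paste_continuous => //; first by cont.
- by apply: keptV_cont; rewrite /squeeze; cont.
- by apply: keptE_cont => //; apply: cont_ui; apply: height_cont; cont.
move=> z /= hz.
have s0 : ui (squeeze (ival (p z)) (height b (ival (q z)))) = ui 0 :> I.
  apply: ival_inj; rewrite !ival_ui !clamp0 //.
  by apply: squeeze_le0; rewrite ?ival_ge0 ?height_bounds ?hz.
rewrite s0 (@keptV_irel _ _ (inl (dsrc (gdart (fa F (~~ b)) d))) (p z)); last 2 first.
- by apply: (freeing_far db); case: (b).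
- by apply: IEnd; rewrite ival_ui clamp0.
rewrite dsrc_gdart; symmetry; apply: (@keptA _ (inl (dsrc d))); first exact: rho_end.
by rewrite hz subrr ival_ui /height; case: (b); [rewrite clamp0 | rewrite clamp1 ?subr0].
Qed.

Lemma half_square_mid b d s t : rho (inr d) = Some b -> ival s = 2^-1 ->
  half_square b d s t = half_square b (drev d) (flip s) t.
Proof.
move=> db s2; rewrite /half_square ival_flip s2.
have /andP[h0 h1] := height_bounds b t.
rewrite !ifT; last 2 first; [lra | lra |].
rewrite /= gdart_rev.
have -> : 1 - 2^-1 = 2^-1 :> R by field.
rewrite (@keptV_irel _ _ (inr (drev (gdart (fa F (~~ b)) d))) (flip (ui (squeeze 2^-1 (height b (ival t)))))); last 2 first.
- by apply: (freeing_far db); case: (b).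
- exact: IRev.
congr keptV; apply: ival_inj; rewrite ival_flip ival_ui.
by rewrite -clamp_rev -squeeze_rev; congr (clamp (squeeze _ _)); field.
Qed.

Lemma half_square_far (b : bool) d s t : rho (inr d) = Some b -> ival t = (~~ b : nat)%:R ->
  half_square b d s t = keptV (fa F (~~ b) (inr d)) s.
Proof.
move=> db tb; rewrite /half_square (height_end _ tb).
have -> : (b == ~~ b)%:R = 0 :> R by case: (b).
have := ival_ge0 s => s0; rewrite ifT; last lra.
by rewrite /squeeze addr0 mulr1 addrC subrK ivalK.
Qed.

Lemma retract_compatible :
  compatible (@fhor R G) (@fmid R G) (cell_fun (fun v s _ => keptV v s) retractE).
Proof.
have hrev (s : I) : ival (flip (flip s)) = ival s by rewrite flipK.
apply: cell_fun_compatible.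
- by move=> v; apply: keptV_cont; cont.
- move=> x; rewrite /retractE; case E: (rho x) => [b|]; last by apply: keptE_cont; cont.
  case: x E => [q|d] E; first by apply: keptV_cont; cont.
  apply: paste_continuous; [by cont | by cont | | |].
  + by apply: half_square_cont; [ | cont | cont].
  + by apply: half_square_cont; [rewrite rho_rev | cont | cont].
  + by move=> [[s t] u] /= s2; apply: half_square_mid => //; lra.
- move=> y s v' s' u; apply: keptV_irel; apply/freeing_None; by exists y.
- move=> x s x' s' t u; case=> [q {}s {}s'|d {}s {}s' s0|d {}s].
  + rewrite /retractE; case E: (rho _) => [b|].
      apply: keptV_irel; last exact: IVert.
      by apply: (freeing_far E); case: (b).
    by apply: keptE_irel => //; exact: IVert.
  + rewrite /retractE rho_end; case E: (rho _) => [b|]; last first.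
      by apply: keptE_irel => //; exact: IEnd.
    have h0 := height_bounds b t.
    rewrite s0 mulr0 ler01 /half_square s0 mulr0.
    transitivity (keptE (inl (dsrc d)) s t); last first.
      by apply: keptE_irel; [exact: rho_end | exact: IVert].
    case: ifP => hh; last by rewrite subr0 heightK ivalK.
    have {}hh : height b (ival t) = 0 by lra.
    rewrite hh /squeeze addr0 mulr1 addrC subrK.
    rewrite (@keptV_irel _ _ (inl (dsrc (gdart (fa F (~~ b)) d))) s); last 2 first.
    * by apply: (freeing_far E); case: (b).
    * by apply: IEnd; rewrite ival_ui clamp0.
    rewrite dsrc_gdart; symmetry; apply: (@keptA _ (inl (dsrc d))); first exact: rho_end.
    by move: hh; rewrite /height; case: (b) => /=; lra.
  + rewrite /retractE rho_rev; case E: (rho _) => [b|]; last first.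
      by apply: keptE_irel => //; exact: IRev.
    rewrite ival_flip drevK flipK; case: ifP => s1; case: ifP => s2 //.
    * by apply: half_square_mid => //; lra.
    * by move/negbT: s1; move/negbT: s2; rewrite -!ltNge => *; exfalso; clear E; lra.
- move=> b x s t u tb; rewrite /retractE; case E: (rho x) => [b'|] fx; last exact: keptA.
  have bb : b = ~~ b'.
    by case: (b =P b') => [e|/eqP]; [move: fx; rewrite e (freeingE E) | case: (b); case: (b')].
  rewrite bb in tb *; case: x E fx => [q|d] E fx //.
  case: ifP => s2; first exact: half_square_far.
  rewrite half_square_far ?rho_rev //=; rewrite gdart_rev; symmetry.
  by apply: keptV_irel; [apply: (freeing_far E); case: (b') | exact: IRev].
- by move=> p s u /freeing_None [[q|//] <-]; rewrite (keptVE _ _ s); exact: fhor_pt.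
- move=> q s t u; rewrite /retractE; case E: (rho _) => [b|].
    have /freeing_None [[q'|//] qq] : freeing (fa F (~~ b) (inl q)) = None.
      by apply: (freeing_far E); case: (b).
    by rewrite -qq (keptVE _ _ s); exact: fhor_pt.
  by move: E => /jE_image [[q'|//] <-]; rewrite keptEE; exact: fhor_pt.
- by move=> d s u s2 /freeing_None [[//|d'] <-]; rewrite (keptVE _ _ s); exact: fmid_pt.
- have mid b d s t : rho (inr d) = Some b -> ival s = 2^-1 -> @fmid R G (half_square b d s t).
    move=> E s2; have /andP[h0 h1] := height_bounds b t.
    rewrite /half_square ifT; last lra.
    have /freeing_None [[//|d'] qq] : freeing (fa F (~~ b) (inr d)) = None.
      by apply: (freeing_far E); case: (b).
    rewrite -qq (keptVE _ _ s); apply: fmid_pt => //.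
    by rewrite s2 /squeeze subrr mul0r addr0 ival_ui clamp_id //; lra.
  move=> d s t u s2; rewrite /retractE; case E: (rho _) => [b|].
    case: ifP => _; apply: mid; rewrite ?rho_rev //.
    by rewrite ival_flip s2; field.
  by move: E => /jE_image [[//|d'] <-]; rewrite keptEE; exact: fmid_pt.
Qed.

Lemma retract_inclusion (f : fspace R G -> fspace R F) :
  (forall z s t, f (fpt z s t) =
     match z with inl x => fpt (inl (jV x)) s t | inr x => fpt (inr (jE x)) s t end) ->
  forall b d s t, rho (inr d) = Some b -> ival s <= 2^-1 ->
  f (half_square b d s t) =
    fpt (F := F) (inr (inr d)) (ui (squeeze (ival s) (height b (ival t))))
      (ui (height b (sink (ival s) (height b (ival t))))).
Proof.
move=> fE b d s t E s2; rewrite /half_square; case: ifP => hh.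
  have /freeing_None [y yE] : freeing (fa F (~~ b) (inr d)) = None.
    by apply: (freeing_far E); case: (b).
  rewrite -yE (keptVE _ _ s) fE yE sink_low //; symmetry; apply: fptA.
  by rewrite ival_ui /height; case: (b); [rewrite clamp0 | rewrite clamp1 ?subr0].
have /jE_image [y yE] := rho_end d.
have {}hh : 4 * ival s <= height b (ival t) by lra.
rewrite -yE keptEE fE yE sink_high //; symmetry; apply: fptE; apply: IEnd.
by rewrite ival_ui clamp0 // squeeze_le0 ?ival_ge0 ?height_bounds.
Qed.
End Retraction.

Definition slideV (v : item (fV F)) (s u : I) : fspace R F := fpt (inl v) s s.

(** The straight-line homotopy, within each removed cell, from the retraction to the
    identity. *)
Definition slideE (x : item (fE F)) (s t u : I) : fspace R F :=
  match rho x with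
  | None => fpt (inr x) s t
  | Some b => match x with
    | inl q => fpt (inr x) s (ui ((1 - ival u) * (~~ b)%:R + ival u * ival t))
    | inr d => let h := height b (ival t) in
        fpt (inr x) (ui ((1 - ival u) * clamp (squeeze (ival s) h) + ival u * ival s))
         (ui ((1 - ival u) * clamp (height b (sink (ival s) h)) + ival u * ival t))
    end
  end.

Lemma slide_compatible :
  compatible (@fhor R F) (@fmid R F) (cell_fun slideV slideE).
Proof.
apply: cell_fun_compatible.
- by move=> v; apply: fpt_cont; cont.
- move=> x; rewrite /slideE; case: (rho x) => [b|]; last by apply: fpt_cont; cont.
  case: x => [q|d]; first by apply: fpt_cont; cont.
  have ch : continuous (fun p : I * I * I => height b (ival p.1.2)).
    by apply: height_cont; cont.
  apply: fpt_cont; rewrite /squeeze /sink; cont.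
  apply: height_cont; cont.
- by move=> y s v' s' u; exact: fptV.
- move=> x s x' s' t u; case=> [q {}s {}s'|d {}s {}s' s0|d {}s].
  + by rewrite /slideE; case: (rho _) => *; apply: fptE; exact: IVert.
  + rewrite /slideE rho_end; case: (rho _) => [b|]; last by apply: fptE; exact: IEnd.
    have /andP[h0 h1] := height_bounds b t.
    have -> : clamp (height b (sink (ival s) (height b (ival t)))) = ival t.
      by rewrite s0 sink_high ?mulr0 ?subr0 ?heightK ?clamp_id ?ival_ge0 ?ival_le1 //; lra.
    rewrite -(mulrDl _ _ (ival t)) subrK mul1r ivalK.
    apply: fptE; apply: IEnd; rewrite ival_ui s0 mulr0 addr0.
    by rewrite (clamp0 (x := squeeze _ _)) ?mulr0 ?clamp0 // /squeeze; lra.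
  + rewrite /slideE rho_rev; case: (rho _) => [b|]; last by apply: fptE; exact: IRev.
    rewrite ival_flip sink_rev.
    rewrite squeeze_rev clamp_rev; set a := clamp _; set e := height _ _.
    have -> : ui ((1 - ival u) * (1 - a) + ival u * (1 - ival s)) =
        flip (ui ((1 - ival u) * a + ival u * ival s)) :> I.
      apply: ival_inj; rewrite ival_flip !ival_ui -clamp_rev; congr clamp; ring.
    by apply: fptE; exact: IRev.
- move=> b x s t u tb fx; rewrite /slideE /slideV; case E: (rho x) => [b'|]; last exact: fptA.
  have bb : b = ~~ b'.
    by case: (b =P b') => [e|/eqP]; [move: fx; rewrite e (freeingE E) | case: (b); case: (b')].
  rewrite bb in tb *; case: x E fx => [q|d] E fx.
    rewrite -tb -mulrDl subrK mul1r ivalK; exact: fptA.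
  have := ival_ge0 s; have := ival_le1 s => s1 s0.
  rewrite (height_end _ tb) (_ : (b' == ~~ b')%:R = 0 :> R); last by case: (b').
  have -> : sink (ival s) 0 = 0.
    by apply/max_idPl; rewrite sub0r oppr_le0 mulr_ge0 // le_min s0 /=; lra.
  have -> : height b' 0 = ival t by rewrite tb /height; case: (b') => //=; rewrite subr0.
  rewrite /squeeze addr0 mulr1 (addrC 2^-1) subrK !clamp_id ?ival_ge0 ?ival_le1 //.
  by rewrite -!mulrDl subrK !mul1r !ivalK; exact: fptA.
- by move=> p s u _; exact: fhor_pt.
- by move=> q s t u; rewrite /slideE; case: (rho _) => *; exact: fhor_pt.
- by move=> d s u s2 _; exact: fmid_pt.
- move=> d s t u s2; rewrite /slideE; case: (rho _) => *; apply: fmid_pt => //.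
  rewrite s2 /squeeze subrr mul0r addr0 ival_ui !clamp_id; lra.
Qed.

Lemma compatible_at F0 (U : topologicalType) (C D : set U)
    (h : fcell F0 -> I -> I -> I -> U) u0 :
  compatible C D h -> compatible C D (fun z s t _ => h z s t u0).
Proof.
move=> [hc hV hE hT hA hh hm]; split=> *; auto.
apply: (cont_comp (k := fun p : I * I * I => h _ p.1.1 p.1.2 p.2)
  (h := fun p : I * I * I => (p.1.1, p.1.2, u0))); first exact: hc.
by cont.
Qed.

(** A square is pushed across from its free side, and an arc is shrunk to its far end. *)
Theorem remove_free_cells_heq : fheq R G F.
Proof.
have fE0 := @natural_compatible R G F jV jE jVE.
(* w0 is a default value; if G is empty, then so is F. *)
have [[w0 _]|no] := pselect (exists w0 : fspace R G, True); last first.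
  have noG (z : fcell G) : False by apply: no; exists (fpt z (ui 0) (ui 0)).
  have noE (x : item (fE F)) : False.
    case E: (rho x) => [b|]; last by case/jE_image: E => y _; exact: (noG (inr y)).
    have /freeing_None [y _] : freeing (fa F (~~ b) x) = None.
      by apply: (freeing_far E); case: (b).
    exact: (noG (inl y)).
  apply: flat_iso_heq; exists jV, jE; split=> //; apply: giso_bij => //.
  by move=> v; apply/jV_image => -[x _]; exact: noE.
have [f [mf fpE]] := compatible_map fE0.
have [r [mr rE]] := compatible_map (compatible_at (ui 0) (retract_compatible w0)).
have rf : cancel f r.
  move=> w; have [[y|y] [s [t ->]]] := fpt_surj w; rewrite fpE rE /=.
    by rewrite (_ : freeing _ = None) ?(keptVE _ _ _ t) //; apply/freeing_None; exists y.
  by rewrite /retractE (_ : rho _ = None) ?keptEE //; apply/jE_image; exists y.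
exists f; split=> //; exists r; split=> //.
  have -> : r \o f = id by apply/funext => x /=; rewrite rf.
  by apply: homotopic_refl; exact: triple_map_id.
have u0K (x : item (fE F)) s t u : ival u = 0 -> slideE x s t u = f (retractE w0 x s t u).
  move=> u0; rewrite /slideE /retractE; case E: (rho x) => [b|]; last first.
    by case/jE_image: (E) => y <-; rewrite keptEE fpE.
  case: x E => [q|d] E; rewrite u0 subr0 !mul1r !mul0r !addr0.
    have /freeing_None [y yE] : freeing (fa F (~~ b) (inl q)) = None.
      by apply: (freeing_far E); case: (b).
    rewrite -yE (keptVE _ _ _ s) fpE yE; apply: fptA.
    by rewrite ival_ui; case: (b); [rewrite clamp0 | rewrite clamp1].
  rewrite -!ival_ui !ivalK; case: ifP => s2.
    by rewrite (retract_inclusion w0 fpE) //; lra.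
  rewrite (retract_inclusion w0 fpE) ?rho_rev // ?ival_flip; last lra.
  rewrite sink_rev squeeze_rev; apply: fptE.
  have -> : ui (1 - squeeze (ival s) (height b (ival t))) =
     flip (ui (squeeze (ival s) (height b (ival t)))) :> I.
    by apply: ival_inj; rewrite ival_flip !ival_ui clamp_rev.
  exact: IRev.
have u1K (x : item (fE F)) s t u : ival u = 1 -> slideE x s t u = fpt (inr x) s t.
  move=> u1; rewrite /slideE; case E: (rho x) => [b|] //.
  by case: x {E} => [q|d]; rewrite u1 subrr !mul0r !mul1r !add0r !ivalK.
apply: (compatible_homotopic slide_compatible) => [z s t u u0|z s t u u1] /=.
- rewrite rE; case: z => [v|x] /=; last exact: u0K.
  case E: (freeing v) => [[x b]|] /=; first exact: u0K.
  by move: E => /freeing_None [y <-]; rewrite (keptVE _ _ _ s) fpE; exact: fptT.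
- case: z => [v|x] /=; last exact: u1K.
  case E: (freeing v) => [[x b]|] /=; last exact: fptT.
  rewrite u1K //; move: E; rewrite /freeing; case: pickP => // -[x2 b2] /andP[_ /eqP/= <-] [-> ->].
  apply: fptA; rewrite ival_ui.
  by case: (b); [rewrite clamp1 | rewrite clamp0].
Qed.
End RemoveFreeCells.

(** * The total space as a square complex *)

Section GsumItems.
Variables (J : finType) (A : J -> graph).

Definition gparts (x : item (gsum A)) : {i : J & item (A i)} :=
  match x with
  | inl p => existT (fun i => item (A i)) (tag p) (inl (tagged p))
  | inr d => existT (fun i => item (A i)) (tag d.1) (inr (tagged d.1, d.2))
  end.

Lemma gpartsE i x : gparts (gsum_in A i x) = existT (fun i => item (A i)) i x.
Proof. by case: x => [p|[e b]] //=; rewrite addbF. Qed.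

Lemma gsum_inP (x : item (gsum A)) : exists i y, x = gsum_in A i y.
Proof.
case: x => [[i p]|[[i e] b]]; first by exists i, (inl p).
by exists i, (inr (e, b)); rewrite /= /gdart /= addbF.
Qed.

Lemma over_gsum_in i x : over (gsum_in A i x) = i.
Proof. by case: x. Qed.
End GsumItems.

Lemma gmap_sum (J K : finType) (A : J -> graph) (B : K -> graph) i k
    (f : gmap (gsum A) (gsum B)) (g : gmap (A i) (B k)) :
  (forall p, gvert f (Tagged (fun i => vert (A i)) p) =
     Tagged (fun k => vert (B k)) (gvert g p)) ->
  (forall e, gedge f (Tagged (fun i => edge (A i)) e) =
     Tagged (fun k => edge (B k)) (gedge g e)) ->
  (forall e, gflip f (Tagged (fun i => edge (A i)) e) = gflip g e) ->
  forall x, f (gsum_in A i x) = gsum_in B k (g x).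
Proof.
move=> fv fe ff [p|[e b]] /=; first by rewrite fv.
by rewrite /gdart /= fe ff !addbF.
Qed.

Lemma att_gsum_in X b e x :
  att X b (gsum_in _ e x) = gsum_in _ (uend X e b) (emb X e b x).
Proof. exact: gmap_sum. Qed.

Lemma monodromy_gsum_in X c x :
  monodromy X (gsum_in _ c x) = gsum_in _ c (mono X c x).
Proof. exact: gmap_sum. Qed.

(** A circle edge is cut along a fibre: its space occurs once among the vertex cells and
    once among the edge cells. *)
Definition flat_of (X : gog) : flat :=
  @Flat (gplus (VS X) (CS X)) (gplus (ES X) (CS X))
    (fun b => gplus_map (att X b) (if b then gid (CS X) else monodromy X)).

Section Realization.
Variables (R : realType) (G : graph).
Notation I := (unit_interval R).

Definition gpt (x : item G) (s : I) : realization R G :=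
  match x with
  | inl p => to_glued _ (vert_point R p)
  | inr d => to_glued _ (edge_point d.1 (if d.2 then flip s else s))
  end.

Lemma gpt_irel x s y s' : irel x s y s' -> gpt x s = gpt y s'.
Proof.
case=> [p {}s {}s'|[e b] {}s {}s' s0|[e b] {}s] //=; last by case: b; rewrite ?flipK.
apply: to_glued_eq; apply: GraphGlue; case: b; rewrite ?ival_flip s0 ?subr0 //.
Qed.

Lemma gpt_surj w : exists x s, w = gpt x s.
Proof.
rewrite -(of_gluedK w); case: (of_glued w) => [[p []|e t]].
  by exists (inl p), (ui 0).
by exists (inr (e, false)), t.
Qed.

Lemma gpt_cont (T : topologicalType) x (p : T -> I) :
  continuous p -> continuous (fun z => gpt x (p z)).
Proof.
move=> cp; case: x => [q|[e b]] /=; first exact: cont_cst.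
apply: cont_comp; first exact: to_glued_continuous.
have ce : continuous (@edge_point R G e) := @existT_continuous _ _ (inr e).
by apply: cont_comp => //; case: b; cont.
Qed.

Lemma vertices_gpt w : vertices w <-> exists p s, w = gpt (inl p) s.
Proof.
by split=> [[p ->]|[p [s ->]]]; [exists p, (ui 0) | exists p].
Qed.

Lemma midpoints_gpt w : midpoints w <-> exists d s, ival s = 2^-1 /\ w = gpt (inr d) s.
Proof.
split=> [[e [t [t2 ->]]]|[[e b] [s [s2 ->]]]]; first by exists (e, false), t.
by exists e, (if b then flip s else s); case: b => //=; split=> //; rewrite ival_flip s2; field.
Qed.

(** The product of a realization with the interval is again a quotient of its pieces. *)
Lemma realization_lift (U : topologicalType) (m : item G -> I -> I -> U) :
  (forall x, continuous (fun p : I * I => m x p.1 p.2)) ->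
  (forall x s y s' t, irel x s y s' -> m x s t = m y s' t) ->
  exists M : realization R G * I -> U,
    continuous M /\ forall x s t, M (gpt x s, t) = m x s t.
Proof.
move=> mc mi.
pose k (w : graph_pieces R G) t : U := match w with
  | existT (inl p) _ => m (inl p) (ui 0) t
  | existT (inr e) s => m (inr (e, false)) s t end.
have kr t x y : graph_glue x y -> k x t = k y t.
  case=> e b s sb; rewrite /k /=; case: b sb => sb; last by apply: mi; exact: IEnd.
  rewrite (mi _ _ _ _ t (IRev (e, false) s)).
  by apply: mi; apply: IEnd; rewrite ival_flip sb subrr.
pose M (p : realization R G * I) := k (of_glued p.1) p.2.
have ME w t : M (to_glued _ w, t) = k w t.
  exact: (glued_respects (f := k^~ t) (@kr t)).
exists M; split.
  apply: glued_prod_continuous.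
  have -> : (fun x : graph_pieces R G * I => M (to_glued (@graph_glue R G) x.1, x.2)) =
     (fun x : graph_pieces R G * I => k x.1 x.2) by apply/funext => -[w t]; exact: ME.
  move=> [[z st] u] W /= nW.
  have kc : continuous (fun p : graph_piece R z * I => k (existT _ z p.1) p.2).
    case: z {st nW} => [p|e] /=; last exact: mc.
    apply: (cont_comp (k := fun t => m (inl p) (ui 0) t)); last by cont.
    by move=> t; exact: (prod_continuous_r (mc (inl p)) (x := ui 0)).
  have [[P Q] /= [Pst Qu] PQ] := kc (st, u) _ nW.
  exists (existT (@graph_piece R G) z @` P, Q) => /=.
    by split=> //; exact: existT_nbhs.
  by move=> [w u'] /= [[st2 P2 <-] Q2]; exact: (PQ (_, _)).
move=> [p|[e b]] s t /=; rewrite ME /k /=; first by apply: mi; exact: IVert.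
case: b => //; rewrite (mi _ _ _ _ t (IRev (e, false) (flip s))) flipK //.
Qed.
End Realization.

Lemma realization_map_gpt (R : realType) G H (f : gmap G H) x (s : unit_interval R) :
  realization_map f (gpt x s) = gpt (f x) s.
Proof.
pose k w := to_glued (@graph_glue R H) (pieces_map f w).
have kr : forall x y, graph_glue x y -> k x = k y.
  move=> y z [e b t tb]; rewrite /k /=; apply: to_glued_eq.
  rewrite -gmap_ends; apply: GraphGlue; case: (gflip f e); rewrite ?addbF ?addbT //.
  by rewrite ival_flip tb; case: (b); rewrite /= ?subrr ?subr0.
case: x => [p|[e b]] /=; rewrite /realization_map -/(k _) (glued_respects (f := k) kr) /k //=.
by case: (gflip f e); rewrite ?addbF ?addbT //; case: b; rewrite /= ?flipK.
Qed.

Section TotalFlat.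
Variables (R : realType) (X : gog).
Notation I := (unit_interval R).
Notation F := (flat_of X).

Definition tot : total_pieces R X -> total_space R X := to_glued (@total_glue R X).

Definition vcell v (x : item (vspace X v)) : fcell F := inl (ginl _ (CS X) (gsum_in _ v x)).
Definition ecell e (x : item (espace X e)) : fcell F := inr (ginl _ (CS X) (gsum_in _ e x)).
Definition cvcell c (x : item (cspace X c)) : fcell F := inl (ginr (VS X) _ (gsum_in _ c x)).
Definition cecell c (x : item (cspace X c)) : fcell F := inr (ginr (ES X) _ (gsum_in _ c x)).

Definition to_total (z : fcell F) (s t : I) : total_space R X :=
  match z with
  | inl x => match gsplit x with
    | inl y => tot (in_vspace (gpt (projT2 (gparts y)) s))
    | inr y => tot (in_cspace (gpt (projT2 (gparts y)) s) (ui 1)) end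
  | inr x => match gsplit x with
    | inl y => tot (in_espace (gpt (projT2 (gparts y)) s) t)
    | inr y => tot (in_cspace (gpt (projT2 (gparts y)) s) t) end
  end.

Lemma to_total_v v x s t : to_total (@vcell v x) s t = tot (in_vspace (gpt x s)).
Proof. by rewrite /to_total /vcell gsplitl gpartsE. Qed.
Lemma to_total_e e x s t : to_total (@ecell e x) s t = tot (in_espace (gpt x s) t).
Proof. by rewrite /to_total /ecell gsplitl gpartsE. Qed.
Lemma to_total_cv c x s t : to_total (@cvcell c x) s t = tot (in_cspace (gpt x s) (ui 1)).
Proof. by rewrite /to_total /cvcell gsplitr gpartsE. Qed.
Lemma to_total_ce c x s t : to_total (@cecell c x) s t = tot (in_cspace (gpt x s) t).
Proof. by rewrite /to_total /cecell gsplitr gpartsE. Qed.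

Lemma fcellP (z : fcell F) :
  [\/ exists v x, z = @vcell v x, exists c x, z = @cvcell c x,
      exists e x, z = @ecell e x | exists c x, z = @cecell c x].
Proof.
case: z => z; have [[y ->]|[y ->]] := gplusP z; have [i [x ->]] := gsum_inP y.
- by apply: Or41; exists i, x.
- by apply: Or42; exists i, x.
- by apply: Or43; exists i, x.
- by apply: Or44; exists i, x.
Qed.

Lemma irel_plus_sum (J K : finType) (A : J -> graph) (B : K -> graph)
    (x y : item (gplus (gsum A) (gsum B))) (s s' : I) : irel x s y s' ->
  (exists i x' y', [/\ x = ginl _ _ (gsum_in A i x'), y = ginl _ _ (gsum_in A i y')
     & irel x' s y' s']) \/
  (exists i x' y', [/\ x = ginr _ _ (gsum_in B i x'), y = ginr _ _ (gsum_in B i y')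
     & irel x' s y' s']).
Proof.
move=> xy; have [[z xz]|[z xz]] := gplusP x; have [i [x' zx]] := gsum_inP z.
  left; move: xy; rewrite xz zx => /irel_lift [y1 [-> /irel_lift [y' [-> xy]]]].
  by exists i, x', y'.
right; move: xy; rewrite xz zx => /irel_lift [y1 [-> /irel_lift [y' [-> xy]]]].
by exists i, x', y'.
Qed.

Lemma in_space_cont (j : uvert X + uedge X + ucirc X) (T : topologicalType)
    (p : T -> total_piece R j) :
  continuous p -> continuous (fun z => tot (existT _ j (p z))).
Proof.
move=> cp; apply: (cont_comp (k := tot)); first exact: to_glued_continuous.
have ce : continuous (existT (@total_piece R X) j) := @existT_continuous _ _ j.
exact: (cont_comp ce cp).
Qed.

Lemma horizontal_pt z s t : vertical_vertex z -> @horizontal R X (to_total z s t).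
Proof.
have [[i [x ->]]|[i [x ->]]|[i [x ->]]|[i [x ->]]] := fcellP z;
  case: x => [p|[e b]] //= _.
- by exists (in_vspace (gpt (inl p) s)) => //; apply/vertices_gpt; exists p, s.
- by exists (in_cspace (gpt (inl p) s) (ui 1)) => //; apply/vertices_gpt; exists p, s.
- by exists (in_espace (gpt (inl p) s) t) => //; apply/vertices_gpt; exists p, s.
- by exists (in_cspace (gpt (inl p) s) t) => //; apply/vertices_gpt; exists p, s.
Qed.

Lemma midgraph_pt z s t : ~~ vertical_vertex z -> ival s = 2^-1 ->
  @midgraph R X (to_total z s t).
Proof.
have [[i [x ->]]|[i [x ->]]|[i [x ->]]|[i [x ->]]] := fcellP z;
  rewrite (to_total_v, to_total_cv, to_total_e, to_total_ce); case: x => [p|d] // _ s2.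
- by exists (in_vspace (gpt (inr d) s)) => //; apply/midpoints_gpt; exists d, s.
- by exists (in_cspace (gpt (inr d) s) (ui 1)) => //; apply/midpoints_gpt; exists d, s.
- by exists (in_espace (gpt (inr d) s) t) => //; apply/midpoints_gpt; exists d, s.
- by exists (in_cspace (gpt (inr d) s) t) => //; apply/midpoints_gpt; exists d, s.
Qed.

Lemma to_total_compatible :
  compatible (horizontal R X) (midgraph R X) (fun z s t _ => to_total z s t).
Proof.
split.
- case=> x /=; case: (gsplit x) => y.
  + by apply: in_space_cont; apply: gpt_cont; cont.
  + by apply: (in_space_cont (j := inr _)); cont; apply: gpt_cont; cont.
  + by apply: (in_space_cont (j := inl (inr _))); cont; apply: gpt_cont; cont.
  + by apply: (in_space_cont (j := inr _)); cont; apply: gpt_cont; cont.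
- move=> x s y s' t _ /irel_plus_sum [] [i [x' [y' [-> -> xy]]]];
    rewrite -!/(vcell _) -!/(cvcell _).
  + by rewrite !to_total_v (gpt_irel xy).
  + by rewrite !to_total_cv (gpt_irel xy).
- move=> x s y s' t _ /irel_plus_sum [] [i [x' [y' [-> -> xy]]]];
    rewrite -!/(ecell _) -!/(cecell _).
  + by rewrite !to_total_e (gpt_irel xy).
  + by rewrite !to_total_ce (gpt_irel xy).
- by [].
- move=> b x s t _ tb; have [[i [y [xy]]]|[i [y [xy]]]|[i [y [xy]]]|[i [y [xy]]]] //
    := fcellP (inr x).
    rewrite -[inr x]/(@inr (item (fV F)) _ x) xy gplus_mapEl att_gsum_in.
    rewrite -/(ecell _) -/(vcell _) to_total_e to_total_v; apply: to_glued_eq.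
    by rewrite -realization_map_gpt; exact: GlueEnd.
  rewrite xy gplus_mapEr -/(cecell _).
  case: b tb => tb.
    rewrite gidE -/(cvcell _) to_total_ce to_total_cv.
    by congr (tot (in_cspace _ _)); apply: ival_inj; rewrite tb ival_ui clamp1.
  rewrite monodromy_gsum_in -/(cvcell _) to_total_ce to_total_cv; apply: to_glued_eq.
  by rewrite -realization_map_gpt; apply: GlueCircle; rewrite // ival_ui clamp1.
- by move=> z s t _; exact: horizontal_pt.
- by move=> z s t _; exact: midgraph_pt.
Qed.

Lemma vcellT v (x : item (vspace X v)) s t t' :
  fpt (vcell x) s t = fpt (vcell x) s t' :> fspace R F.
Proof. exact: (fptT (F := F)). Qed.

Lemma ecell_end (b : bool) e (x : item (espace X e)) s t t' :
  ival t = (b : nat)%:R -> fpt (ecell x) s t = fpt (vcell (emb X e b x)) s t' :> fspace R F.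
Proof.
move=> tb; rewrite /vcell -att_gsum_in -(gplus_mapEl _ (if b then gid (CS X) else monodromy X)).
exact: (fptA (F := F)).
Qed.

Lemma cecell_end (b : bool) c (x : item (cspace X c)) s t t' :
  ival t = (b : nat)%:R ->
  fpt (cecell x) s t = fpt (cvcell (if b then x else mono X c x)) s t' :> fspace R F.
Proof.
move=> tb; transitivity (fpt (F := F) (inl (fa F b (ginr (ES X) _ (gsum_in _ c x)))) s t').
  exact: (fptA (F := F)).
congr (fpt (inl _) s t'); rewrite /fa /= gplus_mapEr.
by case: (b); rewrite ?gidE ?monodromy_gsum_in.
Qed.

(** Both spaces are quotients of the same squares; in the total space the gluing is done
    in two stages. *)
Theorem total_space_flat :
  heq R (horizontal R X) (midgraph R X) (@fhor R F) (@fmid R F).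
Proof.
have [f [mf fpE]] := compatible_map to_total_compatible.
have HV : forall v, exists M : realization R (vspace X v) * I -> fspace R F,
    continuous M /\ forall x s t, M (gpt x s, t) = fpt (vcell x) s t.
  move=> i; apply: realization_lift => [x|x s y s' t xy]; first by apply: fpt_cont; cont.
  by apply: fptV; do 2 apply: irel_map.
pose MV v := projT1 (cid (HV v)).
have MVP v : continuous (MV v) /\ forall x s t, MV v (gpt x s, t) = fpt (vcell x) s t := projT2 (cid (HV v)).
have HE : forall e, exists M : realization R (espace X e) * I -> fspace R F,
    continuous M /\ forall x s t, M (gpt x s, t) = fpt (ecell x) s t.
  move=> i; apply: realization_lift => [x|x s y s' t xy]; first by apply: fpt_cont; cont.
  by apply: fptE; do 2 apply: irel_map.
pose ME e := projT1 (cid (HE e)).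
have MEP e : continuous (ME e) /\ forall x s t, ME e (gpt x s, t) = fpt (ecell x) s t := projT2 (cid (HE e)).
have HC : forall c, exists M : realization R (cspace X c) * I -> fspace R F,
    continuous M /\ forall x s t, M (gpt x s, t) = fpt (cecell x) s t.
  move=> i; apply: realization_lift => [x|x s y s' t xy]; first by apply: fpt_cont; cont.
  by apply: fptE; do 2 apply: irel_map.
pose MC c := projT1 (cid (HC c)).
have MCP c : continuous (MC c) /\ forall x s t, MC c (gpt x s, t) = fpt (cecell x) s t := projT2 (cid (HC c)).
clearbody MV ME MC.
pose k (w : total_pieces R X) : fspace R F := match w with
  | existT (inl (inl v)) x => MV v (x, ui 0)
  | existT (inl (inr e)) xt => ME e xt
  | existT (inr c) xt => MC c xt
  end.
have kv v x s t : k (in_vspace (gpt x s)) = fpt (@vcell v x) s t.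
  exact: (eq_trans ((MVP v).2 x s (ui 0)) (vcellT _ _ _ _)).
have ke e x s t : k (in_espace (gpt x s) t) = fpt (@ecell e x) s t by exact: (MEP e).2.
have kc c x s t : k (in_cspace (gpt x s) t) = fpt (@cecell c x) s t by exact: (MCP c).2.
have kr x y : total_glue x y -> k x = k y.
  case=> [e b w t tb|c w s t s0 t1]; have [y' [r ->]] := gpt_surj w;
    rewrite realization_map_gpt.
    apply: (eq_trans (ke _ _ _ _)); apply: (eq_trans (ecell_end _ _ t tb)).
    exact: esym (kv _ _ _ t).
  apply: (eq_trans (kc _ _ _ _)); apply: (eq_trans (@cecell_end false _ _ _ _ t s0)).
  exact: (esym (eq_trans (kc _ _ _ _) (@cecell_end true _ _ _ _ _ t1))).
pose g (w : total_space R X) := k (of_glued w).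
have gE w : g (tot w) = k w by exact: glued_respects.
have gf : cancel f g.
  move=> w; have [z [s [t ->]]] := fpt_surj w; rewrite fpE.
  have [[i [x ->]]|[i [x ->]]|[i [x ->]]|[i [x ->]]] := fcellP z.
  - by rewrite to_total_v gE; exact: kv.
  - rewrite to_total_cv gE; apply: (eq_trans (kc _ _ _ _)).
    by apply: (@cecell_end true); rewrite ival_ui clamp1.
  - by rewrite to_total_e gE; exact: ke.
  - by rewrite to_total_ce gE; exact: kc.
have tot_surj w : exists z s t, w = to_total z s t.
  rewrite -(of_gluedK w); case: (of_glued w) => [[[v|e]|c]].
  - move=> w'; have [x [s ->]] := gpt_surj w'.
    by exists (vcell x), s, (ui 0); rewrite to_total_v.
  - move=> [w' t]; have [x [s ->]] := gpt_surj w'.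
    by exists (ecell x), s, t; rewrite to_total_e.
  - move=> [w' t]; have [x [s ->]] := gpt_surj w'.
    by exists (cecell x), s, t; rewrite to_total_ce.
have fg : cancel g f.
  move=> w; have [z [s [t ->]]] := tot_surj w.
  by rewrite -fpE gf.
have cg : continuous g.
  apply: glued_continuous.
  have -> : g \o to_glued (@total_glue R X) =
      unstable.sigT_fun (fun i (x : total_piece R i) => k (existT _ i x)).
    by apply/funext => -[i x]; exact: gE.
  apply: sigT_continuous => -[[v|e]|c].
  - exact: (prod_continuous_l (MVP v).1).
  - exact: (MEP e).1.
  - exact: (MCP c).1.
apply: (homeo_heq R _ mf fg gf); split=> //.
- move=> w [[[[v|e]|c] w'] /= /vertices_gpt [p [s E]] <-]; rewrite -/(tot _) gE.
  + by rewrite E (kv v (inl p) s (ui 0)); exact: fhor_pt.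
  + case: w' E => w' t E; have -> : w' = gpt (inl p) s := E.
    by rewrite (ke e (inl p) s t); exact: fhor_pt.
  + case: w' E => w' t E; have -> : w' = gpt (inl p) s := E.
    by rewrite (kc c (inl p) s t); exact: fhor_pt.
- move=> w [[[[v|e]|c] w'] /= /midpoints_gpt [d [s [s2 E]]] <-]; rewrite -/(tot _) gE.
  + by rewrite E (kv v (inr d) s (ui 0)); exact: fmid_pt.
  + case: w' E => w' t E; have -> : w' = gpt (inr d) s := E.
    by rewrite (ke e (inr d) s t); exact: fmid_pt.
  + case: w' E => w' t E; have -> : w' = gpt (inr d) s := E.
    by rewrite (kc c (inr d) s t); exact: fmid_pt.
Qed.
End TotalFlat.

End Spaces.

(** * Building graphs of graphs from their total graphs *)

(** Most graph maps below arise in this way, from a map on items into a larger graph. *)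
Lemma glift A B C (f : gmap A B) (g : gmap C B) :
  injective f -> (forall x, exists y, f y = g x) ->
  exists h : gmap C A, forall x, f (h x) = g x.
Proof.
move=> fi fg.
have /choice [hv hvP] : forall p, exists q, gvert f q = gvert g p.
  by move=> p; have [[q|d] // [qp]] := fg (inl p); exists q.
have /choice [he heP] : forall e, exists a, gedge f a = gedge g e.
  by move=> e; have [[q|[a b]] // [ae _]] := fg (inr (e, false)); exists a.
have ok e b : ends (he e) (b (+) (gflip g e (+) gflip f (he e))) = hv (ends e b).
  apply: (item_inj_vert fi); rewrite hvP -gmap_ends heP -addbA -addbA addbb addbF.
  exact: gmap_ends.
exists (Gmap ok) => -[p|[e b]] /=; first by rewrite hvP.
by rewrite /gdart /= heP -addbA -addbA addbb addbF.
Qed.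

Section SubMap.
Variables (G H : graph) (f : gmap G H).
Variables (P : pred (vert G)) (Q : pred (edge G)) (P' : pred (vert H)) (Q' : pred (edge H)).
Hypothesis PQ : forall e b, Q e -> P (ends e b).
Hypothesis PQ' : forall e b, Q' e -> P' (ends e b).
Hypothesis fP : forall p, P p -> P' (gvert f p).
Hypothesis fQ : forall e, Q e -> Q' (gedge f e).

Definition gsub_map : gmap (gsub PQ) (gsub PQ').
Proof.
refine (@Gmap (gsub PQ) (gsub PQ') (fun p => exist _ (gvert f (val p)) (fP (valP p)))
  (fun e => exist _ (gedge f (val e)) (fQ (valP e))) (fun e => gflip f (val e)) _).
by move=> e b; apply: val_inj; exact: gmap_ends.
Defined.

Lemma gsub_mapE x : gsub_in PQ' (gsub_map x) = f (gsub_in PQ x).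
Proof. by case: x => [p|[e b]] //=; rewrite /gdart /= !addbF. Qed.
End SubMap.

Definition gsum_case (J : finType) (A : J -> graph) H (f : forall i, gmap (A i) H) :
  gmap (gsum A) H :=
  @Gmap (gsum A) H (fun p => gvert (f (tag p)) (tagged p))
    (fun e => gedge (f (tag e)) (tagged e)) (fun e => gflip (f (tag e)) (tagged e))
    (fun e b => gmap_ends (f (tag e)) (tagged e) b).

Lemma gsum_caseE (J : finType) (A : J -> graph) H (f : forall i, gmap (A i) H) i x :
  gsum_case f (gsum_in A i x) = f i x.
Proof. by case: x => [p|[e b]] //=; rewrite /gdart /= addbF. Qed.

(** A graph of graphs described by the disjoint unions bV and bE of its vertex and edge
    spaces, whose parts are cut out by the labels pV and pE.  Attaching maps are then
    single graph maps, and do not depend on the edge they belong to. *)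
Record blueprint := Blueprint {
  bU : finType; bW : finType; bend : bW -> bool -> bU;
  bV : graph; bE : graph;
  pV : vert bV -> bU; pE : vert bE -> bW;
  pV_ends : forall e b, pV (ends e b) = pV (ends e false);
  pE_ends : forall e b, pE (ends e b) = pE (ends e false);
  ba : bool -> gmap bE bV;
  baE : forall b q, pV (gvert (ba b) q) = bend (pE q) b;
  ba_vinj : forall b p q, pE p = pE q -> gvert (ba b) p = gvert (ba b) q -> p = q;
  ba_einj : forall b e f, pE (ends e false) = pE (ends f false) ->
    gedge (ba b) e = gedge (ba b) f -> e = f;
  bC : finType; bcspace : bC -> graph;
  bmono : forall c, embedding (bcspace c) (bcspace c) }.

Section Build.
Variable B : blueprint.

Lemma pV_sub u e b : @pV B (ends e false) == u -> pV (ends e b) == u.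
Proof. by rewrite pV_ends. Qed.
Lemma pE_sub u e b : @pE B (ends e false) == u -> pE (ends e b) == u.
Proof. by rewrite pE_ends. Qed.

Definition bvspace (u : bU B) : graph :=
  @gsub (bV B) (fun p => pV p == u) (fun e => pV (ends e false) == u) (@pV_sub u).
Definition bespace (w : bW B) : graph :=
  @gsub (bE B) (fun p => pE p == w) (fun e => pE (ends e false) == w) (@pE_sub w).

Lemma bemb_vok w b q : @pE B q == w -> pV (gvert (ba B b) q) == bend w b.
Proof. by move=> /eqP <-; rewrite baE. Qed.

Lemma bemb_eok w b e : @pE B (ends e false) == w ->
  pV (ends (gedge (ba B b) e) false) == bend w b.
Proof.
by move=> /eqP <-; rewrite -baE -gmap_ends pV_ends.
Qed.

Definition bemb_map w b : gmap (bespace w) (bvspace (bend w b)) :=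
  gsub_map (@pE_sub w) (@pV_sub _) (@bemb_vok w b) (@bemb_eok w b).

Definition bemb w b : embedding (bespace w) (bvspace (bend w b)).
Proof.
refine (@Embedding _ _ (bemb_map w b) _ _).
  move=> p q [pq]; apply: val_inj; apply: ba_vinj pq.
  by rewrite (eqP (valP p)) (eqP (valP q)).
move=> p q [pq]; apply: val_inj; apply: ba_einj pq.
by rewrite (eqP (valP p)) (eqP (valP q)).
Defined.

Definition build : gog :=
  @Gog (bU B) (bW B) (bC B) (@bend B) bvspace bespace (@bcspace B) bemb (@bmono B).

Definition jV : gmap (VS build) (bV B) :=
  gsum_case (fun u => gsub_in (@pV_sub u)).
Definition jE : gmap (ES build) (bE B) :=
  gsum_case (fun u => gsub_in (@pE_sub u)).

Lemma jV_iso : giso jV.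
Proof.
split; apply: inj_surj_bij.
- move=> [u [p pu]] [u' [p' pu']] /= e; subst p'.
  have uu : u = u' by rewrite -(eqP pu) -(eqP pu').
  by subst u'; congr (existT _ u _); apply: val_inj.
- by move=> p; exists (Tagged (fun u => vert (bvspace u)) (exist _ p (eqxx (pV p)))).
- move=> [u [p pu]] [u' [p' pu']] /= e; subst p'.
  have uu : u = u' by rewrite -(eqP pu) -(eqP pu').
  by subst u'; congr (existT _ u _); apply: val_inj.
- by move=> e; exists (Tagged (fun u => edge (bvspace u)) (exist _ e (eqxx (pV (ends e false))))).
Qed.

Lemma jE_iso : giso jE.
Proof.
split; apply: inj_surj_bij.
- move=> [u [p pu]] [u' [p' pu']] /= e; subst p'.
  have uu : u = u' by rewrite -(eqP pu) -(eqP pu').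
  by subst u'; congr (existT _ u _); apply: val_inj.
- by move=> p; exists (Tagged (fun u => vert (bespace u)) (exist _ p (eqxx (pE p)))).
- move=> [u [p pu]] [u' [p' pu']] /= e; subst p'.
  have uu : u = u' by rewrite -(eqP pu) -(eqP pu').
  by subst u'; congr (existT _ u _); apply: val_inj.
- by move=> e; exists (Tagged (fun u => edge (bespace u)) (exist _ e (eqxx (pE (ends e false))))).
Qed.

Lemma jVatt b x : jV (att build b x) = ba B b (jE x).
Proof.
by case: x => [p|[e c]] //=; rewrite /gdart /= !addbF.
Qed.

Lemma over_jV p : pV (gvert jV p) = tag p.
Proof. by case: p => u [p pu]; exact: eqP pu. Qed.

Lemma over_jE p : pE (gvert jE p) = tag p.
Proof. by case: p => u [p pu]; exact: eqP pu. Qed.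
End Build.

Lemma over_dsrc (J : finType) (A : J -> graph) (d : dart (gsum A)) :
  over (inr d) = tag (dsrc d).
Proof. by case: d => -[]. Qed.

(** * Parts of a graph of graphs *)

Lemma onto_all_but_ext Y X (D D' : cell X -> Prop) (i : cellmap Y X) :
  (forall c, D c <-> D' c) -> onto_all_but D i -> onto_all_but D' i.
Proof. by move=> DD [ii io]; split=> // c; rewrite io DD. Qed.

(** The part of X over the vertices in P and the edges in Q, with the edges of their spaces
    restricted to cV and cE.  The attaching maps are followed by r, which allows a
    half-edge to be moved to another vertex. *)
Section SubBlueprint.
Variables (X : gog) (P : pred (uvert X)) (Q : pred (uedge X)).
Variables (cV : pred (edge (VS X))) (cE : pred (edge (ES X))).
Variables (nend : uedge X -> bool -> uvert X) (r : gmap (VS X) (VS X)).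
Hypothesis nendP : forall e b, Q e -> P (nend e b).
Hypothesis rE : forall b q, Q (tag q) -> tag (gvert r (gvert (att X b) q)) = nend (tag q) b.
Hypothesis rc : forall b a, Q (tag a) -> cE a -> cV (gedge r (gedge (att X b) a)).
Hypothesis r_inj : forall b x y, Q (over x) -> over x = over y ->
  r (att X b x) = r (att X b y) -> x = y.

Definition keptP (c : cell X) : bool :=
  match c with
  | UV v => P v | UE e => Q e
  | VI x => P (over x) && (if x is inr d then cV d.1 else true)
  | EI x => Q (over x) && (if x is inr d then cE d.1 else true)
  end.

Definition sVp : pred (vert (VS X)) := fun p => P (tag p).
Definition sVe : pred (edge (VS X)) := fun e => P (tag e) && cV e.
Definition sEp : pred (vert (ES X)) := fun p => Q (tag p).
Definition sEe : pred (edge (ES X)) := fun e => Q (tag e) && cE e.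

Lemma sV_ok e b : sVe e -> sVp (ends e b). Proof. by case/andP. Qed.
Lemma sE_ok e b : sEe e -> sEp (ends e b). Proof. by case/andP. Qed.

Definition sV : graph := gsub sV_ok.
Definition sE : graph := gsub sE_ok.

Lemma ra_vok b q : sEp q -> sVp (gvert (gcomp r (att X b)) q).
Proof. by move=> Qq; rewrite /sVp /= rE //; exact: nendP. Qed.

Lemma ra_eok b a : sEe a -> sVe (gedge (gcomp r (att X b)) a).
Proof.
move=> /andP[Qa ca]; rewrite /sVe rc //= andbT.
have := @ra_vok b (ends a false) Qa; rewrite -(gmap_ends (gcomp r (att X b)) a false).
exact: id.
Qed.

Definition sub_end (w : {e | Q e}) (b : bool) : {u | P u} :=
  exist _ (nend (val w) b) (nendP b (valP w)).

Definition sub_blueprint : blueprint.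
Proof.
refine (@Blueprint {u | P u} {e | Q e} sub_end sV sE
  (fun p => exist _ (tag (val p)) (valP p)) (fun p => exist _ (tag (val p)) (valP p))
  _ _ (fun b => gsub_map sE_ok sV_ok (@ra_vok b) (@ra_eok b)) _ _ _
  (ucirc X) (cspace X) (mono X)).
- by move=> e b; apply: val_inj.
- by move=> e b; apply: val_inj.
- by move=> b q; apply: val_inj => /=; exact: rE (valP q).
- move=> b p q [pq] [e]; apply: val_inj.
  suff : @inl _ (dart (ES X)) (val p) = inl (val q) by case.
  by apply: (@r_inj b) => //=; [exact: valP p | rewrite e].
- move=> b e f [ef] [E]; apply: val_inj.
  have Qe : Q (tag (val e)) by case/andP: (valP e).
  pose t := gflip (gcomp r (att X b)) (val e); pose t' := gflip (gcomp r (att X b)) (val f).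
  suff : @inr (vert (ES X)) _ (val e, t) = inr (val f, t') by case.
  apply: (@r_inj b) => //=; rewrite /gdart /= E.
  by congr (inr (_, _)); rewrite /t /t' /=; do !case: (gflip _ _).
Defined.

Definition sub_gog : gog := build sub_blueprint.

Definition sub_cellmap : cellmap sub_gog X.
Proof.
refine (@Cellmap sub_gog X val val (gcomp (gsub_in sV_ok) (jV sub_blueprint))
  (gcomp (gsub_in sE_ok) (jE sub_blueprint)) _ _).
- move=> [p|[e b]]; first exact: (congr1 val (over_jV p)).
  exact: (congr1 val (over_jV (ends e b))).
- move=> [p|[e b]]; first exact: (congr1 val (over_jE p)).
  exact: (congr1 val (over_jE (ends e b))).
Defined.

Lemma sub_cellmap_onto : onto_all_but (fun c => ~ keptP c) sub_cellmap.
Proof.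
have iV : injective (cm_V sub_cellmap).
  move=> x y; rewrite !gcompE => /gsub_in_inj; apply: giso_inj; exact: jV_iso.
have iE : injective (cm_E sub_cellmap).
  move=> x y; rewrite !gcompE => /gsub_in_inj; apply: giso_inj; exact: jE_iso.
split.
- case=> [u|w|x|x] [u'|w'|x'|x'] //= [].
  + by move/val_inj => ->.
  + by move/val_inj => ->.
  + by move/iV => ->.
  + by move/iE => ->.
have kept c : keptP (on_cell sub_cellmap c).
  case: c => [u|w|x|x]; [exact: valP u | exact: valP w | |].
  + have : in_sub sVp sVe (gsub_in sV_ok (jV sub_blueprint x)) by apply/(gsub_inP sV_ok); exists (jV sub_blueprint x).
    by rewrite -gcompE /=; case: (gitem _ x) => [p|[e b]] /=; rewrite /sVp /sVe ?andbT.
  + have : in_sub sEp sEe (gsub_in sE_ok (jE sub_blueprint x)) by apply/(gsub_inP sE_ok); exists (jE sub_blueprint x).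
    by rewrite -gcompE /=; case: (gitem _ x) => [p|[e b]] /=; rewrite /sEp /sEe ?andbT.
move=> c; split; first by move=> [c' <-] nk; apply: nk.
move/contrapT.
case: c => [u|w|x|x] /=.
- by move=> Pu; exists (@UV sub_gog (exist _ u Pu)).
- by move=> Pu; exists (@UE sub_gog (exist _ w Pu)).
- move=> h; have /(gsub_inP sV_ok) [y yx] : in_sub sVp sVe x.
    by case: x h => [p|[e b]] /=; rewrite /sVp /sVe ?andbT.
  have [z zy] := giso_surj (jV_iso sub_blueprint) y.
  by exists (@VI sub_gog z) => /=; congr VI; rewrite -yx -zy; exact: (gcompE (gsub_in sV_ok) (jV sub_blueprint)).
- move=> h; have /(gsub_inP sE_ok) [y yx] : in_sub sEp sEe x.
    by case: x h => [p|[e b]] /=; rewrite /sEp /sEe ?andbT.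
  have [z zy] := giso_surj (jE_iso sub_blueprint) y.
  by exists (@EI sub_gog z) => /=; congr EI; rewrite -yx -zy; exact: (gcompE (gsub_in sE_ok) (jE sub_blueprint)).
Qed.

Lemma sub_cellmap_att b x :
  cm_V sub_cellmap (att sub_gog b x) = r (att X b (cm_E sub_cellmap x)).
Proof.
rewrite [LHS]gcompE [att _ _ _ in RHS]/= .
rewrite (jVatt (B := sub_blueprint)) gsub_mapE gcompE; congr (r (att X b _)).
by rewrite /sub_cellmap /= gcompE.
Qed.

Lemma sub_same_circles : same_circles sub_gog X.
Proof.
exists id, (gid (CS X)); split; [by exists id | exact: giso_id | |].
- by move=> x; rewrite gidE.
- by move=> x; rewrite !gidE.
Qed.
End SubBlueprint.

(** * Non-backtracking flows *)

(** Walking for ever without backtracking is a local substitute for the existence of a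
    circuit in every component, which can be followed through collapses.  Walks may
    stop in K. *)
Section Flows.
Variable G : graph.

Definition dtgt (d : dart G) : vert G := dsrc (drev d).

Lemma dtgt_rev d : dtgt (drev d) = dsrc d.
Proof. by rewrite /dtgt drevK. Qed.

Variable K : vert G -> Prop.

Definition flows (D : dart G -> Prop) :=
  forall d, D d -> K (dtgt d) \/ exists d', [/\ D d', dsrc d' = dtgt d & d' <> drev d].

Definition starts (D : dart G -> Prop) p := K p \/ exists d, D d /\ dsrc d = p.

Definition rich := exists D, flows D /\ forall p, starts D p.

Lemma adj_sym : symmetric (@adj G).
Proof.
move=> x y; apply/existsP/existsP => -[d /andP[dx dy]]; exists (drev d);
  by rewrite drevK dx dy.
Qed.

Lemma connect_adj_sym : connect_sym (@adj G).
Proof. exact: sym_connect_sym adj_sym. Qed.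

(** Along a path towards a circuit, or towards K, every vertex inherits the walk of the next
    one, or, if that walk begins by
    coming back, its continuation. *)
Lemma rich_of_components :
  (forall C, is_component C ->
     (exists p, is_circuit p /\ forall d, d \in p -> dsrc d \in C) \/
     (exists x, x \in C /\ K x)) -> rich.
Proof.
move=> hC; pose D d := exists E, flows E /\ E d.
have fD : flows D.
  move=> d [E [fE Ed]]; have [k|[d' [E' s n]]] := fE d Ed; first by left.
  by right; exists d'; split=> //; exists E.
have extD d : K (dtgt d) \/ (exists d', [/\ D d', dsrc d' = dtgt d & d' <> drev d]) -> D d.
  move=> hd; exists (fun x => D x \/ x = d); split; last by right.
  move=> x [Dx|->].
    have [k|[d' [D' s n]]] := fD x Dx; first by left.
    by right; exists d'; split=> //; left.
  case: hd => [k|[d' [D' s n]]]; first by left.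
  by right; exists d'; split=> //; left.
have back x y : adj x y -> starts D y -> starts D x.
  move=> /existsP [d /andP[/eqP dx /eqP dy]] [Ky|[d' [Dd' sd']]].
    by right; exists d; split=> //; apply: extD; left; rewrite /dtgt dy.
  have [e|/eqP n] := eqVneq d' (drev d); last first.
    right; exists d; split=> //; apply: extD; right; exists d'.
    by rewrite /dtgt dy.
  have [k|[d2 [D2 s2 _]]] := fD _ Dd'; first by left; move: k; rewrite e dtgt_rev dx.
  by right; exists d2; split=> //; rewrite s2 e dtgt_rev.
exists D; split=> // x.
have [y [yC yD]] : exists y, connect (@adj G) x y /\ starts D y.
  have [|[p [[p0 cp _] pC]]|[y [yC Ky]]] := hC [set y | connect (@adj G) x y].
  - by exists x.
  - case: p p0 cp pC => // d p _ cp pC; exists (dsrc d).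
    split; first by have := pC d (mem_head d p); rewrite inE.
    right; exists d; split=> //; exists (fun z => z \in d :: p); split; last exact: mem_head.
    move=> z zp; right; exists (next (d :: p) z); split.
    + by rewrite mem_next.
    + by have /andP[/eqP zz _] := next_cycle cp zp; rewrite /dtgt zz.
    + by have /andP[_ /eqP] := next_cycle cp zp.
  - by exists y; rewrite inE in yC; split=> //; left.
case/connectP: yC => q; elim: q x => [|z q IH] x /=; first by move=> _ <-.
by move=> /andP[xz qz] yl; apply: (back _ z) => //; exact: IH.
Qed.
End Flows.

Lemma rich_pull (G G' : graph) (K : vert G -> Prop) (K' : vert G' -> Prop)
    (fv : vert G' -> vert G) (fe : edge G' -> edge G) (D : dart G -> Prop) :
  injective fv -> (forall a b, fv (ends a b) = ends (fe a) b) ->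
  flows K D -> (forall d, D d -> exists a, fe a = d.1) ->
  (forall p, K (fv p) -> K' p) -> (forall p, starts K D (fv p)) -> rich K'.
Proof.
move=> fi fe_ends fD De KK' st; exists (fun d => D (fe d.1, d.2)); split.
- move=> [a b] /= Dab; have [k|[[a' b'] [D' s n]]] := fD _ Dab.
    by left; apply: KK'; rewrite fe_ends.
  right; have [a'' /= aa] := De _ D'; subst a'; exists (a'', b'); split=> //.
    by apply: fi; rewrite /dsrc /= !fe_ends; exact: s.
  by move=> [aa bb]; apply: n; rewrite /drev /= aa bb.
- move=> p; have [k|[[a b] [Dab s]]] := st p; first by left; exact: KK'.
  right; have [a' /= aa] := De _ Dab; subst a; exists (a', b); split=> //.
  by apply: fi; rewrite /dsrc /= fe_ends.
Qed.

Definition no_sink (G : graph) (p : vert G) := False.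

(** * The middle and horizontal graphs without circle edges *)

Definition Mid (X : gog) : graph :=
  @Graph (edge (VS X)) (edge (ES X)) (fun a b => gedge (att X b) a).

Definition Hor (X : gog) : graph :=
  @Graph (vert (VS X)) (vert (ES X)) (fun q b => gvert (att X b) q).

Definition incident (G : graph) (p : vert G) : Prop := exists d : dart G, dsrc d = p.

Definition covers (X : gog) (e : edge (VS X)) : {set bool * edge (ES X)} :=
  [set h | gedge (att X h.1) h.2 == e].

Definition doubly_covered (X : gog) := forall e : edge (VS X), 1 < #|covers e|.

(** The circle edges contribute separate components. *)
Lemma rich_mid X : (forall C : {set vert (mid_graph X)}, ~ is_tree_component C) ->
  rich (@no_sink (Mid X)).
Proof.
move=> nt; have [D [fD sD]] : rich (@no_sink (mid_graph X)).
  apply: rich_of_components => C cC; left; apply: contrapT => np.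
  by apply: (nt C); split.
apply: (@rich_pull (mid_graph X) (Mid X) (@no_sink _) (@no_sink _) (inl : edge (VS X) -> vert (mid_graph X))
  (inl : edge (ES X) -> edge (mid_graph X))
  (fun d => D d /\ exists a, inl a = d.1)) => //.
- by move=> ? ? [].
- move=> [a b] [Dd [a' /= aE]]; subst a; have [//|[[d' b'] [D' s n]]] := fD _ Dd.
  right; exists (d', b'); split=> //; split=> //.
  by case: d' s {D' n} => [d'|d'] //=; exists d'.
- by move=> d [].
- move=> p; have [//|[[a b] [Da s]]] := sD (inl p).
  right; exists (a, b); split=> //; split=> //.
  by case: a s {Da} => [a|a] //=; exists a.
Qed.

(** A tree component avoiding all edges of vertex spaces is excluded, so every component
    has a circuit or a point on an edge. *)
Lemma rich_hor X : (forall C : {set vert (horizontal_graph X)}, ~ isolated_tree C) ->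
  rich (@incident (VS X) : vert (Hor X) -> Prop).
Proof.
move=> nt; pose K (p : vert (horizontal_graph X)) :=
  if p is inl q then @incident (VS X) q else False.
have [D [fD sD]] : rich K.
  apply: rich_of_components => C cC.
  have [[x [xC Kx]]|nK] := pselect (exists x, x \in C /\ K x); first by right; exists x.
  left; apply: contrapT => np; apply: (nt C); split; first by split.
  move=> d; apply/negP => dC; apply: nK; exists (inl (dsrc d)); split=> //.
  by exists d.
apply: (@rich_pull (horizontal_graph X) (Hor X) K _ (inl : vert (VS X) -> vert (horizontal_graph X))
  (inl : vert (ES X) -> edge (horizontal_graph X))
  (fun d => D d /\ exists a, inl a = d.1)) => //.
- by move=> ? ? [].
- move=> [a b] [Dd [a' /= aE]]; subst a; have [k|[[d' b'] [D' s n]]] := fD _ Dd.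
    by left.
  right; exists (d', b'); split=> //; split=> //.
  by case: d' s {D' n} => [d'|d'] //=; exists d'.
- by move=> d [].
- move=> p; have [k|[[a b] [Da s]]] := sD (inl p); first by left.
  right; exists (a, b); split=> //; split=> //.
  by case: a s {Da} => [a|a] //=; exists a.
Qed.

(** * Collapsing free edges *)

Lemma gsum_in_inj (J : finType) (A : J -> graph) i : injective (gsum_in A i).
Proof.
move=> x y e; have := gpartsE x; rewrite e gpartsE.
by move=> /eqP; rewrite eq_Tagged => /eqP.
Qed.

Lemma att_inj X b (x y : item (ES X)) : over x = over y -> att X b x = att X b y -> x = y.
Proof.
have [e [x' ->]] := gsum_inP x; have [f [y' ->]] := gsum_inP y.
rewrite !over_gsum_in => ef; subst f; rewrite !att_gsum_in => /gsum_in_inj E.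
congr (gsum_in _ e _); apply: gitem_inj E; [exact: emb_vert_inj | exact: emb_edge_inj].
Qed.

Lemma over_att X b (x : item (ES X)) : over (att X b x) = uend X (over x) b.
Proof. by have [e [x' ->]] := gsum_inP x; rewrite att_gsum_in !over_gsum_in. Qed.

Lemma gplus_map_inj G G' H H' (f : gmap G G') (g : gmap H H') :
  injective f -> injective g -> injective (gplus_map f g).
Proof.
move=> fi gi x y; have [[x' ->]|[x' ->]] := gplusP x; have [[y' ->]|[y' ->]] := gplusP y;
  rewrite !(gplus_mapEl, gplus_mapEr).
- by move=> /ginl_inj/fi ->.
- by move=> e; case: (ginlr e).
- by move=> /esym e; case: (ginlr e).
- by move=> /ginr_inj/gi ->.
Qed.

Lemma gplus_map_imagel G G' H H' (f : gmap G G') (g : gmap H H') x :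
  (exists y, gplus_map f g y = ginl _ _ x) <-> exists y, f y = x.
Proof.
split=> [[y]|[y <-]]; last by exists (ginl _ _ y); rewrite gplus_mapEl.
have [[y' ->]|[y' ->]] := gplusP y; rewrite ?gplus_mapEl ?gplus_mapEr.
  by move=> /ginl_inj <-; exists y'.
by move=> /esym e; case: (ginlr e).
Qed.

Lemma gplus_gid_imager G G' H (f : gmap G G') x :
  exists y, gplus_map f (gid H) y = ginr _ _ x.
Proof. by exists (ginr _ _ x); rewrite gplus_mapEr gidE. Qed.

Lemma gid_inj H : injective (gid H).
Proof. by move=> x y; rewrite !gidE. Qed.

Lemma card_inj_missing (S T : finType) (f : S -> T) y :
  injective f -> (forall x, f x <> y) -> #|S| < #|T|.
Proof.
move=> fi fy; rewrite -(card_codom fi); apply: proper_card.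
apply/properP; split; first by apply/subsetP => z _.
by exists y => //; apply/negP => /codomP [x yx]; apply: (fy x).
Qed.

Section SubGogFacts.
Variables (X : gog) (P : pred (uvert X)) (Q : pred (uedge X)).
Variables (cV : pred (edge (VS X))) (cE : pred (edge (ES X))).
Variables (nend : uedge X -> bool -> uvert X) (r : gmap (VS X) (VS X)).
Hypothesis nendP : forall e b, Q e -> P (nend e b).
Hypothesis rE : forall b q, Q (tag q) -> tag (gvert r (gvert (att X b) q)) = nend (tag q) b.
Hypothesis rc : forall b a, Q (tag a) -> cE a -> cV (gedge r (gedge (att X b) a)).
Hypothesis r_inj : forall b x y, Q (over x) -> over x = over y ->
  r (att X b x) = r (att X b y) -> x = y.

Notation Y := (sub_gog nendP rE rc r_inj).
Notation i := (sub_cellmap nendP rE rc r_inj).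

Lemma sub_V_inj : injective (cm_V i).
Proof.
have [ii _] := sub_cellmap_onto nendP rE rc r_inj.
by move=> x y e; have [] := ii (@VI Y x) (@VI Y y) (congr1 (@VI X) e).
Qed.

Lemma sub_E_inj : injective (cm_E i).
Proof.
have [ii _] := sub_cellmap_onto nendP rE rc r_inj.
by move=> x y e; have [] := ii (@EI Y x) (@EI Y y) (congr1 (@EI X) e).
Qed.

Lemma sub_V_image x :
  (exists y, cm_V i y = x) <-> P (over x) && (if x is inr d then cV d.1 else true).
Proof.
have [_ io] := sub_cellmap_onto nendP rE rc r_inj; have := io (@VI X x); rewrite /keptP => h.
split=> [[y yx]|k].
  apply/negP => /negP nk; have /h : exists c', on_cell i c' = VI x by exists (VI y); rewrite /= yx.
  by apply; apply/negP.
by have [|[u|w|y|y] //= [yx]] := (h.2 _); [move=> nk; apply: nk | exists y].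
Qed.

Lemma sub_E_image x :
  (exists y, cm_E i y = x) <-> Q (over x) && (if x is inr d then cE d.1 else true).
Proof.
have [_ io] := sub_cellmap_onto nendP rE rc r_inj; have := io (@EI X x); rewrite /keptP => h.
split=> [[y yx]|k].
  apply/negP => /negP nk; have /h : exists c', on_cell i c' = EI x by exists (EI y); rewrite /= yx.
  by apply; apply/negP.
by have [|[u|w|y|y] //= [yx]] := (h.2 _); [move=> nk; apply: nk | exists y].
Qed.
End SubGogFacts.

Definition off_edge (G : graph) (e : edge G) (x : item G) : bool :=
  if x is inr d then d.1 != e else true.

Lemma off_edge_map G H (f : gmap G H) e x s :
  off_edge e (f (inr (x, s))) = (gedge f x != e).
Proof. by []. Qed.

Lemma gitem_inr G H (f : gmap G H) y e s :
  f y = inr (e, s) -> exists e', gedge f e' = e.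
Proof. by case: y => [p|[e' t]] //= [<- _]; exists e'. Qed.

Lemma gitem_inr_src G H (f : gmap G H) y d' :
  f y = inr d' -> exists d, y = inr d /\ gvert f (dsrc d) = dsrc d'.
Proof. by case: y => [p|d] //= [<-]; exists d; rewrite dsrc_gdart. Qed.

Lemma square_edge A B C D (f : gmap B D) (g : gmap A B) (h : gmap C D) (k : gmap A C) :
  (forall x, f (g x) = h (k x)) -> forall e, gedge f (gedge g e) = gedge h (gedge k e).
Proof. by move=> E e; have [] := E (inr (e, false)). Qed.

Lemma square_vert A B C D (f : gmap B D) (g : gmap A B) (h : gmap C D) (k : gmap A C) :
  (forall x, f (g x) = h (k x)) -> forall p, gvert f (gvert g p) = gvert h (gvert k p).
Proof. by move=> E p; have [] := E (inl p). Qed.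

Lemma gitem_inl G H (f : gmap G H) y p : f y = inl p -> exists q, gvert f q = p.
Proof. by case: y => [q|d] //= [<-]; exists q. Qed.

Section CollapseEdge.
Variables (X : gog) (a : edge (ES X)) (b : bool).
Let e := gedge (att X b) a.
Hypothesis e_free : forall b' a', gedge (att X b') a' = e -> b' = b /\ a' = a.

Lemma collapse_rc b' a' : predT (tag a') -> a' != a ->
  gedge (gid (VS X)) (gedge (att X b') a') != e.
Proof. by move=> _ /eqP aa; apply/eqP => /= /e_free []. Qed.

Lemma collapse_r_inj b' (x y : item (ES X)) : predT (over x) -> over x = over y ->
  gid _ (att X b' x) = gid _ (att X b' y) -> x = y.
Proof. by move=> _ xy; rewrite !gidE; exact: att_inj. Qed.

Definition collapse_gog : gog :=
  @sub_gog X predT predT (fun e' => e' != e) (fun a' => a' != a) (uend X) (gid _)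
    (fun _ _ _ => isT) (fun _ _ _ => erefl) collapse_rc collapse_r_inj.

Definition collapse_map : cellmap collapse_gog X :=
  @sub_cellmap X predT predT (fun e' => e' != e) (fun a' => a' != a) (uend X) (gid _)
    (fun _ _ _ => isT) (fun _ _ _ => erefl) collapse_rc collapse_r_inj.

Lemma collapse_att b' x :
  cm_V collapse_map (att collapse_gog b' x) = att X b' (cm_E collapse_map x).
Proof. by rewrite [LHS]sub_cellmap_att gidE. Qed.

Lemma collapse_V_inj : injective (cm_V collapse_map).
Proof. exact: sub_V_inj. Qed.
Lemma collapse_E_inj : injective (cm_E collapse_map).
Proof. exact: sub_E_inj. Qed.
Lemma collapse_V_image x :
  (exists y, cm_V collapse_map y = x) <-> off_edge e x.
Proof.
exact (@sub_V_image X predT predT (fun e' => e' != e) (fun a' => a' != a) (uend X) (gid _)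
    (fun _ _ _ => isT) (fun _ _ _ => erefl) collapse_rc collapse_r_inj x).
Qed.
Lemma collapse_E_image x :
  (exists y, cm_E collapse_map y = x) <-> off_edge a x.
Proof.
exact (@sub_E_image X predT predT (fun e' => e' != e) (fun a' => a' != a) (uend X) (gid _)
    (fun _ _ _ => isT) (fun _ _ _ => erefl) collapse_rc collapse_r_inj x).
Qed.

Lemma collapse_move : collapse_free_edge X collapse_gog.
Proof.
exists e, b, a; split=> //.
- apply/eqP/cards1P; exists (b, a); apply/setP => -[b' a']; rewrite !inE /=.
  by apply/eqP/eqP => [/e_free [-> ->]|[-> ->]].
- exact: sub_same_circles.
exists collapse_map; split=> //; last exact: collapse_att.
apply: onto_all_but_ext (sub_cellmap_onto _ _ _ _) => c; split.
  case: c => [u|w|[p|[e' s]]|[p|[e' s]]] //= /negP.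
    by rewrite negbK => /eqP ->; exists s; left.
  by rewrite negbK => /eqP ->; exists s; right.
by move=> [s [->|->]] /=; rewrite eqxx.
Qed.

Lemma collapse_card : #|edge (VS collapse_gog)| < #|edge (VS X)|.
Proof.
apply: (@card_inj_missing _ _ (gedge (cm_V collapse_map)) e).
  by apply: item_inj_edge; exact: collapse_V_inj.
move=> x xe; have /collapse_V_image : exists y, cm_V collapse_map y =
    cm_V collapse_map (inr (x, false)) by exists (inr (x, false)).
by rewrite off_edge_map xe eqxx.
Qed.

Lemma collapse_edge_preimage a' : a' != a -> exists a'', gedge (cm_E collapse_map) a'' = a'.
Proof.
by move=> aa; have [y /gitem_inr] := (collapse_E_image (inr (a', false))).2 aa.
Qed.

(** The removed vertex of the mid-graph has valence one, so no walk passes through it. *)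
Lemma collapse_rich_mid : rich (@no_sink (Mid X)) -> rich (@no_sink (Mid collapse_gog)).
Proof.
move=> [D [fD sD]].
(* A dart into the removed vertex could only be followed by its reverse. *)
have noback : ~ D (a, ~~ b).
  move=> /fD [//|[[a' b'] [D' s n]]].
  have [bb aa] : b' = b /\ a' = a.
    by apply: e_free; move: s; rewrite /dtgt /dsrc /drev /= negbK.
  by apply: n; rewrite bb aa /drev /= negbK.
apply: (@rich_pull (Mid X) (Mid collapse_gog) (@no_sink _) (@no_sink _) (gedge (cm_V collapse_map)) (gedge (cm_E collapse_map))
  (fun d => D d /\ d.1 != a)).
- by apply: item_inj_edge; exact: collapse_V_inj.
- by move=> a' b'; exact: (square_edge (collapse_att b')).
- move=> [a' b'] [Dd aa]; have [//|[[a2 b2] [D2 s n]]] := fD _ Dd.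
  right; exists (a2, b2); split=> //; split=> //; apply/eqP => /= a2a; subst a2.
  have [bb|bb] : b2 = b \/ b2 = ~~ b by case: (b); case: b2 {D2 s n}; auto.
    have [_ a'a] : ~~ b' = b /\ a' = a by apply: e_free; move: s; rewrite bb => /esym.
    by move: aa; rewrite /= a'a eqxx.
  by apply: noback; rewrite -bb.
- by move=> d [_ /collapse_edge_preimage].
- by [].
- move=> p; have [//|[[a' b'] [Dd s]]] := sD (gedge (cm_V collapse_map) p).
  right; exists (a', b'); split=> //; split=> //; apply/eqP => /= aa; subst a'.
  have [bb|bb] : b' = b \/ b' = ~~ b by case: (b); case: b' {Dd s}; auto.
    have /collapse_V_image : exists y, cm_V collapse_map y =
      cm_V collapse_map (inr (p, false)) by exists (inr (p, false)).
    by rewrite off_edge_map -s bb /dsrc /= eqxx.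
  by apply: noback; rewrite -bb.
Qed.

Lemma collapse_evert_image p : exists q, gvert (cm_E collapse_map) q = p.
Proof. by have [y /gitem_inl] := (collapse_E_image (inl p)).2 isT. Qed.

Lemma collapse_incident p :
  (exists d : dart (VS X), d.1 <> e /\ dsrc d = gvert (cm_V collapse_map) p) ->
  @incident (VS collapse_gog) p.
Proof.
move=> [[e' s] [/= /eqP ee sp]].
have [y /gitem_inr_src [d [_ dE]]] := (collapse_V_image (inr (e', s))).2 ee.
by exists d; apply: (item_inj_vert collapse_V_inj); rewrite dE.
Qed.

(** The endpoints of the removed edge may stop being incident to an edge; the two
    horizontal sides of the removed square then lead to the endpoints of the opposite edge,
    where the walk may stop. *)
Lemma collapse_rich_hor : rich (@incident (VS X) : vert (Hor X) -> Prop) ->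
  rich (@incident (VS collapse_gog) : vert (Hor collapse_gog) -> Prop).
Proof.
move=> [D [fD sD]].
pose K (p : vert (Hor X)) := exists d : dart (VS X), d.1 <> e /\ dsrc d = p.
pose side c : dart (Hor X) := (ends a c, b).
have side_src c : dsrc (side c) = ends e (c (+) gflip (att X b) a).
  by rewrite /dsrc /= gmap_ends.
have side_tgt c : K (dtgt (side c)).
  exists (gedge (att X (~~ b)) a, c (+) gflip (att X (~~ b)) a); split.
    by move=> /= /e_free [bb _]; case: (b) bb.
  by rewrite /dsrc /= gmap_ends.
have inc p : @incident (VS X) p -> K p \/ exists c, dsrc (side c) = p.
  move=> [[e' s] sp]; have [ee|/eqP ne] := eqVneq e' e; last by left; exists (e', s).
  right; exists (s (+) gflip (att X b) a).
  by rewrite side_src -addbA addbb addbF -ee.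
pose D' d := (D d /\ forall c, d <> drev (side c)) \/ exists c, d = side c.
apply: (@rich_pull (Hor X) (Hor collapse_gog) K (@incident (VS collapse_gog))
  (gvert (cm_V collapse_map)) (gvert (cm_E collapse_map)) D').
- exact: (item_inj_vert collapse_V_inj).
- by move=> q b'; exact: (square_vert (collapse_att b')).
- move=> d [[Dd nd]|[c ->]]; last by left.
  have [/inc [k|[c sc]]|[d' [D2 s n]]] := fD d Dd; first by left.
    right; exists (side c); split=> //; first by right; exists c.
    by move=> E; apply: (nd c); rewrite E drevK.
  have [[c cE]|nc] := pselect (exists c, d' = drev (side c)).
    by left; rewrite -s cE; exact: side_tgt.
  right; exists d'; split=> //; left; split=> // c E; apply: nc.
  by exists c.
- by move=> d _; exact: collapse_evert_image.
- by move=> p; exact: collapse_incident.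
- move=> p; have [/inc [k|[c sc]]|[d [Dd s]]] := sD (gvert (cm_V collapse_map) p).
  + by left.
  + by right; exists (side c); split=> //; right; exists c.
  have [[c cE]|nc] := pselect (exists c, d = drev (side c)).
    by left; rewrite -s cE; exact: side_tgt.
  right; exists d; split=> //; left; split=> // c E; apply: nc.
  by exists c.
Qed.

Lemma collapse_flat (R : realType) : fheq R (flat_of collapse_gog) (flat_of X).
Proof.
pose rho (x : item (fE (flat_of X))) : option bool :=
  if x is inr (inl a', _) then if a' == a then Some b else None else None.
have rhol (x : item (ES X)) : rho (ginl _ _ x) = if off_edge a x then None else Some b.
  by case: x => [q|[a' s]] //=; case: eqP.
have rhor (x : item (CS X)) : rho (ginr _ _ x) = None by case: x => [q|[a' s]].
have fal b' (x : item (ES X)) : fa (flat_of X) b' (ginl _ _ x) = ginl _ _ (att X b' x).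
  exact: gplus_mapEl.
have off_att b' x : off_edge e (att X b' x) = false -> off_edge a x = false /\ b' = b.
  case: x => [q|[a' s]] //=; move=> /negbFE /eqP /e_free [-> ->].
  by rewrite eqxx.
have att_off x : off_edge a x = false -> off_edge e (att X b x) = false.
  by case: x => [q|[a' s]] //= /negbFE /eqP ->; rewrite eqxx.
apply: (@remove_free_cells_heq R (flat_of X) (flat_of collapse_gog)
  (gplus_map (cm_V collapse_map) (gid _)) (gplus_map (cm_E collapse_map) (gid _)) rho).
- by apply: gplus_map_inj; [exact: collapse_V_inj | exact: gid_inj].
- by apply: gplus_map_inj; [exact: collapse_E_inj | exact: gid_inj].
- move=> b' y; have [[x ->]|[x ->]] := gplusP y.
    by rewrite /fa /= !gplus_mapEl collapse_att.
  by rewrite /fa /= !gplus_mapEr; case: b'; rewrite !gidE.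
- by case=> [[a'|a'] s].
- move=> x; have [[x' ->]|[x' ->]] := gplusP x.
    rewrite gplus_map_imagel collapse_E_image rhol; case: (off_edge a x') => //.
  by rewrite rhor; split=> // _; exact: gplus_gid_imager.
- move=> v; have [[v' ->]|[v' ->]] := gplusP v.
    rewrite gplus_map_imagel collapse_V_image; split=> [k [x [b' []]]|nx].
      have [[x' ->]|[x' ->]] := gplusP x; last by rewrite rhor.
      rewrite rhol fal; case E: (off_edge a x') => // -[<-] /ginl_inj xv.
      by move: k; rewrite -xv att_off.
    apply: contrapT => /negP /negbTE k; apply: nx.
    case: v' k => [q|[e' s]] k; first by [].
    have ee : e' = e by move: k; rewrite /off_edge /= => /negbFE /eqP.
    exists (ginl (ES X) (CS X) (inr (a, s (+) gflip (att X b) a))), b.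
    have -> : @inr (vert (VS X)) _ (e', s) = att X b (inr (a, s (+) gflip (att X b) a)).
      by rewrite /= /gdart /= -addbA addbb addbF ee.
    by rewrite rhol fal /off_edge eqxx.
  split=> [_ [x [b' []]]|_]; last exact: gplus_gid_imager.
  have [[x' ->]|[x' ->]] := gplusP x; last by rewrite rhor.
  by rewrite fal => _ /(@ginlr (VS X) (CS X)).
- move=> x b1 x' b'; have [[y ->]|[y ->]] := gplusP x; last by rewrite rhor.
  rewrite rhol fal; case E: (off_edge a y) => // -[<-].
  have [[y' ->]|[y' ->]] := gplusP x'; last first.
    by rewrite /fa /= gplus_mapEr => /esym /(@ginlr (VS X) (CS X)).
  rewrite fal => /ginl_inj yy; have := att_off y E; rewrite -yy => /off_att [Ey bb].
  split=> //; apply: (congr1 (ginl (ES X) (CS X))); rewrite bb in yy.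
  case: y y' E Ey yy => [q|[a1 s1]] [q'|[a2 s2]] //= /negbFE /eqP -> /negbFE /eqP ->.
  by move=> [] /addIb ->.
- by move=> q d; rewrite /rho.
Qed.
End CollapseEdge.

(** By richness no edge is uncovered; one that is covered only once is free, and collapsing
    it leaves fewer edges. *)
Lemma collapse_to_doubly_covered (R : realType) X :
  rich (@no_sink (Mid X)) -> rich (@incident (VS X) : vert (Hor X) -> Prop) ->
  exists Y, [/\ converts_to X Y, fheq R (flat_of Y) (flat_of X), doubly_covered Y
    & rich (@incident (VS Y) : vert (Hor Y) -> Prop)].
Proof.
have [n] := ubnP #|edge (VS X)|; elim: n X => // n IH X /ltnSE Xn rm rh.
have [dc|/existsNP [e ne]] := pselect (doubly_covered X).
  exists X; split=> //; first exact: rt_refl.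
  by apply: flat_iso_heq; exists (gid _), (gid _); split; [exact: giso_id | exact: giso_id | move=> b x; rewrite !gidE].
have [D [_ /(_ e) [//|[[a b] [_ abe]]]]] := rm.
have e_free b' a' : gedge (att X b') a' = gedge (att X b) a -> b' = b /\ a' = a.
  move=> E; have c1 : #|covers e| <= 1 by rewrite leqNgt; apply/negP.
  have i1 : (b, a) \in covers e by rewrite inE; apply/eqP.
  have i2 : (b', a') \in covers e by rewrite inE; apply/eqP; exact: etrans E abe.
  by have [-> ->] := card_le1_eqP c1 _ _ i2 i1.
have [|Y [XY hY dY rY]] := IH (collapse_gog e_free) _ (collapse_rich_mid e_free rm) (collapse_rich_hor e_free rh).
  exact: leq_trans (collapse_card e_free) Xn.
exists Y; split=> //.
- apply: rt_trans XY; apply: rt_step; do 3 right; left; left.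
  exact: collapse_move.
- exact: heq_trans hY (collapse_flat _ _).
Qed.

(** * Connectedness in terms of total graphs *)

Lemma connect_map G H (f : gmap G H) p q :
  connect (@adj G) p q -> connect (@adj H) (gvert f p) (gvert f q).
Proof.
case/connectP => s; elim: s p => [|z s IH] p /=; first by move=> _ ->.
move=> /andP[/existsP [d /andP[/eqP dp /eqP dz]] zs] ql.
apply: connect_trans (connect1 _) (IH z zs ql).
by apply/existsP; exists (gdart f d); rewrite -gdart_rev !dsrc_gdart dp dz !eqxx.
Qed.

Definition full_image G H (f : gmap G H) :=
  forall d : dart H, (exists p, gvert f p = dsrc d) -> exists a, gdart f a = d.

Lemma connect_full G H (f : gmap G H) : injective f -> full_image f ->
  forall p q', connect (@adj H) (gvert f p) q' ->
  exists q, gvert f q = q' /\ connect (@adj G) p q.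
Proof.
move=> fi ff p q' /connectP [s]; elim: s p => [|z s IH] p /=.
  by move=> _ ->; exists p.
move=> /andP[/existsP [d /andP[/eqP dp /eqP dz]] zs] ql.
have [d' d'd] : exists a, gdart f a = d by apply: ff; exists p.
have pd : dsrc d' = p by apply: (item_inj_vert fi); rewrite -dsrc_gdart d'd.
have zd : gvert f (dsrc (drev d')) = z by rewrite -dsrc_gdart gdart_rev d'd.
have [q [qq' cq]] : exists q, gvert f q = q' /\ connect (@adj G) (dsrc (drev d')) q.
  by apply: IH; rewrite zd.
exists q; split=> //; apply: connect_trans (connect1 _) cq.
by apply/existsP; exists d'; rewrite pd !eqxx.
Qed.

Lemma connect_full_inj G H (f : gmap G H) : injective f -> full_image f ->
  forall p q, connect (@adj H) (gvert f p) (gvert f q) -> connect (@adj G) p q.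
Proof.
by move=> fi ff p q /(connect_full fi ff) [q' [/(item_inj_vert fi) <-]].
Qed.

Lemma giso_full G H (f : gmap G H) : giso f -> full_image f.
Proof.
move=> /giso_surj fs d _; have [[p|a] // [ad]] := fs (inr d); by exists a.
Qed.

Lemma gsum_in_full (J : finType) (A : J -> graph) i : full_image (gsum_in A i).
Proof.
move=> [[j e] b] [p]; rewrite /dsrc /= => /(congr1 (@tag _ _)) /= ij; subst j.
by exists (e, b); rewrite /gdart /= addbF.
Qed.

Lemma connect_over (J : finType) (A : J -> graph) (p q : vert (gsum A)) :
  connect (@adj (gsum A)) p q -> tag p = tag q.
Proof.
case/connectP => s; elim: s p => [|z s IH] p /=; first by move=> _ ->.
move=> /andP[/existsP [d /andP[/eqP <- /eqP dz]] zs] ql; rewrite -(IH z zs ql) -dz.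
by case: (d).
Qed.

Definition fiber_connected (J : finType) (A : J -> graph) :=
  (forall i, exists p : vert (gsum A), tag p = i) /\
  forall p q : vert (gsum A), tag p = tag q -> connect (@adj (gsum A)) p q.

Lemma fiber_connectedP (J : finType) (A : J -> graph) :
  (forall i, gconnected (A i)) <-> fiber_connected A.
Proof.
split=> [cA|[ne cA] i].
  split=> [i|[i p] [j q] /= ij].
    by have [[x _] _] := cA i; exists (Tagged (fun i => vert (A i)) x).
  by subst j; apply: (connect_map (gsum_in A i)); exact: (cA i).2.
split; first by have [[j p] /= ji] := ne i; subst j; exists p.
move=> x y; apply: (@connect_full_inj _ _ (gsum_in A i)).
- exact: gsum_in_inj.
- exact: gsum_in_full.
- exact: cA.
Qed.

Lemma connected_lone (G : graph) (p : vert G) : gconnected G ->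
  (forall d, dsrc d <> p) -> (forall q, q = p) /\ (forall d : dart G, False).
Proof.
move=> [_ cG] np; have one q : q = p.
  have /connectP [[|z s] /= pth ->] := cG p q; first by [].
  by case/andP: pth => /existsP [d /andP[/eqP /np]].
by split=> // d; apply: (np d); exact: one.
Qed.

(** * Half-edges *)

Definition halves (X : gog) v : {set uedge X * bool} := [set h | uend X h.1 h.2 == v].

Definition half_of (X : gog) (h : bool * edge (ES X)) : uedge X * bool := (tag h.2, h.1).

Lemma half_of_inj X (e : edge (VS X)) h h' :
  h \in covers e -> h' \in covers e -> half_of h = half_of h' -> h = h'.
Proof.
case: h h' => [b a] [b' a']; rewrite !inE /= => /eqP ae /eqP ae' [aa bb]; subst b'.
congr (_, _).
pose x : item (ES X) := inr (a, gflip (att X b) a).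
pose x' : item (ES X) := inr (a', gflip (att X b) a').
suff : x = x' by case.
by apply: (@att_inj _ b) => //=; rewrite /gdart /= -!/(gedge (att X b) _) ae ae' !addbb.
Qed.

Lemma half_of_end X (e : edge (VS X)) h : h \in covers e -> half_of h \in halves (tag e).
Proof.
case: h => b a; rewrite !inE /= => /eqP <- /=.
exact: eqxx.
Qed.

Lemma valence_covers X (e : edge (VS X)) : #|covers e| <= valence (tag e).
Proof.
rewrite -(card_in_imset (f := @half_of X)); last by move=> h h' i1 i2; exact: half_of_inj i1 i2.
by apply: subset_leq_card; apply/subsetP => h /imsetP [k ke ->]; exact: half_of_end.
Qed.

(** * Absorbing an edge into the far end of its vertex *)

(** As the inclusion at the end b2 is onto, all of the vertex space can be moved across the
    edge. *)
Lemma slide_exists X (e2 : uedge X) (b2 : bool) : giso (emb X e2 b2) ->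
  exists sl : gmap (VS X) (VS X),
    (forall x, over x <> uend X e2 b2 -> sl x = x) /\
    (forall y : item (espace X e2),
       sl (att X b2 (gsum_in _ e2 y)) = att X (~~ b2) (gsum_in _ e2 y)).
Proof.
move=> /giso_inverse [si [siK _]].
have hg u : exists g : gmap (vspace X u) (VS X),
    (u <> uend X e2 b2 -> forall x, g x = gsum_in _ u x) /\
    (forall y x, att X b2 (gsum_in _ e2 y) = gsum_in _ u x ->
       g x = att X (~~ b2) (gsum_in _ e2 y)).
  have [->|/eqP ne] := eqVneq u (uend X e2 b2); last first.
    exists (gsum_in _ u); split=> // y x; rewrite att_gsum_in => /(congr1 (@over _ _)).
    by rewrite !over_gsum_in => uu; case: ne.
  exists (gcomp (gcomp (att X (~~ b2)) (gsum_in _ e2)) si); split=> // y x.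
  by rewrite [in X in X -> _]att_gsum_in => /gsum_in_inj <-; rewrite !gcompE siK.
pose g u := projT1 (cid (hg u)).
have gP u := projT2 (cid (hg u)).
exists (gsum_case g); split=> [x|y].
  have [u [x' ->]] := gsum_inP x; rewrite over_gsum_in gsum_caseE => ne.
  exact: (gP u).1.
have [u [x xE]] := gsum_inP (att X b2 (gsum_in _ e2 y)).
by rewrite xE gsum_caseE; exact: (gP u).2.
Qed.

(** The cells kN form a product N x I whose end c meets the rest of the complex only where
    cells of fE are attached; collapsing the product moves these to the other end. *)
Section FlatAbsorb.
Variables (R : realType) (F G : flat) (jV : gmap (fV G) (fV F)) (jE : gmap (fE G) (fE F)).
Variables (N : graph) (kN : gmap N (fE F)) (c : bool).
Hypotheses (jVi : injective jV) (jEi : injective jE).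
Hypotheses (kNi : injective kN) (aNi : injective (gcomp (fa F c) kN)).
Hypothesis jV_image : forall x, (exists y, jV y = x) <-> ~ exists n, fa F c (kN n) = x.
Hypothesis jE_image : forall x, (exists y, jE y = x) <-> ~ exists n, kN n = x.
Hypothesis far_image : forall n, exists y, jV y = fa F (~~ c) (kN n).
Hypothesis attE : forall b y, jV (fa G b y) = fa F b (jE y) \/
  exists n, fa F b (jE y) = fa F c (kN n) /\ jV (fa G b y) = fa F (~~ c) (kN n).

Theorem flat_absorb : fheq R G F.
Proof.
pose nV b : gmap N (fV F) := gcomp (fa F b) kN.
pose TV := gcase jV (nV c).
pose TE := gcase jE kN.
have nVE b x : nV b x = fa F b (kN x) by rewrite gcompE.
have neV x y : jV x <> nV c y.
  rewrite nVE => E; have /jV_image : exists x, jV x = fa F c (kN y) by exists x.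
  by apply; exists y.
have neE x y : jE x <> kN y.
  by move=> E; have /jE_image : exists x, jE x = kN y by [exists x]; apply; exists y.
have TVi : injective TV.
  move=> x y; have [[x' ->]|[x' ->]] := gplusP x; have [[y' ->]|[y' ->]] := gplusP y;
    rewrite !(gcaseEl, gcaseEr).
  - by move=> /jVi ->.
  - by move=> /neV.
  - by move=> /esym /neV.
  - by move=> /aNi ->.
have TVs z : exists x, TV x = z.
  have [[n nz]|/jV_image [y yz]] := pselect (exists n, fa F c (kN n) = z).
    by exists (ginr _ _ n); rewrite gcaseEr nVE.
  by exists (ginl _ _ y); rewrite gcaseEl.
have TEi : injective TE.
  move=> x y; have [[x' ->]|[x' ->]] := gplusP x; have [[y' ->]|[y' ->]] := gplusP y;
    rewrite !(gcaseEl, gcaseEr).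
  - by move=> /jEi ->.
  - by move=> /neE.
  - by move=> /esym /neE.
  - by move=> /kNi ->.
have TEs z : exists x, TE x = z.
  have [[n nz]|/jE_image [y yz]] := pselect (exists n, kN n = z).
    by exists (ginr _ _ n); rewrite gcaseEr.
  by exists (ginl _ _ y); rewrite gcaseEl.
have [h hE] : exists h : gmap N (fV G), forall x, jV (h x) = nV (~~ c) x.
  by apply: glift => // x; rewrite nVE.
have /choice [a aE] : forall b, exists a : gmap (fE G) (gplus (fV G) N),
    forall y, TV (a y) = fa F b (jE y).
  move=> b; have [a aE] := glift (g := gcomp (fa F b) jE) TVi (fun x => TVs _).
  by exists a => y; rewrite aE gcompE.
have I1 : flat_iso (product_flat c h a) F.
  exists TV, TE; split; [exact: giso_bij | exact: giso_bij |] => b x.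
  have [[y ->]|[y ->]] := gplusP x; rewrite /fa /= -/(fa _ _).
    by rewrite !gcaseEl aE.
  rewrite !gcaseEr; case: eqP => [->|/eqP bc].
    by rewrite gcaseEr nVE.
  have -> : b = ~~ c by case: (b) (c) bc => -[].
  by rewrite gcompE gcaseEl hE nVE.
have I2 : flat_iso (collapsed_flat h a) G.
  exists (gid _), (gid _); split; [exact: giso_id | exact: giso_id |] => b y.
  rewrite !gidE gcompE; apply: jVi; have := aE b y.
  have [[z ->]|[n ->]] := gplusP (a b y); rewrite !(gcaseEl, gcaseEr).
    rewrite gidE => zE; have [->|[n [E _]]] := attE b y; first by [].
    by case: (@neV z n); rewrite nVE zE.
  move=> nE; have [E|[n' [E ->]]] := attE b y; first by case: (@neV (fa G b y) n); rewrite E -nE.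
  by rewrite hE nVE; congr (fa F _ (kN _)); apply: aNi; rewrite !gcompE -E -nVE.
apply: heq_trans (flat_iso_heq R I1).
apply: heq_sym; apply: heq_trans (flat_iso_heq R I2).
exact: product_collapse_heq.
Qed.
End FlatAbsorb.

Lemma kept_connected (J K : finType) (A : J -> graph) (B : K -> graph)
    (f : gmap (gsum B) (gsum A)) (v : J) (g : K -> J) :
  injective f -> (forall x, (exists y, f y = x) <-> over x <> v) ->
  injective g -> (forall k, g k <> v) -> (forall x, over (f x) = g (over x)) ->
  (forall j, gconnected (A j)) -> forall k, gconnected (B k).
Proof.
move=> fi fim gi gv og /fiber_connectedP [nA cA]; apply/fiber_connectedP; split=> [k|p q pq].
  have [p pk] := nA (g k); have [|y yE] := (fim (inl p)).2; first by rewrite /= pk.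
  have [q qp] := gitem_inl yE; exists q; apply: gi; rewrite -pk -qp.
  exact: esym (og (inl q)).
apply: (connect_full_inj fi).
  move=> d [p' pd]; have [|y yE] := (fim (inr d)).2.
    rewrite over_dsrc -pd; have := og (inl p') => /= ->; exact: gv.
  by case: y yE => [//|a] [ad]; exists a.
apply: cA; have := og (inl p); have := og (inl q).
by move=> /= -> ->; rewrite pq.
Qed.

Section Absorb.
Variables (X : gog) (e2 : uedge X) (b2 : bool).
Notation v := (uend X e2 b2).
Notation far := (uend X e2 (~~ b2)).
Hypothesis iso2 : giso (emb X e2 b2).
Hypothesis far_v : far != v.
Variable sl : gmap (VS X) (VS X).
Hypothesis sl_off : forall x, over x <> v -> sl x = x.
Hypothesis sl_on : forall y : item (espace X e2),
  sl (att X b2 (gsum_in _ e2 y)) = att X (~~ b2) (gsum_in _ e2 y).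

Lemma over_v x : over x = v -> exists y, x = att X b2 (gsum_in _ e2 y).
Proof.
have [u [x' ->]] := gsum_inP x; rewrite over_gsum_in => uv; subst u.
by have [y <-] := giso_surj iso2 x'; exists y; rewrite att_gsum_in.
Qed.

Definition absorb_end (e : uedge X) (b : bool) : uvert X :=
  if uend X e b == v then far else uend X e b.

Lemma absorb_endP e b : e != e2 -> absorb_end e b != v.
Proof. by move=> _; rewrite /absorb_end; case: ifPn. Qed.

Lemma over_slide x : over (sl x) = if over x == v then far else over x.
Proof.
case: eqP => [/over_v [y ->]|ne]; last by rewrite sl_off.
by rewrite sl_on over_att over_gsum_in.
Qed.

Lemma absorb_rE b q : tag q != e2 ->
  tag (gvert sl (gvert (att X b) q)) = absorb_end (tag q) b.
Proof.
move=> _; have := over_slide (att X b (inl q)); rewrite over_att.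
exact: id.
Qed.

Lemma absorb_r_inj b (x y : item (ES X)) : over x != e2 -> over x = over y ->
  sl (att X b x) = sl (att X b y) -> x = y.
Proof.
move=> _ xy; have oxy : over (att X b x) = over (att X b y) by rewrite !over_att xy.
have [/over_v [x' xE]|ne] := pselect (over (att X b x) = v); last first.
  by rewrite !sl_off -?oxy //; exact: att_inj.
have [y' yE] : exists y', att X b y = att X b2 (gsum_in _ e2 y').
  by apply: over_v; rewrite -oxy xE over_att over_gsum_in.
rewrite xE yE !sl_on => /att_inj; rewrite !over_gsum_in => /(_ erefl) E.
by apply: (@att_inj _ b) => //; rewrite xE yE E.
Qed.

Definition absorb_gog : gog :=
  @sub_gog X (fun u => u != v) (fun e => e != e2) predT predT absorb_end sl
    absorb_endP absorb_rE (fun _ _ _ _ => isT) absorb_r_inj.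

Definition absorb_map : cellmap absorb_gog X :=
  @sub_cellmap X (fun u => u != v) (fun e => e != e2) predT predT absorb_end sl
    absorb_endP absorb_rE (fun _ _ _ _ => isT) absorb_r_inj.

Notation i := absorb_map.
Notation Y := absorb_gog.

Lemma absorb_att b x : cm_V i (att Y b x) = sl (att X b (cm_E i x)).
Proof. exact: sub_cellmap_att. Qed.

Lemma absorb_uend e b : cm_uv i (uend Y e b) = absorb_end (cm_ue i e) b.
Proof. by []. Qed.

Lemma absorb_V_inj : injective (cm_V i).
Proof. exact: sub_V_inj. Qed.
Lemma absorb_E_inj : injective (cm_E i).
Proof. exact: sub_E_inj. Qed.

Lemma absorb_V_image x : (exists y, cm_V i y = x) <-> over x <> v.
Proof.
have := (@sub_V_image X (fun u => u != v) (fun e => e != e2) predT predT absorb_end sl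
    absorb_endP absorb_rE (fun _ _ _ _ => isT) absorb_r_inj x).
have -> : (if x is inr d then predT d.1 else true) = true by case: (x).
by rewrite andbT => -> ; split=> [/eqP|/eqP].
Qed.

Lemma absorb_E_image x : (exists y, cm_E i y = x) <-> over x <> e2.
Proof.
have := (@sub_E_image X (fun u => u != v) (fun e => e != e2) predT predT absorb_end sl
    absorb_endP absorb_rE (fun _ _ _ _ => isT) absorb_r_inj x).
have -> : (if x is inr d then predT d.1 else true) = true by case: (x).
by rewrite andbT => -> ; split=> [/eqP|/eqP].
Qed.

Lemma absorb_onto : onto_all_but (fun c => over_vert v c \/ over_edge e2 c) i.
Proof.
apply: onto_all_but_ext (sub_cellmap_onto _ _ _ _) => c.
have kE (G : graph) (x : item G) : (if x is inr d then predT d.1 else true) = true.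
  by case: x.
case: c => [u|w|x|x]; rewrite /keptP ?kE ?andbT /=; split.
- by move=> /negP; rewrite negbK => /eqP ->; left.
- by move=> [->|//]; rewrite eqxx.
- by move=> /negP; rewrite negbK => /eqP ->; right.
- by move=> [//|->]; rewrite eqxx.
- by move=> /negP; rewrite negbK => /eqP ->; left.
- by move=> [->|//]; rewrite eqxx.
- by move=> /negP; rewrite negbK => /eqP ->; right.
- by move=> [//|->]; rewrite eqxx.
Qed.

Lemma absorb_cm_ue_inj : injective (cm_ue i). Proof. exact: val_inj. Qed.
Lemma absorb_cm_uv_inj : injective (cm_uv i). Proof. exact: val_inj. Qed.

Lemma absorb_circles : same_circles Y X.
Proof. exact: sub_same_circles. Qed.

Lemma absorb_drop_leaf : valence v = 1 -> drop_leaf X Y.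
Proof.
move=> v1; have only e b : uend X e b = v -> (e, b) = (e2, b2).
  move=> eb; have c1 : #|halves v| <= 1 by rewrite -/(valence v) v1.
  by apply: (card_le1_eqP c1); rewrite inE /= ?eb.
exists v, e2, b2; split=> //; first exact: absorb_circles.
exists i; split; first exact: absorb_onto.
  move=> e b; rewrite absorb_uend /absorb_end; case: eqP => // /only [ee _].
  by have := valP e; rewrite [X in X != _]ee eqxx.
move=> b x; rewrite absorb_att sl_off // over_att => /only [ee _].
by have /absorb_E_image := ex_intro (fun y => cm_E i y = cm_E i x) x erefl.
Qed.

Lemma absorb_merge e1 b1 : valence v = 2 -> e1 != e2 -> uend X e1 b1 = v ->
  giso (emb X e1 b1) -> merge_edges X Y.
Proof.
move=> v2 e12 e1v iso1.
have only e b : uend X e b = v -> e != e2 -> (e, b) = (e1, b1).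
  move=> eb ne.
  have /eqP E : [set (e1, b1); (e2, b2)] == halves v.
    rewrite eqEcard cards2 xpair_eqE (negbTE e12) [#|halves v|]v2 /= andbT; apply/subsetP => h; rewrite !inE => /orP[] /eqP -> /=; apply/eqP => //.
  have : (e, b) \in halves v by rewrite inE /= eb.
  by rewrite -E !inE => /orP[] /eqP // [ee _]; rewrite ee eqxx in ne.
have ne2 x : over (cm_E i x) != e2.
  by apply/eqP; apply/absorb_E_image; exists x.
exists v, e1, e2, b1, b2; split=> //; first exact: absorb_circles.
exists i; split; first exact: absorb_onto.
- move=> e b; rewrite absorb_uend /absorb_end; case: (eqVneq (_, b) (e1, b1)) => [[ee bb]|ne].
    have -> : uend X (cm_ue i e) b = v by rewrite bb [cm_ue i e]ee.
    by rewrite eqxx.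
  by case: eqP => // /only /(_ (valP e)) /eqP; rewrite (negbTE ne).
- move=> b x; case: (eqVneq (_, b) (e1, b1)) => [[ex ->]|ne].
    have [|y yE] := @over_v (att X b1 (cm_E i x)); first by rewrite over_att ex.
    exists (gsum_in _ e2 y); rewrite over_gsum_in yE; split=> //.
    by rewrite absorb_att yE sl_on.
  rewrite absorb_att sl_off // over_att => /only /(_ (ne2 x)) /eqP.
  by rewrite (negbTE ne).
Qed.

Lemma absorb_V_kept x : over (cm_V i x) <> v.
Proof. by apply/absorb_V_image; exists x. Qed.

Lemma absorb_flat (R : realType) : fheq R (flat_of Y) (flat_of X).
Proof.
pose kN := gcomp (ginl (ES X) (CS X)) (gsum_in (espace X) e2).
have kNE n : kN n = ginl _ _ (gsum_in (espace X) e2 n) by rewrite gcompE.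
clearbody kN.
have aNE b n : fa (flat_of X) b (kN n) = ginl (VS X) (CS X) (att X b (gsum_in (espace X) e2 n)).
  by rewrite kNE; exact: gplus_mapEl.
have oatt b n : over (att X b (gsum_in (espace X) e2 n)) = uend X e2 b.
  by rewrite over_att over_gsum_in.
have lr (H K : graph) (x : item H) (y : item K) : ginr H K y <> ginl H K x by move=> /esym /ginlr.
apply: (@flat_absorb R (flat_of X) (flat_of Y) (gplus_map (cm_V i) (gid _))
  (gplus_map (cm_E i) (gid _)) _ kN b2).
- by apply: gplus_map_inj; [exact: absorb_V_inj | exact: gid_inj].
- by apply: gplus_map_inj; [exact: absorb_E_inj | exact: gid_inj].
- by move=> x y; rewrite !kNE => /ginl_inj /gsum_in_inj.
- move=> x y; rewrite !gcompE !aNE => /ginl_inj /att_inj; rewrite !over_gsum_in.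
  by move=> /(_ erefl) /gsum_in_inj.
- move=> x; have [[x' ->]|[x' ->]] := gplusP x.
    rewrite gplus_map_imagel absorb_V_image; split=> [ne [n]|nn].
      by rewrite aNE => /ginl_inj xE; apply: ne; rewrite -xE oatt.
    by move=> /over_v [y yE]; apply: nn; exists y; rewrite aNE yE.
  split=> [_ [n]|_]; last exact: gplus_gid_imager.
  by rewrite aNE => /ginlr.
- move=> x; have [[x' ->]|[x' ->]] := gplusP x.
    rewrite gplus_map_imagel absorb_E_image; split=> [ne [n]|nn].
      by rewrite kNE => /ginl_inj xE; apply: ne; rewrite -xE over_gsum_in.
    have [e [y yE]] := gsum_inP x'; rewrite yE over_gsum_in => ee; subst e.
    by apply: nn; exists y; rewrite kNE yE.
  split=> [_ [n]|_]; last exact: gplus_gid_imager.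
  by rewrite kNE => /ginlr.
- move=> n; rewrite aNE gplus_map_imagel absorb_V_image oatt; exact/eqP.
- move=> b y; have [[z ->]|[z ->]] := gplusP y; last first.
    by left; rewrite /fa /= !gplus_mapEr; case: b; rewrite !gidE.
  rewrite /fa /= !gplus_mapEl absorb_att.
  have [/over_v [n nE]|ne] := pselect (over (att X b (cm_E i z)) = v).
    by right; exists n; rewrite -![gplus_map (att X _) _ _]/(fa (flat_of X) _ _) !aNE nE sl_on.
  by left; rewrite sl_off.
Qed.

Lemma absorb_connected : connected_spaces X -> connected_spaces Y.
Proof.
move=> [cV cE cC]; split=> //.
- apply: (kept_connected absorb_V_inj absorb_V_image absorb_cm_uv_inj _ (cm_overV i) cV) => u.
  by apply/eqP; exact: (valP u).
- apply: (kept_connected absorb_E_inj absorb_E_image absorb_cm_ue_inj _ (cm_overE i) cE) => u.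
  by apply/eqP; exact: (valP u).
Qed.
End Absorb.

(** * Vertices of valence at most two *)

Section LowValence.
Variable X : gog.
Hypothesis cX : connected_spaces X.
Hypothesis dX : doubly_covered X.

Lemma valence1_edgeless v : valence v = 1 -> edge (vspace X v) -> False.
Proof.
move=> v1 e; have := valence_covers (Tagged (fun v => edge (vspace X v)) e).
by rewrite /= v1 leqNgt dX.
Qed.

Lemma edgeless_point v : (edge (vspace X v) -> False) ->
  forall p q : vert (vspace X v), p = q.
Proof.
move=> ne p q; have [cV _ _] := cX.
by have [one _] := @connected_lone _ q (cV v) (fun d _ => ne d.1); exact: one.
Qed.

(** An edge of the vertex space would have to be covered twice by the same half-edge; so
    there is none, and the vertex space is a point. *)
Lemma valence1_iso v e b : valence v = 1 -> uend X e b = v -> giso (emb X e b).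
Proof.
move=> v1 ev; subst v; have ne := valence1_edgeless v1; have pt := edgeless_point ne.
have [_ cE _] := cX; have [[x _] _] := cE e.
split; apply: inj_surj_bij.
- exact: emb_vert_inj.
- by move=> p; exists x; exact: pt.
- exact: emb_edge_inj.
- by move=> f; case: (ne f).
Qed.

(** Every edge of the vertex space is covered at least twice, hence by both half-edges; in
    the absence of edges the space is a point. *)
Lemma valence2_iso v e b : valence v = 2 -> uend X e b = v -> giso (emb X e b).
Proof.
move=> v2 ev; subst v.
have onE f : exists a, gedge (emb X e b) a = f.
  pose f' : edge (VS X) := Tagged (fun v => edge (vspace X v)) f.
  have cE : @half_of X @: covers f' = halves (uend X e b).
    apply/eqP; rewrite eqEcard; apply/andP; split.
      by apply/subsetP => h /imsetP [k ke ->]; exact: (half_of_end ke).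
    rewrite card_in_imset; last by move=> h h' i1 i2; exact: half_of_inj i1 i2.
    by rewrite [#|halves _|]v2 dX.
  have : (e, b) \in halves (uend X e b) by rewrite inE /=.
  rewrite -cE => /imsetP [[b' [e' a]]]; rewrite inE /= => /eqP fE [? ?]; subst e' b'.
  by exists a; move/eqP: fE; rewrite /f' eq_Tagged => /eqP.
split; apply: inj_surj_bij => //.
- exact: emb_vert_inj.
- move=> p; have [[[f s] fp]|np] := pselect (exists d, dsrc d = p).
    have [a af] := onE f; exists (ends a (s (+) gflip (emb X e b) a)).
    by rewrite -gmap_ends -addbA addbb addbF af.
  have [cV cE _] := cX; have [[x _] _] := cE e; exists x.
  have [one _] := @connected_lone _ p (cV _) (fun d dp => np (ex_intro _ d dp)).
  exact: one.
- exact: emb_edge_inj.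
Qed.
End LowValence.

Section AbsorbFacts.
Variables (X : gog) (e2 : uedge X) (b2 : bool).
Notation v := (uend X e2 b2).
Notation far := (uend X e2 (~~ b2)).
Hypothesis iso2 : giso (emb X e2 b2).
Hypothesis far_v : far != v.
Variable sl : gmap (VS X) (VS X).
Hypothesis sl_off : forall x, over x <> v -> sl x = x.
Hypothesis sl_on : forall y : item (espace X e2),
  sl (att X b2 (gsum_in _ e2 y)) = att X (~~ b2) (gsum_in _ e2 y).
Hypothesis dX : doubly_covered X.
Notation Y := (absorb_gog iso2 far_v sl_off sl_on).
Notation i := (absorb_map iso2 far_v sl_off sl_on).

(** A square over the absorbed edge is replaced by another one at the same edge of the
    absorbed vertex space. *)
Lemma absorb_covered (e : edge (VS Y)) h : h \in covers (gedge (cm_V i) e) ->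
  exists h', [/\ h' \in covers e,
    tag h.2 <> e2 -> h'.1 = h.1 /\ gedge (cm_E i) h'.2 = h.2 &
    tag h.2 = e2 -> uend X (tag (gedge (cm_E i) h'.2)) h'.1 = v].
Proof.
case: h => b a hc; have {hc} ae : gedge (att X b) a = gedge (cm_V i) e.
  by move: hc; rewrite inE => /eqP.
have eY : over (cm_V i (inr (e, false))) <> v by exact: absorb_V_kept.
have lift b' a' : tag a' <> e2 -> gedge sl (gedge (att X b') a') = gedge (cm_V i) e ->
    exists a'', gedge (cm_E i) a'' = a' /\ (b', a'') \in covers e.
  move=> ne E; have [y /gitem_inr [a'' a''E]] := (absorb_E_image iso2 far_v sl_off sl_on (inr (a', false))).2 ne.
  exists a''; split=> //; rewrite inE; apply/eqP.
  apply: (item_inj_edge (absorb_V_inj (iso2 := iso2) (far_v := far_v) (sl_off := sl_off) (sl_on := sl_on))).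
  have sq x : cm_V i (att Y b' x) = gcomp sl (att X b') (cm_E i x).
    by rewrite gcompE; exact: absorb_att.
  by rewrite -E -a''E; exact: (square_edge sq a'').
have [/eqP ae2|ne] := boolP (tag a == e2); last first.
  have [||a'' [a''E c]] := lift b a; first by apply/eqP.
    rewrite -ae; have := sl_off (x := inr (gedge (cm_V i) e, false)) eY.
    by rewrite ae => /= -[].
  by exists (b, a''); split=> // e2a; rewrite e2a eqxx in ne.
have bE : b = ~~ b2.
  case: (b =P ~~ b2) => // nb; have bb : b = b2 by case: (b) (b2) nb => -[].
  case: eY; rewrite /= -[tag _]/(tag (gedge (cm_V i) e)) -ae bb /=.
  by rewrite ae2.
subst b; case: a ae ae2 => e' a ae /= ee; subst e'.
pose f := gedge (att X b2) (Tagged (fun e => edge (espace X e)) a).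
have fc : (b2, Tagged (fun e => edge (espace X e)) a) \in covers f by rewrite inE.
have [[b' a'] c' ne'] : exists2 h', h' \in covers f & h' != (b2, Tagged (fun e => edge (espace X e)) a).
  have /card_gt1P [h1 [h2 [c1 c2 n12]]] := dX f.
  have [e1|] := eqVneq h1 (b2, Tagged (fun e => edge (espace X e)) a); last by exists h1.
  by exists h2 => //; rewrite -e1 eq_sym.
have vf : uend X (tag a') b' = v.
  by have := half_of_end c'; rewrite inE => /eqP.
have ne2 : tag a' <> e2.
  move=> a'e; have bb : b' = b2.
    case: (b' =P b2) => // nb; move: vf; rewrite a'e.
    have -> : b' = ~~ b2 by case: (b') (b2) nb => -[].
    by move=> E; move: far_v; rewrite E eqxx.
  by case/eqP: ne'; apply: (half_of_inj c' fc); rewrite /half_of /= a'e bb.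
have [|a'' [a''E c]] := lift b' a' ne2.
  have af : gedge (att X b') a' = f by move: c'; rewrite inE => /eqP.
  rewrite af -ae; have := sl_on (inr (a, false)).
  exact: (fun E => congr1 (fun x => if x is inr d then d.1 else f) E).
exists (b', a''); split=> //.
exact: (fun _ => etrans (congr1 (fun t => uend X (tag t) b') a''E) vf).
Qed.

Lemma absorb_doubly_covered : doubly_covered Y.
Proof.
move=> e; have /card_gt1P [h1 [h2 [c1 c2 n12]]] := dX (gedge (cm_V i) e).
have [k1 [k1c k1n k1e]] := absorb_covered c1.
have [k2 [k2c k2n k2e]] := absorb_covered c2.
apply/card_gt1P; exists k1, k2; split=> //; apply/eqP => k12.
have eY : tag (gedge (cm_V i) e) <> v by have := absorb_V_kept (x := inr (e, false)).
have at_u h : h \in covers (gedge (cm_V i) e) -> uend X (tag h.2) h.1 <> v.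
  by move=> /half_of_end; rewrite inE => /eqP /= ->.
have [t1|t1] := pselect (tag h1.2 = e2); have [t2|t2] := pselect (tag h2.2 = e2).
- case/eqP: n12; apply: (half_of_inj c1 c2); rewrite /half_of t1 t2; congr (_, _).
  have := at_u _ c1; have := at_u _ c2; rewrite t1 t2.
  by case: (h1.1) (h2.1) (b2) => [] [] [].
- have [b1 a1] := k2n t2; case: (at_u _ c2).
  by rewrite -b1 -a1 -k12; exact: k1e.
- have [b1 a1] := k1n t1; case: (at_u _ c1).
  by rewrite -b1 -a1 k12; exact: k2e.
- have [b1 a1] := k1n t1; have [b3 a3] := k2n t2; case/eqP: n12.
  by rewrite [h1]surjective_pairing [h2]surjective_pairing -b1 -a1 -b3 -a3 k12.
Qed.

Lemma absorb_valence : valence v = 2 -> forall u, valence u = valence (cm_uv i u).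
Proof.
move=> v2 u.
have /card_gt1P [h1 [h2 [c1 c2 n12]]] : 1 < #|halves v| by rewrite [#|_|]v2.
have e2v : (e2, b2) \in halves v by rewrite inE /=.
have [[e1 b1] c1' n1] : exists2 h, h \in halves v & h != (e2, b2).
  have [E|] := eqVneq h1 (e2, b2); last by exists h1.
  by exists h2 => //; rewrite -E eq_sym.
have only h : h \in halves v -> h = (e1, b1) \/ h = (e2, b2).
  have /eqP E : [set (e1, b1); (e2, b2)] == halves v.
    rewrite eqEcard cards2 n1 [#|halves v|]v2 /= andbT; apply/subsetP => k.
    by rewrite !inE => /orP[] /eqP -> /=; move: c1'; rewrite inE.
  by rewrite -E !inE => /orP[] /eqP; [left | right].
have e12 : e1 <> e2.
  move=> E; move: c1' n1 far_v; rewrite inE /= E xpair_eqE eqxx /=.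
  by case: (b1); case: (b2) => //= /eqP ->; rewrite eqxx.
have uv : cm_uv i u <> v by apply/eqP; exact: (valP u).
pose phi (h : uedge Y * bool) : uedge X * bool :=
  if (cm_ue i h.1, h.2) == (e1, b1) then (e2, ~~ b2) else (cm_ue i h.1, h.2).
have ne2 w : cm_ue i w <> e2 by apply/eqP; exact: (valP w).
have phi_inj : injective phi.
  move=> [w b] [w' b']; rewrite /phi; case: ifP => [/eqP E|nE]; case: ifP => [/eqP E'|nE'] /=.
  - by move=> _; move: E; rewrite -E' /= => -[/val_inj -> ->].
  - by move=> [/esym /ne2].
  - by move=> [/ne2].
  - by move=> [/val_inj -> ->].
have -> : valence (cm_uv i u) = #|phi @: halves u|; last by rewrite card_imset.
apply: eq_card => h; apply/idP/imsetP => [|[[w b]]]; rewrite !inE.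
- move=> /eqP hu; have [E|ne] := eqVneq h (e2, ~~ b2).
    have ne1 : e1 != e2 by apply/eqP.
    exists (exist _ e1 ne1 : uedge Y, b1); last by rewrite /phi /= eqxx.
    rewrite inE; apply/eqP; apply: val_inj; rewrite -[val _]/(cm_uv i _) absorb_uend /absorb_end /=.
    by move: c1'; rewrite inE /= => ->; rewrite -[val u]/(cm_uv i u) -hu E.
  have he : h.1 != e2.
    apply/eqP => E; have nb : h.2 <> ~~ b2.
      by move=> b2E; case/eqP: ne; rewrite [h]surjective_pairing E b2E.
    have bb : h.2 = b2 by move: nb; case: (h.2); case: (b2).
    by apply: uv; rewrite -hu E bb.
  have hv : uend X h.1 h.2 != v by rewrite hu; apply/eqP.
  exists (exist _ h.1 he : uedge Y, h.2); last first.
    rewrite /phi /=; case: eqP => [E|_]; last exact: surjective_pairing.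
    have [h1E h2E] : h.1 = e1 /\ h.2 = b1 by case: E.
    by move: hv; rewrite h1E h2E; move: c1'; rewrite inE /= => ->.
  rewrite inE; apply/eqP; apply: val_inj; rewrite -[val _]/(cm_uv i _) absorb_uend /absorb_end /=.
  by rewrite (negbTE hv) hu.
- move=> /eqP wu ->.
  have wu2 : (if uend X (cm_ue i w) b == v then far else uend X (cm_ue i w) b) = cm_uv i u.
    by rewrite -wu.
  have e1v : uend X e1 b1 == v by move: c1'; rewrite inE.
  rewrite /phi /=; case: ifPn => [/eqP E|nE].
    have [h1E h2E] : cm_ue i w = e1 /\ b = b1 by case: E.
    by move: wu2; rewrite h1E h2E e1v => E2; apply/eqP; exact: E2.
  move: wu2; case: ifPn => [wv|_ E2]; last by apply/eqP; exact: E2.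
  have wE : (cm_ue i w, b) \in halves v by rewrite inE.
  have [E|E] := only _ wE; first by move: nE; rewrite -[sval w]/(cm_ue i w) E eqxx.
  by case: (ne2 w); case: E.
Qed.
End AbsorbFacts.

(** * Dropping leaves *)

Lemma only_half X v h h' : valence v <= 1 -> h \in halves v -> h' \in @halves X v -> h = h'.
Proof. by move=> v1 i1 i2; exact: (card_le1_eqP v1). Qed.

Lemma leaf_not_incident X (p : vert (VS X)) : doubly_covered X ->
  valence (tag p) <= 1 -> ~ incident p.
Proof.
move=> dX v1 [d dp]; have := valence_covers d.1.
have -> : tag d.1 = tag p by rewrite -dp -over_dsrc.
by move=> le; have := leq_trans (dX d.1) (leq_trans le v1).
Qed.

Lemma leaf_point X (p q : vert (VS X)) : connected_spaces X -> doubly_covered X ->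
  valence (tag p) <= 1 -> tag p = tag q -> p = q.
Proof.
move=> [/fiber_connectedP [_ cV] _ _] dX v1 /esym /cV /connectP [[|z s] /=]; first by [].
move=> /andP[/existsP [d /andP[/eqP dq /eqP dz]] zs] pl.
have pq : connect (@adj (VS X)) q p.
  by apply/connectP; exists (z :: s) => //=; rewrite zs andbT; apply/existsP; exists d; rewrite dq dz !eqxx.
case: (@leaf_not_incident X q dX); last by exists d.
by rewrite (connect_over pq).
Qed.

Section DropRich.
Variables (X : gog) (e2 : uedge X) (b2 : bool).
Notation v := (uend X e2 b2).
Notation far := (uend X e2 (~~ b2)).
Hypotheses (cX : connected_spaces X) (dX : doubly_covered X) (v1 : valence v = 1).
Variables (Y : gog) (i : cellmap Y X).
Hypotheses (iV_inj : injective (cm_V i)) (iE_inj : injective (cm_E i)).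
Hypothesis iV_image : forall x, (exists y, cm_V i y = x) <-> over x <> v.
Hypothesis iE_image : forall x, (exists y, cm_E i y = x) <-> over x <> e2.
Hypothesis i_att : forall b x, over (att X b (cm_E i x)) <> v ->
  cm_V i (att Y b x) = att X b (cm_E i x).

(** The horizontal graph loses a vertex of valence one that lies on no edge, through which
    no walk passes. *)
Lemma drop_rich_hor : rich (@incident (VS X) : vert (Hor X) -> Prop) ->
  rich (@incident (VS Y) : vert (Hor Y) -> Prop).
Proof.
move=> [D [fD sD]].
have only e b : uend X e b = v -> (e, b) = (e2, b2).
  by move=> ev; apply: (@only_half X v); rewrite ?v1 // inE /= ?ev.
have e2E (q q' : vert (ES X)) : tag q = e2 -> tag q' = e2 -> q = q'.
  move=> qe q'e; suff : @inl _ (dart (ES X)) q = inl q' by case.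
  apply: (@att_inj X b2); first by rewrite /= qe q'e.
  apply: (congr1 inl); apply: (leaf_point cX dX) => /=; last by rewrite qe q'e.
  by rewrite qe v1.
have noback q : tag q = e2 -> ~ D (q, ~~ b2).
  move=> qe /fD; rewrite /dtgt /drev /= negbK => -[|[[q' b'] [D' s n]]].
    by apply: leaf_not_incident; rewrite // /dsrc /= qe v1.
  have : uend X (tag q') b' = v by apply: (etrans (congr1 (@tag _ _) s)); rewrite /= qe.
  by move=> /only [q'e bb]; apply: n; rewrite bb (e2E q' q).
have kept p : tag (gvert (cm_V i) p) <> v.
  by have /iV_image := ex_intro (fun y => cm_V i y = cm_V i (inl p)) (inl p) erefl.
have bneg b : b <> b2 -> b = ~~ b2 by case: (b); case: (b2).
apply: (@rich_pull (Hor X) (Hor Y) (@incident (VS X)) (@incident (VS Y))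
  (gvert (cm_V i)) (gvert (cm_E i)) (fun d => D d /\ tag d.1 <> e2)).
- exact: (item_inj_vert iV_inj).
- move=> q b; suff E : cm_V i (att Y b (inl q)) = att X b (cm_E i (inl q)) by case: E.
  apply: i_att; rewrite over_att => /only [qe _].
  by have /iE_image := ex_intro (fun y => cm_E i y = cm_E i (inl q)) (inl q) erefl.
- move=> [q b] [Dd qe]; have [k|[[q' b'] [D' s n]]] := fD _ Dd; first by left.
  right; exists (q', b'); split=> //; split=> // q'e.
  have [bb|/bneg bb] := pselect (b' = b2); last by apply: (noback q' q'e); rewrite -bb.
  case: qe; have [] // : (tag q, ~~ b) = (e2, b2).
  by apply: only; apply: (etrans (congr1 (@tag _ _) (esym s))); rewrite /= q'e bb.
- move=> [q b] [_ ne].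
  by have [y /gitem_inl] := (iE_image (inl q)).2 ne.
- move=> p [d dp].
  have [|y /gitem_inr_src [d' [_ d'E]]] := (iV_image (inr d)).2.
    by rewrite over_dsrc dp; by apply: kept.
  exists d'; apply: (item_inj_vert iV_inj).
  by rewrite d'E.
- move=> p; have [k|[[q b] [Dd s]]] := sD (gvert (cm_V i) p); first by left.
  right; exists (q, b); split=> //; split=> // qe.
  have [bb|/bneg bb] := pselect (b = b2); last by apply: (noback q qe); rewrite -bb.
  apply: (kept p).
  by apply: (etrans (congr1 (@tag _ _) (esym s))); rewrite /= qe bb.
Qed.
End DropRich.

Definition tame X := [/\ connected_spaces X, doubly_covered X & forall v : uvert X, 1 < valence v].

(** A vertex of valence at most one is a point on no edge; by richness it has an edge, so it
    can be dropped. *)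
Lemma drop_leaves (R : realType) X : connected_spaces X -> doubly_covered X ->
  rich (@incident (VS X) : vert (Hor X) -> Prop) ->
  exists Y, [/\ converts_to X Y, fheq R (flat_of Y) (flat_of X) & tame Y].
Proof.
have [n] := ubnP #|uvert X|; elim: n X => // n IH X /ltnSE Xn cX dX rX.
have [big|/existsNP [v /negP]] := pselect (forall v : uvert X, 1 < valence v).
  exists X; split=> //; first exact: rt_refl.
  by apply: flat_iso_heq; exists (gid _), (gid _); split; [exact: giso_id | exact: giso_id | move=> b x; rewrite !gidE].
rewrite -leqNgt => v1.
have [e [b ev]] : exists e b, uend X e b = v.
  have [cV _ _] := cX; have [[p _] _] := cV v.
  have [D [_ /(_ (Tagged (fun v => vert (vspace X v)) p))]] := rX.
  case=> [|[[q b] [_ /(congr1 (@tag _ _)) /= qv]]]; first by move/leaf_not_incident; case.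
  by exists (tag q), b.
have {}v1 : valence v = 1.
  apply/eqP; rewrite eqn_leq v1 card_gt0; apply/set0Pn; exists (e, b).
  by rewrite inE /= ev.
subst v.
have iso2 := valence1_iso cX dX v1 erefl.
have far_v : uend X e (~~ b) != uend X e b.
  apply/eqP => E; have : (e, ~~ b) = (e, b).
    by apply: (@only_half X (uend X e b)); rewrite ?v1 // inE /= ?E.
  by case: (b).
have [sl [sl_off sl_on]] := slide_exists iso2.
pose Y := absorb_gog iso2 far_v sl_off sl_on.
have [||||Z [YZ hZ tZ]] := IH Y.
- apply: leq_trans Xn; apply: (@card_inj_missing _ _ (cm_uv (absorb_map iso2 far_v sl_off sl_on)) (uend X e b)).
    exact: absorb_cm_uv_inj.
  by move=> u; apply/eqP; exact: (valP u).
- exact: absorb_connected.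
- exact: absorb_doubly_covered.
- apply: (drop_rich_hor cX dX v1 (i := absorb_map iso2 far_v sl_off sl_on)) => //.
  + exact: absorb_V_inj.
  + exact: absorb_V_image.
  + exact: absorb_E_image.
  + by move=> b' x ne; rewrite absorb_att sl_off.
exists Z; split=> //.
- apply: rt_trans YZ; apply: rt_step; right; left; apply: Or33.
  exact: absorb_drop_leaf.
- exact: heq_trans hZ (absorb_flat _ _ _ _ _).
Qed.

(** * Removing vertices of valence two *)

Definition big_vertices (X : gog) : {set uvert X} := [set v | 2 < valence v].

(** Equality of the Euler characteristics of the horizontal graphs; circle edges contribute
    nothing to them. *)
Definition same_euler (Y X : gog) :=
  #|vert (ES X)| + #|vert (VS Y)| = #|vert (ES Y)| + #|vert (VS X)|.

Lemma same_euler_trans X Y Z : same_euler Z Y -> same_euler Y X -> same_euler Z X.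
Proof. rewrite /same_euler; lia. Qed.

Lemma card_image_compl (S T : finType) (f : S -> T) (A : pred T) :
  injective f -> (forall y, (exists x, f x = y) <-> ~~ A y) -> #|T| = #|S| + #|A|.
Proof.
move=> fi fA; rewrite -(cardC A) addnC -(card_codom fi); congr (_ + _).
apply: eq_card => y; rewrite !inE; apply/idP/codomP => [/fA [x <-]|[x ->]]; first by exists x.
by apply/fA; exists x.
Qed.

Definition recirc (Z : gog) (C : finType) (cs : C -> graph)
    (m : forall c, embedding (cs c) (cs c)) : gog :=
  @Gog (uvert Z) (uedge Z) C (@uend Z) (vspace Z) (espace Z) cs (@emb Z) m.

Lemma deletes_recirc Z X D C cs m : deletes Z X D -> deletes (@recirc Z C cs m) X D.
Proof.
move=> [i [[ii io] iu ia]].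
pose r (c : cell (@recirc Z C cs m)) : cell Z := match c with
  | UV v => @UV Z v | UE e => @UE Z e | VI x => @VI Z x | EI x => @EI Z x end.
pose r' (c : cell Z) : cell (@recirc Z C cs m) := match c with
  | UV v => @UV (@recirc Z C cs m) v | UE e => @UE (@recirc Z C cs m) e
  | VI x => @VI (@recirc Z C cs m) x | EI x => @EI (@recirc Z C cs m) x end.
have rr' : cancel r' r by case.
have r'r : cancel r r' by case.
exists (@Cellmap (@recirc Z C cs m) X (cm_uv i) (cm_ue i) (cm_V i) (cm_E i) (cm_overV i) (cm_overE i)).
have onr c : on_cell (@Cellmap (@recirc Z C cs m) X (cm_uv i) (cm_ue i) (cm_V i) (cm_E i) (cm_overV i) (cm_overE i)) c = on_cell i (r c) by case: c.
split=> //; split.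
  by move=> c c'; rewrite !onr => /ii /(can_inj r'r).
move=> c; rewrite -io; split=> [[c' <-]|[c' <-]]; first by exists (r c').
by exists (r' c'); rewrite onr rr'.
Qed.

Section VertexRemoved.
Variables (X Y : gog) (i : cellmap Y X) (v : uvert X) (e : uedge X).
Hypotheses (iu_inj : injective (cm_uv i)) (iV_inj : injective (cm_V i)) (iE_inj : injective (cm_E i)).
Hypothesis iu_image : forall u, (exists u', cm_uv i u' = u) <-> u <> v.
Hypothesis iV_image : forall x, (exists y, cm_V i y = x) <-> over x <> v.
Hypothesis iE_image : forall x, (exists y, cm_E i y = x) <-> over x <> e.

Lemma removed_euler b : uend X e b = v -> giso (emb X e b) -> same_euler Y X.
Proof.
move=> ev /giso_surj se; subst v.
have cV : #|vert (VS X)| = #|vert (VS Y)| + #|[pred p : vert (VS X) | tag p == uend X e b]|.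
  apply: (card_image_compl (f := gvert (cm_V i))); first exact: item_inj_vert.
  move=> p; rewrite /=; split=> [[q qp]|/eqP ne].
    by apply/eqP; apply: (iV_image (inl p)).1; exists (inl q); rewrite /= qp.
  by have [y /gitem_inl] := (iV_image (inl p)).2 ne.
have cE : #|vert (ES X)| = #|vert (ES Y)| + #|[pred p : vert (ES X) | tag p == e]|.
  apply: (card_image_compl (f := gvert (cm_E i))); first exact: item_inj_vert.
  move=> p; rewrite /=; split=> [[q qp]|/eqP ne].
    by apply/eqP; apply: (iE_image (inl p)).1; exists (inl q); rewrite /= qp.
  by have [y /gitem_inl] := (iE_image (inl p)).2 ne.
suff E : #|[pred p : vert (VS X) | tag p == uend X e b]| = #|[pred p : vert (ES X) | tag p == e]|.
  by rewrite /same_euler cV cE E; lia.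
rewrite -(card_in_image (f := gvert (att X b)) (A := [pred p : vert (ES X) | tag p == e])).
  apply: eq_card => p; rewrite !inE; apply/eqP/imageP => [pe|[q]]; last first.
    by rewrite inE => /eqP qe ->; rewrite /= qe.
  case: p pe => u p /= pu; subst u; have [y /gitem_inl [q qp]] := se (inl p).
  by exists (Tagged (fun e => vert (espace X e)) q); rewrite ?inE //= qp.
move=> p q; rewrite !inE => /eqP pe /eqP qe pq.
suff : @inl _ (dart (ES X)) p = inl q by case.
by apply: (@att_inj X b); rewrite /= ?pe ?qe //; congr inl.
Qed.

Lemma removed_big : valence v = 2 -> (forall u, valence u = valence (cm_uv i u)) ->
  #|big_vertices Y| = #|big_vertices X|.
Proof.
move=> v2 vE; rewrite -(card_imset (mem (big_vertices Y)) iu_inj); apply: eq_card => u.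
apply/imsetP/idP => [[u']|]; rewrite !inE; first by rewrite vE => ? ->.
move=> u3; have [|u' u'u] := (iu_image u).2; first by move=> uv; rewrite uv v2 in u3.
by exists u'; rewrite ?inE ?vE ?u'u.
Qed.

Lemma removed_card : #|uvert Y| < #|uvert X|.
Proof.
apply: (card_inj_missing (f := cm_uv i) (y := v)) => // u; apply/iu_image; by exists u.
Qed.
End VertexRemoved.

Definition simplifies (R : realType) (X Y : gog) :=
  [/\ converts_to X Y, fheq R (flat_of Y) (flat_of X), tame Y,
      #|big_vertices Y| = #|big_vertices X| & same_euler Y X].

Lemma merge_step (R : realType) X e1 b1 e2 b2 : tame X ->
  valence (uend X e2 b2) = 2 -> e1 != e2 -> uend X e1 b1 = uend X e2 b2 ->
  exists Y, simplifies R X Y /\ #|uvert Y| < #|uvert X|.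
Proof.
move=> [cX dX bX] v2 e12 e1v.
have iso2 := valence2_iso cX dX v2 erefl.
have iso1 := valence2_iso cX dX v2 e1v.
have far_v : uend X e2 (~~ b2) != uend X e2 b2.
  apply/eqP => E; have : #|[set (e1, b1); (e2, b2); (e2, ~~ b2)]| <= #|halves (uend X e2 b2)|.
    apply: subset_leq_card; apply/subsetP => h; rewrite !inE => /orP[/orP[]|] /eqP -> /=; exact/eqP.
  rewrite [#|halves _|]v2 setUC cardsU1 cards2 !inE !xpair_eqE (negbTE e12) eq_sym (negbTE e12) eqxx /=.
  by case: (b2).
have [sl [sl_off sl_on]] := slide_exists iso2.
pose Y := absorb_gog iso2 far_v sl_off sl_on; pose i := absorb_map iso2 far_v sl_off sl_on.
have vE := absorb_valence (iso2 := iso2) (far_v := far_v) (sl_off := sl_off) (sl_on := sl_on) v2.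
have ui u : (exists u', cm_uv i u' = u) <-> u <> uend X e2 b2.
  split=> [[u' <-]|/eqP ne]; first by apply/eqP; exact: (valP u').
  by exists (exist _ u ne : uvert Y).
exists Y; split; last exact: (removed_card (absorb_cm_uv_inj (iso2 := iso2) (far_v := far_v) (sl_off := sl_off) (sl_on := sl_on)) ui).
split.
- apply: rt_step; right; left; apply: Or31; exact: absorb_merge v2 e12 e1v iso1.
- exact: absorb_flat.
- split; [exact: absorb_connected | exact: absorb_doubly_covered |].
  by move=> u; rewrite vE.
- apply: (removed_big _ ui v2 vE); exact: absorb_cm_uv_inj.
- apply: (@removed_euler X Y i (uend X e2 b2) e2 _ _ ui _ _ b2 erefl iso2).
  + exact: absorb_V_inj.
  + exact: absorb_E_inj.
  + exact: absorb_V_image.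
  + exact: absorb_E_image.
Qed.

Section Loop.
Variables (X : gog) (e : uedge X).
Notation v := (uend X e false).
Hypothesis loop_e : uend X e true = v.
Hypothesis tX : tame X.
Hypothesis v2 : valence v = 2.

Lemma loop_half h : h \in halves v -> h.1 = e.
Proof.
have /eqP E : [set (e, false); (e, true)] == halves v.
  rewrite eqEcard cards2 xpair_eqE eqxx [#|halves v|]v2 /= andbT.
  by apply/subsetP => k; rewrite !inE => /orP[] /eqP -> /=; rewrite ?loop_e.
by rewrite -E !inE => /orP[] /eqP ->.
Qed.

Lemma loop_iso b : giso (emb X e b).
Proof.
by have [cX dX _] := tX; apply: (valence2_iso cX dX v2); case: b.
Qed.

Lemma loop_kept w b : w != e -> uend X w b != v.
Proof.
by move=> we; apply/eqP => wv; move/eqP: we; apply; apply: (@loop_half (w, b)); rewrite inE /= wv.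
Qed.

Lemma loop_r_inj b (x y : item (ES X)) : over x != e -> over x = over y ->
  gid _ (att X b x) = gid _ (att X b y) -> x = y.
Proof. by move=> _ xy; rewrite !gidE; exact: att_inj. Qed.

Definition loop_sub : gog :=
  @sub_gog X (fun u => u != v) (fun w => w != e) predT predT (uend X) (gid _)
    loop_kept (fun _ _ _ => erefl) (fun _ _ _ _ => isT) loop_r_inj.

Definition loop_map : cellmap loop_sub X :=
  @sub_cellmap X (fun u => u != v) (fun w => w != e) predT predT (uend X) (gid _)
    loop_kept (fun _ _ _ => erefl) (fun _ _ _ _ => isT) loop_r_inj.

Lemma loop_V_image x : (exists y, cm_V loop_map y = x) <-> over x <> v.
Proof.
have := (@sub_V_image X (fun u => u != v) (fun w => w != e) predT predT (uend X) (gid _)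
    loop_kept (fun _ _ _ => erefl) (fun _ _ _ _ => isT) loop_r_inj x).
have -> : (if x is inr d then predT d.1 else true) = true by case: (x).
by rewrite andbT => -> ; split=> [/eqP|/eqP].
Qed.

Lemma loop_E_image x : (exists y, cm_E loop_map y = x) <-> over x <> e.
Proof.
have := (@sub_E_image X (fun u => u != v) (fun w => w != e) predT predT (uend X) (gid _)
    loop_kept (fun _ _ _ => erefl) (fun _ _ _ _ => isT) loop_r_inj x).
have -> : (if x is inr d then predT d.1 else true) = true by case: (x).
by rewrite andbT => -> ; split=> [/eqP|/eqP].
Qed.

Lemma loop_V_inj : injective (cm_V loop_map). Proof. exact: sub_V_inj. Qed.
Lemma loop_E_inj : injective (cm_E loop_map). Proof. exact: sub_E_inj. Qed.

Lemma loop_att b x : cm_V loop_map (att loop_sub b x) = att X b (cm_E loop_map x).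
Proof. by rewrite [LHS]sub_cellmap_att gidE. Qed.

Lemma loop_deletes : deletes loop_sub X (fun c => over_vert v c \/ over_edge e c).
Proof.
exists loop_map; split; [|by []|exact: loop_att].
apply: onto_all_but_ext (sub_cellmap_onto _ _ _ _) => c.
have kE (G : graph) (x : item G) : (if x is inr d then predT d.1 else true) = true.
  by case: x.
case: c => [u|w|x|x]; rewrite /keptP ?kE ?andbT /=; split.
- by move=> /negP; rewrite negbK => /eqP ->; left.
- by move=> [->|//]; rewrite eqxx.
- by move=> /negP; rewrite negbK => /eqP ->; right.
- by move=> [//|->]; rewrite eqxx.
- by move=> /negP; rewrite negbK => /eqP ->; left.
- by move=> [->|//]; rewrite eqxx.
- by move=> /negP; rewrite negbK => /eqP ->; right.
- by move=> [//|->]; rewrite eqxx.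
Qed.

(** Both ends of the loop are isomorphisms onto the same vertex space, so that going once
    around the loop is an automorphism. *)
Lemma loop_monodromy : exists m : gmap (espace X e) (espace X e), injective m /\
  forall x, att X true (gsum_in _ e (m x)) = att X false (gsum_in _ e x).
Proof.
have inj b : injective (gcomp (att X b) (gsum_in _ e)).
  move=> x y; rewrite !gcompE => /att_inj; rewrite !over_gsum_in => /(_ erefl).
  exact: gsum_in_inj.
have [m mE] : exists m : gmap (espace X e) (espace X e), forall x,
    gcomp (att X true) (gsum_in _ e) (m x) = gcomp (att X false) (gsum_in _ e) x.
  apply: glift => // x; rewrite gcompE att_gsum_in.
  have : over (gsum_in (vspace X) v (emb X e false x)) = uend X e true by rewrite over_gsum_in.
  have [u [z ->]] := gsum_inP (gsum_in (vspace X) v (emb X e false x)).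
  rewrite over_gsum_in => uE; subst u.
  have [y <-] := giso_surj (loop_iso true) z.
  by exists y; rewrite gcompE att_gsum_in.
exists m; split=> [x y xy|x]; last by have := mE x; rewrite !gcompE.
by apply: (inj false); rewrite -!mE xy.
Qed.

Variable m : gmap (espace X e) (espace X e).
Hypothesis m_inj : injective m.
Hypothesis mE : forall x, att X true (gsum_in _ e (m x)) = att X false (gsum_in _ e x).

Definition loop_cspace (c : option (ucirc X)) : graph :=
  if c is Some c' then cspace X c' else espace X e.

Definition loop_mono (c : option (ucirc X)) : embedding (loop_cspace c) (loop_cspace c) :=
  match c with
  | Some c' => mono X c'
  | None => Embedding (item_inj_vert m_inj) (item_inj_edge m_inj)
  end.

Definition loop_gog : gog := recirc loop_sub loop_mono.
Notation Y := loop_gog.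

Lemma loop_move : loop_to_circle X Y.
Proof.
exists v, e; split=> //; [exact: loop_iso | exact: loop_iso | exact: deletes_recirc loop_deletes |].
exists Some, None.
exists (gsum_case (fun c => gsum_in loop_cspace (Some c)) : gmap (CS X) (CS Y)), (gid _).
have jCE c x : gsum_case (fun c => gsum_in loop_cspace (Some c)) (gsum_in _ c x) =
    gsum_in loop_cspace (Some c) x by rewrite gsum_caseE.
split.
- split=> [c c' []//|[c|]]; first by split=> // _; exists c.
  by split=> // -[].
- split=> [x y|y].
    have [c [x' ->]] := gsum_inP x; have [c' [y' ->]] := gsum_inP y; rewrite !jCE => E.
    have [cc] : Some c = Some c' by rewrite -(@over_gsum_in _ loop_cspace (Some c) x') E over_gsum_in.
    by subst c'; move: E => /(@gsum_in_inj _ loop_cspace) ->.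
  have [[c|] [y' ->]] := gsum_inP y; rewrite over_gsum_in; split=> //.
    by move=> _; exists (gsum_in _ c y'); rewrite jCE.
  move=> [x]; have [c [x' ->]] := gsum_inP x; rewrite jCE => E.
  by have := @over_gsum_in _ loop_cspace (Some c) x'; rewrite E over_gsum_in.
- split=> x; have [c [x' ->]] := gsum_inP x; rewrite jCE.
    rewrite [in RHS]over_gsum_in; exact: (@over_gsum_in _ loop_cspace (Some c) x').
  by rewrite monodromy_gsum_in jCE; exact: (@monodromy_gsum_in Y (Some c) x').
- exact: giso_id.
- move=> x y; rewrite -mE => /att_inj; rewrite !over_gsum_in => /(_ erefl) /gsum_in_inj ->.
  by rewrite !gidE.
Qed.

Section LoopFlat.
Variables (VY EY : graph) (aY : bool -> gmap EY VY).
Variables (kV : gmap VY (VS X)) (kE : gmap EY (ES X)).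
Variable mm : gmap (gsum loop_cspace) (gsum loop_cspace).
Hypotheses (kV_inj : injective kV) (kE_inj : injective kE).
Hypothesis kV_image : forall x, (exists y, kV y = x) <-> over x <> v.
Hypothesis kE_image : forall x, (exists y, kE y = x) <-> over x <> e.
Hypothesis k_att : forall b x, kV (aY b x) = att X b (kE x).
Hypothesis mmE : forall c x, mm (gsum_in loop_cspace c x) = gsum_in loop_cspace c (loop_mono c x).

(** Cutting the new circle edge where the removed vertex was gives back the complex of X. *)
Lemma loop_flat_iso :
  flat_iso (@Flat (gplus VY (gsum loop_cspace)) (gplus EY (gsum loop_cspace))
    (fun b => gplus_map (aY b) (if b then gid _ else mm))) (flat_of X).
Proof.
pose CSY := gsum loop_cspace.
pose gV : gmap (gplus VY CSY) (gplus (VS X) (CS X)) :=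
  gcase (gcomp (ginl (VS X) (CS X)) (kV))
   (gsum_case (fun c : option (ucirc X) => match c return gmap (loop_cspace c) (gplus _ _) with
      | Some c' => gcomp (ginr (VS X) (CS X)) (gsum_in (cspace X) c')
      | None => gcomp (ginl (VS X) (CS X)) (gcomp (att X true) (gsum_in (espace X) e)) end)).
pose gE : gmap (gplus EY CSY) (gplus (ES X) (CS X)) :=
  gcase (gcomp (ginl (ES X) (CS X)) (kE))
   (gsum_case (fun c : option (ucirc X) => match c return gmap (loop_cspace c) (gplus _ _) with
      | Some c' => gcomp (ginr (ES X) (CS X)) (gsum_in (cspace X) c')
      | None => gcomp (ginl (ES X) (CS X)) (gsum_in (espace X) e) end)).
have V1 x : gV (ginl _ _ x) = ginl (VS X) (CS X) (kV x) by rewrite gcaseEl gcompE.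
have V2 c x : gV (ginr _ _ (gsum_in loop_cspace (Some c) x)) = ginr (VS X) (CS X) (gsum_in _ c x).
  by rewrite gcaseEr gsum_caseE gcompE.
have V3 x : gV (ginr _ _ (gsum_in loop_cspace None x)) =
    ginl (VS X) (CS X) (att X true (gsum_in _ e x)) by rewrite gcaseEr gsum_caseE !gcompE.
have E1 x : gE (ginl _ _ x) = ginl (ES X) (CS X) (kE x) by rewrite gcaseEl gcompE.
have E2 c x : gE (ginr _ _ (gsum_in loop_cspace (Some c) x)) = ginr (ES X) (CS X) (gsum_in _ c x).
  by rewrite gcaseEr gsum_caseE gcompE.
have E3 x : gE (ginr _ _ (gsum_in loop_cspace None x)) =
    ginl (ES X) (CS X) (gsum_in _ e x) by rewrite gcaseEr gsum_caseE gcompE.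
have cases (G : graph) (z : item (gplus G (CSY))) : [\/ exists x, z = ginl _ _ x,
    exists c x, z = ginr _ _ (gsum_in loop_cspace (Some c) x) |
    exists x, z = ginr _ _ (gsum_in loop_cspace None x)].
  have [[x ->]|[x ->]] := gplusP z; first by apply: Or31; exists x.
  have [[c|] [y ->]] := gsum_inP x; first by apply: Or32; exists c, y.
  by apply: Or33; exists y.
have keptV x : over (kV x) <> v by apply/kV_image; exists x.
have keptE x : over (kE x) <> e by apply/kE_image; exists x.
have oT x : over (att X true (gsum_in _ e x)) = v by rewrite over_att over_gsum_in loop_e.
have lr (G H : graph) (x : item G) (y : item H) : ginr G H y <> ginl G H x by move=> /esym /ginlr.
exists gV, gE; split.
- apply: giso_bij => [x y|z].
    have [[x' ->]|[c [x' ->]]|[x' ->]] := cases _ x; have [[y' ->]|[c' [y' ->]]|[y' ->]] := cases _ y;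
      rewrite ?V1 ?V2 ?V3; try by [move/lr | move/ginlr].
    + by move/ginl_inj/kV_inj => ->.
    + by move/ginl_inj => E; case: (keptV x'); rewrite E.
    + move=> /ginr_inj E; have cc : c = c' by rewrite -(over_gsum_in (A := cspace X) x') E over_gsum_in.
      by subst c'; move: E => /gsum_in_inj ->.
    + by move/ginl_inj => E; case: (keptV y'); rewrite -E.
    + by move/ginl_inj/att_inj; rewrite !over_gsum_in => /(_ erefl) /gsum_in_inj ->.
  have [[x ->]|[x ->]] := gplusP z.
    have [xv|/kV_image [y <-]] := pselect (over x = v); last by exists (ginl _ _ y).
    have [u [x' xE]] := gsum_inP x; have uE : u = uend X e true by rewrite loop_e -xv xE over_gsum_in.
    subst u; have [y yx] := giso_surj (loop_iso true) x'.
    by exists (ginr _ _ (gsum_in loop_cspace None y)); rewrite V3 att_gsum_in yx xE.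
  by have [c [x' ->]] := gsum_inP x; exists (ginr _ _ (gsum_in loop_cspace (Some c) x')).
- apply: giso_bij => [x y|z].
    have [[x' ->]|[c [x' ->]]|[x' ->]] := cases _ x; have [[y' ->]|[c' [y' ->]]|[y' ->]] := cases _ y;
      rewrite ?E1 ?E2 ?E3; try by [move/lr | move/ginlr].
    + by move/ginl_inj/kE_inj => ->.
    + by move/ginl_inj => E; case: (keptE x'); rewrite E over_gsum_in.
    + move=> /ginr_inj E; have cc : c = c' by rewrite -(over_gsum_in (A := cspace X) x') E over_gsum_in.
      by subst c'; move: E => /gsum_in_inj ->.
    + by move/ginl_inj => E; case: (keptE y'); rewrite -E over_gsum_in.
    + by move/ginl_inj/gsum_in_inj ->.
  have [[x ->]|[x ->]] := gplusP z.
    have [xv|/kE_image [y <-]] := pselect (over x = e); last by exists (ginl _ _ y).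
    have [u [x' xE]] := gsum_inP x; have uE : u = e by rewrite -xv xE over_gsum_in.
    by subst u; exists (ginr _ _ (gsum_in loop_cspace None x')); rewrite E3 xE.
  by have [c [x' ->]] := gsum_inP x; exists (ginr _ _ (gsum_in loop_cspace (Some c) x')).
- move=> b z; have [[x ->]|[c [x ->]]|[x ->]] := cases _ z; rewrite ?E1 ?E2 ?E3 /fa /=.
  + by rewrite !gplus_mapEl V1; congr (ginl (VS X) (CS X) _); exact: k_att.
  + rewrite !gplus_mapEr; case: b; rewrite ?gidE ?V2 //.
    by rewrite (@mmE (Some c) x) monodromy_gsum_in V2.
  + rewrite gplus_mapEr gplus_mapEl; case: b; rewrite ?gidE ?V3 //.
    by rewrite (@mmE None x) V3 mE.
Qed.
End LoopFlat.

Lemma loop_flat (R : realType) : fheq R (flat_of Y) (flat_of X).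
Proof.
apply: flat_iso_heq.
apply: (@loop_flat_iso _ _ (att loop_sub) (cm_V loop_map) (cm_E loop_map) (monodromy Y)).
- exact: loop_V_inj.
- exact: loop_E_inj.
- exact: loop_V_image.
- exact: loop_E_image.
- exact: loop_att.
- exact: (@monodromy_gsum_in Y).
Qed.

Lemma loop_sub_valence u : valence u = valence (cm_uv loop_map u).
Proof.
pose phi (h : uedge loop_sub * bool) : uedge X * bool := (cm_ue loop_map h.1, h.2).
have phi_inj : injective phi by move=> [w b] [w' b'] [/val_inj -> ->].
have uv : cm_uv loop_map u <> v by apply/eqP; exact: (valP u).
rewrite -[LHS](card_imset (mem (halves u)) phi_inj); apply: eq_card => h.
apply/imsetP/idP => [[[w b]]|]; rewrite !inE.
  by move=> /eqP wu ->; apply/eqP; exact: (congr1 (cm_uv loop_map) wu).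
move=> /eqP hu; have he : h.1 != e.
  apply/eqP => E; apply: uv; rewrite -hu E; case: (h.2) => //.
exists (exist _ h.1 he : uedge loop_sub, h.2); last exact: surjective_pairing.
by rewrite inE; apply/eqP; apply: val_inj.
Qed.

Lemma loop_sub_covered : doubly_covered loop_sub.
Proof.
move=> f; have [_ dX _] := tX.
have fv : tag (gedge (cm_V loop_map) f) <> v.
  by have /loop_V_image := ex_intro (fun y => cm_V loop_map y = cm_V loop_map (inr (f, false))) _ erefl.
have lift h : h \in covers (gedge (cm_V loop_map) f) -> exists2 k, k \in covers f &
    (k.1, gedge (cm_E loop_map) k.2) = h.
  case: h => b a hc; have ne : tag a <> e.
    have := half_of_end hc; rewrite inE /= => /eqP ab ae; apply: fv; rewrite -ab ae.
    by case: (b).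
  have [y /gitem_inr [a' a'E]] := (loop_E_image (inr (a, false))).2 ne.
  exists (b, a'); last by rewrite -[(b, a').2]/a' a'E.
  rewrite inE; apply/eqP; apply: (item_inj_edge loop_V_inj).
  apply: (etrans (square_edge (loop_att b) a')); rewrite a'E.
  by move: hc; rewrite inE => /eqP.
have /card_gt1P [h1 [h2 [c1 c2 n12]]] := dX (gedge (cm_V loop_map) f).
have [k1 k1c k1E] := lift _ c1; have [k2 k2c k2E] := lift _ c2.
apply/card_gt1P; exists k1, k2; split=> //; apply/eqP => k12.
by move: n12; rewrite -k1E -k2E k12 eqxx.
Qed.

Lemma loop_step_aux (R : realType) : simplifies R X Y /\ #|uvert Y| < #|uvert X|.
Proof.
have [[cV cE cC] dX bX] := tX.
have ui u : (exists u', cm_uv loop_map u' = u) <-> u <> v.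
  split=> [[u' <-]|/eqP ne]; first by apply/eqP; exact: (valP u').
  by exists (exist _ u ne : uvert loop_sub).
have uinj : injective (cm_uv loop_map) by exact: val_inj.
split; last exact: (removed_card uinj ui).
split.
- by apply: rt_step; right; left; apply: Or32; exact: loop_move.
- exact: loop_flat.
- split; first split.
  + apply: (kept_connected loop_V_inj loop_V_image uinj _ (cm_overV loop_map) cV) => u.
    by apply/eqP; exact: (valP u).
  + have einj : injective (cm_ue loop_map) by exact: val_inj.
    apply: (kept_connected loop_E_inj loop_E_image einj _ (cm_overE loop_map) cE) => w.
    by apply/eqP; exact: (valP w).
  + by case=> [c|]; [exact: cC | exact: cE].
  + exact: loop_sub_covered.
  + by move=> u; rewrite [valence u]loop_sub_valence.
- exact: (removed_big uinj ui v2 loop_sub_valence).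
- exact: (@removed_euler X loop_sub loop_map v e loop_V_inj loop_E_inj ui loop_V_image loop_E_image false erefl (loop_iso false)).
Qed.
End Loop.

Lemma loop_step (R : realType) X e : uend X e true = uend X e false -> tame X ->
  valence (uend X e false) = 2 -> exists Y, simplifies R X Y /\ #|uvert Y| < #|uvert X|.
Proof.
move=> loop_e tX v2; have [m [mi mE]] := loop_monodromy loop_e tX v2.
exists (loop_gog loop_e v2 mi); exact: loop_step_aux.
Qed.

Lemma simplifies_trans R X Y Z : simplifies R X Y -> simplifies R Y Z -> simplifies R X Z.
Proof.
move=> [c1 h1 _ b1 e1] [c2 h2 t2 b2 e2]; split=> //.
- exact: rt_trans c1 c2.
- exact: heq_trans h2 h1.
- by rewrite b2.
- exact: same_euler_trans e2 e1.
Qed.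

Lemma simplifies_refl R X : tame X -> simplifies R X X.
Proof.
move=> tX; split=> //; first exact: rt_refl.
by apply: flat_iso_heq; exists (gid _), (gid _); split; [exact: giso_id | exact: giso_id | move=> b x; rewrite !gidE].
Qed.

(** Either two edges are merged or a loop becomes a circle edge; each step removes a vertex. *)
Lemma remove_valence2 (R : realType) X : tame X ->
  exists Y, simplifies R X Y /\ forall v : uvert Y, 2 < valence v.
Proof.
have [n] := ubnP #|uvert X|; elim: n X => // n IH X /ltnSE Xn tX.
have [big|/existsNP [v /negP]] := pselect (forall v : uvert X, 2 < valence v).
  by exists X; split=> //; exact: simplifies_refl.
rewrite -leqNgt => v2; have {}v2 : valence v = 2.
  by apply/eqP; rewrite eqn_leq v2; have [_ _ ->] := tX.
have [Y [sY cY]] : exists Y, simplifies R X Y /\ #|uvert Y| < #|uvert X|.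
  have /card_gt1P [[e1 b1] [[e2 b2] [c1 c2 n12]]] : 1 < #|halves v| by rewrite [#|_|]v2.
  move: c1 c2; rewrite !inE /= => /eqP c1 /eqP c2; subst v.
  have [E|e12] := eqVneq e1 e2; last exact: (merge_step R tX (etrans (congr1 (@valence X) c2) v2) e12 (esym c2)).
  subst e2; have bb : b2 = ~~ b1 by move: n12; rewrite xpair_eqE eqxx; case: (b1); case: (b2).
  subst b2; apply: (@loop_step R X e1) => //; first by case: b1 c2 {v2 n12} => /=.
  by case: b1 c2 v2 {n12} => /= c2 v2 //; rewrite c2.
have [||Z [sZ bZ]] := IH Y; [exact: leq_trans Xn | by case: sY |].
by exists Z; split=> //; exact: simplifies_trans sY sZ.
Qed.

(** * First return maps *)

Definition ivert (G : graph) (x : item G) : vert G :=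
  match x with inl p => p | inr d => dsrc d end.

Lemma ivert_map G H (f : gmap G H) x : ivert (f x) = gvert f (ivert x).
Proof. by case: x => [p|d] //=; rewrite dsrc_gdart. Qed.

Section FirstReturn.
Variables (C : graph) (m : gmap C C).
Hypothesis m_inj : injective m.

Fixpoint iterg (n : nat) : gmap C C := if n is k.+1 then gcomp m (iterg k) else gid C.

Lemma itergE n x : iterg n x = iter n m x.
Proof. by elim: n => [|n IH] /=; rewrite ?gidE // gcompE IH. Qed.

Lemma itergV n p : gvert (iterg n) p = iter n (gvert m) p.
Proof. by elim: n => [|n IH] //=; rewrite IH. Qed.

Lemma ivert_iter n x : ivert (iter n m x) = iter n (gvert m) (ivert x).
Proof. by rewrite -itergE ivert_map itergV. Qed.

Lemma iter_inj n : injective (fun x => iter n m x).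
Proof. by elim: n => [|n IH] x y //= /m_inj /IH. Qed.

(** A union of components that meets every orbit, so that every point returns to it. *)
Record section := Section {
  sec :> pred (vert C);
  sec_closed : forall d : dart C, sec (dsrc d) = sec (dsrc (drev d));
  sec_meets : forall p, exists n, sec (iter n (gvert m) p) }.

Lemma sec_ends (S : section) e b : S (ends e false) -> S (ends e b).
Proof. by case: b => //; rewrite -[ends e false]/(dsrc (e, false)) sec_closed. Qed.

Definition sgraph (S : section) : graph := gsub (@sec_ends S).

Definition sin (S : section) : gmap (sgraph S) C := gsub_in (@sec_ends S).

Lemma sin_inj (S : section) : injective (sin S). Proof. exact: gsub_in_inj. Qed.

Lemma sin_image (S : section) x : (exists y, sin S y = x) <-> S (ivert x).
Proof.
rewrite gsub_inP; case: x => [p|[e []]] //=.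
by rewrite -[ends e false]/(dsrc (e, false)) sec_closed.
Qed.

Lemma sin_sec (S : section) y : S (ivert (sin S y)).
Proof. by apply/sin_image; exists y. Qed.

Lemma return_exists (S : section) p : exists n, S (iter n.+1 (gvert m) p).
Proof.
by have [n Sn] := sec_meets S (gvert m p); exists n; rewrite iterSr.
Qed.

Definition rtime (S : section) p : nat := ex_minn (return_exists S p).

Lemma rtime_min (S : section) p k : k < rtime S p -> ~~ S (iter k.+1 (gvert m) p).
Proof.
rewrite /rtime; case: ex_minnP => n _ min kn; apply/negP => /min.
by rewrite leqNgt kn.
Qed.

Lemma rtime_adj (S : section) (d : dart C) : rtime S (dsrc d) = rtime S (dsrc (drev d)).
Proof.
apply: eq_ex_minn => n.
have := sec_closed S (gdart (iterg n.+1) d); rewrite -gdart_rev !dsrc_gdart !itergV.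
exact: id.
Qed.

(** The return time is constant on components, so this is a graph map. *)
Definition fret (S : section) : gmap C C.
Proof.
refine (@Gmap C C (fun p => gvert (iterg (rtime S p).+1) p)
  (fun e => gedge (iterg (rtime S (ends e false)).+1) e)
  (fun e => gflip (iterg (rtime S (ends e false)).+1) e) _).
move=> e b; rewrite gmap_ends; congr (gvert (iterg _.+1) _).
by case: b => //; exact: (rtime_adj S (e, false)).
Defined.

Lemma fretE S x : fret S x = iter (rtime S (ivert x)).+1 m x.
Proof.
rewrite -itergE; case: x => [p|[e b]] //=.
suff -> : rtime S (dsrc (e, b)) = rtime S (ends e false) by [].
by case: b => //; rewrite -(rtime_adj S (e, false)).
Qed.

Definition first_return (S : section) x y := exists n,
  [/\ y = iter n.+1 m x, S (ivert y) & forall k, k < n -> ~~ S (ivert (iter k.+1 m x))].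

Lemma fret_first (S : section) x : first_return S x (fret S x).
Proof.
exists (rtime S (ivert x)); rewrite fretE /rtime; case: ex_minnP => n Sn min.
split=> //; first by rewrite ivert_iter.
move=> k kn; apply/negP; rewrite ivert_iter => /min; rewrite leqNgt kn.
by [].
Qed.

Lemma first_return_unique (S : section) x y y' :
  first_return S x y -> first_return S x y' -> y = y'.
Proof.
move=> [n [-> Sn mn]] [n' [-> Sn' mn']].
case: (ltngtP n n') => [nn|nn|-> //].
  by have := mn' n nn; rewrite Sn.
by have := mn n' nn; rewrite Sn'.
Qed.

Lemma fret_sec (S : section) x : S (ivert (fret S x)).
Proof. by have [n [_ Sn _]] := fret_first S x. Qed.

(** Of two points with the same first return, the one that takes longer to return would
    pass through the other one before. *)
Lemma fret_inj (S : section) x y : S (ivert x) -> S (ivert y) ->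
  fret S x = fret S y -> x = y.
Proof.
have wlog_lt n n' x' y' : n <= n' -> S (ivert x') -> iter n.+1 m x' = iter n'.+1 m y' ->
    (forall k, k < n' -> ~~ S (ivert (iter k.+1 m y'))) -> x' = y'.
  move=> nn Sx E min; have E2 : x' = iter (n' - n) m y'.
    apply: (@iter_inj n.+1); rewrite E -iterD; congr (iter _ m y'); lia.
  case: (posnP (n' - n)) => [z|pos]; first by rewrite E2 z.
  have := min (n' - n).-1; rewrite prednK // -E2 Sx /=; lia.
move=> Sx Sy; have [n [-> _ mn]] := fret_first S x; have [n' [-> _ mn']] := fret_first S y.
move=> E; case: (leqP n n') => [nn|/ltnW nn]; first exact: wlog_lt nn Sx E mn'.
by symmetry; exact: wlog_lt nn Sy (esym E) mn.
Qed.

Definition Fret_exists (S : section) : exists f : gmap (sgraph S) (sgraph S),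
  forall x, sin S (f x) = fret S (sin S x).
Proof.
have [f fE] := glift (g := gcomp (fret S) (sin S)) (@sin_inj S)
  (fun x => (sin_image _ _).2 (eq_ind_r (fun z => S (ivert z)) (fret_sec S _) (gcompE _ _ x))).
by exists f => x; rewrite fE gcompE.
Qed.

Lemma fret_sub (S S' : section) x : (forall p, S' p -> S p) ->
  S' (ivert (fret S x)) -> fret S' x = fret S x.
Proof.
move=> SS Sf; apply: (first_return_unique (fret_first S' x)).
have [n [E Sn min]] := fret_first S x; exists n; split=> // k kn.
by apply: contraNN (min k kn); exact: SS.
Qed.

Lemma fret_skip (S S' : section) x : (forall p, S' p -> S p) ->
  ~~ S' (ivert (fret S x)) -> fret S' x = fret S' (fret S x).
Proof.
move=> SS nS; apply: (first_return_unique (fret_first S' x)).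
have [n [E Sn min]] := fret_first S x; have [n' [E' Sn' min']] := fret_first S' (fret S x).
exists (n + n'.+1); split=> //; first by rewrite E' E -iterD; congr (iter _ m x); lia.
move=> k kn; case: (ltngtP k n) => kn'.
- by apply: contraNN (min k kn'); exact: SS.
- have := min' (k - n.+1); rewrite E -iterD.
  have -> : (k - n.+1).+1 + n.+1 = k.+1 by lia.
  by apply; lia.
- by rewrite kn' -E.
Qed.

(** If the component of p0 returned to itself, its orbit would never meet S'. *)
Lemma fret_leaves (S S' : section) (p0 : vert C) x : (forall p, S' p -> S p) ->
  (forall p, S p -> ~~ S' p -> connect (@adj C) p p0) -> ~~ S' p0 ->
  S (ivert x) -> ~~ S' (ivert x) -> S' (ivert (fret S x)).
Proof.
move=> SS K nS0 Sx nSx; apply: contraT => nSf.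
have S'adj p q : connect (@adj C) p q -> S' p = S' q.
  case/connectP => s; elim: s p => [|z s IH] p /=; first by move=> _ ->.
  move=> /andP[/existsP [d /andP[/eqP <- /eqP dz]] zs] ql.
  by rewrite (sec_closed S') dz; exact: IH.
have comp q : connect (@adj C) q p0 -> ~~ S' q by move=> /S'adj ->.
have rt q : connect (@adj C) q p0 -> rtime S q = rtime S p0.
  case/connectP => s; elim: s q => [|z s IH] q /=; first by move=> _ ->.
  move=> /andP[/existsP [d /andP[/eqP <- /eqP dz]] zs] ql.
  by rewrite (rtime_adj S) dz; exact: IH.
pose g := iterg (rtime S p0).+1.
have xE : fret S x = g x by rewrite fretE itergE rt //; exact: K.
have gK q : connect (@adj C) q p0 -> connect (@adj C) (gvert g q) p0.
  move=> qp; apply: (connect_trans (y := gvert g (ivert x))).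
    by apply: connect_map; apply: connect_trans qp _; rewrite connect_adj_sym; exact: K.
  by rewrite -ivert_map -xE; apply: K => //; exact: fret_sec.
have stay n : forall q, connect (@adj C) q p0 -> ~~ S' (iter n (gvert m) q).
  elim/ltn_ind: n => n IH q qp; case: (ltnP n (rtime S p0).+1) => nr; last first.
    have -> : iter n (gvert m) q = iter (n - (rtime S p0).+1) (gvert m) (gvert g q).
      by rewrite itergV -iterD subnK.
    by apply: IH; [lia | exact: gK].
  case: n nr {IH} => [|n] nr; first exact: comp.
  by apply: contraNN (@rtime_min S q n _); [exact: SS | rewrite rt].
have [n] := sec_meets S' p0.
by move=> S'n; have := stay n p0 (connect0 _ _); rewrite S'n.
Qed.
End FirstReturn.

Lemma gplus_map_imager G G' H H' (f : gmap G G') (g : gmap H H') x :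
  (exists y, gplus_map f g y = ginr _ _ x) <-> exists y, g y = x.
Proof.
split=> [[y]|[y <-]]; last by exists (ginr _ _ y); rewrite gplus_mapEr.
have [[y' ->]|[y' ->]] := gplusP y; rewrite ?gplus_mapEl ?gplus_mapEr.
  by move=> /ginlr.
by move=> /ginr_inj <-; exists y'.
Qed.

Lemma sec_connect (C : graph) (m : gmap C C) (S : section m) p q :
  connect (@adj C) p q -> S p = S q.
Proof.
case/connectP => s; elim: s p => [|z s IH] p /=; first by move=> _ ->.
move=> /andP[/existsP [d /andP[/eqP <- /eqP dz]] zs] ql.
by rewrite (sec_closed S) dz; exact: IH.
Qed.

Section ReturnFlat.
Variables (R : realType) (V E C : graph) (a : bool -> gmap E V) (m : gmap C C).
Hypothesis m_inj : injective m.

Definition return_map (S : section m) (f : gmap (sgraph S) (sgraph S)) :=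
  forall x, sin S (f x) = fret S (sin S x).

Definition return_flat (S : section m) (f : gmap (sgraph S) (sgraph S)) : flat :=
  @Flat (gplus V (sgraph S)) (gplus E (sgraph S))
    (fun b => gplus_map (a b) (if b then gid _ else f)).

Lemma section_incl (S S' : section m) : (forall p, S' p -> S p) ->
  exists i : gmap (sgraph S') (sgraph S), forall x, sin S (i x) = sin S' x.
Proof.
by move=> SS; apply: glift => [|x]; [exact: sin_inj | apply/sin_image/SS; exact: sin_sec].
Qed.

(** Removing one component from the section makes the arcs that start there and end
    elsewhere a product, which can be absorbed. *)
Lemma return_step (S S' : section m) f f' p0 : (forall p, S' p -> S p) ->
  (forall p, S p -> ~~ S' p -> connect (@adj C) p p0) -> ~~ S' p0 ->
  return_map f -> return_map f' ->
  fheq R (@return_flat S' f') (@return_flat S f).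
Proof.
move=> SS K nS0 fE' fE2.
have [i iE] := section_incl SS.
have i_inj : injective i by move=> x y xy; apply: (@sin_inj _ _ S'); rewrite -!iE xy.
have i_image y : (exists x, i x = y) <-> S' (ivert (sin S y)).
  split=> [[x <-]|/sin_image [x xy]]; first by rewrite iE; exact: sin_sec.
  by exists x; apply: (@sin_inj _ _ S); rewrite iE.
have PQ e b : S (ends e false) && ~~ S' (ends e false) -> S (ends e b) && ~~ S' (ends e b :> vert C).
  case: b => //; rewrite -[ends e false]/(dsrc (e, false)) (sec_closed S) (sec_closed S').
  exact: id.
pose N := @gsub C (fun p => S p && ~~ S' p) (fun e => S (ends e false) && ~~ S' (ends e false)) PQ.
have n_image x : (exists n : item N, gsub_in PQ n = x) <-> S (ivert x) && ~~ S' (ivert x).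
  rewrite gsub_inP; case: x => [p|[e []]] //=.
  rewrite -[ends e false]/(dsrc (e, false)) (sec_closed S) (sec_closed S'); exact: iff_refl.
have [k kE] : exists k : gmap N (sgraph S), forall n, sin S (k n) = gsub_in PQ n.
  apply: glift => [|n]; first exact: sin_inj.
  by apply/sin_image; have /n_image/andP[] := ex_intro (fun z => gsub_in PQ z = gsub_in PQ n) n erefl.
have k_inj : injective k by move=> x y xy; apply: (@gsub_in_inj _ _ _ PQ); rewrite -!kE xy.
have k_image y : (exists n, k n = y) <-> ~~ S' (ivert (sin S y)).
  split=> [[n <-]|nS].
    by rewrite kE; have /n_image/andP[] := ex_intro (fun z => gsub_in PQ z = gsub_in PQ n) n erefl.
  have /n_image [n ny] : S (ivert (sin S y)) && ~~ S' (ivert (sin S y)) by rewrite nS sin_sec.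
  by exists n; apply: (@sin_inj _ _ S); rewrite kE.
have faT x : fa (@return_flat S f) true (ginr _ _ x) = ginr _ _ x by rewrite /fa /= gplus_mapEr gidE.
have faF x : fa (@return_flat S f) false (ginr _ _ x) = ginr _ _ (f x) by rewrite /fa /= gplus_mapEr.
have faT' x : fa (@return_flat S' f') true (ginr _ _ x) = ginr _ _ x by rewrite /fa /= gplus_mapEr gidE.
have faF' x : fa (@return_flat S' f') false (ginr _ _ x) = ginr _ _ (f' x) by rewrite /fa /= gplus_mapEr.
have kN n : gcomp (ginr E (sgraph S)) k n = ginr _ _ (k n) by rewrite gcompE.
have imageP (G : graph) (x : item (gplus G (sgraph S))) :
    (exists y, gplus_map (gid G) i y = x) <-> ~ exists n, ginr _ _ (k n) = x.
  have [[z ->]|[z ->]] := gplusP x.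
    split=> [_ [n /esym/ginlr //]|_].
    by exists (ginl _ _ z); rewrite gplus_mapEl gidE.
  rewrite gplus_map_imager i_image; split=> [Sz [n /ginr_inj nz]|nn].
    by have /negP := (k_image z).1 (ex_intro _ n nz).
  apply: contraT => /k_image [n nz]; case: nn.
  by exists n; rewrite nz.
apply: (@flat_absorb R (@return_flat S f) (@return_flat S' f')
  (gplus_map (gid V) i) (gplus_map (gid E) i) N (gcomp (ginr E (sgraph S)) k) true).
- by apply: gplus_map_inj => //; exact: gid_inj.
- by apply: gplus_map_inj => //; exact: gid_inj.
- by move=> x y; rewrite !kN => /ginr_inj /k_inj.
- by move=> x y; rewrite gcompE [in X in X -> _]gcompE !kN !faT => /ginr_inj /k_inj.
- move=> x; rewrite imageP; split=> ne [n nx]; apply: ne; exists n.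
    by rewrite -nx kN faT.
  by rewrite kN faT nx.
- move=> x; rewrite imageP; split=> ne [n nx]; apply: ne; exists n.
    by rewrite -nx kN.
  by rewrite kN nx.
- move=> n; rewrite kN faF gplus_map_imager i_image fE' kE.
  have /n_image/andP[Sn nSn] := ex_intro (fun z => gsub_in PQ z = gsub_in PQ n) n erefl.
  exact: (fret_leaves SS K nS0 Sn nSn).
- move=> b y; have [[z ->]|[z ->]] := gplusP y.
    by left; rewrite /fa /= !gplus_mapEl !gidE.
  have gE : gplus_map (gid E) i (ginr _ _ z) = ginr _ _ (i z) by rewrite gplus_mapEr.
  rewrite gE; case: b; first by left; rewrite faT' faT gplus_mapEr.
  rewrite faF' faF gplus_mapEr.
  have [nS|/negPn Sf] := boolP (~~ S' (ivert (sin S (f (i z))))).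
    right; have /k_image [n nE] := nS; exists n; rewrite kN faT faF nE; split=> //.
    congr (gitem (ginr _ _) _); apply: (@sin_inj _ _ S); rewrite iE fE2 fE' fE' iE.
    have fS : ~~ S' (ivert (fret S (sin S' z))) by rewrite -iE -fE'.
    rewrite (fret_skip SS fS); apply: fret_sub => //.
    by apply: (fret_leaves SS K) => //; exact: fret_sec.
  left; congr (gitem (ginr _ _) _); apply: (@sin_inj _ _ S); rewrite iE fE2 fE' iE.
  by apply: fret_sub => //; rewrite -iE -fE'.
Qed.

(** The components outside the smaller section are removed one at a time. *)
Lemma return_flat_heq (S S' : section m) f f' : (forall p, S' p -> S p) ->
  return_map f -> return_map f' ->
  fheq R (@return_flat S' f') (@return_flat S f).
Proof.
have [n] := ubnP #|[pred p | S p && ~~ S' p]|; elim: n S f => // n IH S f /ltnSE Sn SS fE' fE2.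
have [[p0 /andP[S0 nS0]]|none] := pselect (exists p, S p && ~~ S' p); last first.
  have [i iE] := section_incl SS.
  have S'S p : S p -> S' p by move=> Sp; apply: contraT => nS; case: none; exists p; rewrite Sp.
  have i_iso : giso i.
    apply: giso_bij => [x y xy|y]; first by apply: (@sin_inj _ _ S'); rewrite -!iE xy.
    have /sin_image [x xy] : S' (ivert (sin S y)) by apply: S'S; exact: sin_sec.
    by exists x; apply: (@sin_inj _ _ S); rewrite iE.
  have giso_plus G : giso (gplus_map (gid G) i).
    apply: giso_bij => [|y]; first by apply: gplus_map_inj; [exact: gid_inj | exact: giso_inj].
    have [[z ->]|[z ->]] := gplusP y; first by exists (ginl _ _ z); rewrite gplus_mapEl gidE.
    by have [x <-] := giso_surj i_iso z; exists (ginr _ _ x); rewrite gplus_mapEr.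
  apply: flat_iso_heq; exists (gplus_map (gid V) i), (gplus_map (gid E) i); split; [exact: giso_plus | exact: giso_plus |].
  move=> b x.
  have [[z ->]|[z ->]] := gplusP x; rewrite /fa /= ?gplus_mapEl ?gidE ?gplus_mapEl //.
  rewrite !gplus_mapEr; case: b; rewrite ?gidE //.
  apply: (congr1 (ginr V (sgraph S))); apply: (@sin_inj _ _ S); rewrite iE fE2 fE' iE.
  by apply: fret_sub => //; apply: S'S; exact: fret_sec.
pose S1p : pred (vert C) := fun p => S p && ~~ connect (@adj C) p p0.
have S'1 p : S' p -> S1p p.
  move=> S'p; rewrite /S1p (SS _ S'p); apply: contraL S'p => /(sec_connect S') ->; exact: nS0.
have S1c (d : dart C) : S1p (dsrc d) = S1p (dsrc (drev d)).
  rewrite /S1p (sec_closed S); congr (_ && ~~ _).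
  have dd : connect (@adj C) (dsrc d) (dsrc (drev d)).
    by apply: connect1; apply/existsP; exists d; rewrite !eqxx.
  by rewrite (same_connect (@connect_adj_sym C) dd).
have S1m p : exists n, S1p (iter n (gvert m) p).
  by have [k Sk] := sec_meets S' p; exists k; exact: S'1.
pose S1 := Section S1c S1m.
have [f1 f1E] := Fret_exists S1.
have h1 : fheq R (@return_flat S1 f1) (@return_flat S f).
  apply: (@return_step S S1 f f1 p0) => //.
  - by move=> p /andP[].
  - by move=> p Sp; rewrite /= /S1p Sp /= negbK.
  - by rewrite /= /S1p connect0 andbF.
apply: heq_trans h1; apply: IH => //.
apply: leq_trans Sn; apply: proper_card; apply/properP; split.
  by apply/subsetP => p; rewrite !inE => /andP[/andP[-> _] ->].
by exists p0; rewrite !inE /= /S1p ?S0 ?connect0 //= andbF.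
Qed.
End ReturnFlat.

(** * Passing to components *)

Section Components.
Variable G : graph.

Lemma connect_dart (d : dart G) : connect (@adj G) (dsrc d) (dsrc (drev d)).
Proof. by apply: connect1; apply/existsP; exists d; rewrite !eqxx. Qed.

Lemma connect_ends (e : edge G) b : connect (@adj G) (ends e b) (ends e false).
Proof. by case: b; [exact: (connect_dart (e, true)) | exact: connect0]. Qed.

Definition comp_of (p : vert G) : {q : vert G | root (@adj G) q == q} :=
  exist _ (root (@adj G) p) (introT eqP (root_root (@connect_adj_sym G) p)).

Lemma comp_ofP p q : reflect (comp_of p = comp_of q) (connect (@adj G) p q).
Proof.
apply: (iffP idP) => [pq|]; first by apply/val_inj/eqP; rewrite root_connect //; exact: connect_adj_sym.
by move=> /(congr1 val) /= /eqP; rewrite root_connect //; exact: connect_adj_sym.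
Qed.

Lemma comp_of_root u : comp_of (val u) = u.
Proof. by apply: val_inj; exact: eqP (valP u). Qed.

Section Closed.
Variables (P : pred (vert G)) (PQ : forall e b, P (ends e false) -> P (ends e b)).
Hypothesis clP : forall p q, connect (@adj G) p q -> P p = P q.

Lemma gsub_full : full_image (gsub_in PQ).
Proof.
move=> d [[p Pp] /= pd]; case: d pd => e b pd.
have Pe : P (ends e false) by rewrite -(clP (connect_ends e b)) -[ends e b]/(dsrc (e, b)) -pd.
by exists (exist _ e Pe, b); rewrite /gdart /= addbF.
Qed.

Lemma gsub_connected p0 : P p0 -> (forall p, P p -> connect (@adj G) p p0) ->
  gconnected (gsub PQ).
Proof.
move=> P0 Pc; split; first by exists (exist _ p0 P0).
move=> [p Pp] [q Pq]; apply: (connect_full_inj (@gsub_in_inj _ _ _ PQ) gsub_full).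
by apply: connect_trans (Pc p Pp) _; rewrite connect_adj_sym; exact: Pc.
Qed.
End Closed.
End Components.

Section Split.
Variable X : gog.
Notation C := (CS X).
Notation m := (monodromy X).

Lemma monodromy_inj : injective m.
Proof.
move=> x y; have [c [x' ->]] := gsum_inP x; have [c' [y' ->]] := gsum_inP y.
rewrite !monodromy_gsum_in => E.
have cc : c = c' by have := congr1 (@over _ _) E; rewrite !over_gsum_in.
subst c'; move/gsum_in_inj: E => E.
congr (gitem (gsum_in _ c) _); apply: gitem_inj E; [exact: emb_vert_inj | exact: emb_edge_inj].
Qed.

Lemma gvert_m_inj : injective (gvert m).
Proof. exact: item_inj_vert monodromy_inj. Qed.

(** The components permuted cyclically by the monodromy make up one class of this relation,
    and give one circle edge. *)
Definition orb : rel (vert C) := relU (@adj C) (frel (gvert m)).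

Lemma orb_sym : connect_sym orb.
Proof.
apply: relU_sym; first exact: connect_adj_sym.
exact: fconnect_sym gvert_m_inj.
Qed.

Lemma orb_adj p q : connect (@adj C) p q -> connect orb p q.
Proof. by apply: connect_sub => {p q} p q pq; apply: connect1; rewrite /orb /= pq. Qed.

Lemma orb_m p : connect orb p (gvert m p).
Proof. by apply: connect1; rewrite /orb /= eqxx orbT. Qed.

Lemma orb_iter n p : connect orb p (iter n (gvert m) p).
Proof. by elim: n => //= n IH; apply: connect_trans IH (orb_m _). Qed.

Lemma root_adj p q : connect (@adj C) p q -> root orb p = root orb q.
Proof. by move=> /orb_adj pq; apply/eqP; rewrite root_connect //; exact: orb_sym. Qed.

Lemma root_iter n p : root orb (iter n (gvert m) p) = root orb p.
Proof.
by apply/esym/eqP; rewrite root_connect; [exact: orb_iter | exact: orb_sym].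
Qed.

(** In every cycle of components, the one that contains the chosen root. *)
Definition rep : pred (vert C) := fun p => connect (@adj C) p (root orb p).

Lemma rep_adj p q : connect (@adj C) p q -> rep p = rep q.
Proof.
by move=> pq; rewrite /rep (root_adj pq) (same_connect (@connect_adj_sym C) pq).
Qed.

Lemma rep_meets p : exists n, rep (iter n (gvert m) p).
Proof.
suff [n nr] : exists n, connect (@adj C) (iter n (gvert m) p) (root orb p).
  by exists n; rewrite /rep root_iter.
have /connectP [s] := connect_root orb p; elim: s p => [|z s IH] p /=.
  by move=> _ E; exists 0; rewrite /= E.
move=> /andP[pz zs] zl.
have zp : root orb z = root orb p.
  by apply/esym/eqP; rewrite root_connect; [exact: connect1 | exact: orb_sym].
have [n nz] : exists n, connect (@adj C) (iter n (gvert m) z) (root orb z).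
  by apply: IH; rewrite ?zp.
rewrite zp in nz; case/orP: pz => [pz|/eqP/= pz]; last by subst z; exists n.+1; rewrite iterSr.
exists n; apply: connect_trans nz; rewrite -(itergV m n p) -(itergV m n z); apply: connect_map; exact: connect1.
Qed.

Definition rep_section : section m := Section (fun d => rep_adj (connect_dart d)) rep_meets.

Definition all_section : section m :=
  @Section _ m predT (fun _ => erefl) (fun _ => ex_intro _ 0 erefl).

Definition circ_in (r : {r | root orb r == r}) : pred (vert C) :=
  fun p => connect (@adj C) p (val r).

Lemma circ_in_adj r p q : connect (@adj C) p q -> circ_in r p = circ_in r q.
Proof. by move=> pq; rewrite /circ_in (same_connect (@connect_adj_sym C) pq). Qed.

Lemma circ_in_sub r e b : circ_in r (ends e false) -> circ_in r (ends e b).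
Proof. by rewrite (circ_in_adj r (connect_ends e b)). Qed.

Lemma circ_in_rep r p : circ_in r p -> rep_section p /\ root orb p = val r.
Proof.
move=> pr; have E : root orb p = val r by rewrite (root_adj pr); exact: eqP (valP r).
by split=> //; rewrite /= /rep E.
Qed.

Definition ccspace r : graph := gsub (@circ_in_sub r).

Lemma fret_circ r x : circ_in r (ivert x) -> circ_in r (ivert (fret rep_section x)).
Proof.
move=> /circ_in_rep [_ E]; have [n [-> + _]] := fret_first rep_section x.
by rewrite ivert_iter -[sec rep_section _]/(rep _) /rep root_iter E.
Qed.

Lemma ccmono_exists r : exists f : gmap (ccspace r) (ccspace r),
  forall x, gsub_in (@circ_in_sub r) (f x) = fret rep_section (gsub_in (@circ_in_sub r) x).
Proof.
have mem x : (exists y, gsub_in (@circ_in_sub r) y = x) <-> circ_in r (ivert x).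
  rewrite gsub_inP; case: x => [p|[e b]] //=.
by rewrite /dsrc (circ_in_adj r (connect_ends e b)).
have [f fE] := @glift _ _ _ (gsub_in (@circ_in_sub r)) (gcomp (fret rep_section) (gsub_in (@circ_in_sub r)))
  (@gsub_in_inj _ _ _ _) (fun x => (mem _).2 (eq_ind_r (fun z => circ_in r (ivert z))
    (fret_circ ((mem _).1 (ex_intro _ x erefl))) (gcompE _ _ x))).
by exists f => x; rewrite fE gcompE.
Qed.

Definition ccmono_map r := projT1 (cid (ccmono_exists r)).

Lemma ccmonoE r x :
  gsub_in (@circ_in_sub r) (ccmono_map r x) = fret rep_section (gsub_in (@circ_in_sub r) x).
Proof. exact: projT2 (cid (ccmono_exists r)) x. Qed.

Lemma circ_in_ivert r (x : item (ccspace r)) : circ_in r (ivert (gsub_in (@circ_in_sub r) x)).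
Proof.
case: x => [[p pr]|[[e er] b]] //=.
by rewrite /dsrc; exact: circ_in_sub.
Qed.

Lemma ccmono_inj r : injective (ccmono_map r).
Proof.
move=> x y xy; apply: (@gsub_in_inj _ _ _ (@circ_in_sub r)).
apply: (@fret_inj _ _ monodromy_inj rep_section); last by rewrite -!ccmonoE xy.
- exact: (circ_in_rep (circ_in_ivert x)).1.
- exact: (circ_in_rep (circ_in_ivert y)).1.
Qed.

Definition ccmono r : embedding (ccspace r) (ccspace r) :=
  Embedding (item_inj_vert (@ccmono_inj r)) (item_inj_edge (@ccmono_inj r)).

Definition split_blueprint : blueprint.
Proof.
refine (@Blueprint {p : vert (VS X) | root (@adj _) p == p} {p : vert (ES X) | root (@adj _) p == p}
  (fun w b => comp_of (gvert (att X b) (val w))) (VS X) (ES X)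
  (@comp_of (VS X)) (@comp_of (ES X)) _ _ (att X) _ _ _ {r | root orb r == r} ccspace ccmono).
- by move=> e b; apply/comp_ofP; exact: connect_ends.
- by move=> e b; apply/comp_ofP; exact: connect_ends.
- move=> b q; apply/comp_ofP; apply: connect_map; apply/comp_ofP.
  by rewrite comp_of_root.
- move=> b p q /comp_ofP /connect_over pq E.
  by have [] := @att_inj X b (inl p) (inl q) pq (congr1 inl E).
- move=> b e f /comp_ofP /connect_over pq E.
  pose x : item (ES X) := inr (e, gflip (att X b) e).
  pose y : item (ES X) := inr (f, gflip (att X b) f).
  suff : x = y by case.
  apply: (@att_inj X b x y pq); apply: (congr1 inr); rewrite /gdart [LHS]/= [RHS]/= !addbb.
  by congr (_, _); exact: E.
Defined.

Definition splitting : gog := build split_blueprint.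

Definition jC : gmap (CS splitting) C :=
  gsum_case (fun r => gsub_in (@circ_in_sub r)).

Lemma jC_in r (x : item (ccspace r)) :
  jC (gsum_in (cspace splitting) r x) = gsub_in (@circ_in_sub r) x.
Proof. exact: (@gsum_caseE _ ccspace). Qed.

Lemma jC_inj : injective jC.
Proof.
move=> x y; have [r [x' ->]] := gsum_inP x; have [r' [y' ->]] := gsum_inP y.
rewrite !jC_in => E.
have rr : r = r'.
  apply: val_inj; rewrite -(circ_in_rep (circ_in_ivert x')).2 E.
  exact: (circ_in_rep (circ_in_ivert y')).2.
by subst r'; move/gsub_in_inj: E => ->.
Qed.

Lemma jC_image x : (exists y, jC y = x) <-> rep_section (ivert x).
Proof.
split=> [[y <-]|Sx].
  have [r [y' ->]] := gsum_inP y; rewrite jC_in.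
  exact: (circ_in_rep (circ_in_ivert y')).1.
pose r : {r | root orb r == r} :=
  exist _ (root orb (ivert x)) (introT eqP (root_root orb_sym (ivert x))).
have [z zx] : exists z, gsub_in (@circ_in_sub r) z = x.
  apply/gsub_inP; case: x Sx @r => [p|[e b]] //= Sx.
  by rewrite -(circ_in_adj _ (connect_ends e b)).
by exists (gsum_in (cspace splitting) r z); rewrite jC_in.
Qed.

Lemma jC_mono x : jC (monodromy splitting x) = fret rep_section (jC x).
Proof.
have [r [x' ->]] := gsum_inP x.
rewrite (@monodromy_gsum_in splitting r x') !jC_in; exact: ccmonoE.
Qed.

Lemma splitting_components : split_components X splitting.
Proof.
split.
- split=> [u|u|r].
  + apply: (@gsub_connected (VS X) _ _ _ (val u)); last first.
    * by move=> p /eqP E; apply/comp_ofP; rewrite comp_of_root.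
    * by apply/eqP; exact: comp_of_root.
    * by move=> p q /comp_ofP /= ->.
  + apply: (@gsub_connected (ES X) _ _ _ (val u)); last first.
    * by move=> p /eqP E; apply/comp_ofP; rewrite comp_of_root.
    * by apply/eqP; exact: comp_of_root.
    * by move=> p q /comp_ofP /= ->.
  + apply: (@gsub_connected C _ _ _ (val r)) => //.
    * by move=> p q; exact: circ_in_adj.
    * exact: connect0.
- exists (jV split_blueprint), (jE split_blueprint); split; [exact: jV_iso | exact: jE_iso |].
  exact: jVatt.
- exists jC; split.
  + exact: jC_inj.
  + move=> d [p pd].
    have [[q|a] // [ad]] : exists y, jC y = inr d.
      apply/jC_image; rewrite -(pd : ivert (jC (inl p)) = ivert (inr d)).
      by apply/jC_image; exists (inl p).
    by exists a.
  + move=> x; have [n Sn] := rep_meets (ivert x).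
    have [y yE] : exists y, jC y = iter n m x by apply/jC_image; rewrite ivert_iter.
    by exists n, y.
  + move=> y; have [n [E _ min]] := fret_first rep_section (jC y).
    exists n; split; first by rewrite jC_mono E.
    by move=> k y' /min /negP nS E'; apply: nS; rewrite E'; apply/jC_image; exists y'.
Qed.

(** Only the circle edges change: the section at which they are cut shrinks from
    everything to one component in each cycle. *)
Lemma splitting_heq (R : realType) : fheq R (flat_of splitting) (flat_of X).
Proof.
have giso_plus G G' H H' (f : gmap G G') (g : gmap H H') : giso f -> giso g ->
    giso (gplus_map f g).
  move=> gf gg; apply: giso_bij => [|y]; first by apply: gplus_map_inj; exact: giso_inj.
  have [[z ->]|[z ->]] := gplusP y.
    by have [x <-] := giso_surj gf z; exists (ginl _ _ x); rewrite gplus_mapEl.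
  by have [x <-] := giso_surj gg z; exists (ginr _ _ x); rewrite gplus_mapEr.
have [f fE] := Fret_exists rep_section; have [f' fE'] := Fret_exists all_section.
have h1 : fheq R (@return_flat _ _ C (att X) m rep_section f) (@return_flat _ _ C (att X) m all_section f').
  by apply: return_flat_heq => //; exact: monodromy_inj.
have [k kE] : exists k : gmap (CS splitting) (sgraph rep_section), forall x, sin rep_section (k x) = jC x.
  by apply: glift => [|x]; [exact: sin_inj | apply/sin_image/jC_image; exists x].
have k_iso : giso k.
  apply: giso_bij => [x y xy|y]; first by apply: jC_inj; rewrite -!kE xy.
  have [x xy] : exists x, jC x = sin rep_section y by apply/jC_image; exact: sin_sec.
  by exists x; apply: (@sin_inj _ _ rep_section); rewrite kE.
have sin_iso : giso (sin all_section).
  by apply: giso_bij => [|y]; [exact: sin_inj | apply/sin_image].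
apply: heq_trans (heq_trans h1 _).
- apply: flat_iso_heq.
  have := @jVatt split_blueprint; have := jV_iso split_blueprint; have := jE_iso split_blueprint.
  rewrite -/splitting -[bV _]/(VS X) -[bE _]/(ES X) -[ba _]/(att X).
  move: (jV _) (jE _) => jv je je_iso jv_iso jvE.
  exists (gplus_map jv k), (gplus_map je k).
  split; [exact: giso_plus | exact: giso_plus | move=> b x].
  have [[z ->]|[z ->]] := gplusP x.
    have -> : fa (flat_of splitting) b (ginl _ _ z) = ginl _ _ (att splitting b z).
      exact: gplus_mapEl.
    by rewrite !gplus_mapEl jvE.
  have -> : fa (flat_of splitting) b (ginr _ _ z) =
      ginr _ _ ((if b then gid _ else monodromy splitting) z) by exact: gplus_mapEr.
  rewrite !gplus_mapEr.
  apply: (congr1 (ginr _ _)); case: b; first by rewrite !gidE.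
  by apply: (@sin_inj _ _ rep_section); rewrite kE jC_mono fE kE.
- apply: flat_iso_heq.
  exists (gplus_map (gid _) (sin all_section)), (gplus_map (gid _) (sin all_section)).
  split; [by apply: giso_plus => //; exact: giso_id | by apply: giso_plus => //; exact: giso_id |].
  move=> b x; have [[z ->]|[z ->]] := gplusP x.
    have -> : fa (return_flat (att X) f') b (ginl _ _ z) = ginl _ _ (att X b z) by exact: gplus_mapEl.
    by rewrite !gplus_mapEl !gidE.
  have -> : fa (return_flat (att X) f') b (ginr _ _ z) =
      ginr _ _ ((if b then gid _ else f') z) by exact: gplus_mapEr.
  rewrite !gplus_mapEr.
  apply: (congr1 (ginr _ _)); case: b; first by rewrite !gidE.
  rewrite fE'; apply: (first_return_unique (fret_first _ _)).
  by exists 0; split.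
Qed.
End Split.

Lemma split_exists R X : exists Y, split_components X Y /\ fheq R (flat_of Y) (flat_of X).
Proof. by exists (splitting X); split; [exact: splitting_components | exact: splitting_heq]. Qed.

(** * Pulling the two sides of a vertex space apart *)

Lemma subflat_exists (F : flat) (PV : item (fV F) -> Prop) (PE : item (fE F) -> Prop) :
  (forall d, PV (inr (drev d)) <-> PV (inr d)) -> (forall d, PV (inr d) -> PV (inl (dsrc d))) ->
  (forall d, PE (inr (drev d)) <-> PE (inr d)) -> (forall d, PE (inr d) -> PE (inl (dsrc d))) ->
  (forall b x, PE x -> PV (fa F b x)) ->
  exists G (jV : gmap (fV G) (fV F)) (jE : gmap (fE G) (fE F)),
    [/\ injective jV, injective jE, forall b y, jV (fa G b y) = fa F b (jE y),
        forall x, (exists y, jE y = x) <-> PE x & forall z, (exists y, jV y = z) <-> PV z].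
Proof.
move=> Vr Vs Er Es EV.
have sub (H : graph) (P : item H -> Prop) :
    (forall d, P (inr (drev d)) <-> P (inr d)) -> (forall d, P (inr d) -> P (inl (dsrc d))) ->
    exists K (j : gmap K H), injective j /\ forall x, (exists y, j y = x) <-> P x.
  move=> rv sr; have ok e b : `[< P (inr (e, false)) >] -> `[< P (inl (ends e b)) >].
    move=> /asboolP Pe; apply/asboolP; apply: (sr (e, b)); case: b => //.
    exact/(rv (e, false)).
  exists (gsub (P := fun p => `[< P (inl p) >]) ok), (gsub_in ok).
  split=> [|x]; first exact: gsub_in_inj.
  rewrite gsub_inP; case: x => [p|[e b]] /=; first by split=> /asboolP.
  have -> : P (inr (e, b)) <-> P (inr (e, false)) by case: b => //; exact: (rv (e, false)).
  by split=> /asboolP.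
have [VG [jV [jVi jVP]]] := sub _ PV Vr Vs; have [EG [jE [jEi jEP]]] := sub _ PE Er Es.
have /choice [a aE] : forall b, exists f : gmap EG VG, forall y, jV (f y) = gcomp (fa F b) jE y.
  by move=> b; apply: glift => // y; rewrite gcompE; apply/jVP/EV/jEP; exists y.
by exists (Flat a), jV, jE; split=> // b y; rewrite aE gcompE.
Qed.

(** In W a second copy of N, joined to the first by a product, receives some of the ends
    of edges.  A cell of N that is on one side only has a free copy, and is removed
    together with its cell of the product. *)
Section PullApart.
Variables (R : realType) (V E N : graph) (h : gmap N V).
Variables (a : bool -> gmap E (gplus V N)) (on_side : bool -> item N -> bool).
Hypothesis h_inj : injective h.
Hypothesis on_side_rev : forall s d, on_side s (inr (drev d)) = on_side s (inr d).
Hypothesis on_side_src : forall s d, on_side s (inr d) -> on_side s (inl (dsrc d)).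
Hypothesis on_side_cover : forall n, on_side false n || on_side true n.
Hypothesis a_sideF : forall b e n, a b e = ginl _ _ (h n) -> on_side false n.
Hypothesis a_sideT : forall b e n, a b e = ginr _ _ n -> on_side true n.

Notation W := (product_flat true h a).

Lemma W_l b x : fa W b (ginl _ _ x) = a b x. Proof. exact: gcaseEl. Qed.
Lemma W_T n : fa W true (ginr _ _ n) = ginr _ _ n. Proof. exact: gcaseEr. Qed.
Lemma W_F n : fa W false (ginr _ _ n) = ginl _ _ (h n).
Proof. by rewrite /fa /= gcaseEr gcompE. Qed.

Definition lostE (K : item N -> bool) (x : item (fE W)) := exists n, ~~ K n /\ x = ginr _ _ n.
Definition lostV (K : item N -> bool) (z : item (fV W)) := exists n,
  ~~ K n /\ ((~~ on_side false n /\ z = ginl _ _ (h n)) \/ (~~ on_side true n /\ z = ginr _ _ n)).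

Definition restricts K G (jV : gmap (fV G) (fV W)) (jE : gmap (fE G) (fE W)) :=
  [/\ injective jV, injective jE, forall b y, jV (fa G b y) = fa W b (jE y),
      forall x, (exists y, jE y = x) <-> ~ lostE K x
    & forall z, (exists y, jV y = z) <-> ~ lostV K z].

Definition in_both n := on_side false n && on_side true n.

(** Edges and vertices are dropped by separate uses of this lemma, since an arc of the
    product can be shrunk only when no square is left beside it. *)
Lemma drop_cells (K K' : item N -> bool) G jV jE G' jV' jE' :
  (forall n, K' n -> K n) -> (forall n, in_both n -> K' n) ->
  (forall d, K' (inr (drev d)) = K' (inr d)) ->
  (forall q d, ~~ K' (inl q) -> K (inr d) -> dsrc d <> q) ->
  @restricts K G jV jE -> @restricts K' G' jV' jE' -> fheq R G' G.
Proof.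
move=> KK bK K'r iso [jVi jEi jA jEP jVP] [jVi' jEi' jA' jEP' jVP'].
have [kV kVE] : exists k : gmap (fV G') (fV G), forall x, jV (k x) = jV' x.
  apply: glift => // x; apply/jVP => -[n [nK H]]; case: ((jVP' (jV' x)).1 (ex_intro _ x erefl)).
  by exists n; split=> //; apply: contraNN nK; exact: KK.
have [kE kEE] : exists k : gmap (fE G') (fE G), forall x, jE (k x) = jE' x.
  apply: glift => // x; apply/jEP => -[n [nK H]]; case: ((jEP' (jE' x)).1 (ex_intro _ x erefl)).
  by exists n; split=> //; apply: contraNN nK; exact: KK.
pose rhoW (z : item (fE W)) : option bool :=
  if gsplit z is inr n then (if K' n then None else Some (~~ on_side true n)) else None.
have rhoWr n : rhoW (ginr _ _ n) = if K' n then None else Some (~~ on_side true n).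
  by rewrite /rhoW gsplitr.
have rhoW_some z b : rhoW z = Some b -> exists n, [/\ z = ginr _ _ n, ~~ K' n & b = ~~ on_side true n].
  have [[x ->]|[n ->]] := gplusP z; first by rewrite /rhoW gsplitl.
  by rewrite rhoWr; case: ifPn => // nK [<-]; exists n.
have freeE n : ~~ K' n -> fa W (~~ on_side true n) (ginr _ _ n) = (if on_side true n then ginl _ _ (h n) else ginr _ _ n).
  by move=> _; case: (on_side true n); rewrite ?W_T ?W_F.
have nboth n : ~~ K' n -> on_side false n = ~~ on_side true n.
  move=> nK; have := on_side_cover n; have : ~~ in_both n by apply: contraNN nK; exact: bK.
  by rewrite /in_both; case: (on_side false n); case: (on_side true n).
apply: (@remove_free_cells_heq R G G' kV kE (fun x => rhoW (jE x))).
- by move=> x y xy; apply: jVi'; rewrite -!kVE xy.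
- by move=> x y xy; apply: jEi'; rewrite -!kEE xy.
- by move=> b y; apply: jVi; rewrite kVE jA jA' kEE.
- move=> d; rewrite /= gdart_rev; case: (gdart jE d) => -[e|e] b //=.
  by rewrite /rhoW /= (K'r (e, b)) (on_side_rev true (e, b)).
- move=> x; have -> : (exists y, kE y = x) <-> exists y, jE' y = jE x.
    by split=> -[y yx]; exists y; [rewrite -kEE yx | apply: jEi; rewrite kEE].
  rewrite jEP'; split=> [nl|r0 [n [nK xE]]]; last by move: r0; rewrite xE rhoWr (negbTE nK).
  case rE: (rhoW (jE x)) => [b|] //; have [n [xE nK _]] := rhoW_some _ _ rE.
  by case: nl; exists n.
- move=> v; have -> : (exists y, kV y = v) <-> exists y, jV' y = jV v.
    by split=> -[y yx]; exists y; [rewrite -kVE yx | apply: jVi; rewrite kVE].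
  rewrite jVP'; split=> nl L; apply: nl.
    have [x [b [/rhoW_some [n [xE nK bE]] vE]]] := L; exists n; split=> //.
    rewrite -vE jA xE bE freeE //; have := nboth n nK.
    by case: (on_side true n) => sF; [left; rewrite sF | right].
  have [n [nK H]] := L.
  have Kn : K n.
    by apply: contraT => nKn; case: ((jVP (jV v)).1 (ex_intro _ v erefl)); exists n.
  have [x xn] : exists x, jE x = ginr _ _ n.
    by apply/jEP => -[n' [nK' /ginr_inj nn]]; move: nK'; rewrite -nn Kn.
  exists x, (~~ on_side true n); rewrite xn rhoWr (negbTE nK); split=> //.
  apply: jVi; rewrite jA xn freeE //; have := nboth n nK.
  by case: H => -[sn ->]; case: (on_side true n) sn => //= sn sF; rewrite sF in sn.
- move=> x b x' b' /rhoW_some [n [xE nK bE]] /(congr1 jV); rewrite !jA xE bE freeE // => H.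
  have [[e eE]|[n' nE]] := gplusP (jE x').
    move: H; rewrite eE W_l; have := nboth n nK; case sT: (on_side true n) => /= sF H.
      by have := a_sideF H; rewrite sF.
    by have := a_sideT H; rewrite sT.
  move: H; rewrite nE; case: b'; rewrite ?W_T ?W_F; case: (on_side true n) => H.
  + by case: (ginlr (esym H)).
  + by split=> //; apply: jEi; rewrite xE nE (ginr_inj H).
  + by split=> //; apply: jEi; rewrite xE nE (h_inj (ginl_inj H)).
  + by case: (ginlr H).
- move=> q d rq dq; case rE: (rhoW (jE (inl q))) rq => [b|] // _.
  have [n [qE nK _]] := rhoW_some _ _ rE; case: n qE nK {rE} => [n|//] /= [qE] nK.
  have [[x xE]|[n' nE]] := gplusP (jE (inr d)).
    by have := congr1 (@ivert _) xE; rewrite !ivert_map [ivert _]dq qE; case: x {xE}.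
  have Kn' : K n' by apply: contraT => nKn; case: ((jEP (jE (inr d))).1 (ex_intro _ _ erefl)); exists n'.
  case: n' nE Kn' => [//|d'] dE Kd; apply: (iso n d' nK Kd).
  by have := congr1 (@ivert _) dE; rewrite !ivert_map [ivert _]dq qE => -[].
Qed.

Lemma pull_apart_heq G jV jE : @restricts in_both G jV jE -> fheq R G (collapsed_flat h a).
Proof.
move=> rG; apply: heq_trans (product_collapse_heq R true h a).
pose K1 (n : item N) := if n is inr _ then in_both n else true.
have rW : @restricts predT W (gid _) (gid _).
  split; [exact: gid_inj | exact: gid_inj | by move=> b y; rewrite !gidE | |].
    by move=> x; split=> [_ [n []]|_] //; exists x; rewrite gidE.
  by move=> x; split=> [_ [n []]|_] //; exists x; rewrite gidE.
have b_rev d : in_both (inr (drev d)) = in_both (inr d) by rewrite /in_both !on_side_rev.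
have b_src d : in_both (inr d) -> in_both (inl (dsrc d)) by move=> /andP[/on_side_src sF /on_side_src sT]; rewrite /in_both sF.
have [G1 [jV1 [jE1 [i1 i2 A1 E1 V1]]]] : exists G1 (jV1 : gmap (fV G1) (fV W)) (jE1 : gmap (fE G1) (fE W)),
    restricts K1 jV1 jE1.
  apply: (@subflat_exists W (fun z => ~ lostV K1 z) (fun z => ~ lostE K1 z)).
  - have rv d : lostV K1 (inr d) -> lostV K1 (inr (drev d)).
      move=> [[n|n] [nK]] //= H; exists (inr (drev n)); rewrite /= b_rev; split=> //.
      rewrite !on_side_rev !gdart_rev.
      by case: H => -[ns [->]]; [left | right].
    move=> d; split=> nl L; apply: nl; first exact: rv.
    by rewrite -(drevK d); exact: rv.
  - by move=> d _ [[n|n] [] // _ [] []].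
  - have rv d : lostE K1 (inr d) -> lostE K1 (inr (drev d)).
      by move=> [[n|n] [nK]] //= [->]; exists (inr (drev n)); rewrite /= b_rev gdart_rev.
    move=> d; split=> nl L; apply: nl; first exact: rv.
    by rewrite -(drevK d); exact: rv.
  - by move=> d _ [[n|n] [] //].
  - move=> b x nl [n [nK H]]; have [[e xE]|[n' xE]] := gplusP x.
      move: H; rewrite xE W_l; case=> -[/negP ns E']; apply: ns.
        exact: a_sideF E'.
      exact: a_sideT E'.
    apply: nl; exists n; split=> //; move: H; rewrite xE; case: b; rewrite ?W_T ?W_F.
      by case=> -[_]; [move=> /esym/ginlr | move=> /ginr_inj ->].
    by case=> -[_]; [move=> /ginl_inj/h_inj -> | move=> /ginlr].
have r1 : restricts K1 jV1 jE1 by split.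
have h1 : fheq R G1 W.
  apply: (drop_cells (K := predT) (K' := K1) _ _ _ _ rW r1) => //.
  - by case.
apply: heq_trans h1; apply: (drop_cells (K := K1) (K' := in_both) _ _ _ _ r1 rG) => //.
- by case.
- move=> q d nq Kd dq; move: nq; rewrite -dq; apply/negP; rewrite negbK; exact: b_src.
Qed.
End PullApart.

(** * Half-edges through a cell *)

Lemma dart_item_inj (G : graph) (d d' : dart G) : inr d = inr d' :> item G -> d = d'.
Proof. by case. Qed.

Section Through.
Variable X : gog.

Definition through (x : item (VS X)) : {set uedge X * bool} :=
  [set h | `[< exists2 y, over y = h.1 & att X h.2 y = x >]].

Lemma throughP x h : reflect (exists2 y, over y = h.1 & att X h.2 y = x) (h \in through x).
Proof. by rewrite inE; exact: asboolP. Qed.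

Lemma over_ivert (J : finType) (A : J -> graph) (x : item (gsum A)) : tag (ivert x) = over x.
Proof. by case: x. Qed.

Lemma through_rev d : through (inr (drev d)) = through (inr d).
Proof.
have sub d' : through (inr (drev d')) \subset through (inr d').
  apply/subsetP => h /throughP [y oy E]; case: y oy E => [q|k] ok // /dart_item_inj kd.
  by apply/throughP; exists (inr (drev k)) => //; rewrite /= gdart_rev kd drevK.
by apply/eqP; rewrite eqEsubset sub -{1}(drevK d) sub.
Qed.

Lemma through_src d : through (inr d) \subset through (inl (dsrc d)).
Proof.
apply/subsetP => h /throughP [y oy E]; case: y oy E => [q|k] ok // /dart_item_inj kd.
by apply/throughP; exists (inl (dsrc k)) => //; rewrite -kd dsrc_gdart.
Qed.

Lemma through_end x h : h \in through x -> uend X h.1 h.2 = over x.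
Proof. by case/throughP => y oy <-; rewrite over_att oy. Qed.

Lemma through_halves x : through x \subset halves (over x).
Proof. by apply/subsetP => h /through_end hx; rewrite inE hx. Qed.

Lemma through_covers e s : #|through (inr (e, s))| = #|covers e|.
Proof.
rewrite -(card_in_imset (f := @half_of X)); last by move=> h h' i1 i2; exact: half_of_inj i1 i2.
apply: eq_card => h; apply/throughP/imsetP => [[[//|[a t]] ah [ae _]]|[[b a] ba ->]].
  by exists (h.2, a); rewrite ?inE /= ?ae //; case: (h) ah => h1 h2 /= <-.
exists (inr (a, s (+) gflip (att X b) a)) => //.
move: ba; rewrite inE /= => /eqP ae; congr inr.
by rewrite /gdart /= -/(gedge (att X b) a) ae addbK.
Qed.

Definition item_covered := forall x, 1 < #|through x|.

(** The vertex space is a single point. *)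
Lemma full_through (p : vert (VS X)) (h : uedge X * bool) : gconnected (vspace X (tag p)) -> gconnected (espace X h.1) ->
  (forall d : dart (VS X), dsrc d <> p) -> h \in halves (tag p) -> h \in through (inl p).
Proof.
move=> cV [[q _] _] np; rewrite inE => /eqP hp; apply/throughP.
exists (gsum_in (espace X) h.1 (inl q)) => //.
have [u [x E]] := gsum_inP (att X h.2 (gsum_in (espace X) h.1 (inl q))).
have uE : u = tag p by rewrite -hp -(over_gsum_in (A := vspace X) x) -E over_att over_gsum_in.
subst u; rewrite E; case: p cV np {hp E} x => u p cV np x /=.
have nd d : dsrc d <> p.
  by move=> dp; apply: (np (gdart (gsum_in (vspace X) u) d)); rewrite dsrc_gdart dp.
have [one nodart] := connected_lone cV nd.
by case: x => [q'|d]; [rewrite (one q') | case: (nodart d)].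
Qed.

Lemma tame_item_covered : tame X -> item_covered.
Proof.
move=> [[cV cE _] dX bX].
have dart_covered d : 1 < #|through (inr d)| by case: d => e s; rewrite through_covers.
case=> [p|d]; last exact: dart_covered.
have [[d <-]|nd] := pselect (exists d, dsrc d = p).
  exact: leq_trans (dart_covered d) (subset_leq_card (through_src d)).
apply: leq_trans (bX (tag p)) (subset_leq_card _).
apply/subsetP => h; apply: full_through => // d dp; by apply: nd; exists d.
Qed.

Lemma item_covered_tame : connected_spaces X -> item_covered -> tame X.
Proof.
move=> cX iX; split=> // [e|v]; first by rewrite -(through_covers e false).
have [cV _ _] := cX; have [[p _] _] := cV v.
pose x : item (VS X) := gsum_in (vspace X) v (inl p).
by apply: leq_trans (iX x) (subset_leq_card _); exact: through_halves.
Qed.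

End Through.

(** * Two disjoint pairs of meeting half-edges *)

(** Pairwise intersecting edges of a graph form a star or a triangle.  A star is excluded,
    since some edge avoids its centre; a fourth vertex next to a triangle is joined to
    some vertex, and two vertices of the triangle remain. *)
Lemma two_disjoint_pairs (T : finType) (A : {set T}) (r : T -> T -> Prop) :
  (forall x y, r x y -> r y x) ->
  (forall x, x \in A -> exists y, [/\ y \in A, y != x & r x y]) ->
  (forall z, z \in A -> exists x y, [/\ [/\ x \in A, y \in A & x != y], r x y, x != z & y != z]) ->
  3 < #|A| ->
  exists a b c d, [/\ [/\ a \in A, b \in A, c \in A & d \in A], r a b, r c d & uniq [:: a; b; c; d]].
Proof.
move=> sym S1 S2 A4.
pose goal := exists a b c d,
  [/\ [/\ a \in A, b \in A, c \in A & d \in A], r a b, r c d & uniq [:: a; b; c; d]].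
have four a b c d : a \in A -> b \in A -> c \in A -> d \in A -> r a b -> r c d ->
    a != b -> a != c -> a != d -> b != c -> b != d -> c != d -> goal.
  move=> aA bA cA dA rab rcd ab ac ad bc bd cd; exists a, b, c, d; split=> //.
  by rewrite /= !inE !negb_or ab ac ad bc bd cd.
have step w x : w \in A -> x \in A -> w != x -> r w x ->
    goal \/ exists b, [/\ b \in A, b != x, b != w & r x b].
  move=> wA xA wx rwx; have [a [b [[aA bA ab] rab aw bw]]] := S2 w wA.
  have [ax|ax] := eqVneq a x.
    by subst a; right; exists b; split=> //; rewrite eq_sym.
  have [bx|bx] := eqVneq b x.
    by subst b; right; exists a; split=> //; exact: sym.
  by left; apply: (four w x a b); rewrite // eq_sym.
have [w0 w0A] : exists w, w \in A by apply/set0Pn; rewrite -card_gt0; apply: leq_trans A4.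
have [w [x [[wA xA wx] rwx _ _]]] := S2 w0 w0A.
have [//|[b [bA bx bw rxb]]] := step w x wA xA wx rwx.
have xw : x != w by rewrite eq_sym.
have [//|[d [dA dw dx rwd]]] := step x w xA wA xw (sym _ _ rwx).
have [bd|bd] := eqVneq b d; last by apply: (four x b w d); rewrite // eq_sym.
subst d.
(* Here w, x and b form a triangle. *)
have [y [yA yx yw yb]] : exists y, [/\ y \in A, y != x, y != w & y != b].
  have : 0 < #|A :\: [set x; w; b]|.
    rewrite cardsD subn_gt0; apply: leq_ltn_trans (subset_leq_card (subsetIr _ _)) _.
    apply: leq_trans A4; rewrite ltnS; apply: leq_trans (leq_card_setU _ _) _.
    by rewrite cards2 cards1 xw.
  by rewrite card_gt0 => /set0Pn [y]; rewrite !inE !negb_or => /andP[/andP[/andP[yx yw] yb] yA]; exists y.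
have [z [zA zy ryz]] := S1 y yA.
have [zx|zx] := eqVneq z x.
  by subst z; apply: (four y x w b); rewrite // eq_sym.
have [zw|zw] := eqVneq z w.
  by subst z; apply: (four y w x b); rewrite // eq_sym.
by apply: (four y z w x); rewrite // eq_sym.
Qed.

Section Meeting.
Variable X : gog.
Hypothesis tX : tame X.

Definition meet (h h' : uedge X * bool) := exists p, h \in through (inl p) /\ h' \in through (inl p).

Lemma through_point h : exists p : vert (VS X), h \in through (inl p).
Proof.
have [[_ cE _] _ _] := tX; have [[q _] _] := cE h.1.
pose y : vert (ES X) := gvert (gsum_in (espace X) h.1) q.
exists (gvert (att X h.2) y); apply/throughP; exists (inl y) => //.
Qed.

(** The image is closed under adjacency, and the vertex space is connected. *)
Lemma closed_half (h : uedge X * bool) : (forall d : dart (VS X), h \in through (inl (dsrc d)) -> h \in through (inr d)) ->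
  forall p, h \in halves (tag p) -> h \in through (inl p).
Proof.
move=> cl p hp; have [[cV _ _] _ _] := tX; have [p0 hp0] := through_point h.
have : tag p0 = tag p.
  by move: hp; rewrite inE (through_end hp0) => /eqP.
move/(((fiber_connectedP (vspace X)).1 cV).2 p0 p)/connectP => [s].
elim: s p0 hp0 => [|z s IH] p0 hp0 /=; first by move=> _ ->.
move=> /andP[/existsP [d /andP[/eqP dp /eqP dz]] zs] pl; apply: (IH z _ zs pl).
have := cl d; rewrite dp => /(_ hp0); rewrite -through_rev -dz.
by apply: subsetP; exact: through_src.
Qed.

(** Two half-edges pass through every point, so every half-edge meets another one.  If no
    two half-edges other than z met, each of them would contain all edges at its points,
    hence be onto, and then they would meet. *)
Lemma four_halves v : 3 < valence v -> exists h1 h2 h3 h4,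
  [/\ [/\ h1 \in halves v, h2 \in halves v, h3 \in halves v & h4 \in halves v],
      meet h1 h2, meet h3 h4 & uniq [:: h1; h2; h3; h4]].
Proof.
move=> v4; have iX := tame_item_covered tX.
have at_v h p : h \in halves v -> h \in through (inl p) -> through (inl p) \subset halves v.
  by move=> + hp; rewrite inE (through_end hp) => /eqP <-; exact: through_halves.
apply: (two_disjoint_pairs _ _ _ v4).
- by move=> x y [p [xp yp]]; exists p.
- move=> h hv; have [p hp] := through_point h.
  have /card_gt1P [k1 [k2 [k1p k2p k12]]] := iX (inl p).
  have [k1h|k1h] := eqVneq k1 h.
    exists k2; split; [exact: (subsetP (at_v h p hv hp)) | by rewrite eq_sym -k1h | by exists p].
  by exists k1; split; [exact: (subsetP (at_v h p hv hp)) | by [] | exists p].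
- move=> z zv; apply: contrapT => none.
  have only g k p : g \in halves v -> g != z -> g \in through (inl p) -> k \in through (inl p) ->
      k != z -> k = g.
    move=> gv gz gp kp kz; apply/eqP; apply: contraT => kg; case: none.
    exists k, g; split=> //; first split=> //.
      exact: (subsetP (at_v g p gv gp)).
    by exists p.
  have onto g p : g \in halves v -> g != z -> tag p = v -> g \in through (inl p).
    move=> gv gz pv; apply: closed_half; last by rewrite pv.
    move=> d gd; have /card_gt1P [k1 [k2 [k1d k2d k12]]] := iX (inr d).
    have [k [kd kz]] : exists k, k \in through (inr d) /\ k != z.
      by have [E|] := eqVneq k1 z; [exists k2; rewrite -E eq_sym | exists k1].
    by rewrite -(only g k (dsrc d) gv gz gd _ kz) //; apply: subsetP kd; exact: through_src.
  have : 1 < #|halves v :\ z| by move: v4; rewrite -[valence v]/#|halves v| (cardsD1 z) zv add1n ltnS; exact: ltnW.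
  move=> /card_gt1P [g [g' [+ + gg]]]; rewrite !in_setD1 => /andP[gz gv] /andP[gz' gv'].
  have [p gp] := through_point g.
  have pv : tag p = v.
    by move: gv; rewrite inE (through_end gp) => /eqP.
  by move/eqP: gg; apply; exact: (only g' g p gv' gz' (onto g' p gv' gz' pv) gp gz).
Qed.

(** If only two half-edges passed through each point, they would also pass through every edge
    at that point; then every half-edge would be onto, and there would be only two. *)
Lemma branch_point v : 2 < valence v -> exists p, tag p = v /\ 2 < #|through (inl p : item (VS X))|.
Proof.
move=> v3; have iX := tame_item_covered tX; apply: contrapT => none.
have two p : tag p = v -> #|through (inl p)| <= 2.
  by move=> pv; rewrite leqNgt; apply/negP => b; apply: none; exists p.
have [[cV _ _] _ _] := tX; have [[q _] _] := cV v.
pose p : vert (VS X) := gvert (gsum_in (vspace X) v) q.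
have : halves v \subset through (inl p).
  apply/subsetP => g gv; apply: closed_half => // d gd.
  have dv : tag (dsrc d) = v.
    by move: gv; rewrite inE (through_end gd) => /eqP.
  have /eqP -> // : through (inr d) == through (inl (dsrc d)).
  by rewrite eqEcard through_src; apply: leq_trans (two _ dv) (iX _).
move/subset_leq_card; rewrite [#|halves v|]/(valence v) => /(leq_trans v3).
by rewrite ltnNge two.
Qed.

(** Twice the number of horizontal edges is the sum of the horizontal valences, which are at
    least two, and at least three at one point of every vertex space. *)
Lemma vertex_bound : (forall v : uvert X, 2 < valence v) ->
  #|uvert X| + 2 * #|vert (VS X)| <= 2 * #|vert (ES X)|.
Proof.
move=> v3; have iX := tame_item_covered tX.
have /choice [f fP] := fun v => branch_point (v3 v).
apply: (@leq_trans (\sum_(p : vert (VS X)) (2 + (f (tag p) == p)))).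
  rewrite big_split /= sum_nat_const mulnC addnC leq_add2l.
  have f_inj : injective f by move=> u w uw; rewrite -(fP u).1 uw (fP w).1.
  rewrite -(card_codom f_inj) -sum1_card big_mkcond /=; apply: leq_sum => p _.
  by case: codomP => [[u ->]|//]; rewrite (fP u).1 eqxx.
apply: (@leq_trans (\sum_(p : vert (VS X)) #|[set h : bool * vert (ES X) | gvert (att X h.1) h.2 == p]|)).
  apply: leq_sum => p _; apply: (@leq_trans #|through (inl p)|).
    have [E|_] := eqVneq; last by rewrite addn0 iX.
    by rewrite addn1; move: (fP (tag p)).2; rewrite E.
  apply: leq_trans (leq_imset_card (fun h : bool * vert (ES X) => (tag h.2, h.1)) _).
  apply: subset_leq_card; apply/subsetP => h /throughP [[q|//] oq [qp]]; apply/imsetP.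
  exists (h.2, q); first by rewrite inE /= -qp.
  by case: h oq {qp} => h1 h2 /= <-.
have -> : 2 * #|vert (ES X)| = #|{: bool * vert (ES X)}| by rewrite card_prod card_bool.
rewrite -sum1_card (partition_big (fun h : bool * vert (ES X) => gvert (att X h.1) h.2) predT) //=.
by apply: leq_sum => p _; rewrite -sum1_card; apply: eq_leq; apply: eq_bigl => h; rewrite inE.
Qed.
End Meeting.

(** * Separating the incident edges of a vertex *)

Section Separate.
Variables (X : gog) (v : uvert X) (cls : uedge X -> bool -> bool).

Definition on_side s (x : item (VS X)) : bool := `[< side_image v cls s x >].

Lemma on_sideP s x : reflect (side_image v cls s x) (on_side s x). Proof. exact: asboolP. Qed.

Lemma on_side_over s x : on_side s x -> over x = v.
Proof. by case/on_sideP => e [b [y [<- _ <- <-]]]; exact: over_att. Qed.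

Lemma on_side_att b y : uend X (over y) b = v -> on_side (cls (over y) b) (att X b y).
Proof. by move=> yv; apply/on_sideP; exists (over y), b, y. Qed.

Lemma on_side_rev s d : on_side s (inr (drev d)) = on_side s (inr d).
Proof.
have imp d' : on_side s (inr d') -> on_side s (inr (drev d')).
  case/on_sideP => e [b [y [eb cb oy E]]]; case: y oy E => [//|k] ok /dart_item_inj kd.
  by apply/on_sideP; exists e, b, (inr (drev k)); split=> //; rewrite /= gdart_rev kd.
by apply/idP/idP => /imp //; rewrite drevK.
Qed.

Lemma on_side_src s d : on_side s (inr d) -> on_side s (inl (dsrc d)).
Proof.
case/on_sideP => e [b [y [eb cb oy E]]]; case: y oy E => [//|k] ok /dart_item_inj kd.
by apply/on_sideP; exists e, b, (inl (dsrc k)); split=> //; rewrite -kd dsrc_gdart.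
Qed.

(** The vertex spaces of the separated graph of graphs live here, all of them in the copy
    numbered false except one side of v. *)
Definition Twin : graph := gsum (fun _ : bool => VS X).

Definition twin (s : bool) : gmap (VS X) Twin := gsum_in (fun _ : bool => VS X) s.

Lemma twin_inj s : injective (twin s).
Proof. exact: (@gsum_in_inj _ (fun _ : bool => VS X) s). Qed.

Lemma twin_eq s s' x x' : twin s x = twin s' x' -> s = s' /\ x = x'.
Proof.
move=> E; have ss : s = s'.
  have := congr1 (fun z : item Twin => over z) E.
  by rewrite !(over_gsum_in (A := fun _ : bool => VS X)).
by subst s'; split=> //; exact: twin_inj E.
Qed.

Lemma twinP z : exists s x, z = twin s x.
Proof. by have [s [x ->]] := gsum_inP z; exists s, x. Qed.

Definition kept s (x : item (VS X)) : bool := if over x == v then on_side s x else ~~ s.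

Lemma kept_ok (e : edge Twin) b :
  kept (tag e) (inr (tagged e, false)) -> kept (tag (ends e b : vert Twin)) (inl (tagged (ends e b))).
Proof.
case: e => s e; rewrite /kept /=.
case: (tag e == v) => //.
by case: b => [|/on_side_src //]; rewrite -(on_side_rev s (e, false)) => /on_side_src.
Qed.

Definition TV : graph := @gsub Twin (fun p => kept (tag p) (inl (tagged p)))
  (fun e => kept (tag e) (inr (tagged e, false))) kept_ok.

Definition TV_in : gmap TV Twin := gsub_in kept_ok.

Lemma kept_rev s e b : kept s (inr (e, b)) = kept s (inr (e, false)).
Proof. by rewrite /kept /=; case: b; rewrite // -(on_side_rev s (e, false)). Qed.

Lemma TV_image s x : (exists y, TV_in y = twin s x) <-> kept s x.
Proof.
rewrite gsub_inP; case: x => [p|[e b]] //=.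
by rewrite (kept_rev s e b).
Qed.

Definition on_both x := on_side false x && on_side true x.

Lemma both_ok e b : on_both (inr (e, false)) -> on_both (inl (ends e b)).
Proof.
rewrite /on_both => /andP[eF eT]; case: b.
  by rewrite -[ends e true]/(dsrc (e, true)) !on_side_src // (on_side_rev _ (e, false)).
by rewrite -[ends e false]/(dsrc (e, false)) !on_side_src.
Qed.

Definition Meet : graph := gsub (P := fun p => on_both (inl p)) both_ok.
Definition Meet_in : gmap Meet (VS X) := gsub_in both_ok.

Lemma both_rev e b : on_both (inr (e, b)) = on_both (inr (e, false)).
Proof. by rewrite /on_both; case: b; rewrite // -!(on_side_rev _ (e, false)). Qed.

Lemma Meet_image x : (exists y, Meet_in y = x) <-> on_both x.
Proof. by rewrite gsub_inP; case: x => [p|[e b]] //=; rewrite (both_rev e b). Qed.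

Lemma Meet_both n : on_both (Meet_in n). Proof. by apply/Meet_image; exists n. Qed.

Definition copy b (e : uedge X) : bool := (uend X e b == v) && cls e b.

Definition edge_end (b : bool) : gmap (ES X) Twin.
Proof.
refine (@Gmap (ES X) Twin
  (fun q => existT (fun _ : bool => vert (VS X)) (copy b (tag q)) (gvert (att X b) q))
  (fun a => existT (fun _ : bool => edge (VS X)) (copy b (tag a)) (gedge (att X b) a))
  (gflip (att X b)) _).
move=> a c; exact: (congr1 (fun q => existT (fun _ : bool => vert (VS X)) (copy b (tag a)) q)
  (gmap_ends (att X b) a c)).
Defined.

Lemma edge_endE b x : edge_end b x = twin (copy b (over x)) (att X b x).
Proof. by case: x => [q|[a c]] //=; rewrite /gdart /= addbF. Qed.

Definition cell_end (b : bool) : gmap (gplus (ES X) Meet) Twin :=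
  gcase (edge_end b) (gcomp (twin b) Meet_in).

Lemma cell_end_l b x :
  cell_end b (ginl _ _ x) = twin (copy b (over x)) (att X b x).
Proof. by rewrite /cell_end gcaseEl edge_endE. Qed.

Lemma cell_end_r b n :
  cell_end b (ginr _ _ n) = twin b (Meet_in n).
Proof. by rewrite /cell_end gcaseEr gcompE. Qed.

Lemma kept_att b x : kept (copy b (over x)) (att X b x).
Proof.
rewrite /kept over_att /copy; case: eqP => //= xv.
exact: on_side_att.
Qed.

Lemma kept_both s x : on_both x -> kept s x.
Proof.
move=> /andP[xF xT]; rewrite /kept (on_side_over xF) eqxx.
by case: s.
Qed.

Lemma TV_end_exists : exists f : bool -> gmap (gplus (ES X) Meet) TV,
  forall b x, TV_in (f b x) = cell_end b x.
Proof.
have /choice [f fE] : forall b, exists f : gmap (gplus (ES X) Meet) TV,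
    forall x, TV_in (f x) = cell_end b x; last by exists f.
move=> b; apply: glift => [|x]; first exact: gsub_in_inj.
have [[y ->]|[n ->]] := gplusP x.
  by rewrite cell_end_l; apply/TV_image; exact: kept_att.
by rewrite cell_end_r; apply/TV_image; apply: kept_both; exact: Meet_both.
Qed.

Definition piece (x : vert (gplus (ES X) Meet)) : option (uedge X) :=
  if x is inl q then Some (tag q) else None.

Lemma cell_end_inj b x y : piece (ivert x) = piece (ivert y) -> cell_end b x = cell_end b y -> x = y.
Proof.
have [[x' ->]|[n ->]] := gplusP x; have [[y' ->]|[n' ->]] := gplusP y; rewrite !ivert_map //=.
  rewrite !over_ivert !cell_end_l => -[oxy]; rewrite oxy => /twin_inj /att_inj -> //.
by rewrite !cell_end_r => _ /twin_inj /gsub_in_inj ->.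
Qed.

Variable tv_end : bool -> gmap (gplus (ES X) Meet) TV.
Hypothesis tv_endE : forall b x, TV_in (tv_end b x) = cell_end b x.

Lemma TV_index (p : vert TV) : (tag (tagged (val p)) == v) || ~~ tag (val p).
Proof. by have := valP p; rewrite /kept /=; case: eqP. Qed.

Lemma end_index (w : option (uedge X)) b :
  ((if w is Some e then uend X e b else v) == v) || ~~ (if w is Some e then copy b e else b).
Proof. by case: w => [e|]; rewrite ?eqxx // /copy; case: eqP. Qed.

Definition side_vert : finType := {u : uvert X * bool | (u.1 == v) || ~~ u.2}.

Definition side_end (w : option (uedge X)) b : side_vert :=
  exist _ (if w is Some e then uend X e b else v, if w is Some e then copy b e else b) (end_index w b).

Lemma tv_end_vert b q : val (gvert (tv_end b) q) = gvert (cell_end b) q.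
Proof. by have := tv_endE b (inl q) => -[]. Qed.

Lemma tv_end_inj b x y : piece (ivert x) = piece (ivert y) -> tv_end b x = tv_end b y -> x = y.
Proof. by move=> pxy xy; apply: (cell_end_inj pxy (b := b)); rewrite -!tv_endE xy. Qed.

Lemma Meet_over (n : vert Meet) : tag (val n) = v.
Proof.
by have /andP[/on_side_over nv _] := valP n; exact: nv.
Qed.

Definition separate_blueprint : blueprint.
Proof.
refine (@Blueprint side_vert (option (uedge X)) side_end TV (gplus (ES X) Meet)
  (fun p => exist _ (tag (tagged (val p)), tag (val p)) (TV_index p)) piece _ _ tv_end _ _ _
  (ucirc X) (cspace X) (mono X)).
- by move=> [[s [u e]] ke] b; exact: val_inj.
- by case=> [[u a]|n] b.
- move=> b q; apply: val_inj; rewrite /= tv_end_vert.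
  case: q => [[w q]|n] /=; first by congr (_, _).
  by rewrite Meet_over.
- by move=> b p q pq E; have [] := @tv_end_inj b (inl p) (inl q) pq (congr1 inl E).
- move=> b e f pq E.
  pose x : item (gplus (ES X) Meet) := inr (e, gflip (tv_end b) e).
  pose y : item (gplus (ES X) Meet) := inr (f, gflip (tv_end b) f).
  suff : x = y by case.
  apply: (@tv_end_inj b x y).
    by move: pq; rewrite /x /y /= /dsrc /=; case: (e); case: (f).
  by apply: (congr1 inr); rewrite /gdart [LHS]/= [RHS]/= !addbb; congr (_, _).
Defined.

Definition separated : gog := build separate_blueprint.
Notation Y := separated.

Definition qV : gmap (VS Y) Twin := gcomp TV_in (jV separate_blueprint).
Definition rE : gmap (ES Y) (gplus (ES X) Meet) := jE separate_blueprint.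

Lemma qV_inj : injective qV.
Proof.
move=> x y; rewrite !gcompE => /gsub_in_inj; apply: giso_inj; exact: jV_iso.
Qed.

Lemma qV_image s x : (exists y, qV y = twin s x) <-> kept s x.
Proof.
rewrite -TV_image; split=> [[y <-]|[y <-]]; first by exists (jV separate_blueprint y); rewrite gcompE.
by have [z <-] := giso_surj (jV_iso separate_blueprint) y; exists z; rewrite gcompE.
Qed.

Lemma rE_iso : giso rE. Proof. exact: jE_iso. Qed.

Lemma qV_att b x : qV (att Y b x) = cell_end b (rE x).
Proof.
rewrite gcompE -tv_endE; have -> // : jV separate_blueprint (att Y b x) = tv_end b (rE x).
exact: (@jVatt separate_blueprint).
Qed.

Lemma over_qV y s x : qV y = twin s x -> val (over y) = (over x, s).
Proof.
move=> E; rewrite -over_ivert -[tag _]over_jV.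
have := congr1 (@ivert _) E; rewrite !ivert_map /=.
by move=> ->; rewrite /= over_ivert.
Qed.

Lemma over_rE x : over x = piece (ivert (rE x)).
Proof. by rewrite -over_ivert -[tag _]over_jE ivert_map. Qed.
End Separate.

(** The result of a separation, with its cells named by those of X: a vertex by the vertex
    it comes from and the number of the copy, the new edge by None. *)
Record separation X (v : uvert X) (cls : uedge X -> bool -> bool) (Y : gog) := Separation {
  sepU : uvert Y -> uvert X * bool;
  sepU_inj : injective sepU;
  sepU_image : forall u s, (exists u', sepU u' = (u, s)) <-> (u == v) || ~~ s;
  sepW : uedge Y -> option (uedge X);
  sepW_inj : injective sepW;
  sepW_surj : forall o, exists w, sepW w = o;
  sepW_end : forall w b,
    sepU (uend Y w b) = if sepW w is Some e then (uend X e b, copy v cls b e) else (v, b);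
  sepV : gmap (VS Y) (Twin X);
  sepV_inj : injective sepV;
  sepV_image : forall s x, (exists y, sepV y = twin X s x) <-> kept v cls s x;
  sepE : gmap (ES Y) (gplus (ES X) (Meet v cls));
  sepE_iso : giso sepE;
  sepV_att : forall b x, sepV (att Y b x) = cell_end v cls b (sepE x);
  sepV_over : forall y s x, sepV y = twin X s x -> sepU (over y) = (over x, s);
  sepE_over : forall x, sepW (over x) = piece (ivert (sepE x));
  sepC : gmap (CS Y) (CS X);
  sepC_iso : giso sepC;
  sepC_mono : forall x, sepC (monodromy Y x) = monodromy X (sepC x);
  sep_circ : same_circles Y X }.

Lemma separation_exists X (v : uvert X) cls : exists Y (S : separation v cls Y), True.
Proof.
have [f fE] := TV_end_exists v cls; pose Y := separated fE.
have uinj : injective (fun u : uvert Y => val (u : side_vert v)) by move=> x y /val_inj.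
have uimage u s : (exists u' : uvert Y, val (u' : side_vert v) = (u, s)) <-> (u == v) || ~~ s.
  split=> [[u' uE]|us]; first by have := valP (u' : side_vert v); rewrite uE.
  by exists (exist _ (u, s) us : side_vert v).
have circ : same_circles Y X.
  exists id, (gid _); split; [by exists id | exact: giso_id | by move=> x; rewrite gidE |].
  by move=> x; rewrite !gidE.
unshelve eexists Y, (@Separation X v cls Y (fun u => val (u : side_vert v)) uinj uimage
  (fun w => w) (fun x y xy => xy) _ _ (qV fE) (@qV_inj _ _ _ _ fE) (@qV_image _ _ _ _ fE)
  (rE fE) (@rE_iso _ _ _ _ fE) (@qV_att _ _ _ _ fE) (@over_qV _ _ _ _ fE) (@over_rE _ _ _ _ fE)
  (gid _) (@giso_id _) _ circ).
- by move=> o; exists o.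
- by move=> [e|] b.
- by move=> x; rewrite !gidE.
- by [].
Qed.

Definition untwin X : gmap (Twin X) (VS X) := gsum_case (fun _ : bool => gid (VS X)).

Lemma untwinE X s x : untwin X (twin X s x) = x.
Proof. by rewrite /untwin (@gsum_caseE _ (fun _ : bool => VS X)) gidE. Qed.

Section Separation.
Variables (X Y : gog) (v : uvert X) (cls : uedge X -> bool -> bool).
Variable S : separation v cls Y.
Notation sV := (sepV S).
Notation sE := (sepE S).
Notation sU := (sepU S).
Notation sW := (sepW S).
Notation on_side := (on_side v cls).
Notation both := (on_both v cls).

Lemma sepVP y : exists s x, [/\ sV y = twin X s x, kept v cls s x & sU (over y) = (over x, s)].
Proof.
have [s [x sx]] := twinP (sV y); exists s, x; split=> //; first by apply/(sepV_image S); exists y.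
exact: sepV_over sx.
Qed.

Lemma separation_separate : (exists p, on_side false (inl p) /\ on_side true (inl p)) -> separate X Y.
Proof.
move=> [p [pF pT]]; exists v, cls; split.
- by exists p; split; [exact/on_sideP | exact/on_sideP].
- exact: sep_circ S.
have wP s : exists u, sU u = (v, s) by apply/(sepU_image S); rewrite eqxx.
have /choice [w wE] := wP.
have /choice [ie ieE] := fun e => sepW_surj S (Some e).
have [e0 e0E] := sepW_surj S None.
have [iE iEE] : exists f : gmap (ES X) (ES Y), forall x, sE (f x) = ginl _ _ x.
  apply: glift => [|x]; first exact: giso_inj (sepE_iso S).
  by have [y yx] := giso_surj (sepE_iso S) (ginl _ _ x); exists y.
have over_None y : sW (over y) = None -> exists n, sE y = ginr _ _ n.
  rewrite (sepE_over S); have [[x ->]|[n ->]] := gplusP (sE y); first by rewrite ivert_map.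
  by exists n.
have over_e0 y : over y = e0 -> exists n, sE y = ginr _ _ n by move=> oy; apply: over_None; rewrite oy.
have [fN fNE] : exists f : gmap (espace Y e0) (Meet v cls),
    forall z, ginr (ES X) (Meet v cls) (f z) = gcomp sE (gsum_in _ e0) z.
  apply: glift => [|z]; first exact: ginr_inj.
  have [n nz] : exists n, sE (gsum_in _ e0 z) = ginr _ _ n by apply: over_e0; rewrite over_gsum_in.
  by exists n; rewrite gcompE nz.
have iE_over x : over (iE x) = ie (over x).
  by apply: (@sepW_inj _ _ _ _ S); rewrite (sepE_over S) iEE ivert_map ieE /= over_ivert.
pose pV := gcomp (untwin X) sV.
have pVE y s x : sV y = twin X s x -> pV y = x by move=> yE; rewrite gcompE yE untwinE.
exists (fun u => (sU u).1), w, pV, ie, e0, iE, (gcomp (Meet_in v cls) fN); split.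
- split=> [E|u|u uv].
  + by have := wE true; rewrite -E wE.
  + split=> [uv|[s ->]]; last by rewrite wE.
    by exists (sU u).2; apply: (@sepU_inj _ _ _ _ S); rewrite wE; case: (sU u) uv => a b /= ->.
  + have [u' u'E] : exists u', sU u' = (u, false) by apply/(sepU_image S); rewrite orbT.
    exists u'; split=> [|u2 u2E]; first by rewrite u'E.
    apply: (@sepU_inj _ _ _ _ S); rewrite u'E; case E: (sU u2) u2E => [a s] /= au; subst a.
    have : (u == v) || ~~ s by apply/(sepU_image S); exists u2.
    by case: eqP => //= _ /negbTE ->.
- split=> [y|s x|x xv|y y'].
  + by have [s [x [yE _ ->]]] := sepVP y; rewrite (pVE _ _ _ yE).
  + split=> [/on_sideP sx|[y [yw <-]]].
      have [y yE] : exists y, sV y = twin X s x.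
        by apply/(sepV_image S); rewrite /kept (on_side_over sx) eqxx.
      exists y; split; last exact: pVE yE.
      by apply: (@sepU_inj _ _ _ _ S); rewrite (sepV_over yE) wE (on_side_over sx).
    have [s' [x' [yE kx yU]]] := sepVP y; rewrite (pVE _ _ _ yE); apply/on_sideP.
    by move: yU kx; rewrite yw wE => -[vx <-]; rewrite /kept -vx eqxx.
  + have [y yE] : exists y, sV y = twin X false x by apply/(sepV_image S); rewrite /kept; case: eqP.
    by exists y; exact: pVE yE.
  + have [s [x [yE _ yU]]] := sepVP y; have [s' [x' [yE' _ yU']]] := sepVP y'.
    move=> oy; rewrite (pVE _ _ _ yE) (pVE _ _ _ yE') => xx; apply: (@sepV_inj _ _ _ _ S).
    by rewrite yE yE' xx; move: yU; rewrite oy yU' => -[_ ->].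
- split=> [e e' /(congr1 sW)|e|s|e b].
  + by rewrite !ieE => -[].
  + split=> [[e' <-] E|ne]; first by have := ieE e'; rewrite E e0E.
    case E: (sW e) => [e'|]; last by case: ne; apply: (@sepW_inj _ _ _ _ S); rewrite E e0E.
    by exists e'; apply: (@sepW_inj _ _ _ _ S); rewrite ieE E.
  + by apply: (@sepU_inj _ _ _ _ S); rewrite (sepW_end S) e0E wE.
  + have E : sU (uend Y (ie e) b) = (uend X e b, copy v cls b e) by rewrite (sepW_end S) ieE.
    case: eqP => ev; last by rewrite E.
    by apply: (@sepU_inj _ _ _ _ S); rewrite E wE /copy ev eqxx.
- split=> [x y /(congr1 (gitem sE))|y|x|b x].
  + by rewrite !iEE => /ginl_inj.
  + split=> [[x <-]|ne].
      by rewrite iE_over => E; have := ieE (over x); rewrite E e0E.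
    have [[x xE]|[n nE]] := gplusP (sE y).
      by exists x; apply: (giso_inj (sepE_iso S)); rewrite iEE xE.
    by case: ne; apply: (@sepW_inj _ _ _ _ S); rewrite (sepE_over S) nE ivert_map e0E.
  + exact: iE_over.
  + by apply: (pVE _ (copy v cls b (over x))); rewrite (sepV_att S) iEE cell_end_l.
- split=> [x y|x|s z].
  + rewrite !gcompE => /gsub_in_inj E; apply: (@gsum_in_inj _ (espace Y) e0).
    apply: (giso_inj (sepE_iso S)); have := fNE x; have := fNE y; rewrite !gcompE => <- <-.
    by rewrite E.
  + have -> : (side_image v cls false x /\ side_image v cls true x) <-> both x.
      by split=> [[/on_sideP xF /on_sideP xT]|/andP[/on_sideP xF /on_sideP xT]] //; apply/andP.
    rewrite -Meet_image; split=> [[z zx]|[n nx]]; first by exists (fN z); rewrite -gcompE.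
    have [y yE] := giso_surj (sepE_iso S) (ginr _ _ n).
    have oy : over y = e0 by apply: (@sepW_inj _ _ _ _ S); rewrite (sepE_over S) yE ivert_map e0E.
    have [e [z zE]] := gsum_inP y; have ee : e = e0 by rewrite -oy zE over_gsum_in.
    subst e; exists z; rewrite gcompE -nx; congr (gitem (Meet_in v cls) _).
    by apply: (@ginr_inj (ES X)); rewrite fNE gcompE -zE yE.
  + rewrite gcompE; apply: (pVE _ s); rewrite (sepV_att S).
    by have := fNE z; rewrite gcompE => <-; rewrite cell_end_r.
Qed.

Hypothesis covered : forall x, over x = v -> on_side false x || on_side true x.

Lemma kept_some x : kept v cls (~~ kept v cls false x) x.
Proof.
have := @covered x; rewrite /kept; case: eqP => [-> /(_ erefl)|_ _ //].
by case E: (on_side false x) => //=; rewrite ?E.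
Qed.

Lemma kept_twice x : kept v cls false x -> kept v cls true x -> both x.
Proof. by rewrite /kept /on_both; case: eqP => // _ -> ->. Qed.

(** A point on both sides gives one more vertex and one more edge of the horizontal graph. *)
Lemma separation_euler : same_euler Y X.
Proof.
rewrite /same_euler; have -> : #|vert (ES Y)| = #|vert (ES X)| + #|vert (Meet v cls)|.
  by rewrite (bij_eq_card (sepE_iso S).1) card_sum.
suff -> : #|vert (VS Y)| = #|vert (VS X)| + #|vert (Meet v cls)| by lia.
have place s p : kept v cls s (inl p) -> exists q, gvert sV q = gvert (twin X s) p.
  by move=> /(sepV_image S) [[q|//] [qE]]; exists q; rewrite qE.
have /choice [f fE] := fun p : vert (VS X) => place _ p (kept_some (inl p)).
have /choice [g gE] := fun n : vert (Meet v cls) =>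
  place true (val n) (kept_both true (Meet_both (inl n))).
(* A point on both sides stands for its copy numbered false, and as a point of the new edge for the other copy. *)
pose psi (z : vert (VS X) + vert (Meet v cls)) := match z with inl p => f p | inr n => g n end.
suff psi_bij : bijective psi by rewrite -(bij_eq_card psi_bij) card_sum.
have tE s s' p p' : gvert (twin X s) p = gvert (twin X s') p' -> s = s' /\ p = p'.
  by move=> E; have [-> [->]] := @twin_eq X s s' (inl p) (inl p') (congr1 inl E).
have cross p n : f p <> g n.
  move=> /(congr1 (gvert sV)); rewrite fE gE => /tE [nk pE]; move: nk.
  by rewrite pE (kept_both false (Meet_both (inl n))).
apply: inj_surj_bij.
  move=> [p|n] [p'|n'] //=.
  - by move=> /(congr1 (gvert sV)); rewrite !fE => /tE [_ ->].
  - by move/cross.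
  - by move/esym/cross.
  - by move=> /(congr1 (gvert sV)); rewrite !gE => /tE [_ /val_inj ->].
move=> q; have [s [x [qE kx _]]] := sepVP (inl q).
case: x qE kx => [p|d] // qE kx; have {}qE : gvert sV q = gvert (twin X s) p by case: qE => ->.
have sV_vinj := item_inj_vert (@sepV_inj _ _ _ _ S).
have [kF|nF] := boolP (kept v cls false (inl p)); last first.
  exists (inl p); apply: sV_vinj; rewrite /= fE qE nF /=.
  by case: s kx {qE} => // kx; rewrite kx in nF.
case: s qE kx => qE kx; last by exists (inl p); apply: sV_vinj; rewrite /= fE qE kF.
have /Meet_image [[n|//] [np]] := kept_twice kF kx.
by exists (inr n); apply: sV_vinj; rewrite /= gE qE -np.
Qed.

Lemma Vat_ok (e : edge (VS X)) b : tag e == v -> tag (ends e b) == v.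
Proof. exact. Qed.

Definition Vat : graph := @gsub (VS X) (fun p => tag p == v) (fun e => tag e == v) Vat_ok.
Definition Vat_in : gmap Vat (VS X) := gsub_in Vat_ok.

Lemma Vat_image x : (exists n, Vat_in n = x) <-> over x = v.
Proof. by rewrite gsub_inP; case: x => [p|d] /=; split=> /eqP. Qed.

Definition Vat_l : gmap Vat (gplus (VS X) (CS X)) := gcomp (ginl _ _) Vat_in.

Definition twin_of : gmap (gplus (gplus (VS X) (CS X)) Vat) (gplus (Twin X) (CS X)) :=
  gcase (gplus_map (twin X false) (gid _)) (gcomp (ginl _ _) (gcomp (twin X true) Vat_in)).

Lemma twin_of_l x : twin_of (ginl _ _ (ginl _ _ x)) = ginl _ _ (twin X false x).
Proof. by rewrite /twin_of gcaseEl gplus_mapEl. Qed.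

Lemma twin_of_c x : twin_of (ginl _ _ (ginr _ _ x)) = ginr _ _ x.
Proof. by rewrite /twin_of gcaseEl gplus_mapEr gidE. Qed.

Lemma twin_of_r n : twin_of (ginr _ _ n) = ginl _ _ (twin X true (Vat_in n)).
Proof. by rewrite /twin_of gcaseEr !gcompE. Qed.

Lemma gplus3P (A B C : graph) (z : item (gplus (gplus A B) C)) :
  [\/ exists x, z = ginl _ _ (ginl _ _ x), exists x, z = ginl _ _ (ginr _ _ x) | exists x, z = ginr _ _ x].
Proof.
have [[y ->]|[x ->]] := gplusP z; last by apply: Or33; exists x.
by have [[x ->]|[x ->]] := gplusP y; [apply: Or31; exists x | apply: Or32; exists x].
Qed.

Lemma twin_of_inj : injective twin_of.
Proof.
move=> x y; have [[a ->]|[a ->]|[a ->]] := gplus3P x; have [[b ->]|[b ->]|[b ->]] := gplus3P y;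
  rewrite ?twin_of_l ?twin_of_c ?twin_of_r.
- by move/ginl_inj/twin_inj ->.
- by move/ginlr.
- by move/ginl_inj/twin_eq => -[].
- by move/esym/ginlr.
- by move/ginr_inj ->.
- by move/esym/ginlr.
- by move/ginl_inj/twin_eq => -[].
- by move/ginlr.
- by move/ginl_inj/twin_inj/gsub_in_inj ->.
Qed.

Lemma end_exists : exists a : bool -> gmap (gplus (ES X) (CS X)) (gplus (gplus (VS X) (CS X)) Vat),
  forall b x, twin_of (a b x) =
    gplus_map (edge_end v cls b) (if b then gid _ else monodromy X) x.
Proof.
have /choice [f fE] : forall b, exists f : gmap (gplus (ES X) (CS X)) (gplus (gplus (VS X) (CS X)) Vat),
    forall x, twin_of (f x) = gplus_map (edge_end v cls b) (if b then gid _ else monodromy X) x; last by exists f.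
move=> b; apply: glift => [|x]; first exact: twin_of_inj.
have [[y ->]|[c ->]] := gplusP x; last by exists (ginl _ _ (ginr _ _ ((if b then gid _ else monodromy X) c))); rewrite twin_of_c gplus_mapEr.
rewrite gplus_mapEl edge_endE; case E: (copy v cls b (over y)).
  have /Vat_image [n nE] : over (att X b y) = v by rewrite over_att; case/andP: E => /eqP.
  by exists (ginr _ _ n); rewrite twin_of_r nE.
by exists (ginl _ _ (ginl _ _ (att X b y))); rewrite twin_of_l.
Qed.

(** The vertex space is doubled along a product, which does not change the homotopy type,
    and the two copies are trimmed to the two sides. *)
Lemma separation_flat (R : realType) : fheq R (flat_of Y) (flat_of X).
Proof.
have [a aE] := end_exists.
have h_inj : injective Vat_l by move=> x y; rewrite !gcompE => /ginl_inj /gsub_in_inj.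
pose sdN s n := on_side s (Vat_in n).
have collapse : fheq R (collapsed_flat Vat_l a) (flat_of X).
  apply: flat_iso_heq; exists (gid _), (gid _); split; [exact: giso_id | exact: giso_id | move=> b x].
  have back z : gcase (gid _) Vat_l z = gplus_map (untwin X) (gid _) (twin_of z).
    have [[y ->]|[y ->]|[y ->]] := gplus3P z; rewrite ?twin_of_l ?twin_of_c ?twin_of_r.
    - by rewrite gcaseEl gidE gplus_mapEl untwinE.
    - by rewrite gcaseEl gidE gplus_mapEr gidE.
    - by rewrite gcaseEr gcompE gplus_mapEl untwinE.
  rewrite !gidE; have -> : fa (collapsed_flat Vat_l a) b x = gcase (gid _) Vat_l (a b x) by exact: gcompE.
  rewrite back aE; have [[y ->]|[y ->]] := gplusP x.
    by rewrite !gplus_mapEl edge_endE untwinE.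
  by rewrite !gplus_mapEr gidE.
apply: heq_trans collapse.
have [k kE] : exists k : gmap (Meet v cls) Vat, forall n, Vat_in (k n) = Meet_in v cls n.
  apply: glift => [|n]; first exact: gsub_in_inj.
  by apply/Vat_image; have /andP[/on_side_over] := Meet_both n.
pose jE : gmap (gplus (ES Y) (CS Y)) (gplus (gplus (ES X) (CS X)) Vat) :=
  gcase (gcomp (gcase (gcomp (ginl _ _) (ginl _ _)) (gcomp (ginr _ _) k)) sE)
    (gcomp (gcomp (ginl _ _) (ginr _ _)) (sepC S)).
have jE_l y x : sE y = ginl _ _ x -> jE (ginl _ _ y) = ginl _ _ (ginl _ _ x).
  by move=> yx; rewrite gcaseEl gcompE yx gcaseEl gcompE.
have jE_r y n : sE y = ginr _ _ n -> jE (ginl _ _ y) = ginr _ _ (k n).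
  by move=> yx; rewrite gcaseEl gcompE yx gcaseEr gcompE.
have jE_c c : jE (ginr _ _ c) = ginl _ _ (ginr _ _ (sepC S c)) by rewrite gcaseEr !gcompE.
have [jV jVE] : exists j : gmap (gplus (VS Y) (CS Y)) (gplus (gplus (VS X) (CS X)) Vat),
    forall y, twin_of (j y) = gplus_map sV (sepC S) y.
  apply: glift => [|y]; first exact: twin_of_inj.
  have [[z ->]|[c ->]] := gplusP y; last first.
    by exists (ginl _ _ (ginr _ _ (sepC S c))); rewrite twin_of_c gplus_mapEr.
  have [s [x [zE kx _]]] := sepVP z; rewrite gplus_mapEl zE; case: s zE kx => zE kx.
    have /Vat_image [n nx] : over x = v by move: kx; rewrite /kept; case: eqP.
    by exists (ginr _ _ n); rewrite twin_of_r nx.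
  by exists (ginl _ _ (ginl _ _ x)); rewrite twin_of_l.
have k_inj : injective k.
  by move=> x y xy; apply: (@gsub_in_inj _ _ _ (@both_ok X v cls)); rewrite -!kE xy.
have sC_inj := giso_inj (sepC_iso S).
have sE_inj := giso_inj (sepE_iso S).
apply: (@pull_apart_heq R _ _ Vat Vat_l a sdN h_inj _ _ _ _ _ (flat_of Y) jV jE).
- by move=> s d; rewrite /sdN -[Vat_in _]/(inr (gdart Vat_in (drev d))) gdart_rev on_side_rev.
- move=> s d; rewrite /sdN -[Vat_in (inr d)]/(inr (gdart Vat_in d)) => /on_side_src.
  by rewrite dsrc_gdart.
- by move=> n; apply: covered; apply/Vat_image; exists n.
- move=> b e n /(congr1 (gitem twin_of)); rewrite aE -[Vat_l n]/(Vat_l n) gcompE twin_of_l.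
  have [[x ->]|[c ->]] := gplusP e; last by rewrite gplus_mapEr => /esym/ginlr.
  rewrite gplus_mapEl edge_endE => /ginl_inj/twin_eq [cF xn]; rewrite /sdN -xn.
  have xv : uend X (over x) b = v by rewrite -over_att xn; apply/Vat_image; exists n.
  by move: cF; rewrite /copy xv eqxx /= => <-; exact: on_side_att.
- move=> b e n /(congr1 (gitem twin_of)); rewrite aE twin_of_r.
  have [[x ->]|[c ->]] := gplusP e; last by rewrite gplus_mapEr => /esym/ginlr.
  rewrite gplus_mapEl edge_endE => /ginl_inj/twin_eq [cF xn]; rewrite /sdN -xn.
  have xv : uend X (over x) b = v by rewrite -over_att xn; apply/Vat_image; exists n.
  by move: cF; rewrite /copy xv eqxx /= => <-; exact: on_side_att.
split.
- move=> x y xy; have := congr1 (gitem twin_of) xy; rewrite !jVE.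
  by apply: gplus_map_inj => //; exact: sepV_inj.
- move=> x y; have [[x' ->]|[c ->]] := gplusP x; have [[y' ->]|[c' ->]] := gplusP y.
  + have [[z xz]|[z xz]] := gplusP (sE x'); have [[w yw]|[w yw]] := gplusP (sE y');
      rewrite ?(jE_l _ _ xz) ?(jE_r _ _ xz) ?(jE_l _ _ yw) ?(jE_r _ _ yw).
    * by move=> /ginl_inj/ginl_inj zw; congr (gitem (ginl _ _) _); apply: sE_inj; rewrite xz yw zw.
    * by move/ginlr.
    * by move/esym/ginlr.
    * by move=> /ginr_inj/k_inj zw; congr (gitem (ginl _ _) _); apply: sE_inj; rewrite xz yw zw.
  + rewrite jE_c; have [[z xz]|[z xz]] := gplusP (sE x'); rewrite ?(jE_l _ _ xz) ?(jE_r _ _ xz).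
      by move=> /ginl_inj/ginlr.
    by move/esym/ginlr.
  + rewrite jE_c; have [[z xz]|[z xz]] := gplusP (sE y'); rewrite ?(jE_l _ _ xz) ?(jE_r _ _ xz).
      by move=> /ginl_inj/esym/ginlr.
    by move/ginlr.
  + by rewrite !jE_c => /ginl_inj/ginr_inj/sC_inj ->.
- move=> b y; apply: twin_of_inj; rewrite jVE.
  have [[x ->]|[c ->]] := gplusP y.
    have -> : fa (flat_of Y) b (ginl _ _ x) = ginl _ _ (att Y b x) by exact: gplus_mapEl.
    rewrite gplus_mapEl (sepV_att S); have [[z xz]|[z xz]] := gplusP (sE x).
      by rewrite xz (jE_l _ _ xz) W_l aE gplus_mapEl cell_end_l edge_endE.
    rewrite xz (jE_r _ _ xz) cell_end_r -kE; case: b; first by rewrite W_T twin_of_r.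
    by rewrite W_F gcompE twin_of_l.
  have -> : fa (flat_of Y) b (ginr _ _ c) =
    ginr _ _ ((if b then gid _ else monodromy Y) c) by exact: gplus_mapEr.
  rewrite gplus_mapEr jE_c W_l aE gplus_mapEr; apply: (congr1 (ginr _ _)).
  by case: b; rewrite ?gidE // sepC_mono.
- move=> x; have [[z ->]|[c ->]|[n ->]] := gplus3P x.
  + split=> [_ [n [_ /ginlr]]|_] //; have [y yz] := giso_surj (sepE_iso S) (ginl _ _ z).
    by exists (ginl _ _ y); exact: jE_l.
  + split=> [_ [n [_ /ginlr]]|_] //; have [y yc] := giso_surj (sepC_iso S) c.
    by exists (ginr _ _ y); rewrite jE_c yc.
  + split=> [[y yn] [n' [nb /ginr_inj nn]]|nl].
      subst n'; have [[x' yE]|[c yE]] := gplusP y; last by move: yn; rewrite yE jE_c => /ginlr.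
      have [[z xz]|[z xz]] := gplusP (sE x'); move: yn; rewrite yE ?(jE_l _ _ xz) ?(jE_r _ _ xz).
        by move/ginlr.
      move=> /ginr_inj zn; move/negP: nb; apply; rewrite /in_both /sdN -zn kE.
      exact: Meet_both.
    have : both (Vat_in n) by apply: contraT => nb; case: nl; exists n.
    move=> /Meet_image [m mn]; have [y ym] := giso_surj (sepE_iso S) (ginr _ _ m).
    exists (ginl _ _ y); rewrite (jE_r _ _ ym); apply: (congr1 (ginr _ _)).
    by apply: (@gsub_in_inj _ _ _ Vat_ok); rewrite -/Vat_in kE mn.
- move=> z; have -> : (exists y, jV y = z) <-> exists y, gplus_map sV (sepC S) y = twin_of z.
    by split=> -[y yz]; exists y; [rewrite -jVE yz | apply: twin_of_inj; rewrite jVE].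
  have sV_plus s x : (exists y, gplus_map sV (sepC S) y = ginl _ _ (twin X s x)) <-> kept v cls s x.
    rewrite -(sepV_image S); split=> [[y]|[y yx]]; last by exists (ginl _ _ y); rewrite gplus_mapEl yx.
    have [[y' ->]|[c ->]] := gplusP y; last by rewrite gplus_mapEr => /esym/ginlr.
    by rewrite gplus_mapEl => /ginl_inj yx; exists y'.
  have [[x ->]|[c ->]|[n ->]] := gplus3P z.
  + rewrite twin_of_l sV_plus; split=> [kx [n [_ [[nF E]|[_ /ginlr]]]]|nl] //.
      move: E; rewrite gcompE => /ginl_inj/ginl_inj xn; move: kx nF; rewrite xn /kept.
      have /eqP -> := (Vat_image (Vat_in n)).1 (ex_intro _ n erefl).
      by rewrite /sdN => ->.
    rewrite /kept; case: eqP => // /Vat_image [n nx]; apply: contraT => nF; case: nl; exists n.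
    rewrite /in_both /sdN nx (negbTE nF); split=> //; left; split=> //.
    by rewrite gcompE nx.
  + rewrite twin_of_c; split=> [_ [n [_ [[_ E]|[_ /ginlr]]]]|_] //.
      by move: E; rewrite gcompE => /ginl_inj/esym/ginlr.
    have [y yc] := giso_surj (sepC_iso S) c; exists (ginr _ _ y); by rewrite gplus_mapEr yc.
  + rewrite twin_of_r sV_plus /kept.
    have /eqP -> := (Vat_image (Vat_in n)).1 (ex_intro _ n erefl).
    split=> [kx [n' [_ [[_ /esym/ginlr]|[nT /ginr_inj nn]]]]|nl] //.
      by move: nT; rewrite -nn /sdN kx.
    apply: contraT => nT; case: nl; exists n; rewrite /in_both /sdN (negbTE nT) andbF; split=> //.
    by right.
Qed.
End Separation.

(** * Properties kept by passing to components *)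

Lemma over_map (I J : finType) (A : I -> graph) (B : J -> graph) (f : gmap (gsum A) (gsum B)) :
  (forall i, gconnected (A i)) -> exists c : I -> J, forall x, over (f x) = c (over x).
Proof.
move=> /fiber_connectedP [ne cA]; have /choice [p pE] := ne.
exists (fun i => tag (gvert f (p i))) => x.
rewrite -over_ivert ivert_map; apply: connect_over; apply: connect_map; apply: cA.
by rewrite pE over_ivert.
Qed.

Section SplitKeeps.
Variables (X Y : gog) (iV : gmap (VS Y) (VS X)) (iE : gmap (ES Y) (ES X)).
Hypotheses (iV_iso : giso iV) (iE_iso : giso iE).
Hypothesis i_att : forall b x, iV (att Y b x) = att X b (iE x).
Hypothesis cY : connected_spaces Y.

(** The half-edges through a cell stay distinct, although an edge may become several. *)
Lemma split_through z : #|through (iV z)| <= #|through z|.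
Proof.
have [_ cE _] := cY; have [c cP] := over_map iE cE.
apply: leq_trans (leq_imset_card (fun h => (c h.1, h.2)) (through z)).
apply: subset_leq_card; apply/subsetP => h /throughP [y oy yz].
have [w wy] := giso_surj iE_iso y.
apply/imsetP; exists (over w, h.2); last by rewrite /= -cP wy oy; case: (h).
apply/throughP; exists w => //; apply: (giso_inj iV_iso).
by rewrite i_att wy.
Qed.

Lemma split_doubly_covered : doubly_covered X -> doubly_covered Y.
Proof.
move=> dX e; rewrite -(through_covers e false); apply: leq_trans (split_through _).
by rewrite -[iV _]/(inr (gdart iV (e, false))); case: (gdart _ _) => a s; rewrite through_covers.
Qed.

Lemma split_rich : rich (@incident (VS X) : vert (Hor X) -> Prop) ->
  rich (@incident (VS Y) : vert (Hor Y) -> Prop).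
Proof.
move=> [D [fD sD]].
apply: (@rich_pull (Hor X) (Hor Y) (@incident (VS X)) (@incident (VS Y))
  (gvert iV) (gvert iE : edge (Hor Y) -> edge (Hor X)) D) => //.
- exact: item_inj_vert (giso_inj iV_iso).
- move=> a b; exact: (square_vert (i_att b) a).
- move=> d _; have [[q|k] // [qd]] := giso_surj iE_iso (inl d.1).
  by exists q.
- move=> p [d dp]; have [[q|k] // kd] := giso_surj iV_iso (inr d).
  exists k; apply: (item_inj_vert (giso_inj iV_iso)); rewrite -dp -dsrc_gdart.
  by congr (dsrc _); exact: dart_item_inj kd.
Qed.

Lemma split_euler : same_euler Y X.
Proof. by rewrite /same_euler (bij_eq_card iV_iso.1) (bij_eq_card iE_iso.1) addnC. Qed.
End SplitKeeps.

(** * Separating and splitting creates a new branching vertex *)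

(** Here Z is obtained from the separated graph of graphs by passing to components; rho and
    tau tell where its vertices and edges come from. *)
Section Grown.
Variables (X Z : gog) (v : uvert X) (cls : uedge X -> bool -> bool).
Notation on_side := (on_side v cls).
Notation kept := (kept v cls).
Notation both := (on_both v cls).
Hypothesis tX : tame X.
Variables (qV : gmap (VS Z) (Twin X)) (qE : gmap (ES Z) (gplus (ES X) (Meet v cls))).
Variables (rho : uvert Z -> uvert X * bool) (tau : uedge Z -> option (uedge X)).
Hypothesis qV_inj : injective qV.
Hypothesis qV_image : forall s x, (exists y, qV y = twin X s x) <-> kept s x.
Hypothesis qE_iso : giso qE.
Hypothesis q_att : forall b x, qV (att Z b x) = cell_end v cls b (qE x).
Hypothesis rhoE : forall y s x, qV y = twin X s x -> rho (over y) = (over x, s).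
Hypothesis tauE : forall x, tau (over x) = piece (ivert (qE x)).

(** Some half-edge passes through every cell. *)
Lemma side_covered x : over x = v -> on_side false x || on_side true x.
Proof.
move=> xv; have := tame_item_covered tX x; rewrite ltnNge; apply: contraNT; rewrite negb_or => /andP[nF nT].
have -> : through x = set0; last by rewrite cards0.
apply/setP => h; rewrite in_set0; apply/negP => /throughP [y oy yx].
have := @on_side_att X v cls h.2 y; rewrite yx -over_att yx => /(_ xv).
by case: (cls _ _); [rewrite (negbTE nT) | rewrite (negbTE nF)].
Qed.

Lemma lift_half h s x z : h \in through x -> copy v cls h.2 h.1 = s -> qV z = twin X s x ->
  exists w, tau w = Some h.1 /\ (w, h.2) \in through z.
Proof.
move=> /throughP [y oy yx] cs zx; have [k ky] := giso_surj qE_iso (ginl _ _ y).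
exists (over k); split; first by rewrite tauE ky ivert_map /= over_ivert oy.
apply/throughP; exists k => //; apply: qV_inj.
by rewrite q_att ky cell_end_l zx oy cs yx.
Qed.

Lemma lift_both s x z : both x -> qV z = twin X s x ->
  exists w, tau w = None /\ (w, s) \in through z.
Proof.
move=> /Meet_image [n nx] zx; have [k kn] := giso_surj qE_iso (ginr _ _ n).
exists (over k); split; first by rewrite tauE kn ivert_map.
by apply/throughP; exists k => //; apply: qV_inj; rewrite q_att kn cell_end_r zx nx.
Qed.

Lemma lift_halves (A : {set uedge X * bool}) s x z : A \subset through x ->
  (forall h, h \in A -> copy v cls h.2 h.1 = s) -> qV z = twin X s x -> #|A| <= #|through z|.
Proof.
move=> Ax As zx; pose f (h : uedge Z * bool) := (tau h.1, h.2).
apply: leq_trans (leq_imset_card f (through z)).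
rewrite -(card_imset (mem A) (f := fun h : uedge X * bool => (Some h.1, h.2))); last by move=> [a b] [c d] [-> ->].
apply: subset_leq_card; apply/subsetP => _ /imsetP [h hA ->].
have [w [wh wz]] := lift_half (subsetP Ax h hA) (As h hA) zx.
by apply/imsetP; exists (w, h.2); rewrite // /f /= wh.
Qed.

Lemma twin_cell z : exists s x, qV z = twin X s x /\ kept s x.
Proof.
have [s [x zx]] := twinP (qV z); exists s, x; split=> //.
by apply/qV_image; exists z.
Qed.

(** A cell on one side only keeps all its half-edges; each copy of a cell on both sides is met by
    a half-edge of its class and by the new edge. *)
Lemma grown_item_covered : item_covered Z.
Proof.
move=> z; have iX := tame_item_covered tX; have [s [x [zx kx]]] := twin_cell z.
have end_x h : h \in through x -> uend X h.1 h.2 = over x by exact: through_end.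
have [xv|xv] := eqVneq (over x) v; last first.
  apply: leq_trans (iX x) (lift_halves (subxx _) _ zx) => h /end_x hx.
  by move: kx; rewrite /copy /kept hx (negbTE xv); case: s {zx}.
have sx : on_side s x by move: kx; rewrite /kept xv eqxx.
have cls_sd h : h \in through x -> on_side (cls h.1 h.2) x.
  move=> hx; have := end_x h hx; rewrite xv; case/throughP: hx => y <- <-; exact: on_side_att.
have [bx|nb] := boolP (both x).
  have [e [b [y [eb cb oy yx]]]] : side_image v cls s x by exact/on_sideP.
  have hx : (e, b) \in through x by apply/throughP; exists y.
  have [|w1 [we1 wz1]] := lift_half (s := s) hx _ zx; first by rewrite /copy /= eb eqxx.
  have [w2 [we2 wz2]] := lift_both bx zx.
  apply/card_gt1P; exists (w1, b), (w2, s); split=> //.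
  by apply/eqP => -[ww _]; move: we1; rewrite ww we2.
apply: leq_trans (iX x) (lift_halves (subxx _) _ zx) => h hx.
rewrite /copy end_x // xv eqxx /=; have := cls_sd h hx; move: nb sx; rewrite /on_both.
by case: (s); case: (cls _ _) => // /negP nb sx sx'; case: nb; rewrite sx sx'.
Qed.

Lemma cell_src z s d : qV z = twin X s (inr d) ->
  exists z', qV z' = twin X s (inl (dsrc d)) /\ over z' = over z.
Proof.
case: z => [p|k] zd; first by [].
exists (inl (dsrc k)); split=> //.
have := congr1 (fun x => inl (ivert x) : item (Twin X)) zd; rewrite !ivert_map.
exact: id.
Qed.

Lemma cell_tgt z s d : qV z = twin X s (inr d) ->
  exists z', qV z' = twin X s (inl (dsrc (drev d))) /\ over z' = over z.
Proof.
case: z => [p|k] zd; first by [].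
have zd' : qV (inr (drev k)) = twin X s (inr (drev d)).
  rewrite -[qV _]/(inr (gdart qV (drev k))) -[twin X s _]/(inr (gdart (twin X s) (drev d))).
  by rewrite !gdart_rev (dart_item_inj zd).
have [z' [z'E oz]] := cell_src zd'; exists z'; split=> //.
Qed.

(** A path of the vertex space can be followed within a component of a side until it first
    meets the other side. *)
Lemma walk s (P : item (VS X) -> Prop) z p p' :
  (forall d, P (inl (dsrc d)) -> kept s (inl (dsrc d)) ->
     (kept s (inr d) /\ P (inl (dsrc (drev d)))) \/ on_both v cls (inl (dsrc d))) ->
  qV z = twin X s (inl p) -> P (inl p) -> connect (@adj (VS X)) p p' ->
  exists z' q, [/\ qV z' = twin X s (inl q), over z' = over z & q = p' \/ both (inl q)].
Proof.
move=> step + + /connectP [t]; elim: t z p => [|r t IH] z p zp Pp /=.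
  by move=> _ ->; exists z, p; split=> //; left.
move=> /andP[/existsP [d /andP[/eqP dp /eqP dr]] rt] rl.
have kp : kept s (inl p) by apply/qV_image; exists z.
have := step d; rewrite dp => /(_ Pp kp) [[]|bp]; last by exists z, p; split=> //; right.
move=> /qV_image [k kd]; rewrite dr => Pr.
have [z1 [z1E oz1]] := cell_src kd; have [z2 [z2E oz2]] := cell_tgt kd.
rewrite dp in z1E; rewrite dr in z2E.
have z1z : z1 = z by apply: qV_inj; rewrite z1E zp.
have [z' [q [z'E oz' qE']]] := IH z2 r z2E Pr rt rl.
by exists z', q; split=> //; rewrite oz' oz2 -oz1 z1z.
Qed.

Lemma same_vertex_connect p p' : tag p = tag p' -> connect (@adj (VS X)) p p'.
Proof. have [[cV _ _] _ _] := tX; exact: ((fiber_connectedP (vspace X)).1 cV).2. Qed.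

Lemma point_over u : exists p : vert (VS X), tag p = u.
Proof. have [[cV _ _] _ _] := tX; exact: ((fiber_connectedP (vspace X)).1 cV).1. Qed.

(** Away from v nothing is cut, so the half-edges stay at one vertex. *)
Lemma far_vertex u : u != v -> exists z, rho z = (u, false) /\ valence u <= valence z.
Proof.
move=> uv; have [p pu] := point_over u.
have far_kept x : over x = u -> kept false x by move=> xu; rewrite /kept xu (negbTE uv).
have [z zp] : exists z, qV z = twin X false (inl p) by apply/qV_image/far_kept.
exists (over z); split; first by rewrite (rhoE zp) -pu.
pose f (h : uedge Z * bool) := (tau h.1, h.2).
apply: leq_trans (leq_imset_card f (halves (over z))).
rewrite -[valence u]/#|halves u| -(card_imset (mem (halves u)) (f := fun h : uedge X * bool => (Some h.1, h.2))); last by move=> [a b] [c d] [-> ->].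
apply: subset_leq_card; apply/subsetP => _ /imsetP [h hu ->].
have [q hq] := through_point tX h.
have qu : tag q = u by move: hu; rewrite inE (through_end hq) => /eqP.
have [||||z' [q' [z'E oz' [qE'|/andP[/on_side_over qv _]]]]] := @walk false (fun x => over x = u) z p q.
- move=> d du _; left; split; last exact: du.
  by apply: far_kept.
- exact: zp.
- exact: pu.
- by apply: same_vertex_connect; rewrite pu qu.
- subst q'; have [|w [wh wz]] := lift_half (s := false) hq _ z'E.
    by rewrite /copy (through_end hq) /= qu (negbTE uv).
  apply/imsetP; exists (w, h.2); last by rewrite /f /= wh.
  by rewrite -oz'; exact: (subsetP (through_halves z')).
- by have := rhoE z'E; rewrite oz' (rhoE zp) qv /= pu => -[/eqP]; rewrite (negbTE uv).
Qed.

Lemma meet_side s z p : qV z = twin X s (inl p) -> tag p = v ->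
  (exists q, on_side (~~ s) (inl q)) -> exists z' q, [/\ qV z' = twin X s (inl q), over z' = over z & both (inl q)].
Proof.
move=> zp pv [p0 p0s]; have p0v := on_side_over p0s.
have on_side_both x : kept s x -> on_side (~~ s) x -> both x.
  by move=> + sx; rewrite /kept (on_side_over sx) eqxx /on_both; case: (s) sx => /= -> ->.
have [||||z' [q [zq oz qq]]] := @walk s (fun x => over x = v) z p p0.
- move=> d dv kd; have [sn|sn] := boolP (on_side (~~ s) (inl (dsrc d))).
    by right; exact: on_side_both.
  left; split; last exact: dv.
  have nd : ~~ on_side (~~ s) (inr d) by apply: contraNN sn; exact: on_side_src.
  have dv' : over (inr d : item (VS X)) = v by exact: dv.
  rewrite /kept dv' eqxx; have := side_covered dv'.
  by case: (s) nd => /= /negbTE ->; rewrite ?orbF.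
- exact: zp.
- exact: pv.
- by apply: same_vertex_connect; rewrite pv.
exists z', q; split=> //; case: qq => // qp0; subst q; apply: on_side_both => //.
by apply/qV_image; exists z'.
Qed.

(** The third half-edge carries a component of the intersection of the two sides; by
    connectedness every component of a side meets it. *)
Lemma side_vertex s p h1 h2 : h1 != h2 -> tag p = v ->
  h1 \in through (inl p) -> h2 \in through (inl p) -> cls h1.1 h1.2 = s -> cls h2.1 h2.2 = s ->
  (exists q, on_side (~~ s) (inl q)) -> exists z, rho z = (v, s) /\ 2 < valence z.
Proof.
move=> h12 pv h1p h2p c1 c2 other.
have copyE h : h \in through (inl p) -> cls h.1 h.2 = s -> copy v cls h.2 h.1 = s.
  by move=> hp cs; rewrite /copy (through_end hp) /= pv eqxx cs.
have [y oy yp] : exists2 y, over y = h1.1 & att X h1.2 y = inl p by exact/throughP.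
have sp : on_side s (inl p) by rewrite -yp -c1 -oy; apply: on_side_att; rewrite -over_att yp.
have [z zp] : exists z, qV z = twin X s (inl p) by apply/qV_image; rewrite /kept /= pv eqxx.
have [z' [q [zq oz bq]]] := meet_side zp pv other.
have [w1 [w1E w1z]] := lift_half h1p (copyE _ h1p c1) zp.
have [w2 [w2E w2z]] := lift_half h2p (copyE _ h2p c2) zp.
have [w3 [w3E w3z]] := lift_both bq zq.
exists (over z); split; first by rewrite (rhoE zp) -pv.
have w12 : (w1, h1.2) != (w2, h2.2).
  apply: contraNneq h12 => -[ww bb]; move: w2E; rewrite -ww w1E => -[ee].
  by case: h1 h2 ee bb {h1p h2p c1 c2 oy yp w1z w2z w1E} => a b [c d] /= -> ->.
have : [set (w1, h1.2); (w2, h2.2); (w3, s)] \subset halves (over z).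
  apply/subsetP => k; rewrite !in_setU !in_set1 => /orP[/orP[]|] /eqP ->.
  - exact: (subsetP (through_halves z)).
  - exact: (subsetP (through_halves z)).
  - by rewrite -oz; exact: (subsetP (through_halves z')).
move/subset_leq_card; rewrite setUC cardsU1 cards2 w12 in_set2 !xpair_eqE.
have -> : w3 == w1 = false by apply/eqP => E; move: w1E; rewrite -E w3E.
by have -> : w3 == w2 = false by apply/eqP => E; move: w2E; rewrite -E w3E.
Qed.
End Grown.

(** * Lowering the valences to three *)

(** Every vertex other than v survives, and v is replaced by at least two vertices of
    valence at least three, one for each pair of intersecting half-edges. *)
Lemma grow_step (R : realType) X (v : uvert X) : tame X ->
  (forall u : uvert X, 2 < valence u) -> 3 < valence v ->
  exists Z, [/\ converts_to X Z, fheq R (flat_of Z) (flat_of X), tame Z, same_euler Z X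
    & #|uvert X| < #|big_vertices Z|].
Proof.
move=> tX X3 v4.
have [h1 [h2 [h3 [h4 [[h1v h2v h3v h4v] [p [h1p h2p]] [q [h3q h4q]] u4]]]]] := four_halves tX v4.
pose cls e b := (e, b) \in [set h1; h2].
have clsE h : cls h.1 h.2 = (h \in [set h1; h2]) by rewrite /cls; case: h.
have pv : tag p = v by move: h1v; rewrite inE (through_end h1p) => /eqP.
have qv : tag q = v by move: h3v; rewrite inE (through_end h3q) => /eqP.
move: u4; rewrite /= !inE !negb_or => /andP[/and3P[n12 n13 n14] /andP[/andP[n23 n24] /andP[n34 _]]].
have [Y [S _]] := separation_exists v cls.
have cov := @side_covered X v cls tX.
have [Z [sZ hZ]] := split_exists R Y.
have [cZ [iV [iE [iV_iso iE_iso i_att]]] _] := sZ.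
have [cV cE _] := cZ.
have [cu cuE] := over_map iV cV; have [ce ceE] := over_map iE cE.
pose qV := gcomp (sepV S) iV; pose qE := gcomp (sepE S) iE.
have qV_inj : injective qV by move=> x y; rewrite !gcompE => /(@sepV_inj _ _ _ _ S) /(giso_inj iV_iso).
have qV_image s x : (exists y, qV y = twin X s x) <-> kept v cls s x.
  rewrite -(sepV_image S); split=> [[y]|[y yx]]; first by rewrite gcompE => yx; exists (iV y).
  by have [z zy] := giso_surj iV_iso y; exists z; rewrite gcompE zy.
have qE_iso : giso qE by apply: giso_comp => //; exact: sepE_iso.
have q_att b x : qV (att Z b x) = cell_end v cls b (qE x) by rewrite !gcompE i_att (sepV_att S).
have rhoE y s x : qV y = twin X s x -> sepU S (cu (over y)) = (over x, s).
  by rewrite gcompE -cuE; exact: sepV_over.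
have tauE x : sepW S (ce (over x)) = piece (ivert (qE x)) by rewrite -ceE (sepE_over S) gcompE.
have sdh h s x : h \in through x -> h \in halves v -> cls h.1 h.2 = s -> on_side v cls s x.
  move=> /throughP [y oy yx]; rewrite inE => /eqP hv cs; rewrite -cs -yx -oy.
  by apply: on_side_att; rewrite oy.
have c1 : cls h1.1 h1.2 = true by rewrite clsE !inE eqxx.
have c2 : cls h2.1 h2.2 = true by rewrite clsE !inE eqxx orbT.
have c3 : cls h3.1 h3.2 = false.
  by rewrite clsE !inE; apply/negbTE; rewrite negb_or ![h3 == _]eq_sym n13 n23.
have c4 : cls h4.1 h4.2 = false.
  by rewrite clsE !inE; apply/negbTE; rewrite negb_or ![h4 == _]eq_sym n14 n24.
have sp : on_side v cls true (inl p) := sdh _ _ _ h1p h1v c1.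
have sq : on_side v cls false (inl q) := sdh _ _ _ h3q h3v c3.
have meets : exists p, on_side v cls false (inl p) /\ on_side v cls true (inl p).
  have [z zp] : exists z, qV z = twin X true (inl p) by apply/qV_image; rewrite /kept /= pv eqxx.
  have [|z' [r [_ _ /andP[rF rT]]]] := meet_side tX qV_inj qV_image zp pv.
    by exists q.
  by exists r.
have tZ : tame Z.
  apply: item_covered_tame => //.
  exact: (grown_item_covered (tau := fun w => sepW S (ce w)) tX qV_inj qV_image qE_iso q_att tauE).
have big o : exists z, sepU S (cu z) = (if o is Some u then (u, false) else (v, true)) /\ 2 < valence z.
  case: o => [u|]; last first.
    apply: (side_vertex (rho := fun u => sepU S (cu u)) (tau := fun w => sepW S (ce w)) tX qV_inj qV_image qE_iso q_att rhoE tauE n12 pv h1p h2p c1 c2).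
    by exists q.
  have [->|uv] := eqVneq u v.
    apply: (side_vertex (rho := fun u => sepU S (cu u)) (tau := fun w => sepW S (ce w)) tX qV_inj qV_image qE_iso q_att rhoE tauE n34 qv h3q h4q c3 c4).
    by exists p.
  have [z [zu zv]] := far_vertex (rho := fun u => sepU S (cu u)) (tau := fun w => sepW S (ce w)) tX qV_inj qV_image qE_iso q_att rhoE tauE uv.
  by exists z; split=> //; apply: leq_trans zv.
have /choice [zeta zetaE] := big.
exists Z; split=> //.
- apply: rt_trans (rt_step _ _ _ _ _) (rt_step _ _ _ _ _).
    by do 4!right; left; exact: (separation_separate S meets).
  by left; exact: sZ.
- exact: heq_trans hZ (separation_flat S cov R).
- exact: same_euler_trans (split_euler iV_iso iE_iso) (separation_euler S cov).
- have zeta_inj : injective zeta.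
    move=> o o' oo; have := (zetaE o).1; rewrite oo (zetaE o').1.
    by case: o {oo} => [u|]; case: o' => [u'|] //= [->].
  rewrite -card_option -(card_codom zeta_inj); apply: subset_leq_card.
  by apply/subsetP => _ /codomP [o ->]; rewrite inE (zetaE o).2.
Qed.

(** Each round adds a vertex of valence at least three; their number is bounded by a
    quantity that does not change. *)
Lemma make_trivalent (R : realType) X : tame X -> (forall u : uvert X, 2 < valence u) ->
  exists Y, [/\ converts_to X Y, fheq R (flat_of Y) (flat_of X), tame Y
    & forall u : uvert Y, valence u = 3].
Proof.
have [n] := ubnP (2 * #|vert (ES X)| - 2 * #|vert (VS X)| - #|uvert X|).
elim: n X => // n IH X /ltnSE Xn tX X3.
have [all3|/existsNP [v v3]] := pselect (forall u : uvert X, valence u = 3).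
  have [c h t _ _] := simplifies_refl R tX; by exists X.
have v4 : 3 < valence v by rewrite ltn_neqAle X3 andbT eq_sym; apply/eqP.
have [Z [cZ hZ tZ eZ bZ]] := grow_step R tX X3 v4.
have [Y [[cY hY tY bY eY] Y3]] := remove_valence2 R tZ.
have YX : #|uvert X| < #|uvert Y|.
  by move: bZ; rewrite -bY => /leq_trans; apply; exact: max_card.
have eYX := same_euler_trans eY eZ.
have [|||W [cW hW tW W3]] := IH Y => //.
  have := vertex_bound tX X3; have := vertex_bound tY Y3; move: eYX YX Xn.
  rewrite /same_euler; lia.
exists W; split=> //.
- exact: rt_trans cZ (rt_trans _ _ _ _ _ cY cW).
- exact: heq_trans hW (heq_trans hY hZ).
Qed.

(** * Reducedness *)

Lemma over_map_bij (I J : finType) (A : I -> graph) (B : J -> graph) (f : gmap (gsum A) (gsum B)) c :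
  (forall i, gconnected (A i)) -> (forall j, gconnected (B j)) -> giso f ->
  (forall x, over (f x) = c (over x)) -> bijective c.
Proof.
move=> /fiber_connectedP [neA cA] /fiber_connectedP [neB cB] fi cE.
have cV p : tag (gvert f p) = c (tag p) by exact: (cE (inl p)).
apply: inj_surj_bij => [i i' ii|j].
  have [p pi] := neA i; have [p' pi'] := neA i'.
  rewrite -pi -pi'; apply: connect_over.
  apply: (connect_full_inj (giso_inj fi) (giso_full fi)); apply: cB.
  by rewrite !cV pi pi' ii.
have [q qj] := neB j; have [[p|//] [pq]] := giso_surj fi (inl q).
by exists (tag p); rewrite -cV pq.
Qed.

(** Connected spaces are their own components, and for a connected circle space the first
    return is the monodromy itself. *)
Lemma split_connected_iso X Y : connected_spaces X -> split_components X Y -> iso Y X.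
Proof.
move=> [cV cE cC] [[cV' cE' cC'] [iV [iE [iV_iso iE_iso i_att]]] [j [j_inj j_full j_meets j_mono]]].
have [cu cuE] := over_map iV cV'; have [ce ceE] := over_map iE cE'; have [cc ccE] := over_map j cC'.
have bu := over_map_bij cV' cV iV_iso cuE; have be := over_map_bij cE' cE iE_iso ceE.
have m_over x : over (monodromy X x) = over x.
  by have [c [x' ->]] := gsum_inP x; rewrite monodromy_gsum_in !over_gsum_in.
have j_surj x : exists y, j y = x.
  have [n [y ny]] := j_meets x.
  have ox : over (j y) = over x by rewrite -ny; elim: (n) => //= k IH; rewrite m_over.
  have [|q [qx _]] := connect_full (p := ivert y) (q' := ivert x) j_inj j_full.
    apply: ((fiber_connectedP (cspace X)).1 cC).2; rewrite -ivert_map !over_ivert; exact: ox.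
  case: x ox qx {ny} => [p|d] _ qx; first by exists (inl q); rewrite /= qx.
  have [a ad] : exists a, gdart j a = d by apply: j_full; exists q.
  by exists (inr a); rewrite /= ad.
have j_iso : giso j := giso_bij j_inj j_surj.
have bc := over_map_bij cC' cC j_iso ccE.
split; last first.
  exists cc, j; split=> // y; have [n [nE nmin]] := j_mono y.
  case: n nE nmin => [|n] nE nmin; first exact: esym nE.
  by have [z zE] := j_surj (iter 1 (monodromy X) (j y)); case: (nmin 0 z isT).
exists (Cellmap cuE ceE); split=> [||b x].
- split.
    have [iu ie] := (bij_inj bu, bij_inj be).
    case=> [u|e|x|x] [u'|e'|x'|x'] //= [].
    + by move/iu ->.
    + by move/ie ->.
    + by move/(giso_inj iV_iso) ->.
    + by move/(giso_inj iE_iso) ->.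
  move=> c; split=> [_ []|_]; case: c => [u|e|x|x].
  + by have [g _ gK] := bu; exists (UV (g u)); rewrite /= gK.
  + by have [g _ gK] := be; exists (UE (g e)); rewrite /= gK.
  + by have [y yx] := giso_surj iV_iso x; exists (VI y); rewrite /= yx.
  + by have [y yx] := giso_surj iE_iso x; exists (EI y); rewrite /= yx.
- move=> e b /=; have [p <-] := ((fiber_connectedP (espace Y)).1 cE').1 e.
  have := cuE (att Y b (inl p)); rewrite i_att !over_att ceE => E; exact: esym E.
- exact: i_att.
Qed.

Lemma tame_reduced X : tame X -> (forall v : uvert X, 2 < valence v) -> reduced X.
Proof.
move=> [cX dX _] X3 Y; case.
- exact: split_connected_iso.
- case=> [[v [e1 [e2 [b1 [b2 [[v2 _ _ _] _ _ _ _]]]]]]|[v [e [[v2 _ _] _ _ _ _]]]|[v [e [b [v1 _ _ _ _]]]]].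
  + by have := X3 v; rewrite v2.
  + by have := X3 v; rewrite v2.
  + by have := X3 v; rewrite v1.
- move=> [e [none _ _]]; have /card_gt1P [[b a] [_ [+ _ _]]] := dX e.
  by rewrite inE => /eqP /none.
- case=> [[e [b [a [_ one _ _]]]]|[v [e [b [_ v1 _ _ _]]]]].
    by have := dX e; rewrite [#|covers e|]one.
  by have := X3 v; rewrite v1.
Qed.

(** * Conversion to a reduced trivalent graph of graphs *)

Import all_order all_algebra classical_sets topology.

Theorem theorem2p4 (R : realType) (X : gog)
    (no_tree : forall C : {set vert (mid_graph X)}, ~ is_tree_component C)
    (no_isolated_tree :
       forall C : {set vert (horizontal_graph X)}, ~ isolated_tree C) :
  exists X' : gog,
    [/\ converts_to X X', reduced X',
        forall v : uvert X', valence v = 3%N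
      & exists f : total_space R X' -> total_space R X,
          triple_homotopy_equivalence R
            (horizontal R X') (midgraph R X')
            (horizontal R X) (midgraph R X) f].
Proof.
have [X1 [c1 h1 d1 r1]] := collapse_to_doubly_covered R (rich_mid no_tree) (rich_hor no_isolated_tree).
have [X2 [s2 h2]] := split_exists R X1.
have [cX2 [iV [iE [iV_iso iE_iso i_att]]] _] := s2.
have d2 := split_doubly_covered iV_iso iE_iso i_att cX2 d1.
have r2 := split_rich iV_iso iE_iso i_att r1.
have [X3 [c3 h3 t3]] := drop_leaves R cX2 d2 r2.
have [X4 [[c4 h4 t4 _ _] v4]] := remove_valence2 R t3.
have [X5 [c5 h5 t5 v5]] := make_trivalent R t4 v4.
exists X5; split=> //.
- apply: rt_trans c1 (rt_trans _ _ _ _ _ (rt_step _ _ _ _ _) (rt_trans _ _ _ _ _ c3 (rt_trans _ _ _ _ _ c4 c5))).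
  by left.
- by apply: tame_reduced => // v; rewrite v5.
- have h : fheq R (flat_of X5) (flat_of X).
    exact: heq_trans h5 (heq_trans h4 (heq_trans h3 (heq_trans h2 h1))).
  exact: heq_trans (total_space_flat R X5) (heq_trans h (heq_sym (total_space_flat R X))).
Qed.
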